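(* Let $\nu>0$ be real and let $z\in\mathbb{C}$ with $\mathrm{Re}\,z>0$. Then $$\frac{\partial I_\nu(z)}{\partial\nu}=-\frac{\nu I_\nu(z)}{2\sqrt\pi}\,G_{2,4}^{3,1}\left(z^2\left|\begin{array}{c}\frac12,\ 1\\ 0,\ 0,\ \nu,\ -\nu\end{array}\right.\right)-\frac{K_\nu(z)\,(z/2)^{2\nu}}{\Gamma^2(\nu+1)}\,{}_2F_3\left(\left.\begin{array}{c}\nu,\ \nu+\frac12\\ \nu+1,\ \nu+1,\ 2\nu+1\end{array}\right|z^2\right).$$
   Context: Powers take their principal values. $I_\nu(z)=(z/2)^\nu\sum_{k\ge0}\frac{(z/2)^{2k}}{k!\,\Gamma(\nu+k+1)}$, and $K_\nu(z)=\frac\pi2\frac{I_{-\nu}(z)-I_\nu(z)}{\sin\pi\nu}$ for $\nu\notin\mathbb{Z}$ (defined by the limit in $\nu$ for integral $\nu$); $\partial/\partial\nu$ is the derivative with respect to the order at fixed $z$. ${}_pF_q\left(\left.\begin{array}{c}a_1,\dots,a_p\\ b_1,\dots,b_q\end{array}\right|x\right)=\sum_{k\ge0}\frac{(a_1)_k\cdots(a_p)_k}{(b_1)_k\cdots(b_q)_k}\frac{x^k}{k!}$ with $(\alpha)_k=\alpha(\alpha+1)\cdots(\alpha+k-1)$. The Meijer $G$-function is $$G_{p,q}^{m,n}\left(x\left|\begin{array}{c}a_1,\dots,a_p\\ b_1,\dots,b_q\end{array}\right.\right)=\frac1{2\pi i}\int_L\frac{\prod_{\ell=1}^m\Gamma(b_\ell-s)\prod_{\ell=1}^n\Gamma(1-a_\ell+s)}{\prod_{\ell=m+1}^{q}\Gamma(1-b_\ell+s)\prod_{\ell=n+1}^{p}\Gamma(a_\ell-s)}\,x^s\,ds,$$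 where $L$ separates the poles of the factors $\Gamma(b_\ell-s)$ ($1\le\ell\le m$) from those of the factors $\Gamma(1-a_\ell+s)$ ($1\le\ell\le n$); for $p<q$ one may take $L$ to be a loop starting and ending at $+\infty$ and encircling all poles of the $\Gamma(b_\ell-s)$, but none of the $\Gamma(1-a_\ell+s)$, once in the negative (clockwise) direction. $x^s$ is the principal value. *)

(* Defs.v *)
(* Stdlib real numbers with Coquelicot (complex numbers, derivatives, Riemann
   integrals, series). *)
From Stdlib Require Import Reals Factorial List ClassicalEpsilon.
From Coquelicot Require Import Coquelicot.
Import ListNotations.
Open Scope R_scope.

Definition Cexp (w : C) : C :=
  (exp (Re w) * cos (Im w), exp (Re w) * sin (Im w)).

(* Principal argument, in (-PI, PI]: off the ray (-oo, 0] it is given by the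
   half-angle formula, and on the negative reals it is PI.  The value at 0 is
   irrelevant. *)
Definition Carg (w : C) : R :=
  if Rlt_dec 0 (Cmod w + Re w) then 2 * atan (Im w / (Cmod w + Re w)) else PI.

Definition Clog (w : C) : C := (ln (Cmod w), Carg w).

(* Principal value of w ^ s, for w <> 0. *)
Definition Cpower (w s : C) : C := Cexp (s * Clog w).

(* Limits and sums of convergent complex sequences, componentwise. *)
Definition CLim_seq (u : nat -> C) : C :=
  (real (Lim_seq (fun n => Re (u n))), real (Lim_seq (fun n => Im (u n)))).

Definition CSeries (u : nat -> C) : C :=
  (Series (fun n => Re (u n)), Series (fun n => Im (u n))).

Definition Cprod (l : list C) : C := fold_right Cmult (RtoC 1) l.

(* (alpha)_k *)
Fixpoint pochhammer (alpha : C) (k : nat) : C :=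
  match k with
  | O => RtoC 1
  | S j => (pochhammer alpha j * (alpha + INR j))%C
  end.

(* The entire function 1 / Gamma, by Euler's limit
   Gamma(w) = lim n! n^w / (w (w+1) ... (w+n)); it vanishes at the poles of
   Gamma, and quotients by Gamma are written below as products with it. *)
Definition rGamma (w : C) : C :=
  CLim_seq (fun n =>
    pochhammer w (S n) / (INR (fact n) * Cpower (INR n) w))%C.

Definition Gamma (w : C) : C := (/ rGamma w)%C.

Definition BesselI (nu : R) (z : C) : C :=
  (Cpower (z / 2) nu *
   CSeries (fun k =>
     (z / 2) ^ (2 * k) / INR (fact k) * rGamma (nu + INR k + 1)))%C.

Definition BesselK_formula (nu : R) (z : C) : C :=
  (PI / 2 * ((BesselI (- nu) z - BesselI nu z) / sin (PI * nu)))%C.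

(* [Lim] is a limit over points different from [nu]. *)
Definition BesselK (nu : R) (z : C) : C :=
  if Req_EM_T (frac_part nu) 0 then
    (real (Lim (fun mu => Re (BesselK_formula mu z)) nu),
     real (Lim (fun mu => Im (BesselK_formula mu z)) nu))
  else BesselK_formula nu z.

(* pFq with upper parameters [a] and lower parameters [b]. *)
Definition hypergeometric (a b : list C) (x : C) : C :=
  CSeries (fun k =>
    Cprod (map (fun al => pochhammer al k) a) /
    Cprod (map (fun be => pochhammer be k) b) *
    (x ^ k / INR (fact k)))%C.

(* In the Meijer G-function G^{m,n}_{p,q}, p and q are the lengths of [a] and
   [b]. *)
Definition meijer_integrand (m n : nat) (a b : list C) (x s : C) : C :=
  (Cprod (map (fun be => Gamma (be - s)) (firstn m b)) *
   Cprod (map (fun al => Gamma (1 - al + s)) (firstn n a)) *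
   Cprod (map (fun be => rGamma (1 - be + s)) (skipn m b)) *
   Cprod (map (fun al => rGamma (al - s)) (skipn n a)) *
   Cpower x s)%C.

(* The net change of a continuous argument of L(t) - w as t goes from -oo to
   +oo is [theta]; [dL] is the derivative of [L]. *)
Definition total_turn (L dL : R -> C) (w : C) (theta : R) : Prop :=
  is_RInt_gen (fun t => Im (dL t / (L t - w))%C)
    (Rbar_locally m_infty) (Rbar_locally p_infty) theta.

(* [L] is a continuously differentiable loop (the derivative may vanish, so
   corners are allowed) which comes from +oo along a ray parallel to the
   positive real axis, returns to +oo along another one, avoids the poles of
   the Gamma factors in the numerator, and turns once clockwise around each
   pole b_l + k of Gamma(b_l - s), l <= m, and not at all around the poles
   a_l - 1 - k of Gamma(1 - a_l + s), l <= n. *)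
Definition meijer_loop (m n : nat) (a b : list C) (L dL : R -> C) : Prop :=
  (forall t : R, @is_derive R_AbsRing C_R_NormedModule L t (dL t)) /\
  (forall t : R, @continuous R_UniformSpace C_UniformSpace dL t) /\
  (exists T h0 h1 : R,
     (forall t, t <= - T -> L t = (- t, h0)) /\
     (forall t, T <= t -> L t = (t, h1))) /\
  (forall (be : C) (k : nat), In be (firstn m b) ->
     (forall t, L t <> (be + INR k)%C) /\
     total_turn L dL (be + INR k)%C (- (2 * PI))) /\
  (forall (al : C) (k : nat), In al (firstn n a) ->
     (forall t, L t <> (al - 1 - INR k)%C) /\
     total_turn L dL (al - 1 - INR k)%C 0).

Definition is_meijerG (m n : nat) (a b : list C) (x g : C) : Prop :=
  exists L dL : R -> C,
    meijer_loop m n a b L dL /\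
    exists v : C,
      @is_RInt_gen C_R_NormedModule
        (fun t => meijer_integrand m n a b x (L t) * dL t)%C
        (Rbar_locally m_infty) (Rbar_locally p_infty) v /\
      g = (v / (2 * PI * Ci))%C.

(* The loop form of the G-function, for p < q and x <> 0.  By Cauchy's theorem
   [is_meijerG] determines at most one value, whatever the loop. *)
Definition meijerG (m n : nat) (a b : list C) (x : C) : C :=
  epsilon (inhabits (RtoC 0)) (is_meijerG m n a b x).

(* Main.v *)
Require Import Defs.
From Stdlib Require Import Reals Lra Lia Psatz List ClassicalEpsilon Classical Factorial Wf_nat.
From Coquelicot Require Import Coquelicot.
Import ListNotations.
Open Scope R_scope.

(* Write l = Log (z / 2) and t = (z / 2)^2.  Multiplying power series with Vandermonde's identity gives
   I_mu z I_sigma' - z I_mu' I_sigma = (sigma - mu) T(mu, sigma) with T entire in mu.  Its derivatives in mu at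
   mu = sigma = nu and at mu = nu, sigma = -nu are two linear equations for the derivatives of I_nu and z I_nu'
   with respect to the order, with determinant the Wronskian 2 sin(pi nu) / pi of I_nu and I_(-nu).  Eliminating,
   dI_nu/dnu is a combination of T(nu, nu) I_(-nu) and R(nu) I_nu, where T(nu, nu) is the 2F3 term and R is explicit.

   For nonintegral nu the G-function is evaluated by residues: any admissible loop has the same integral as a
   standard one, which can be closed by vertical segments at Re s -> oo, where the integrand decays geometrically.
   The double pole at 0 and the simple poles at 1, 2, ... and nu, nu + 1, ... contribute, by the duplication and
   reflection formulas for 1/Gamma, a multiple of T(nu, nu) + R(nu).  Integral orders follow because both sides
   are continuous in nu, the singularity of K_nu being removable. *)

(** [meijerG] is chosen by [epsilon], so one loop must be shown admissible and all admissible loops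
    must be shown to give one value. Of such a loop little is known beyond its two rays and its
    [total_turn] about each pole; no homotopy or Jordan curve is at hand. Integration along a closed
    path is therefore treated as an abstract linear functional that kills derivatives: on a strip,
    partial fractions reduce the integrand to the functions [/ (s - p)], whose integrals are winding
    numbers. This argument tolerates repeated poles, so loops are compared for every nu > 0. The
    evaluation does not: at an integral order the poles nu + k merge with positive integers into
    double poles, and continuity in nu replaces that computation. The elimination leaves the
    derivative of 1/Gamma in one place only, [cross_opp], and the double pole at 0 produces the same
    derivative; hence no digamma value has to be computed. *)

Ltac as_C := lazymatch goal with |- @eq _ ?a ?b => cut (@eq C a b); [exact (fun H => H)|] end.
(* Variables introduced under [filter_imp] have type [UniformSpace.sort _], which [ring] and [field] do not
   recognise as [C] or [R]. *)
Ltac uncast :=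
  repeat match goal with
  | x : ?T |- _ => lazymatch T with UniformSpace.sort _ => idtac end;
      let T' := eval simpl in T in
      first [unify T' C; change C in (type of x) | unify T' R; change R in (type of x)]
  end.
Ltac cring := uncast; as_C; ring.
Ltac as_R := lazymatch goal with |- @eq _ ?a ?b => cut (@eq R a b); [exact (fun H => H)|] end.
Ltac rring := uncast; as_R; ring.
Ltac rfield := uncast; as_R; field.
Ltac cfield := uncast; as_C; field.

(** * Modulus and continuity in the complex plane *)

Lemma Cmod_le_abs (z : C) : Cmod z <= Rabs (Re z) + Rabs (Im z).
Proof.
  replace z with (RtoC (Re z) + (0, Im z))%C at 1.
  2:{ destruct z; unfold RtoC, Cplus; simpl; f_equal; ring. }
  eapply Rle_trans; [apply Cmod_triangle|].
  rewrite Cmod_R. apply Rplus_le_compat_l.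
  unfold Cmod; simpl. rewrite Rmult_0_l, Rplus_0_l, Rmult_1_r.
  rewrite <- sqrt_Rsqr_abs. right. reflexivity.
Qed.

Lemma re_le_Cmod (z : C) : Rabs (Re z) <= Cmod z.
Proof. apply Rle_trans with (2 := Rmax_Cmod z). apply Rmax_l. Qed.

Lemma im_le_Cmod (z : C) : Rabs (Im z) <= Cmod z.
Proof. apply Rle_trans with (2 := Rmax_Cmod z). apply Rmax_r. Qed.

(** Neighbourhoods in [C] are those of a product, given by squares; since |x| + |y| dominates the
    modulus, halving the radius passes from a disc to a square inside it. *)
Lemma locally_C (a : C) (P : C -> Prop) :
  locally a P <-> exists d, 0 < d /\ forall s, Cmod (s - a) < d -> P s.
Proof.
  split.
  - intros [d Hd]. exists d. split; [apply cond_pos|].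
    intros s Hs. apply Hd. split.
    + apply Rle_lt_trans with (2 := Hs). apply (re_le_Cmod (s - a)%C).
    + apply Rle_lt_trans with (2 := Hs). apply (im_le_Cmod (s - a)%C).
  - intros [d [Hd H]].
    exists (mkposreal (d / 2) ltac:(lra)). intros s [H1 H2]. apply H.
    apply Rle_lt_trans with (1 := Cmod_le_abs _).
    unfold ball in H1, H2; simpl in H1, H2.
    unfold AbsRing_ball, abs, minus, plus, opp in H1, H2; simpl in H1, H2.
    unfold Re, Im, Cminus, Cplus, Copp; simpl. lra.
Qed.

Lemma cont_C {T : UniformSpace} (f : T -> C) (x : T) :
  continuous f x <->
  forall eps, 0 < eps -> locally x (fun y => Cmod (f y - f x) < eps).
Proof.
  split.
  - intros H eps He. apply (H (fun c => Cmod (c - f x) < eps)). apply locally_C. exists eps. auto.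
  - intros H P HP. apply locally_C in HP. destruct HP as [d [Hd HP]].
    unfold filtermap. generalize (H d Hd). apply filter_imp. intros y Hy. apply HP, Hy.
Qed.

Lemma cont_comps {T : UniformSpace} (f : T -> C) (x : T) :
  continuous f x <->
  continuous (fun y => Re (f y)) x /\ continuous (fun y => Im (f y)) x.
Proof.
  split.
  - intros H. split.
    + apply (continuous_comp f fst); [exact H|]. apply continuous_fst.
    + apply (continuous_comp f snd); [exact H|]. apply continuous_snd.
  - intros [H1 H2]. apply cont_C. intros eps He.
    assert (He2 : 0 < eps / 2) by lra.
    generalize (proj1 (filterlim_locally _ _) H1 (mkposreal _ He2))
               (proj1 (filterlim_locally _ _) H2 (mkposreal _ He2)).
    intros K1 K2. generalize (filter_and _ _ K1 K2). apply filter_imp.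
    intros y [L1 L2]. apply Rle_lt_trans with (1 := Cmod_le_abs _).
    unfold ball in L1, L2; simpl in L1, L2.
    unfold AbsRing_ball, abs, minus, plus, opp in L1, L2; simpl in L1, L2.
    unfold Re, Im, Cminus, Cplus, Copp in *; simpl in *. lra.
Qed.

Lemma cont_plus {T : UniformSpace} (f g : T -> C) (x : T) :
  continuous f x -> continuous g x -> continuous (fun y => f y + g y)%C x.
Proof.
  rewrite !cont_comps. intros [H1 H2] [H3 H4]. split.
  - apply (continuous_plus (fun y => Re (f y)) (fun y => Re (g y))); assumption.
  - apply (continuous_plus (fun y => Im (f y)) (fun y => Im (g y))); assumption.
Qed.

Lemma cont_opp {T : UniformSpace} (f : T -> C) (x : T) :
  continuous f x -> continuous (fun y => - f y)%C x.
Proof.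
  rewrite !cont_comps. intros [H1 H2]. split.
  - apply (continuous_opp (fun y => Re (f y))); assumption.
  - apply (continuous_opp (fun y => Im (f y))); assumption.
Qed.

Lemma cont_minus {T : UniformSpace} (f g : T -> C) (x : T) :
  continuous f x -> continuous g x -> continuous (fun y => f y - g y)%C x.
Proof. intros Hf Hg. apply cont_plus; [exact Hf|]. apply cont_opp, Hg. Qed.

Lemma cont_mult {T : UniformSpace} (f g : T -> C) (x : T) :
  continuous f x -> continuous g x -> continuous (fun y => f y * g y)%C x.
Proof.
  rewrite !cont_comps. intros [H1 H2] [H3 H4]. split.
  - apply (continuous_minus (fun y => Re (f y) * Re (g y)) (fun y => Im (f y) * Im (g y)));
      apply (continuous_mult (K := R_AbsRing)); assumption.
  - apply (continuous_plus (fun y => Re (f y) * Im (g y)) (fun y => Im (f y) * Re (g y)));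
      apply (continuous_mult (K := R_AbsRing)); assumption.
Qed.

Lemma Cmod_neq0_sq (z : C) : z <> 0 -> Re z ^ 2 + Im z ^ 2 <> 0.
Proof.
  intros H K. apply H. destruct z as [a b]; simpl in K.
  assert (a = 0) by nra. assert (b = 0) by nra. subst. reflexivity.
Qed.

Lemma cont_inv {T : UniformSpace} (f : T -> C) (x : T) :
  continuous f x -> f x <> 0 -> continuous (fun y => / f y)%C x.
Proof.
  rewrite !cont_comps. intros [H1 H2] H0.
  assert (HD : continuous (fun y => / (Re (f y) ^ 2 + Im (f y) ^ 2)) x).
  { apply (continuous_comp (fun y => Re (f y) ^ 2 + Im (f y) ^ 2) Rinv).
    - apply (continuous_plus (fun y => Re (f y) ^ 2) (fun y => Im (f y) ^ 2)).
      + apply (continuous_comp (fun y => Re (f y)) (fun u => u ^ 2)); [assumption|].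
        apply continuity_pt_filterlim. reg.
      + apply (continuous_comp (fun y => Im (f y)) (fun u => u ^ 2)); [assumption|].
        apply continuity_pt_filterlim. reg.
    - apply continuous_Rinv. apply Cmod_neq0_sq, H0. }
  split.
  - apply (continuous_mult (K := R_AbsRing) (fun y => Re (f y))); assumption.
  - apply (continuous_mult (K := R_AbsRing) (fun y => - Im (f y))); [|assumption].
    apply (continuous_opp (fun y => Im (f y))); assumption.
Qed.

Lemma cont_ext_loc {T : UniformSpace} (f g : T -> C) (x : T) :
  locally x (fun y => f y = g y) -> continuous f x -> continuous g x.
Proof. intros H. apply continuous_ext_loc. revert H. apply filter_imp. auto. Qed.

Lemma cont_pow {T : UniformSpace} (f : T -> C) (x : T) (n : nat) :
  continuous f x -> continuous (fun y => f y ^ n)%C x.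
Proof.
  intros H. induction n as [|n IH].
  - apply continuous_const.
  - apply cont_mult; [exact H|exact IH].
Qed.

Lemma cont_RtoC {T : UniformSpace} (f : T -> R) (x : T) :
  continuous f x -> continuous (fun y => RtoC (f y)) x.
Proof.
  intros H. apply cont_comps. split; [exact H|]. apply continuous_const.
Qed.

(** * Complex derivatives in Caratheodory form *)

(** With a slope function continuous at [a], the rules for sums, products and compositions become
    algebraic identities between slopes, without error terms. *)
Definition CD (f : C -> C) (a l : C) : Prop :=
  exists phi : C -> C,
    locally a (fun s => f s = f a + phi s * (s - a))%C /\
    continuous phi a /\ phi a = l.

Definition PD (g : R -> C) (t : R) (d : C) : Prop :=
  exists psi : R -> C,
    locally t (fun u => g u = g t + psi u * RtoC (u - t))%C /\
    continuous psi t /\ psi t = d.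

Lemma CD_ext_loc (f g : C -> C) (a l : C) :
  locally a (fun s => f s = g s) -> CD f a l -> CD g a l.
Proof.
  intros H [phi [H1 [H2 H3]]]. exists phi. split; [|auto].
  generalize (filter_and _ _ H H1). apply filter_imp. intros s [K1 K2].
  rewrite <- K1, K2. rewrite (locally_singleton _ _ H). reflexivity.
Qed.

Lemma CD_ext (f g : C -> C) (a l : C) :
  (forall s, f s = g s) -> CD f a l -> CD g a l.
Proof. intros H. apply CD_ext_loc. apply filter_forall. exact H. Qed.

Lemma CD_const (c a : C) : CD (fun _ => c) a 0.
Proof.
  exists (fun _ => RtoC 0). split; [|split; [apply continuous_const|reflexivity]].
  apply filter_forall. intros s. cring.
Qed.

Lemma CD_id (a : C) : CD (fun s => s) a 1.
Proof.
  exists (fun _ => RtoC 1). split; [|split; [apply continuous_const|reflexivity]].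
  apply filter_forall. intros s. cring.
Qed.

Lemma CD_cont (f : C -> C) (a l : C) : CD f a l -> continuous f a.
Proof.
  intros [phi [H1 [H2 H3]]].
  apply (cont_ext_loc (fun s => f a + phi s * (s - a))%C).
  - revert H1. apply filter_imp. auto.
  - apply cont_plus; [apply continuous_const|]. apply cont_mult; [exact H2|].
    apply cont_minus; [apply continuous_id|apply continuous_const].
Qed.

Lemma CD_plus (f g : C -> C) (a l m : C) :
  CD f a l -> CD g a m -> CD (fun s => f s + g s)%C a (l + m).
Proof.
  intros [p [H1 [H2 H3]]] [q [K1 [K2 K3]]]. exists (fun s => p s + q s)%C.
  split; [|split].
  - generalize (filter_and _ _ H1 K1). apply filter_imp.
    intros s [E1 E2]. rewrite E1, E2. cring.
  - apply cont_plus; assumption.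
  - rewrite H3, K3. reflexivity.
Qed.

Lemma CD_mult (f g : C -> C) (a l m : C) :
  CD f a l -> CD g a m -> CD (fun s => f s * g s)%C a (l * g a + f a * m).
Proof.
  intros Hf Hg. pose proof (CD_cont _ _ _ Hg) as Cg.
  destruct Hf as [p [H1 [H2 H3]]]. destruct Hg as [q [K1 [K2 K3]]].
  exists (fun s => p s * g s + f a * q s)%C.
  split; [|split].
  - generalize (filter_and _ _ H1 K1). apply filter_imp.
    intros s [E1 E2]. rewrite E1, E2. cring.
  - apply cont_plus; apply cont_mult; try assumption. apply continuous_const.
  - rewrite H3, K3. reflexivity.
Qed.

Lemma CD_scal (c : C) (f : C -> C) (a l : C) :
  CD f a l -> CD (fun s => c * f s)%C a (c * l).
Proof.
  intros H. replace (c * l)%C with (0 * f a + c * l)%C by ring.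
  apply (CD_mult (fun _ => c)); [apply CD_const|exact H].
Qed.

Lemma CD_eq (f : C -> C) (a l m : C) : CD f a l -> l = m -> CD f a m.
Proof. intros H <-. exact H. Qed.

Lemma CD_opp (f : C -> C) (a l : C) : CD f a l -> CD (fun s => - f s)%C a (- l).
Proof.
  intros H. apply (CD_ext (fun s => (-1) * f s)%C); [intros; ring|].
  eapply CD_eq; [apply CD_scal, H|cring].
Qed.

Lemma CD_minus (f g : C -> C) (a l m : C) :
  CD f a l -> CD g a m -> CD (fun s => f s - g s)%C a (l - m).
Proof. intros Hf Hg. apply CD_plus; [exact Hf|apply CD_opp, Hg]. Qed.

Lemma CD_comp (f g : C -> C) (a l m : C) :
  CD f (g a) l -> CD g a m -> CD (fun s => f (g s)) a (l * m).
Proof.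
  intros [p [H1 [H2 H3]]] Hg. pose proof (CD_cont _ _ _ Hg) as Cg.
  destruct Hg as [q [K1 [K2 K3]]].
  exists (fun s => p (g s) * q s)%C. split; [|split].
  - pose proof (Cg _ H1) as G. unfold filtermap in G.
    generalize (filter_and _ _ G K1). apply filter_imp.
    intros s [E1 E2]. rewrite E1. rewrite E2 at 2. cring.
  - apply cont_mult; [|exact K2]. apply continuous_comp; assumption.
  - rewrite H3, K3. reflexivity.
Qed.

Lemma cont_neq0 {T : UniformSpace} (f : T -> C) (x : T) :
  continuous f x -> f x <> 0 -> locally x (fun y => f y <> 0).
Proof.
  intros H H0. apply cont_C with (eps := Cmod (f x)) in H.
  2: apply Cmod_gt_0, H0.
  revert H. apply filter_imp. intros y Hy K. rewrite K in Hy.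
  replace (0 - f x)%C with (- f x)%C in Hy by ring. rewrite Cmod_opp in Hy. lra.
Qed.

Lemma CD_inv (f : C -> C) (a l : C) :
  CD f a l -> f a <> 0 -> CD (fun s => / f s)%C a (- l / (f a * f a)).
Proof.
  intros Hf H0. pose proof (CD_cont _ _ _ Hf) as Cf.
  destruct Hf as [p [H1 [H2 H3]]].
  exists (fun s => - p s / (f a * f s))%C. split; [|split].
  - generalize (filter_and _ _ H1 (cont_neq0 _ _ Cf H0)). apply filter_imp.
    intros s [E1 E2].
    assert (E3 : (p s * (s - a) = f s - f a)%C) by (rewrite E1; ring).
    replace (- p s / (f a * f s) * (s - a))%C with
      (- (p s * (s - a)) / (f a * f s))%C by (field; auto).
    rewrite E3. cfield. auto.
  - apply cont_mult; [apply cont_opp, H2|]. apply cont_inv.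
    + apply cont_mult; [apply continuous_const|exact Cf].
    + apply Cmult_neq_0; exact H0.
  - rewrite H3. reflexivity.
Qed.

(** Backwards, the slope function is the difference quotient completed by [l] at [a]. *)
Lemma CD_cont_slope (f : C -> C) (a l : C) :
  CD f a l <->
  forall eps, 0 < eps -> locally a (fun s => Cmod (f s - f a - l * (s - a)) <= eps * Cmod (s - a)).
Proof.
  split.
  - intros [p [H1 [H2 H3]]] eps He.
    generalize (filter_and _ _ H1 (proj1 (cont_C _ _) H2 eps He)). apply filter_imp.
    intros s [E1 E2]. rewrite E1.
    replace (f a + p s * (s - a) - f a - l * (s - a))%C with ((p s - l) * (s - a))%C by ring.
    rewrite Cmod_mult. rewrite H3 in E2. apply Rmult_le_compat_r; [apply Cmod_ge_0|lra].
  - intros H.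
    exists (fun s => if excluded_middle_informative (s = a) then l else (f s - f a) / (s - a))%C.
    split; [|split].
    + apply filter_forall. intros s. uncast.
      destruct (excluded_middle_informative (s = a)) as [->|N]; [cring|].
      cfield. intros K. apply N. replace s with (s - a + a)%C by ring. rewrite K. ring.
    + apply cont_C. intros eps He. generalize (H (eps/2) ltac:(lra)). apply filter_imp.
      intros s Hs. uncast.
      destruct (excluded_middle_informative (a = a)) as [_|N]; [|easy].
      destruct (excluded_middle_informative (s = a)) as [->|N].
      * replace (l - l)%C with (RtoC 0) by ring. rewrite Cmod_0. exact He.
      * assert (Hn : (s - a <> 0)%C).
        { intros K. apply N. replace s with (s - a + a)%C by ring. rewrite K. ring. }
        replace ((f s - f a) / (s - a) - l)%C with ((f s - f a - l * (s - a)) / (s - a))%C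
          by (field; exact Hn).
        rewrite Cmod_div by exact Hn.
        apply Rle_lt_trans with (eps / 2); [|lra].
        apply Rmult_le_reg_r with (Cmod (s - a)); [apply Cmod_gt_0, Hn|].
        unfold Rdiv at 1. rewrite Rmult_assoc, Rinv_l, Rmult_1_r; [exact Hs|].
        apply Rgt_not_eq, Cmod_gt_0, Hn.
    + destruct (excluded_middle_informative (a = a)); easy.
Qed.

Lemma CD_unique (f : C -> C) (a l m : C) : CD f a l -> CD f a m -> l = m.
Proof.
  rewrite !CD_cont_slope. intros H K.
  apply NNPP. intros N.
  assert (Hd : 0 < Cmod (l - m)).
  { apply Cmod_gt_0. intros E. apply N. replace l with (l - m + m)%C by ring. rewrite E. ring. }
  set (e := Cmod (l - m) / 4).
  assert (He : 0 < e) by (unfold e; lra).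
  generalize (filter_and _ _ (H e He) (K e He)).
  intros L. apply locally_C in L. destruct L as [d [Hd0 L]].
  destruct (L (a + RtoC (d / 2))%C) as [L1 L2].
  { replace (a + RtoC (d / 2) - a)%C with (RtoC (d/2)) by ring.
    rewrite Cmod_R, Rabs_pos_eq; lra. }
  replace (a + RtoC (d / 2) - a)%C with (RtoC (d/2)) in L1, L2 by ring.
  set (u := (f (a + RtoC (d/2)) - f a)%C) in *.
  assert (T : Cmod ((l - m) * RtoC (d/2)) <= 2 * (e * Cmod (RtoC (d/2)))).
  { replace ((l - m) * RtoC (d/2))%C with ((u - m * RtoC (d/2)) + - (u - l * RtoC (d/2)))%C by ring.
    eapply Rle_trans; [apply Cmod_triangle|]. rewrite Cmod_opp. lra. }
  rewrite Cmod_mult, Cmod_R, Rabs_pos_eq in T by lra. unfold e in T. nra.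
Qed.

Lemma PD_comps (g : R -> C) (t : R) (d : C) :
  PD g t d <->
  is_derive (fun u => Re (g u)) t (Re d) /\ is_derive (fun u => Im (g u)) t (Im d).
Proof.
  assert (D1 : forall (h : R -> R) (l : R),
     is_derive h t l <-> exists p : R -> R,
       locally t (fun u => h u = h t + p u * (u - t)) /\ continuous p t /\ p t = l).
  { intros h l. split.
    - intros H. apply is_derive_Reals in H.
      exists (fun u => if Req_EM_T u t then l else (h u - h t) / (u - t)).
      split; [|split].
      + apply filter_forall. intros u. uncast. destruct (Req_EM_T u t) as [->|N]; [rring|rfield; lra].
      + apply filterlim_locally. intros eps.
        destruct (H eps (cond_pos eps)) as [dl Hdl]. exists dl. intros u Hu. uncast.
        destruct (Req_EM_T t t) as [_|N]; [|easy].
        destruct (Req_EM_T u t) as [->|N]; [apply ball_center|].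
        specialize (Hdl (u - t) ltac:(lra) Hu).
        replace (t + (u - t)) with u in Hdl by rring. exact Hdl.
      + destruct (Req_EM_T t t); easy.
    - intros [p [H1 [H2 H3]]]. apply is_derive_Reals. intros eps He.
      generalize (filter_and _ _ H1 (proj1 (filterlim_locally _ _) H2 (mkposreal eps He))).
      intros [dl Hdl]. exists dl. intros k Hk0 Hk.
      destruct (Hdl (t + k)) as [E1 E2].
      { unfold ball; simpl; unfold AbsRing_ball, abs, minus, plus, opp; simpl.
        replace (t + k + - t) with k by ring. exact Hk. }
      rewrite E1. unfold ball in E2; simpl in E2; unfold AbsRing_ball, abs, minus, plus, opp in E2; simpl in E2.
      replace ((h t + p (t + k) * (t + k - t) - h t) / k - l) with (p (t + k) + - p t) by (rewrite H3; field; exact Hk0).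
      exact E2. }
  rewrite !D1. split.
  - intros [p [H1 [H2 H3]]]. apply cont_comps in H2. destruct H2 as [H2 H2'].
    split.
    + exists (fun u => Re (p u)). split; [|split; [exact H2|rewrite H3; reflexivity]].
      revert H1. apply filter_imp. intros u ->. simpl. unfold Re; simpl. ring.
    + exists (fun u => Im (p u)). split; [|split; [exact H2'|rewrite H3; reflexivity]].
      revert H1. apply filter_imp. intros u ->. simpl. unfold Im; simpl. ring.
  - intros [[p [H1 [H2 H3]]] [q [K1 [K2 K3]]]].
    exists (fun u => (p u, q u)). split; [|split].
    + generalize (filter_and _ _ H1 K1). apply filter_imp. intros u [E1 E2].
      unfold Re, Im in *. apply injective_projections; simpl in *; lra.
    + apply cont_comps. split; assumption.
    + rewrite H3, K3. symmetry. apply surjective_pairing.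
Qed.

Lemma norm_C_R (z : C) : @norm R_AbsRing C_R_NormedModule z = Cmod z.
Proof.
  unfold norm; simpl. unfold prod_norm, norm; simpl. unfold abs; simpl.
  unfold Cmod. f_equal. rewrite !Rmult_1_r, <- !Rabs_mult.
  rewrite !Rabs_pos_eq by apply Rle_0_sqr. ring.
Qed.

Lemma PD_slope (g : R -> C) (t : R) (d : C) :
  PD g t d <->
  forall eps, 0 < eps ->
    locally t (fun u => Cmod (g u - g t - d * RtoC (u - t)) <= eps * Rabs (u - t)).
Proof.
  split.
  - intros [p [H1 [H2 H3]]] eps He.
    generalize (filter_and _ _ H1 (proj1 (cont_C _ _) H2 eps He)). apply filter_imp.
    intros s [E1 E2]. rewrite E1.
    replace (g t + p s * RtoC (s - t) - g t - d * RtoC (s - t))%C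
      with ((p s - d) * RtoC (s - t))%C by cring.
    rewrite Cmod_mult, Cmod_R. rewrite H3 in E2.
    apply Rmult_le_compat_r; [apply Rabs_pos|lra].
  - intros H.
    exists (fun s => if Req_EM_T s t then d else (g s - g t) / RtoC (s - t))%C.
    split; [|split].
    + apply filter_forall. intros s. uncast.
      destruct (Req_EM_T s t) as [->|N].
      * replace (t - t) with 0 by ring. cring.
      * cfield. intros K. apply RtoC_inj in K. lra.
    + apply cont_C. intros eps He. generalize (H (eps/2) ltac:(lra)). apply filter_imp.
      intros s Hs. uncast.
      destruct (Req_EM_T t t) as [_|N]; [|easy].
      destruct (Req_EM_T s t) as [->|N].
      * replace (d - d)%C with (RtoC 0) by ring. rewrite Cmod_0. exact He.
      * assert (Hn : RtoC (s - t) <> 0).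
        { intros K. apply RtoC_inj in K. lra. }
        replace ((g s - g t) / RtoC (s - t) - d)%C
          with ((g s - g t - d * RtoC (s - t)) / RtoC (s - t))%C by (field; exact Hn).
        rewrite Cmod_div by exact Hn.
        apply Rle_lt_trans with (eps / 2); [|lra].
        apply Rmult_le_reg_r with (Cmod (RtoC (s - t))); [apply Cmod_gt_0, Hn|].
        unfold Rdiv at 1. rewrite Rmult_assoc, Rinv_l, Rmult_1_r.
        { rewrite Cmod_R. exact Hs. }
        apply Rgt_not_eq, Cmod_gt_0, Hn.
    + destruct (Req_EM_T t t); easy.
Qed.

(** The bridge to the derivative in which the theorem is stated; [norm_C_R] identifies its norm with
    the modulus. *)
Lemma PD_is_derive (g : R -> C) (t : R) (d : C) :
  PD g t d <-> @is_derive R_AbsRing C_R_NormedModule g t d.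
Proof.
  rewrite PD_slope.
  assert (E : forall u, minus (minus (g u : C_R_NormedModule) (g t))
                 (scal (minus u t : R_AbsRing) (d : C_R_NormedModule)) =
              (g u - g t - d * RtoC (u - t))%C).
  { intros u. unfold minus, plus, opp, scal; simpl.
    unfold prod_plus, prod_opp, prod_scal; simpl. unfold plus, opp, scal; simpl.
    unfold mult; simpl. apply injective_projections; simpl; ring. }
  split.
  - intros H. split.
    { apply (is_linear_scal_l (K := R_AbsRing) (V := C_R_NormedModule)). }
    intros x Hx. pose proof (is_filter_lim_locally_unique (K := R_AbsRing) (V := R_NormedModule) t x Hx) as Ex. subst x.
    intros eps. generalize (H eps (cond_pos eps)). apply filter_imp. intros u Hu.
    rewrite E, norm_C_R. exact Hu.
  - intros [_ H] eps He. generalize (H t (fun P K => K) (mkposreal eps He)).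
    apply filter_imp. intros u Hu. rewrite E, norm_C_R in Hu. exact Hu.
Qed.

Lemma PD_cont (g : R -> C) (t : R) (d : C) : PD g t d -> continuous g t.
Proof.
  intros [p [H1 [H2 H3]]].
  apply (cont_ext_loc (fun s => g t + p s * RtoC (s - t))%C).
  - revert H1. apply filter_imp. auto.
  - apply cont_plus; [apply continuous_const|]. apply cont_mult; [exact H2|].
    apply cont_RtoC. apply (continuous_minus (fun u : R => u) (fun _ => t)).
    + apply continuous_id.
    + apply continuous_const.
Qed.

Lemma CD_PD_comp (f : C -> C) (g : R -> C) (t : R) (l d : C) :
  CD f (g t) l -> PD g t d -> PD (fun u => f (g u)) t (l * d).
Proof.
  intros [p [H1 [H2 H3]]] Hg. pose proof (PD_cont _ _ _ Hg) as Cg.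
  destruct Hg as [q [K1 [K2 K3]]].
  exists (fun s => p (g s) * q s)%C. split; [|split].
  - pose proof (Cg _ H1) as G. unfold filtermap in G.
    generalize (filter_and _ _ G K1). apply filter_imp.
    intros s [E1 E2]. rewrite E1. rewrite E2 at 2. cring.
  - apply cont_mult; [|exact K2]. apply (continuous_comp g p); assumption.
  - rewrite H3, K3. reflexivity.
Qed.

Lemma PD_affine (a b : C) (t : R) : PD (fun u => a + RtoC u * b)%C t b.
Proof.
  exists (fun _ => b). split; [|split; [apply continuous_const|reflexivity]].
  apply filter_forall. intros u. rewrite RtoC_minus. cring.
Qed.

(** * Integrals of complex functions of a real variable *)

Definition CInt (f : R -> C) (a b : R) : C :=
  (RInt (fun t => Re (f t)) a b, RInt (fun t => Im (f t)) a b).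

Definition pcont (f : R -> C) (a b : R) : Prop :=
  forall t, a <= t <= b -> continuous f t.

Lemma ex_RInt_pcont (f : R -> C) (a b : R) : a <= b -> pcont f a b ->
  ex_RInt (fun t => Re (f t)) a b /\ ex_RInt (fun t => Im (f t)) a b.
Proof.
  intros Hab H. split; apply (ex_RInt_continuous (V := R_CompleteNormedModule));
  rewrite Rmin_left, Rmax_right by exact Hab; intros t Ht; apply H, cont_comps in Ht; tauto.
Qed.

Lemma is_RInt_CInt (f : R -> C) (a b : R) : a <= b -> pcont f a b ->
  @is_RInt C_R_NormedModule f a b (CInt f a b).
Proof.
  intros Hab H. destruct (ex_RInt_pcont f a b Hab H) as [H1 H2].
  apply (is_RInt_fct_extend_pair (U := R_NormedModule) (V := R_NormedModule));
  apply (RInt_correct (V := R_CompleteNormedModule)); assumption.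
Qed.

Lemma is_RInt_CInt_eq (f : R -> C) (a b : R) (l : C) :
  @is_RInt C_R_NormedModule f a b l -> CInt f a b = l.
Proof.
  intros H. unfold CInt. rewrite (surjective_pairing l). f_equal.
  - apply (is_RInt_unique (V := R_CompleteNormedModule)).
    apply (is_RInt_fct_extend_fst (U := R_NormedModule) (V := R_NormedModule) f a b l H).
  - apply (is_RInt_unique (V := R_CompleteNormedModule)).
    apply (is_RInt_fct_extend_snd (U := R_NormedModule) (V := R_NormedModule) f a b l H).
Qed.

Lemma CInt_ext (f g : R -> C) (a b : R) : a <= b ->
  (forall t, a <= t <= b -> f t = g t) -> CInt f a b = CInt g a b.
Proof.
  intros Hab H. unfold CInt. f_equal; apply RInt_ext;
  rewrite Rmin_left, Rmax_right by exact Hab; intros t Ht; rewrite H by lra; reflexivity.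
Qed.

Lemma CInt_plus (f g : R -> C) (a b : R) : a <= b -> pcont f a b -> pcont g a b ->
  CInt (fun t => f t + g t)%C a b = (CInt f a b + CInt g a b)%C.
Proof.
  intros Hab Hf Hg. destruct (ex_RInt_pcont f a b Hab Hf) as [F1 F2].
  destruct (ex_RInt_pcont g a b Hab Hg) as [G1 G2].
  unfold CInt, Cplus. simpl. f_equal;
  [apply (RInt_plus (V := R_CompleteNormedModule) (fun t => Re (f t)) (fun t => Re (g t)))
  |apply (RInt_plus (V := R_CompleteNormedModule) (fun t => Im (f t)) (fun t => Im (g t)))];
  assumption.
Qed.

Lemma CInt_scal (c : C) (f : R -> C) (a b : R) : a <= b -> pcont f a b ->
  CInt (fun t => c * f t)%C a b = (c * CInt f a b)%C.
Proof.
  intros Hab Hf. destruct (ex_RInt_pcont f a b Hab Hf) as [F1 F2].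
  destruct c as [x y]. unfold CInt, Cmult. simpl. f_equal.
  - rewrite <- (RInt_scal (V := R_CompleteNormedModule) (fun t => Re (f t))) by assumption.
    rewrite <- (RInt_scal (V := R_CompleteNormedModule) (fun t => Im (f t))) by assumption.
    apply (RInt_minus (V := R_CompleteNormedModule) (fun t => x * Re (f t)) (fun t => y * Im (f t)));
    apply (ex_RInt_scal (V := R_NormedModule)); assumption.
  - rewrite <- (RInt_scal (V := R_CompleteNormedModule) (fun t => Re (f t))) by assumption.
    rewrite <- (RInt_scal (V := R_CompleteNormedModule) (fun t => Im (f t))) by assumption.
    apply (RInt_plus (V := R_CompleteNormedModule) (fun t => x * Im (f t)) (fun t => y * Re (f t)));
    apply (ex_RInt_scal (V := R_NormedModule)); assumption.
Qed.

Lemma CInt_opp (f : R -> C) (a b : R) : a <= b -> pcont f a b ->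
  CInt (fun t => - f t)%C a b = (- CInt f a b)%C.
Proof.
  intros Hab Hf. rewrite (CInt_ext _ (fun t => (-1) * f t)%C) by (auto; intros; ring).
  rewrite CInt_scal by assumption. ring.
Qed.

Lemma CInt_minus (f g : R -> C) (a b : R) : a <= b -> pcont f a b -> pcont g a b ->
  CInt (fun t => f t - g t)%C a b = (CInt f a b - CInt g a b)%C.
Proof.
  intros Hab Hf Hg. unfold Cminus; rewrite <- (CInt_opp g) by assumption. apply CInt_plus; auto.
  intros t Ht. apply cont_opp, Hg, Ht.
Qed.

Lemma CInt_norm (f : R -> C) (a b M : R) : a <= b -> pcont f a b ->
  (forall t, a <= t <= b -> Cmod (f t) <= M) -> Cmod (CInt f a b) <= (b - a) * M.
Proof.
  intros Hab Hf HM. rewrite <- norm_C_R.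
  apply (norm_RInt_le_const (V := C_R_NormedModule) f a b); auto.
  - intros t Ht. rewrite norm_C_R. auto.
  - apply is_RInt_CInt; assumption.
Qed.

Lemma CInt_norm_le (f : R -> C) (g : R -> R) (a b lg : R) : a <= b -> pcont f a b ->
  (forall t, a <= t <= b -> Cmod (f t) <= g t) -> is_RInt g a b lg -> Cmod (CInt f a b) <= lg.
Proof.
  intros Hab Hf HM Hg. rewrite <- norm_C_R.
  apply (norm_RInt_le (V := C_R_NormedModule) f g a b); auto.
  - intros t Ht. rewrite norm_C_R. auto.
  - apply is_RInt_CInt; assumption.
Qed.

Lemma CInt_Chasles (f : R -> C) (a b c : R) : a <= b -> b <= c -> pcont f a c ->
  (CInt f a b + CInt f b c = CInt f a c)%C.
Proof.
  intros Hab Hbc H.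
  destruct (ex_RInt_pcont f a b Hab) as [F1 F2]; [intros t Ht; apply H; lra|].
  destruct (ex_RInt_pcont f b c Hbc) as [G1 G2]; [intros t Ht; apply H; lra|].
  unfold CInt, Cplus; simpl. f_equal;
  apply (RInt_Chasles (V := R_CompleteNormedModule)); assumption.
Qed.

Lemma CInt_FTC (G g : R -> C) (a b : R) : a <= b ->
  (forall t, a <= t <= b -> PD G t (g t)) -> pcont g a b ->
  CInt g a b = (G b - G a)%C.
Proof.
  intros Hab H Hg. unfold CInt, Cminus, Cplus, Copp; simpl. f_equal;
  apply is_RInt_unique.
  - apply (is_RInt_derive (V := R_CompleteNormedModule) (fun t => Re (G t)));
    rewrite Rmin_left, Rmax_right by exact Hab; intros t Ht.
    + apply PD_comps, (H t Ht).
    + apply (cont_comps g), Hg, Ht.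
  - apply (is_RInt_derive (V := R_CompleteNormedModule) (fun t => Im (G t)));
    rewrite Rmin_left, Rmax_right by exact Hab; intros t Ht.
    + apply PD_comps, (H t Ht).
    + apply (cont_comps g), Hg, Ht.
Qed.

Lemma CInt_const (c : C) (a b : R) : a <= b -> CInt (fun _ => c) a b = ((b - a)%R * c)%C.
Proof.
  intros Hab. rewrite (CInt_FTC (fun t => 0 + RtoC t * c)%C); auto.
  - rewrite RtoC_minus. ring.
  - intros t Ht. apply PD_affine.
  - intros t Ht. apply continuous_const.
Qed.

Lemma cont_Cmod {T : UniformSpace} (f : T -> C) (x : T) :
  continuous f x -> continuous (fun y => Cmod (f y)) x.
Proof.
  intros H. apply filterlim_locally. intros eps.
  generalize (proj1 (cont_C _ _) H eps (cond_pos eps)). apply filter_imp. intros y Hy.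
  unfold ball; simpl. unfold AbsRing_ball, abs, minus, plus, opp; simpl.
  apply Rle_lt_trans with (2 := Hy).
  assert (K1 := Cmod_triangle (f y - f x) (f x)).
  assert (K2 := Cmod_triangle (f x - f y) (f y)).
  replace (f y - f x + f x)%C with (f y) in K1 by ring.
  replace (f x - f y + f y)%C with (f x) in K2 by ring.
  replace (f x - f y)%C with (- (f y - f x))%C in K2 by ring.
  rewrite Cmod_opp in K2. apply Rabs_le. lra.
Qed.

Lemma pcont_bounded (f : R -> C) (a b : R) : a <= b -> pcont f a b ->
  exists M, 0 < M /\ forall t, a <= t <= b -> Cmod (f t) <= M.
Proof.
  intros Hab Hf.
  destruct (continuity_ab_maj (fun t => Cmod (f t)) a b Hab) as [m [Hm _]].
  - intros t Ht. apply continuity_pt_filterlim. apply cont_Cmod. apply Hf, Ht.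
  - exists (Cmod (f m) + 1). split; [generalize (Cmod_ge_0 (f m)); lra|].
    intros t Ht. specialize (Hm t Ht). simpl in Hm. lra.
Qed.

(** A Heine-Cantor statement on a neighbourhood of a compact arc: the radii found at the single
    parameters form a gauge on [a, b], and compactness replaces it by one radius. The halves of
    [eps] and of [r] pay for passing through the centre of the covering interval. *)
Lemma unif_along (U : C -> Prop) (f : C -> C) (A : R -> C) (a b : R) :
  (forall s, U s -> locally s U) -> (forall s, U s -> continuous f s) ->
  pcont A a b -> (forall t, a <= t <= b -> U (A t)) ->
  forall eps, 0 < eps -> exists d, 0 < d /\ forall t h, a <= t <= b -> Cmod h < d ->
    U (A t + h)%C /\ Cmod (f (A t + h) - f (A t))%C < eps.
Proof.
  intros Uo Hf HA HU eps He.
  assert (E : forall t, exists d : posreal, a <= t <= b -> forall u h, Rabs (u - t) < d ->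
      Cmod h < d -> U (A u + h)%C /\ Cmod (f (A u + h) - f (A t))%C < eps / 2).
  { intros t. destruct (classic (a <= t <= b)) as [Ht|Ht].
    2:{ exists (mkposreal 1 Rlt_0_1). tauto. }
    assert (He2 : 0 < eps / 2) by lra.
    pose proof (filter_and _ _ (Uo _ (HU t Ht)) (proj1 (cont_C _ _) (Hf _ (HU t Ht)) _ He2)) as L.
    apply locally_C in L. destruct L as [r [Hr L]].
    assert (Hr2 : 0 < r / 2) by lra.
    destruct (proj1 (cont_C _ _) (HA t Ht) _ Hr2) as [d Hd].
    assert (Hm : 0 < Rmin d (r / 2)) by (apply Rmin_pos; [apply cond_pos|lra]).
    exists (mkposreal _ Hm). intros _ u h Hu Hh. simpl in Hu, Hh.
    apply L.
    replace (A u + h - A t)%C with ((A u - A t) + h)%C by ring.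
    eapply Rle_lt_trans; [apply Cmod_triangle|].
    assert (Cmod (A u - A t) < r / 2).
    { apply Hd. apply Rlt_le_trans with (1 := Hu). apply Rmin_l. }
    generalize (Rmin_r d (r / 2)). lra. }
  apply (choice (fun t (d : posreal) => a <= t <= b -> forall u h, Rabs (u - t) < d ->
      Cmod h < d -> U (A u + h)%C /\ Cmod (f (A u + h) - f (A t))%C < eps / 2)) in E.
  destruct E as [delta Hdelta].
  destruct (compactness_value_1d a b delta) as [d Hd].
  exists d. split; [apply cond_pos|]. intros t h Ht Hh.
  (* The covering centre [u] is delivered under a double negation. *)
  specialize (Hd t Ht). apply NNPP in Hd. destruct Hd as [u [Hu [H1 H2]]].
  assert (Hdu := cond_pos (delta u)).
  destruct (Hdelta u Hu t h H1 ltac:(lra)) as [K1 K2].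
  destruct (Hdelta u Hu t (RtoC 0) H1) as [K3 K4]; [rewrite Cmod_0; lra|].
  split; [exact K1|].
  replace (A t + 0)%C with (A t) in K4 by ring.
  replace (f (A t + h) - f (A t))%C with ((f (A t + h) - f (A u)) + - (f (A t) - f (A u)))%C by ring.
  eapply Rle_lt_trans; [apply Cmod_triangle|]. rewrite Cmod_opp. lra.
Qed.

(** * Holomorphic functions *)

(** A total derivative operator; its value carries information only where some [CD f a l] holds. *)
Definition D (f : C -> C) (a : C) : C := epsilon (inhabits (RtoC 0)) (CD f a).

Lemma D_correct (f : C -> C) (a l : C) : CD f a l -> CD f a (D f a).
Proof. intros H. unfold D. apply epsilon_spec. exists l. exact H. Qed.

Lemma D_eq (f : C -> C) (a l : C) : CD f a l -> D f a = l.
Proof. intros H. apply (CD_unique f a); [apply (D_correct f a l H)|exact H]. Qed.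

Definition copen (U : C -> Prop) : Prop := forall s, U s -> locally s U.

(** Continuity of the derivative is built in, so that derivatives can be integrated along paths and
    Goursat's argument is avoided. *)
Definition Hol (U : C -> Prop) (f : C -> C) : Prop :=
  forall s, U s -> CD f s (D f s) /\ continuous (D f) s.

Lemma Hol_intro (U : C -> Prop) (f f' : C -> C) : copen U ->
  (forall s, U s -> CD f s (f' s)) -> (forall s, U s -> continuous f' s) -> Hol U f.
Proof.
  intros Uo H1 H2 s Hs. split.
  - apply (D_correct f s (f' s)). auto.
  - apply (cont_ext_loc f'); [|auto].
    generalize (Uo s Hs). apply filter_imp. intros u Hu. symmetry. apply D_eq. auto.
Qed.

Lemma Hol_cont (U : C -> Prop) (f : C -> C) (s : C) : Hol U f -> U s -> continuous f s.
Proof. intros H Hs. apply (CD_cont f s (D f s)). apply H, Hs. Qed.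

Lemma Hol_sub (U V : C -> Prop) (f : C -> C) : (forall s, V s -> U s) -> Hol U f -> Hol V f.
Proof. intros H Hf s Hs. apply Hf, H, Hs. Qed.

Lemma Hol_ext (U : C -> Prop) (f g : C -> C) : copen U ->
  (forall s, U s -> f s = g s) -> Hol U f -> Hol U g.
Proof.
  intros Uo H Hf. apply (Hol_intro U g (D f) Uo).
  - intros s Hs. apply (CD_ext_loc f); [|apply Hf, Hs].
    generalize (Uo s Hs). apply filter_imp. exact H.
  - intros s Hs. apply Hf, Hs.
Qed.

Lemma Hol_local (U : C -> Prop) (f : C -> C) :
  (forall s, U s -> exists V, V s /\ Hol V f) -> Hol U f.
Proof. intros H s Hs. destruct (H s Hs) as [V [HV Hf]]. apply Hf, HV. Qed.

Lemma Hol_const (U : C -> Prop) (c : C) : copen U -> Hol U (fun _ => c).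
Proof.
  intros Uo. apply (Hol_intro U _ (fun _ => RtoC 0) Uo).
  - intros s _. apply CD_const.
  - intros s _. apply continuous_const.
Qed.

Lemma Hol_id (U : C -> Prop) : copen U -> Hol U (fun s => s).
Proof.
  intros Uo. apply (Hol_intro U _ (fun _ => RtoC 1) Uo).
  - intros s _. apply CD_id.
  - intros s _. apply continuous_const.
Qed.

Lemma Hol_plus (U : C -> Prop) (f g : C -> C) : copen U ->
  Hol U f -> Hol U g -> Hol U (fun s => f s + g s)%C.
Proof.
  intros Uo Hf Hg. apply (Hol_intro U _ (fun s => D f s + D g s)%C Uo); intros s Hs.
  - apply CD_plus; [apply Hf, Hs|apply Hg, Hs].
  - apply cont_plus; [apply Hf, Hs|apply Hg, Hs].
Qed.

Lemma Hol_mult (U : C -> Prop) (f g : C -> C) : copen U ->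
  Hol U f -> Hol U g -> Hol U (fun s => f s * g s)%C.
Proof.
  intros Uo Hf Hg. apply (Hol_intro U _ (fun s => D f s * g s + f s * D g s)%C Uo); intros s Hs.
  - apply CD_mult; [apply Hf, Hs|apply Hg, Hs].
  - apply cont_plus; apply cont_mult; try (apply Hf, Hs); try (apply Hg, Hs);
    apply (Hol_cont U); assumption.
Qed.

Lemma Hol_opp (U : C -> Prop) (f : C -> C) : copen U -> Hol U f -> Hol U (fun s => - f s)%C.
Proof.
  intros Uo Hf. apply (Hol_intro U _ (fun s => - D f s)%C Uo); intros s Hs.
  - apply CD_opp, Hf, Hs.
  - apply cont_opp, Hf, Hs.
Qed.

Lemma Hol_minus (U : C -> Prop) (f g : C -> C) : copen U ->
  Hol U f -> Hol U g -> Hol U (fun s => f s - g s)%C.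
Proof. intros Uo Hf Hg. apply Hol_plus; auto. apply Hol_opp; auto. Qed.

Lemma Hol_inv (U : C -> Prop) (f : C -> C) : copen U ->
  Hol U f -> (forall s, U s -> f s <> 0) -> Hol U (fun s => / f s)%C.
Proof.
  intros Uo Hf H0. apply (Hol_intro U _ (fun s => - D f s / (f s * f s))%C Uo); intros s Hs.
  - apply CD_inv; [apply Hf, Hs|auto].
  - apply cont_mult; [apply cont_opp, Hf, Hs|].
    apply cont_inv; [apply cont_mult; apply (Hol_cont U); assumption|].
    apply Cmult_neq_0; auto.
Qed.

Lemma Hol_comp (U V : C -> Prop) (f g : C -> C) : copen V ->
  Hol U f -> Hol V g -> (forall s, V s -> U (g s)) -> Hol V (fun s => f (g s)).
Proof.
  intros Vo Hf Hg H. apply (Hol_intro V _ (fun s => D f (g s) * D g s)%C Vo); intros s Hs.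
  - apply CD_comp; [apply Hf, H, Hs|apply Hg, Hs].
  - apply cont_mult; [|apply Hg, Hs].
    apply (continuous_comp g (D f)); [apply (Hol_cont V); assumption|apply Hf, H, Hs].
Qed.

(** The mean value inequality, from integrating the derivative minus its value at [s] along the
    segment. *)
Lemma CD_increment (U : C -> Prop) (f : C -> C) (s k : C) (e : R) : Hol U f ->
  (forall u, 0 <= u <= 1 -> U (s + RtoC u * k)%C) ->
  (forall u, 0 <= u <= 1 -> Cmod (D f (s + RtoC u * k) - D f s)%C <= e) ->
  Cmod (f (s + k) - f s - D f s * k)%C <= e * Cmod k.
Proof.
  intros Hf HU He.
  assert (Ck : pcont (fun u : R => D f (s + RtoC u * k)%C * k)%C 0 1).
  { intros u Hu. apply cont_mult; [|apply continuous_const].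
    apply (continuous_comp (fun u : R => s + RtoC u * k)%C (D f)).
    - apply (PD_cont _ _ k), PD_affine.
    - apply Hf, HU, Hu. }
  assert (E1 : CInt (fun u : R => D f (s + RtoC u * k)%C * k)%C 0 1 = (f (s + k) - f s)%C).
  { rewrite (CInt_FTC (fun u => f (s + RtoC u * k)%C)); try lra; auto.
    - rewrite Cmult_1_l, Cmult_0_l, Cplus_0_r. reflexivity.
    - intros u Hu. apply (CD_PD_comp f (fun u => s + RtoC u * k)%C).
      + apply Hf, HU, Hu.
      + apply PD_affine. }
  assert (E2 : CInt (fun _ : R => D f s * k)%C 0 1 = (D f s * k)%C).
  { rewrite CInt_const by lra. replace (1 - 0) with 1 by ring. ring. }
  rewrite <- E1, <- E2, <- CInt_minus; try lra; auto.
  2:{ intros u _. apply continuous_const. }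
  replace (e * Cmod k) with ((1 - 0) * (e * Cmod k)) by ring.
  apply CInt_norm; try lra.
  - intros u Hu. apply cont_minus; [apply Ck, Hu|apply continuous_const].
  - intros u Hu. replace (D f (s + RtoC u * k) * k - D f s * k)%C with
      ((D f (s + RtoC u * k) - D f s) * k)%C by ring.
    rewrite Cmod_mult. apply Rmult_le_compat_r; [apply Cmod_ge_0|auto].
Qed.

(** Differentiation under the integral sign with an affine dependence on the parameter; this shape
    covers the Cauchy kernel, the contraction of a circle to a point and the primitive along rays.
    Uniformity of [D f] along the arc comes from [unif_along]. *)
Lemma CD_CInt_param (U : C -> Prop) (f : C -> C) (A B M : R -> C) (a b : R) (w : C) :
  a <= b -> copen U -> Hol U f -> pcont A a b -> pcont B a b -> pcont M a b ->
  (forall t, a <= t <= b -> U (A t + w * B t)%C) ->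
  CD (fun v => CInt (fun t => f (A t + v * B t) * M t)%C a b) w
     (CInt (fun t => D f (A t + w * B t) * (B t * M t))%C a b).
Proof.
  intros Hab Uo Hf HA HB HM HU.
  apply CD_cont_slope. intros eps He.
  destruct (pcont_bounded B a b Hab HB) as [KB [HKB HB']].
  destruct (pcont_bounded M a b Hab HM) as [KM [HKM HM']].
  set (A' := fun t => (A t + w * B t)%C).
  assert (CA' : pcont A' a b).
  { intros t Ht. apply cont_plus; [apply HA, Ht|]. apply cont_mult; [apply continuous_const|apply HB, Ht]. }
  (* The summand 1 keeps the denominator positive when a = b. *)
  set (e := eps / ((b - a + 1) * KB * KM)).
  assert (He1 : 0 < e).
  { apply Rdiv_lt_0_compat; [exact He|]. apply Rmult_lt_0_compat; [|exact HKM].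
    apply Rmult_lt_0_compat; lra. }
  destruct (unif_along U (D f) A' a b Uo) with (eps := e) as [d [Hd H]]; auto.
  { intros s Hs. apply Hf, Hs. }
  apply locally_C. exists (d / KB). split; [apply Rdiv_lt_0_compat; assumption|].
  intros v Hv. set (h := (v - w)%C) in *.
  assert (Hh : forall t u, a <= t <= b -> 0 <= u <= 1 -> Cmod (RtoC u * (h * B t)) < d).
  { intros t u Ht Hu. rewrite !Cmod_mult, Cmod_R, Rabs_pos_eq by lra.
    specialize (HB' t Ht).
    apply Rle_lt_trans with (1 * (Cmod h * KB)).
    - apply Rmult_le_compat; try lra; [apply Rmult_le_pos; apply Cmod_ge_0|].
      apply Rmult_le_compat_l; [apply Cmod_ge_0|lra].
    - rewrite Rmult_1_l. apply Rmult_lt_reg_r with (/ KB); [apply Rinv_0_lt_compat, HKB|].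
      rewrite Rmult_assoc, Rinv_r, Rmult_1_r by lra. exact Hv. }
  assert (Ev : forall t, (A t + v * B t = A' t + h * B t)%C).
  { intros t. unfold A', h. ring. }
  assert (C1 : pcont (fun t => f (A t + v * B t) * M t)%C a b).
  { intros t Ht. apply cont_mult; [|apply HM, Ht].
    apply (continuous_comp (fun t => A t + v * B t)%C f).
    - apply cont_plus; [apply HA, Ht|]. apply cont_mult; [apply continuous_const|apply HB, Ht].
    - apply (Hol_cont U f); [exact Hf|].
      destruct (H t (RtoC 1 * (h * B t))%C Ht (Hh t 1 Ht ltac:(lra))) as [K _].
      rewrite Cmult_1_l in K. rewrite Ev. exact K. }
  assert (C2 : pcont (fun t => f (A t + w * B t) * M t)%C a b).
  { intros t Ht. apply cont_mult; [|apply HM, Ht].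
    apply (continuous_comp A' f); [apply CA', Ht|].
    apply (Hol_cont U f); [exact Hf|apply HU, Ht]. }
  assert (C3 : pcont (fun t => D f (A t + w * B t) * (B t * M t))%C a b).
  { intros t Ht. apply cont_mult; [|apply cont_mult; [apply HB, Ht|apply HM, Ht]].
    apply (continuous_comp A' (D f)); [apply CA', Ht|]. apply Hf, HU, Ht. }
  rewrite <- CInt_minus by assumption.
  rewrite (Cmult_comm _ h), <- CInt_scal by assumption.
  rewrite <- CInt_minus; auto.
  2:{ intros t Ht. apply cont_minus; [apply C1, Ht|apply C2, Ht]. }
  2:{ intros t Ht. apply cont_mult; [apply continuous_const|apply C3, Ht]. }
  apply Rle_trans with ((b - a) * (e * (Cmod h * KB) * KM)).
  - apply CInt_norm; [exact Hab| |].
    + intros t Ht. apply cont_minus; [apply cont_minus; [apply C1, Ht|apply C2, Ht]|].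
      apply cont_mult; [apply continuous_const|apply C3, Ht].
    + intros t Ht. rewrite Ev. fold (A' t).
      replace (f (A' t + h * B t) * M t - f (A' t) * M t - h * (D f (A' t) * (B t * M t)))%C
        with ((f (A' t + h * B t) - f (A' t) - D f (A' t) * (h * B t)) * M t)%C by ring.
      rewrite Cmod_mult. apply Rmult_le_compat; try apply Cmod_ge_0; auto.
      apply Rle_trans with (e * Cmod (h * B t)).
      * apply (CD_increment U); [exact Hf| |].
        -- intros u Hu. apply H; auto.
        -- intros u Hu. apply Rlt_le. apply H; auto.
      * apply Rmult_le_compat_l; [lra|]. rewrite Cmod_mult.
        apply Rmult_le_compat_l; [apply Cmod_ge_0|auto].
  - replace ((b - a) * (e * (Cmod h * KB) * KM)) with (eps * Cmod h * ((b - a) / (b - a + 1))).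
    2:{ unfold e. field. repeat split; lra. }
    rewrite <- (Rmult_1_r (eps * Cmod h)) at 2.
    apply Rmult_le_compat_l; [apply Rmult_le_pos; [lra|apply Cmod_ge_0]|].
    apply Rmult_le_reg_r with (b - a + 1); [lra|]. unfold Rdiv.
    rewrite Rmult_assoc, Rinv_l; lra.
Qed.

(** * Cauchy's formula *)

Definition circ (t : R) : C := (cos t, sin t).

Lemma PD_circ (t : R) : PD circ t (Ci * circ t).
Proof.
  apply PD_comps. unfold circ, Ci, Cmult, Re, Im; simpl. split.
  - replace (0 * cos t - 1 * sin t) with (- sin t) by ring. apply is_derive_cos.
  - replace (0 * sin t + 1 * cos t) with (cos t) by ring. apply is_derive_sin.
Qed.

Lemma Cmod_circ (t : R) : Cmod (circ t) = 1.
Proof.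
  unfold Cmod, circ. cbn [fst snd].
  replace (cos t ^ 2 + sin t ^ 2) with 1; [apply sqrt_1|].
  generalize (sin2_cos2 t). unfold Rsqr. intros H. nra.
Qed.

Definition cpath (a : C) (r : R) (t : R) : C := (a + r * circ t)%C.
Definition dcpath (r : R) (t : R) : C := (r * (Ci * circ t))%C.

Lemma PD_cpath (a : C) (r t : R) : PD (cpath a r) t (dcpath r t).
Proof.
  apply (CD_PD_comp (fun s => a + r * s)%C circ t (RtoC r)); [|apply PD_circ].
  eapply CD_eq; [apply CD_plus; [apply CD_const|apply CD_scal, CD_id]|ring].
Qed.

Lemma cont_cpath (a : C) (r t : R) : continuous (cpath a r) t.
Proof. apply (PD_cont _ _ _ (PD_cpath a r t)). Qed.

Lemma cont_dcpath (r t : R) : continuous (dcpath r) t.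
Proof.
  apply cont_mult; [apply continuous_const|]. apply cont_mult; [apply continuous_const|].
  apply (PD_cont _ _ _ (PD_circ t)).
Qed.

Lemma cpath_2PI (a : C) (r : R) : cpath a r (2 * PI) = cpath a r 0.
Proof. unfold cpath, circ. rewrite cos_2PI, sin_2PI, cos_0, sin_0. reflexivity. Qed.

Lemma Cmod_cpath (a : C) (r t : R) : 0 <= r -> Cmod (cpath a r t - a) = r.
Proof.
  intros Hr. unfold cpath. replace (a + r * circ t - a)%C with (r * circ t)%C by ring.
  rewrite Cmod_mult, Cmod_R, Cmod_circ, Rabs_pos_eq by lra. ring.
Qed.

Lemma two_PI_pos : 0 <= 2 * PI.
Proof. generalize PI_RGT_0. lra. Qed.

Definition disc (a : C) (r : R) (s : C) : Prop := Cmod (s - a) < r.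

Lemma copen_disc (a : C) (r : R) : copen (disc a r).
Proof.
  intros s Hs. apply locally_C. exists (r - Cmod (s - a)). unfold disc in *.
  split; [lra|]. intros u Hu.
  replace (u - a)%C with ((u - s) + (s - a))%C by ring.
  eapply Rle_lt_trans; [apply Cmod_triangle|]. lra.
Qed.

Lemma copen_neq0 : copen (fun u => u <> 0).
Proof.
  intros u Hu. apply (cont_neq0 (fun u => u) u); [apply continuous_id|exact Hu].
Qed.

Lemma copen_disc_in (U : C -> Prop) (a : C) : copen U -> U a ->
  exists r, 0 < r /\ forall s, Cmod (s - a) <= r -> U s.
Proof.
  intros Uo Ha. destruct (proj1 (locally_C _ _) (Uo a Ha)) as [d [Hd H]].
  exists (d / 2). split; [lra|]. intros s Hs. apply H. lra.
Qed.

Lemma Hol_CInt_param (U V : C -> Prop) (f : C -> C) (A B M : R -> C) (a b : R) :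
  a <= b -> copen U -> copen V -> Hol U f -> Hol U (D f) ->
  pcont A a b -> pcont B a b -> pcont M a b ->
  (forall w t, V w -> a <= t <= b -> U (A t + w * B t)%C) ->
  Hol V (fun v => CInt (fun t => f (A t + v * B t) * M t)%C a b).
Proof.
  intros Hab Uo Vo Hf Hf' HA HB HM HU.
  apply (Hol_intro V _ (fun w => CInt (fun t => D f (A t + w * B t) * (B t * M t))%C a b) Vo).
  - intros w Hw. apply (CD_CInt_param U); auto.
  - intros w Hw. eapply CD_cont.
    apply (CD_CInt_param U (D f) A B (fun t => B t * M t)%C); auto.
    intros t Ht. apply cont_mult; [apply HB, Ht|apply HM, Ht].
Qed.

Lemma CD_Cinv (u : C) : u <> 0 -> CD Cinv u (- (1) / (u * u)).
Proof. intros Hu. apply (CD_inv (fun s => s) u 1); [apply CD_id|exact Hu]. Qed.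

Lemma Hol_Cinv : Hol (fun u => u <> 0) Cinv.
Proof.
  apply (Hol_inv _ (fun s => s) copen_neq0); [apply Hol_id, copen_neq0|auto].
Qed.

(** Holomorphy of derivatives in general is deduced from Cauchy's formula, so for the kernel itself
    it is checked by hand. *)
Lemma Hol_D_Cinv : Hol (fun u => u <> 0) (D Cinv).
Proof.
  apply (Hol_ext _ (fun u => - (1) / (u * u))%C _ copen_neq0).
  - intros u Hu. symmetry. apply D_eq, CD_Cinv, Hu.
  - apply Hol_mult; [exact copen_neq0|apply (Hol_const _ (- (1))%C), copen_neq0|].
    apply Hol_inv; [exact copen_neq0| |].
    + apply Hol_mult; try apply Hol_id; exact copen_neq0.
    + intros s Hs. apply Cmult_neq_0; exact Hs.
Qed.

Lemma circle_neq (a w : C) (r t : R) : 0 < r -> Cmod (w - a) < r -> (cpath a r t - w <> 0)%C.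
Proof.
  intros Hr Hw E.
  assert (E2 : (w - a = cpath a r t - a)%C).
  { replace w with (w + (cpath a r t - w))%C at 1 by (rewrite E; ring). ring. }
  rewrite E2, Cmod_cpath in Hw; lra.
Qed.

Definition cauchy_int (a : C) (r : R) (phi : R -> C) (w : C) : C :=
  CInt (fun t => / (cpath a r t - w) * phi t)%C 0 (2 * PI).

Lemma cauchy_int_param (a : C) (r : R) (phi : R -> C) (w : C) :
  cauchy_int a r phi w = CInt (fun t => / (cpath a r t + w * (-1)) * phi t)%C 0 (2 * PI).
Proof.
  apply CInt_ext; [apply two_PI_pos|]. intros t _.
  replace (cpath a r t + w * -1)%C with (cpath a r t - w)%C by ring. reflexivity.
Qed.

(** The density [phi] is arbitrary. The second half, on the derivative, is what [Hol_D] transfers to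
    all holomorphic functions. *)
Lemma Hol_cauchy_int (a : C) (r : R) (phi : R -> C) : 0 < r -> pcont phi 0 (2 * PI) ->
  Hol (disc a r) (cauchy_int a r phi) /\ Hol (disc a r) (D (cauchy_int a r phi)).
Proof.
  intros Hr Hphi.
  assert (HU : forall w t, disc a r w -> 0 <= t <= 2 * PI -> (cpath a r t + w * (-1) <> 0)%C).
  { intros w t Hw _. replace (cpath a r t + w * -1)%C with (cpath a r t - w)%C by ring.
    apply circle_neq; assumption. }
  assert (C1 : pcont (cpath a r) 0 (2 * PI)) by (intros t _; apply cont_cpath).
  assert (C2 : pcont (fun _ => (-1)%C) 0 (2 * PI)) by (intros t _; apply continuous_const).
  assert (C3 : pcont (fun t => (-1) * phi t)%C 0 (2 * PI)).
  { intros t Ht. apply cont_mult; [apply continuous_const|apply Hphi, Ht]. }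
  split.
  - apply (Hol_ext _ (fun w => CInt (fun t => / (cpath a r t + w * (-1)) * phi t)%C 0 (2 * PI))
              _ (copen_disc a r)).
    { intros w _. symmetry. apply cauchy_int_param. }
    apply (Hol_CInt_param (fun u => u <> 0) (disc a r) Cinv (cpath a r) (fun _ => (-1)%C) phi);
      auto using two_PI_pos, copen_neq0, copen_disc, Hol_Cinv, Hol_D_Cinv.
  - apply (Hol_ext _ (fun w => CInt (fun t => D Cinv (cpath a r t + w * (-1)) * ((-1) * phi t))%C 0 (2 * PI))
              _ (copen_disc a r)).
    { intros w Hw. symmetry. apply D_eq.
      apply (CD_ext (fun w => CInt (fun t => / (cpath a r t + w * (-1)) * phi t)%C 0 (2 * PI))).
      { intros s. symmetry. apply cauchy_int_param. }
      apply (CD_CInt_param (fun u => u <> 0) Cinv (cpath a r) (fun _ => (-1)%C) phi);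
        auto using two_PI_pos, copen_neq0, copen_disc, Hol_Cinv, Hol_D_Cinv. }
    assert (H2 : Hol (fun u => u <> 0) (D (D Cinv))).
    { apply (Hol_ext _ (fun u => 2 / (u * u * u))%C _ copen_neq0).
      - intros u Hu. symmetry. apply D_eq.
        apply (CD_ext_loc (fun u => - (1) / (u * u))%C).
        + generalize (copen_neq0 u Hu). apply filter_imp. intros v Hv. symmetry. apply D_eq, CD_Cinv, Hv.
        + eapply CD_eq.
          * apply (CD_mult (fun _ => (- (1))%C) (fun u => / (u * u))%C); [apply CD_const|].
            apply (CD_inv (fun u => u * u)%C).
            -- apply (CD_mult (fun u => u) (fun u => u)); apply CD_id.
            -- apply Cmult_neq_0; exact Hu.
          * field. exact Hu.
      - apply Hol_mult; [exact copen_neq0|apply (Hol_const _ (2)%C), copen_neq0|].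
        apply Hol_inv; [exact copen_neq0| |].
        + apply Hol_mult; [exact copen_neq0| |apply Hol_id, copen_neq0].
          apply Hol_mult; try apply Hol_id; exact copen_neq0.
        + intros s Hs. repeat apply Cmult_neq_0; exact Hs. }
    apply (Hol_CInt_param (fun u => u <> 0) (disc a r) (D Cinv) (cpath a r) (fun _ => (-1)%C)
             (fun t => (-1) * phi t)%C);
      auto using two_PI_pos, copen_neq0, copen_disc, Hol_Cinv, Hol_D_Cinv.
Qed.

Lemma CD_zero_const (f : C -> C) (a b : C) :
  (forall u, 0 <= u <= 1 -> CD f (a + RtoC u * (b - a))%C 0) -> f b = f a.
Proof.
  intros H.
  assert (E : CInt (fun _ => RtoC 0) 0 1 = (f b - f a)%C).
  { rewrite (CInt_FTC (fun u => f (a + RtoC u * (b - a))%C)).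
    - f_equal; [|f_equal]; f_equal; ring.
    - lra.
    - intros t Ht. replace (RtoC 0) with (0 * (b - a))%C by ring.
      apply (CD_PD_comp f (fun u => a + RtoC u * (b - a))%C); [apply H, Ht|apply PD_affine].
    - intros t _. apply continuous_const. }
  rewrite CInt_const in E by lra.
  replace (f b) with ((f b - f a) + f a)%C by ring. rewrite <- E. ring.
Qed.

Lemma seg_disc (a w c : C) (u r : R) : 0 <= u <= 1 -> Cmod (w - a) <= r -> Cmod (c - a) <= r ->
  Cmod (w + RtoC u * (c - w) - a) <= r.
Proof.
  intros Hu Hw Hc.
  replace (w + RtoC u * (c - w) - a)%C with (RtoC (1 - u) * (w - a) + RtoC u * (c - a))%C
    by (rewrite RtoC_minus; ring).
  eapply Rle_trans; [apply Cmod_triangle|].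
  rewrite !Cmod_mult, !Cmod_R, !Rabs_pos_eq by lra. nra.
Qed.

(** The derivative in w is the integral of (gamma - w)^(-2) dgamma, which has the primitive -1 /
    (gamma - w) and vanishes over the closed circle; so the value is that at the centre, where the
    integrand is the constant [Ci]. *)
Lemma cauchy_winding (a : C) (r : R) (w : C) : 0 < r -> Cmod (w - a) < r ->
  cauchy_int a r (dcpath r) w = (2 * PI * Ci)%C.
Proof.
  intros Hr Hw.
  assert (C1 : pcont (dcpath r) 0 (2 * PI)) by (intros t _; apply cont_dcpath).
  transitivity (cauchy_int a r (dcpath r) a).
  - apply CD_zero_const. intros u Hu.
    assert (Hv : Cmod (a + RtoC u * (w - a) - a) < r).
    { replace (a + RtoC u * (w - a) - a)%C with (RtoC u * (w - a))%C by ring.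
      rewrite Cmod_mult, Cmod_R, Rabs_pos_eq by lra.
      generalize (Cmod_ge_0 (w - a)). nra. }
    set (v := (a + RtoC u * (w - a))%C) in *.
    apply (CD_ext (fun w => CInt (fun t => / (cpath a r t + w * (-1)) * dcpath r t)%C 0 (2 * PI))).
    { intros s. symmetry. apply cauchy_int_param. }
    assert (N : forall t, (cpath a r t + v * (-1) <> 0)%C).
    { intros t. replace (cpath a r t + v * -1)%C with (cpath a r t - v)%C by ring.
      apply circle_neq; assumption. }
    eapply CD_eq.
    { apply (CD_CInt_param (fun u => u <> 0) Cinv (cpath a r) (fun _ => (-1)%C) (dcpath r));
      auto using two_PI_pos, copen_neq0, copen_disc, Hol_Cinv, Hol_D_Cinv.
      - intros t _; apply cont_cpath.
      - intros t _. apply continuous_const. }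
    rewrite (CInt_FTC (fun t => - / (cpath a r t + v * (-1)))%C).
    + rewrite cpath_2PI. ring.
    + apply two_PI_pos.
    + intros t _.
      replace (D Cinv (cpath a r t + v * -1) * (-1 * dcpath r t))%C with
         ((- (D Cinv (cpath a r t + v * -1) * (1 + 0))) * dcpath r t)%C by ring.
      apply (CD_PD_comp (fun s => - / (s + v * -1))%C (cpath a r)); [|apply PD_cpath].
      apply CD_opp. apply (CD_comp Cinv (fun s => s + v * -1)%C).
      * apply Hol_Cinv, N.
      * apply CD_plus; [apply CD_id|apply CD_const].
    + intros t Ht. apply cont_mult; [|apply cont_mult; [apply continuous_const|apply cont_dcpath]].
      apply (continuous_comp (fun t => cpath a r t + v * -1)%C (D Cinv)).
      * apply cont_plus; [apply cont_cpath|apply continuous_const].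
      * apply Hol_Cinv, N.
  - unfold cauchy_int. rewrite (CInt_ext _ (fun _ => Ci)).
    + rewrite CInt_const by apply two_PI_pos. rewrite RtoC_minus, RtoC_mult. ring.
    + apply two_PI_pos.
    + intros t _. unfold cpath, dcpath.
      assert (circ t <> 0).
      { intros E. generalize (Cmod_circ t). rewrite E, Cmod_0. lra. }
      assert (RtoC r <> 0). { intros E. apply RtoC_inj in E. lra. }
      replace (a + r * circ t - a)%C with (r * circ t)%C by ring. field. auto.
Qed.

(** The circle is contracted to w: with g(u) the integral of f(w + u (gamma - w)) / (gamma - w), the
    kernel cancels in g'(u), which is the integral of a derivative over a closed curve. Thus g(1),
    the Cauchy integral, equals g(0), which is f(w) times the winding number. *)
Lemma cauchy_formula (U : C -> Prop) (f : C -> C) (a : C) (r : R) (w : C) :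
  copen U -> Hol U f -> 0 < r -> (forall s, Cmod (s - a) <= r -> U s) -> Cmod (w - a) < r ->
  cauchy_int a r (fun t => f (cpath a r t) * dcpath r t)%C w = (2 * PI * Ci * f w)%C.
Proof.
  intros Uo Hf Hr HU Hw.
  set (M := fun t => (dcpath r t / (cpath a r t - w))%C).
  assert (N : forall t, (cpath a r t - w <> 0)%C) by (intros t; apply circle_neq; assumption).
  assert (CM : pcont M 0 (2 * PI)).
  { intros t _. apply cont_mult; [apply cont_dcpath|]. apply cont_inv; [|apply N].
    apply cont_minus; [apply cont_cpath|apply continuous_const]. }
  assert (CB : pcont (fun t => cpath a r t - w)%C 0 (2 * PI)).
  { intros t _. apply cont_minus; [apply cont_cpath|apply continuous_const]. }
  set (g := fun l : C => CInt (fun t => f (w + l * (cpath a r t - w)) * M t)%C 0 (2 * PI)).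
  assert (HS : forall u t, 0 <= u <= 1 -> U (w + RtoC u * (cpath a r t - w))%C).
  { intros u t Hu. apply HU, seg_disc; [exact Hu|lra|]. rewrite Cmod_cpath; lra. }
  assert (E : g 1 = g 0).
  { apply CD_zero_const. intros u Hu.
    replace (0 + RtoC u * (1 - 0))%C with (RtoC u) by ring.
    eapply CD_eq.
    { apply (CD_CInt_param U f (fun _ => w) (fun t => cpath a r t - w)%C M); auto using two_PI_pos.
      - intros t _. apply continuous_const. }
    rewrite (CInt_ext _ (fun t => D f (w + RtoC u * (cpath a r t - w)) * dcpath r t)%C);
      [|apply two_PI_pos|intros t _; unfold M; field; apply N].
    assert (PDw : forall t, PD (fun t => w + RtoC u * (cpath a r t - w))%C t (RtoC u * dcpath r t)).
    { intros t. apply (CD_PD_comp (fun s => w + RtoC u * (s - w))%C (cpath a r)); [|apply PD_cpath].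
      eapply CD_eq; [apply CD_plus; [apply CD_const|]; apply CD_scal, CD_minus; [apply CD_id|apply CD_const]|].
      ring. }
    assert (CDf : pcont (fun t => D f (w + RtoC u * (cpath a r t - w)))%C 0 (2 * PI)).
    { intros t Ht. apply (continuous_comp (fun t => w + RtoC u * (cpath a r t - w))%C (D f)).
      - apply (PD_cont _ _ _ (PDw t)).
      - apply Hf, HS, Hu. }
    destruct (Req_dec u 0) as [->|Hu0].
    - rewrite (CInt_ext _ (fun t => D f w * dcpath r t)%C);
        [|apply two_PI_pos|intros t _; rewrite Cmult_0_l, Cplus_0_r; reflexivity].
      rewrite (CInt_FTC (fun t => D f w * cpath a r t)%C).
      + rewrite cpath_2PI. ring.
      + apply two_PI_pos.
      + intros t _. apply (CD_PD_comp (fun s => D f w * s)%C (cpath a r)); [|apply PD_cpath].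
        eapply CD_eq; [apply CD_scal, CD_id|ring].
      + intros t _. apply cont_mult; [apply continuous_const|apply cont_dcpath].
    - assert (Hc : RtoC u <> 0) by (intros K; apply RtoC_inj in K; lra).
      rewrite (CInt_FTC (fun t => / RtoC u * f (w + RtoC u * (cpath a r t - w)))%C).
      + rewrite cpath_2PI. ring.
      + apply two_PI_pos.
      + intros t _.
        replace (D f (w + RtoC u * (cpath a r t - w)) * dcpath r t)%C with
          (/ RtoC u * D f (w + RtoC u * (cpath a r t - w)) * (RtoC u * dcpath r t))%C by (field; exact Hc).
        apply (CD_PD_comp (fun s => / RtoC u * f s)%C (fun t => w + RtoC u * (cpath a r t - w))%C).
        * apply CD_scal. apply Hf, HS, Hu.
        * apply PDw.
      + intros t Ht. apply cont_mult; [apply CDf, Ht|apply cont_dcpath]. }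
  assert (G1 : g 1 = cauchy_int a r (fun t => f (cpath a r t) * dcpath r t)%C w).
  { apply CInt_ext; [apply two_PI_pos|]. intros t _. unfold M.
    replace (w + 1 * (cpath a r t - w))%C with (cpath a r t) by ring. field. apply N. }
  assert (G0 : g 0 = (2 * PI * Ci * f w)%C).
  { unfold g. rewrite (CInt_ext _ (fun t => f w * M t)%C).
    - rewrite CInt_scal by auto using two_PI_pos.
      rewrite <- (cauchy_winding a r w Hr Hw). unfold cauchy_int.
      rewrite Cmult_comm. f_equal. apply CInt_ext; [apply two_PI_pos|].
      intros t _. unfold M. field. apply N.
    - apply two_PI_pos.
    - intros t _. rewrite Cmult_0_l, Cplus_0_r. reflexivity. }
  rewrite <- G1, E, G0. reflexivity.
Qed.

Lemma two_PI_Ci_neq0 : (2 * PI * Ci <> 0)%C.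
Proof.
  intros E. apply (f_equal Im) in E. unfold Ci, Cmult, RtoC, Im in E; simpl in E.
  generalize PI_RGT_0. lra.
Qed.

Lemma pcont_boundary (U : C -> Prop) (f : C -> C) (a : C) (r : R) : 0 < r ->
  (forall s, U s -> continuous f s) -> (forall s, Cmod (s - a) <= r -> U s) ->
  pcont (fun t => f (cpath a r t) * dcpath r t)%C 0 (2 * PI).
Proof.
  intros Hr Hf HU t _. apply cont_mult; [|apply cont_dcpath].
  apply (continuous_comp (cpath a r) f); [apply cont_cpath|].
  apply Hf, HU. rewrite Cmod_cpath; lra.
Qed.

(** Locally f is a Cauchy integral, and those have holomorphic derivatives by [Hol_cauchy_int]. *)
Lemma Hol_D (U : C -> Prop) (f : C -> C) : copen U -> Hol U f -> Hol U (D f).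
Proof.
  intros Uo Hf. apply Hol_local. intros a Ha.
  destruct (copen_disc_in U a Uo Ha) as [r [Hr HU]].
  exists (disc a r). split.
  { unfold disc. replace (a - a)%C with (RtoC 0) by ring. rewrite Cmod_0. exact Hr. }
  set (phi := fun t => (f (cpath a r t) * dcpath r t)%C).
  assert (Hphi : pcont phi 0 (2 * PI)).
  { apply (pcont_boundary U); auto. intros s Hs. apply (Hol_cont U); assumption. }
  destruct (Hol_cauchy_int a r phi Hr Hphi) as [H1 H2].
  apply (Hol_ext _ (fun w => / (2 * PI * Ci) * D (cauchy_int a r phi) w)%C _ (copen_disc a r)).
  - intros w Hw. symmetry. apply D_eq.
    apply (CD_ext_loc (fun w => / (2 * PI * Ci) * cauchy_int a r phi w)%C).
    + generalize (copen_disc a r w Hw). apply filter_imp. intros v Hv. uncast.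
      unfold phi. rewrite (cauchy_formula U) by assumption. as_C. field. split.
      * intros E. generalize (two_PI_Ci_neq0). rewrite E. intros K. apply K. ring.
      * intros E. generalize (two_PI_Ci_neq0). rewrite E. intros K. apply K. ring.
    + apply CD_scal. apply H1, Hw.
  - apply Hol_mult; auto using copen_disc. apply (Hol_const _ (/ (2 * PI * Ci))%C), copen_disc.
Qed.

Definition dquot (f : C -> C) (p s : C) : C :=
  if excluded_middle_informative (s = p) then D f p else ((f s - f p) / (s - p))%C.

Lemma dquot_diag (f : C -> C) (p : C) : dquot f p p = D f p.
Proof. unfold dquot. destruct (excluded_middle_informative (p = p)); easy. Qed.

Lemma dquot_off (f : C -> C) (p s : C) : s <> p -> dquot f p s = ((f s - f p) / (s - p))%C.
Proof. intros H. unfold dquot. destruct (excluded_middle_informative (s = p)); easy. Qed.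

Lemma Cminus_neq0 (s p : C) : s <> p -> (s - p <> 0)%C.
Proof. intros H E. apply H. replace s with ((s - p) + p)%C by ring. rewrite E. ring. Qed.

Lemma dquot_spec (f : C -> C) (p s : C) : (f s = f p + (s - p) * dquot f p s)%C.
Proof.
  destruct (classic (s = p)) as [->|N]; [ring|].
  rewrite dquot_off by exact N. field. apply Cminus_neq0, N.
Qed.

(** Near p the completed quotient is itself a Cauchy integral, with density f(gamma) / (gamma - p),
    because 1/(gamma - w) - 1/(gamma - p) = (w - p) / ((gamma - w)(gamma - p)). Away from p it is an
    ordinary quotient. *)
Lemma Hol_dquot (U : C -> Prop) (f : C -> C) (p : C) : copen U -> U p -> Hol U f ->
  Hol U (dquot f p).
Proof.
  intros Uo Hp Hf. apply Hol_local. intros s Hs.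
  destruct (classic (s = p)) as [->|N].
  - destruct (copen_disc_in U p Uo Hp) as [r [Hr HU]].
    exists (disc p r).
    assert (Hpp : disc p r p).
    { unfold disc. replace (p - p)%C with (RtoC 0) by ring. rewrite Cmod_0. exact Hr. }
    split; [exact Hpp|].
    set (phi := fun t => (f (cpath p r t) * dcpath r t)%C).
    set (psi := fun t => (/ (cpath p r t - p) * phi t)%C).
    assert (Hphi : pcont phi 0 (2 * PI)).
    { apply (pcont_boundary U); auto. intros u Hu. apply (Hol_cont U); assumption. }
    assert (Nr : forall w t, disc p r w -> (cpath p r t - w <> 0)%C).
    { intros w t Hw. apply circle_neq; assumption. }
    assert (Hpsi : pcont psi 0 (2 * PI)).
    { intros t Ht. apply cont_mult; [|apply Hphi, Ht]. apply cont_inv; [|apply Nr, Hpp].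
      apply cont_minus; [apply cont_cpath|apply continuous_const]. }
    assert (PI0 : RtoC PI <> 0) by (intros E; apply RtoC_inj in E; generalize PI_RGT_0; lra).
    assert (Ci0 : Ci <> 0) by (intros E; apply (f_equal Im) in E; simpl in E; lra).
    destruct (Hol_cauchy_int p r psi Hr Hpsi) as [H1 _].
    assert (HH : Hol (disc p r) (fun w => / (2 * PI * Ci) * cauchy_int p r psi w)%C).
    { apply Hol_mult; auto using copen_disc. apply (Hol_const _ (/ (2 * PI * Ci))%C), copen_disc. }
    assert (Hq : forall w, disc p r w ->
       (f w = f p + (w - p) * (/ (2 * PI * Ci) * cauchy_int p r psi w))%C).
    { intros w Hw.
      assert (E : ((w - p) * cauchy_int p r psi w = 2 * PI * Ci * (f w - f p))%C).
      { replace (2 * PI * Ci * (f w - f p))%C with (2 * PI * Ci * f w - 2 * PI * Ci * f p)%C by ring.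
        rewrite <- (cauchy_formula U f p r w) by assumption.
        rewrite <- (cauchy_formula U f p r p) by assumption.
        unfold cauchy_int.
        assert (K : forall v, disc p r v -> pcont (fun t => / (cpath p r t - v) * phi t)%C 0 (2 * PI)).
        { intros v Hv t Ht. apply cont_mult; [|apply Hphi, Ht]. apply cont_inv; [|apply Nr, Hv].
          apply cont_minus; [apply cont_cpath|apply continuous_const]. }
        rewrite <- CInt_scal, <- CInt_minus; auto using two_PI_pos.
        - apply CInt_ext; [apply two_PI_pos|]. intros t _. unfold psi, phi. field.
          split; apply Nr; assumption.
        - intros t Ht. apply cont_mult; [|apply Hpsi, Ht]. apply cont_inv; [|apply Nr, Hw].
          apply cont_minus; [apply cont_cpath|apply continuous_const]. }
      replace ((w - p) * (/ (2 * PI * Ci) * cauchy_int p r psi w))%C with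
        (/ (2 * PI * Ci) * ((w - p) * cauchy_int p r psi w))%C by ring.
      rewrite E. field. auto. }
    apply (Hol_ext _ _ _ (copen_disc p r)) with (2 := HH).
    intros w Hw. destruct (classic (w = p)) as [->|Nw].
    + rewrite dquot_diag. symmetry. apply D_eq.
      apply (CD_ext_loc (fun w => f p + (w - p) * (/ (2 * PI * Ci) * cauchy_int p r psi w))%C).
      * generalize (copen_disc p r p Hw). apply filter_imp. intros v Hv. symmetry. apply Hq, Hv.
      * eapply CD_eq.
        { apply CD_plus; [apply CD_const|].
          apply (CD_mult (fun w => w - p)%C (fun w => / (2 * PI * Ci) * cauchy_int p r psi w)%C).
          - apply CD_minus; [apply CD_id|apply CD_const].
          - apply HH, Hw. }
        ring.
    + rewrite dquot_off by exact Nw. rewrite (Hq w Hw). field. repeat split; auto.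
      apply Cminus_neq0, Nw.
  - exists (fun u => U u /\ (u - p <> 0)%C).
    assert (Vo : copen (fun u => U u /\ (u - p <> 0)%C)).
    { intros u [H1 H2]. apply filter_and; [apply Uo, H1|].
      apply (cont_neq0 (fun u => u - p)%C); [|exact H2].
      apply cont_minus; [apply continuous_id|apply continuous_const]. }
    split; [split; [exact Hs|apply Cminus_neq0, N]|].
    apply (Hol_ext _ (fun u => (f u - f p) / (u - p))%C _ Vo).
    + intros u [_ Hu]. symmetry. apply dquot_off. intros E. apply Hu. rewrite E. ring.
    + apply Hol_mult; [exact Vo| |].
      * apply Hol_minus; [exact Vo| |apply Hol_const, Vo].
        apply (Hol_sub U); [tauto|exact Hf].
      * apply Hol_inv; [exact Vo| |tauto].
        apply Hol_minus; [exact Vo|apply Hol_id, Vo|apply Hol_const, Vo].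
Qed.

(** * Limits and primitives of holomorphic functions *)

Definition loc_unif (U : C -> Prop) (F : nat -> C -> C) (f : C -> C) : Prop :=
  forall a, U a -> exists r, 0 < r /\ (forall s, Cmod (s - a) <= r -> U s) /\
    forall eps, 0 < eps -> exists N, forall n, (N <= n)%nat -> forall s, Cmod (s - a) <= r ->
      Cmod (F n s - f s) < eps.

(** Weierstrass' theorem: Cauchy's formula passes to the uniform limit, so the limit is again a
    Cauchy integral. *)
Lemma Hol_limit (U : C -> Prop) (F : nat -> C -> C) (f : C -> C) : copen U ->
  (forall n, Hol U (F n)) -> loc_unif U F f -> Hol U f.
Proof.
  intros Uo HF HL.
  assert (Cf : forall s, U s -> continuous f s).
  { intros s Hs. apply cont_C. intros eps He.
    destruct (HL s Hs) as [r [Hr [HU Hun]]].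
    destruct (Hun (eps / 3) ltac:(lra)) as [N HN].
    assert (L1 : locally s (fun y => Cmod (F N y - F N s) < eps / 3)).
    { apply (cont_C (F N) s); [apply (Hol_cont U); auto|lra]. }
    assert (L2 : locally s (fun y => Cmod (y - s) < r)).
    { apply locally_C. exists r. auto. }
    generalize (filter_and _ _ L1 L2). apply filter_imp. intros y [K1 K2].
    assert (K3 := HN N (Nat.le_refl N) y ltac:(lra)).
    assert (K4 : Cmod (F N s - f s) < eps / 3).
    { apply (HN N (Nat.le_refl N)). replace (s - s)%C with (RtoC 0) by ring. rewrite Cmod_0. lra. }
    replace (f y - f s)%C with (- (F N y - f y) + ((F N y - F N s) + (F N s - f s)))%C by ring.
    eapply Rle_lt_trans; [apply Cmod_triangle|]. rewrite Cmod_opp.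
    assert (K5 := Cmod_triangle (F N y - F N s) (F N s - f s)). lra. }
  apply Hol_local. intros a Ha. destruct (HL a Ha) as [r [Hr [HU Hun]]].
  exists (disc a r). split.
  { unfold disc. replace (a - a)%C with (RtoC 0) by ring. rewrite Cmod_0. exact Hr. }
  set (phi := fun t => (f (cpath a r t) * dcpath r t)%C).
  assert (Hphi : pcont phi 0 (2 * PI)) by (apply (pcont_boundary U); auto).
  destruct (Hol_cauchy_int a r phi Hr Hphi) as [H1 _].
  apply (Hol_ext _ (fun w => / (2 * PI * Ci) * cauchy_int a r phi w)%C _ (copen_disc a r)).
  2:{ apply Hol_mult; auto using copen_disc. apply (Hol_const _ (/ (2 * PI * Ci))%C), copen_disc. }
  intros w Hw.
  assert (PI0 : RtoC PI <> 0) by (intros E; apply RtoC_inj in E; generalize PI_RGT_0; lra).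
  assert (Ci0 : Ci <> 0) by (intros E; apply (f_equal Im) in E; simpl in E; lra).
  assert (E : (cauchy_int a r phi w - 2 * PI * Ci * f w = 0)%C).
  2:{ replace (cauchy_int a r phi w) with
       (cauchy_int a r phi w - 2 * PI * Ci * f w + 2 * PI * Ci * f w)%C by ring.
      rewrite E. field. auto. }
  apply Cmod_eq_0. apply Rle_antisym; [|apply Cmod_ge_0].
  apply Rnot_lt_le. intros Hpos.
  set (X := Cmod (cauchy_int a r phi w - 2 * PI * Ci * f w)) in *.
  assert (Nr : forall t, (cpath a r t - w <> 0)%C) by (intros t; apply circle_neq; assumption).
  destruct (pcont_bounded (fun t => / (cpath a r t - w) * dcpath r t)%C 0 (2 * PI)) as [K [HK HKb]].
  { apply two_PI_pos. }
  { intros t _. apply cont_mult; [|apply cont_dcpath]. apply cont_inv; [|apply Nr].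
    apply cont_minus; [apply cont_cpath|apply continuous_const]. }
  assert (P0 := PI_RGT_0).
  (* The errors 2 PI e K of the integral and 2 PI e of the value then add up to X / 2, which
     contradicts X > 0. *)
  set (e := X / (2 * (2 * PI * K + 2 * PI))).
  assert (He : 0 < e). { apply Rdiv_lt_0_compat; [exact Hpos|nra]. }
  destruct (Hun e He) as [N HN].
  assert (Fphi : pcont (fun t => F N (cpath a r t) * dcpath r t)%C 0 (2 * PI)).
  { apply (pcont_boundary U); auto. intros s Hs. apply (Hol_cont U); auto. }
  assert (EN := cauchy_formula U (F N) a r w Uo (HF N) Hr HU Hw).
  assert (B1 : Cmod (cauchy_int a r phi w - cauchy_int a r (fun t => F N (cpath a r t) * dcpath r t)%C w)
               <= 2 * PI * (e * K)).
  { unfold cauchy_int.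
    assert (Cinvk : forall p, pcont p 0 (2 * PI) -> pcont (fun t => / (cpath a r t - w) * p t)%C 0 (2 * PI)).
    { intros p Hp t Ht. apply cont_mult; [|apply Hp, Ht]. apply cont_inv; [|apply Nr].
      apply cont_minus; [apply cont_cpath|apply continuous_const]. }
    rewrite <- CInt_minus; auto using two_PI_pos.
    replace (2 * PI * (e * K)) with ((2 * PI - 0) * (e * K)) by ring.
    apply CInt_norm; [apply two_PI_pos| |].
    - intros t Ht. apply cont_minus; [apply (Cinvk _ Hphi t Ht)|apply (Cinvk _ Fphi t Ht)].
    - intros t Ht. unfold phi.
      replace (/ (cpath a r t - w) * (f (cpath a r t) * dcpath r t) -
        / (cpath a r t - w) * (F N (cpath a r t) * dcpath r t))%C with
        (- (F N (cpath a r t) - f (cpath a r t)) * (/ (cpath a r t - w) * dcpath r t))%C by ring.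
      rewrite Cmod_mult, Cmod_opp. apply Rmult_le_compat; try apply Cmod_ge_0.
      + apply Rlt_le. apply (HN N (Nat.le_refl N)). rewrite Cmod_cpath; lra.
      + apply HKb, Ht. }
  rewrite EN in B1.
  assert (B2 : Cmod (2 * PI * Ci * F N w - 2 * PI * Ci * f w) <= 2 * PI * e).
  { replace (2 * PI * Ci * F N w - 2 * PI * Ci * f w)%C with (RtoC (2 * PI) * (Ci * (F N w - f w)))%C
      by (rewrite RtoC_mult; ring).
    rewrite !Cmod_mult, Cmod_R, Rabs_pos_eq by lra.
    replace (Cmod Ci) with 1.
    2:{ unfold Cmod, Ci; simpl. rewrite <- sqrt_1 at 1. f_equal. ring. }
    rewrite Rmult_1_l. apply Rmult_le_compat_l; [lra|]. apply Rlt_le.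
    apply (HN N (Nat.le_refl N)). unfold disc in Hw. lra. }
  assert (B3 : X <= 2 * PI * (e * K) + 2 * PI * e).
  { unfold X.
    replace (cauchy_int a r phi w - 2 * PI * Ci * f w)%C with
      ((cauchy_int a r phi w - 2 * PI * Ci * F N w) + (2 * PI * Ci * F N w - 2 * PI * Ci * f w))%C by ring.
    eapply Rle_trans; [apply Cmod_triangle|]. lra. }
  assert (B4 : 2 * PI * (e * K) + 2 * PI * e = X / 2).
  { unfold e. field. nra. }
  lra.
Qed.

Definition star (U : C -> Prop) (a : C) : Prop :=
  forall w u, U w -> 0 <= u <= 1 -> U (a + RtoC u * (w - a))%C.

(** The primitive is the integral of f along the segment from a to w. After differentiating under
    the integral sign, the integrand is the derivative in t of t f(a + t (w - a)), whose increment
    over [0, 1] is f(w). *)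
Lemma Hol_primitive (U : C -> Prop) (a : C) (f : C -> C) : copen U -> star U a -> Hol U f ->
  exists G, forall w, U w -> CD G w (f w).
Proof.
  intros Uo Hst Hf.
  exists (fun w => CInt (fun t => f (a * (1 - RtoC t) + w * RtoC t) * 1)%C 0 1 * (w - a))%C.
  intros w Hw.
  assert (E : forall t, (a * (1 - RtoC t) + w * RtoC t = a + RtoC t * (w - a))%C) by (intros; ring).
  assert (CA : forall a b, pcont (fun t => a * (1 - RtoC t))%C 0 b).
  { intros a' b t _. apply cont_mult; [apply continuous_const|].
    apply cont_minus; [apply continuous_const|apply cont_RtoC, continuous_id]. }
  assert (CB : forall b, pcont (fun t => RtoC t) 0 b).
  { intros b t _. apply cont_RtoC, continuous_id. }
  assert (HS : forall t, 0 <= t <= 1 -> U (a * (1 - RtoC t) + w * RtoC t)%C).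
  { intros t Ht. rewrite E. apply Hst; assumption. }
  assert (P1 : forall t, PD (fun t => a * (1 - RtoC t) + w * RtoC t)%C t (w - a)).
  { intros t. destruct (PD_affine a (w - a) t) as [psi [H1 H2]]. exists psi. split; [|exact H2].
    revert H1. apply filter_imp. intros u Hu. rewrite !E. exact Hu. }
  assert (C0 : pcont (fun t => f (a * (1 - RtoC t) + w * RtoC t)%C) 0 1).
  { intros t Ht. apply (continuous_comp (fun t => a * (1 - RtoC t) + w * RtoC t)%C f).
    - apply (PD_cont _ _ _ (P1 t)).
    - apply (Hol_cont U); auto. }
  assert (C1 : pcont (fun t => D f (a * (1 - RtoC t) + w * RtoC t)%C) 0 1).
  { intros t Ht. apply (continuous_comp (fun t => a * (1 - RtoC t) + w * RtoC t)%C (D f)).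
    - apply (PD_cont _ _ _ (P1 t)).
    - apply Hf; auto. }
  assert (CDt : pcont (fun t => D f (a * (1 - RtoC t) + w * RtoC t) * (RtoC t * 1))%C 0 1).
  { intros t Ht. apply cont_mult; [apply C1, Ht|].
    apply cont_mult; [apply (CB 1 t Ht)|apply continuous_const]. }
  eapply CD_eq.
  { apply (CD_mult (fun w => CInt (fun t => f (a * (1 - RtoC t) + w * RtoC t) * 1)%C 0 1)).
    - apply (CD_CInt_param U f (fun t => a * (1 - RtoC t))%C (fun t => RtoC t) (fun _ => RtoC 1)); auto; try lra.
      intros t _. apply continuous_const.
    - apply CD_minus; [apply CD_id|apply CD_const]. }
  simpl.
  rewrite (CInt_ext (fun t => f (a * (1 - RtoC t) + w * RtoC t) * 1)%C
             (fun t => f (a * (1 - RtoC t) + w * RtoC t))%C); [|lra|intros; ring].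
  replace (1 - 0)%C with (RtoC 1) by ring. rewrite Cmult_1_r.
  rewrite (Cmult_comm _ (w - a)), <- CInt_scal, <- CInt_plus; try lra; auto.
  2: { intros t Ht. apply cont_mult; [apply continuous_const|apply CDt, Ht]. }
  rewrite (CInt_FTC (fun t => RtoC t * f (a * (1 - RtoC t) + w * RtoC t))%C).
  - replace (a * (1 - 1) + w * 1)%C with w by ring. ring.
  - lra.
  - intros t Ht.
    apply PD_slope. 
    assert (K : PD (fun t => RtoC t * f (a * (1 - RtoC t) + w * RtoC t))%C t
       (1 * f (a * (1 - RtoC t) + w * RtoC t) + RtoC t * (D f (a * (1 - RtoC t) + w * RtoC t) * (w - a)))%C).
    2:{ apply PD_slope. eapply (eq_rect _ (PD _ t) K). ring. }
    destruct (CD_PD_comp f (fun t => a * (1 - RtoC t) + w * RtoC t)%C t _ _ 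
        (proj1 (Hf _ (HS t Ht))) (P1 t)) as [q [Q1 [Q2 Q3]]].
    exists (fun u => (1 * f (a * (1 - RtoC u) + w * RtoC u) + RtoC t * q u)%C).
    split; [|split].
    + revert Q1. apply filter_imp. intros u Hu. uncast. rewrite RtoC_minus in *.
      transitivity (RtoC u * (f (a * (1 - RtoC u) + w * RtoC u)) )%C; [reflexivity|].
      transitivity ((RtoC u - RtoC t) * (f (a * (1 - RtoC u) + w * RtoC u)) +
          RtoC t * (f (a * (1 - RtoC u) + w * RtoC u)))%C; [cring|].
      rewrite Hu at 2. cring.
    + apply cont_plus; (apply cont_mult; [apply continuous_const|]); [apply C0, Ht|exact Q2].
    + rewrite Q3. reflexivity.
  - intros t Ht. apply cont_plus; [|apply C0, Ht].
    apply cont_mult; [apply continuous_const|apply CDt, Ht].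
Qed.

(** * The complex exponential *)

Definition Cuniv (s : C) : Prop := True.

Lemma copen_all : copen Cuniv.
Proof. intros s _. apply filter_forall. intros; exact I. Qed.

Lemma Cexp_add (u v : C) : Cexp (u + v) = (Cexp u * Cexp v)%C.
Proof.
  destruct u as [a b], v as [c d]. unfold Cexp, Cmult, Cplus, Re, Im; simpl.
  rewrite exp_plus, cos_plus, sin_plus. f_equal; ring.
Qed.

Lemma Cexp_0 : Cexp 0 = 1.
Proof. unfold Cexp, RtoC; simpl. rewrite exp_0, cos_0, sin_0. f_equal; ring. Qed.

Lemma Cmod_Cexp (w : C) : Cmod (Cexp w) = exp (Re w).
Proof.
  replace (Cexp w) with (RtoC (exp (Re w)) * circ (Im w))%C.
  - rewrite Cmod_mult, Cmod_circ, Cmod_R, Rabs_pos_eq; [ring|]. left; apply exp_pos.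
  - unfold Cexp, circ, Cmult, RtoC; simpl. f_equal; ring.
Qed.

Lemma Cexp_neq0 (w : C) : Cexp w <> 0.
Proof. apply Cmod_gt_0. rewrite Cmod_Cexp. apply exp_pos. Qed.

Lemma Cexp_opp (w : C) : Cexp (- w) = (/ Cexp w)%C.
Proof.
  assert (E : (Cexp w * Cexp (- w) = 1)%C).
  { rewrite <- Cexp_add. replace (w + - w)%C with (RtoC 0) by ring. apply Cexp_0. }
  rewrite <- (Cmult_1_l (/ Cexp w)), <- E. field. apply Cexp_neq0.
Qed.

Lemma Cexp_RtoC (x : R) : Cexp x = exp x.
Proof. unfold Cexp, RtoC; simpl. rewrite cos_0, sin_0. f_equal; ring. Qed.

(** Obtained from the real derivatives at 0 of exp and of the unit circle through exp(x) circ(y) - 1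
    - (x + i y) = exp(x) (circ(y) - 1 - i y) + (exp(x) - 1) i y + (exp(x) - 1 - x). *)
Lemma CD_Cexp_0 : CD Cexp 0 1.
Proof.
  apply CD_cont_slope. intros eps He.
  assert (P1 : PD (fun x => RtoC (exp x)) 0 1).
  { apply PD_comps. simpl. split.
    - replace 1 with (exp 0) by apply exp_0. apply is_derive_exp.
    - apply (is_derive_const (K := R_AbsRing) (V := R_NormedModule)). }
  assert (P2 : PD circ 0 Ci).
  { replace Ci with (Ci * circ 0)%C; [apply PD_circ|].
    unfold circ. rewrite cos_0, sin_0. change (1, 0) with (RtoC 1). ring. }
  (* The three error terms are at most 3, 2 and 1 times e m, and 6 / 8 of [eps] suffices. *)
  set (e := Rmin 1 (eps / 8)).
  assert (He0 : 0 < e) by (apply Rmin_pos; lra).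
  assert (He1 : e <= 1) by apply Rmin_l.
  assert (He2 : e <= eps / 8) by apply Rmin_r.
  destruct (proj1 (PD_slope _ _ _) P1 e He0) as [d1 H1].
  destruct (proj1 (PD_slope _ _ _) P2 e He0) as [d2 H2].
  apply locally_C. exists (Rmin e (Rmin d1 d2)). split.
  { apply Rmin_pos; [exact He0|]. apply Rmin_pos; apply cond_pos. }
  intros h Hh. replace (h - 0)%C with h in * by ring.
  assert (A1 := re_le_Cmod h). assert (A2 := im_le_Cmod h).
  assert (B0 := Rmin_l e (Rmin d1 d2)). assert (B1 := Rmin_r e (Rmin d1 d2)).
  assert (B2 := Rmin_l d1 d2). assert (B3 := Rmin_r d1 d2).
  destruct h as [x y]. simpl in A1, A2.
  specialize (H1 x). specialize (H2 y).
  assert (K1 : ball 0 d1 x).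
  { unfold ball; simpl; unfold AbsRing_ball, abs, minus, plus, opp; simpl. 
    replace (x + - 0) with x by ring. lra. }
  assert (K2 : ball 0 d2 y).
  { unfold ball; simpl; unfold AbsRing_ball, abs, minus, plus, opp; simpl. 
    replace (y + - 0) with y by ring. lra. }
  specialize (H1 K1). specialize (H2 K2). clear K1 K2.
  rewrite Rminus_0_r in H1, H2.
  rewrite exp_0 in H1.
  assert (C0 : circ 0 = 1). { unfold circ. rewrite cos_0, sin_0. reflexivity. }
  rewrite C0 in H2.
  rewrite Cexp_0.
  assert (E : (Cexp (x, y) - 1 - 1 * (x, y) =
     RtoC (exp x) * (circ y - 1 - Ci * y) + (RtoC (exp x) - 1) * (Ci * y)
     + (RtoC (exp x) - 1 - 1 * x))%C).
  { replace (Cexp (x, y)) with (RtoC (exp x) * circ y)%C.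
    - replace (x, y) with (RtoC x + Ci * RtoC y)%C. ring.
      unfold Ci, Cplus, Cmult, RtoC; simpl. f_equal; ring.
    - unfold Cexp, circ, Cmult, RtoC; simpl. f_equal; ring. }
  rewrite E. set (m := Cmod (x, y)) in *.
  assert (Hm : 0 <= m) by apply Cmod_ge_0.
  assert (G1 : Cmod (RtoC (exp x) - 1) <= 2 * m).
  { replace (RtoC (exp x) - 1)%C with ((RtoC (exp x) - 1 - 1 * x) + x)%C by ring.
    eapply Rle_trans; [apply Cmod_triangle|]. rewrite Cmod_R.
    assert (e * Rabs x <= 1 * Rabs x) by (apply Rmult_le_compat_r; [apply Rabs_pos|lra]). lra. }
  assert (G2 : Cmod (RtoC (exp x)) <= 3).
  { replace (RtoC (exp x)) with ((RtoC (exp x) - 1) + 1)%C by ring.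
    eapply Rle_trans; [apply Cmod_triangle|]. rewrite Cmod_1. lra. }
  assert (G3 : Cmod (Ci * y) <= m).
  { rewrite Cmod_mult, Cmod_R. replace (Cmod Ci) with 1; [lra|].
    unfold Cmod, Ci; simpl. rewrite <- sqrt_1 at 1. f_equal. ring. }
  eapply Rle_trans; [apply Cmod_triangle|].
  eapply Rle_trans; [apply Rplus_le_compat_r, Cmod_triangle|].
  rewrite !Cmod_mult in *.
  assert (T1 : Cmod (RtoC (exp x)) * Cmod (circ y - 1 - Ci * y) <= 3 * (e * m)).
  { apply Rmult_le_compat; try apply Cmod_ge_0; auto.
    eapply Rle_trans; [exact H2|]. apply Rmult_le_compat_l; lra. }
  assert (T2 : Cmod (RtoC (exp x) - 1) * (Cmod Ci * Cmod y) <= (2 * m) * e).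
  { apply Rmult_le_compat; auto; try apply Cmod_ge_0; [|lra].
    apply Rmult_le_pos; apply Cmod_ge_0. }
  assert (T3 : Cmod (RtoC (exp x) - 1 - 1 * x) <= e * m).
  { eapply Rle_trans; [exact H1|]. apply Rmult_le_compat_l; lra. }
  assert (e * m <= eps / 8 * m) by (apply Rmult_le_compat_r; lra). nra.
Qed.

Lemma CD_Cexp (w : C) : CD Cexp w (Cexp w).
Proof.
  apply (CD_ext (fun s => Cexp w * Cexp (s - w))%C).
  - intros s. rewrite <- Cexp_add. f_equal. ring.
  - eapply CD_eq.
    + apply CD_scal. apply (CD_comp Cexp (fun s => s - w)%C).
      * replace (w - w)%C with (RtoC 0) by ring. apply CD_Cexp_0.
      * apply CD_minus; [apply CD_id|apply CD_const].
    + ring.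
Qed.

Lemma Hol_Cexp : Hol Cuniv Cexp.
Proof.
  apply (Hol_intro _ _ Cexp copen_all).
  - intros s _. apply CD_Cexp.
  - intros s _. apply (CD_cont _ _ _ (CD_Cexp s)).
Qed.

Lemma CD_lipschitz (f : C -> C) (s k : C) (M : R) : Hol Cuniv f ->
  (forall u, 0 <= u <= 1 -> Cmod (D f (s + RtoC u * k)) <= M) ->
  Cmod (f (s + k) - f s)%C <= M * Cmod k.
Proof.
  intros Hf HM.
  assert (Cg : pcont (fun u => D f (s + RtoC u * k) * k)%C 0 1).
  { intros u Hu. apply cont_mult; [|apply continuous_const].
    apply (continuous_comp (fun u => s + RtoC u * k)%C (D f)).
    - apply (PD_cont _ _ _ (PD_affine s k u)).
    - apply Hf. exact I. }
  assert (E : CInt (fun u => D f (s + RtoC u * k) * k)%C 0 1 = (f (s + k) - f s)%C).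
  { rewrite (CInt_FTC (fun u => f (s + RtoC u * k)%C)); try lra; auto.
    - f_equal; [|f_equal]; f_equal; ring.
    - intros t Ht. apply (CD_PD_comp f (fun u => s + RtoC u * k)%C); [apply Hf; exact I|apply PD_affine]. }
  rewrite <- E. replace (M * Cmod k) with ((1 - 0) * (M * Cmod k)) by ring.
  apply CInt_norm; auto; try lra.
  intros t Ht. rewrite Cmod_mult. apply Rmult_le_compat_r; [apply Cmod_ge_0|auto].
Qed.

Lemma Cexp_bound1 (v : C) : Cmod (Cexp v - 1) <= exp (Cmod v) * Cmod v.
Proof.
  assert (H : Cmod (Cexp (0 + v) - Cexp 0) <= exp (Cmod v) * Cmod v).
  { apply CD_lipschitz; [apply Hol_Cexp|]. intros u Hu.
    rewrite (D_eq _ _ _ (CD_Cexp _)), Cmod_Cexp.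
    assert (E : Re (0 + RtoC u * v) <= Cmod v).
    { assert (K := re_le_Cmod v). apply Rabs_le_between in K.
      unfold Re, Cplus, Cmult, RtoC; simpl. unfold Re in K. generalize (Cmod_ge_0 v). nra. }
    destruct E as [E| ->]; [left; apply exp_increasing, E|lra]. }
  rewrite Cplus_0_l, Cexp_0 in H. exact H.
Qed.

Lemma Cexp_bound2 (v : C) : Cmod (Cexp v - 1 - v) <= exp (Cmod v) * Cmod v * Cmod v.
Proof.
  assert (H : Cmod (Cexp (0 + v) - Cexp 0 - D Cexp 0 * v) <= exp (Cmod v) * Cmod v * Cmod v).
  { apply (CD_increment Cuniv); [apply Hol_Cexp|intros; exact I|].
    intros u Hu. rewrite !(D_eq _ _ _ (CD_Cexp _)), Cexp_0, Cplus_0_l.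
    eapply Rle_trans; [apply Cexp_bound1|].
    assert (E : Cmod (RtoC u * v) <= Cmod v).
    { rewrite Cmod_mult, Cmod_R, Rabs_pos_eq by lra. generalize (Cmod_ge_0 v). nra. }
    apply Rmult_le_compat; auto; try apply Cmod_ge_0; [left; apply exp_pos|].
    destruct E as [E| ->]; [left; apply exp_increasing, E|lra]. }
  rewrite Cplus_0_l, Cexp_0, (D_eq _ _ _ (CD_Cexp _)), Cexp_0, Cmult_1_l in H. exact H.
Qed.

(** * Limits of complex sequences *)

Definition Clim (u : nat -> C) (l : C) : Prop :=
  is_lim_seq (fun n => Re (u n)) (Re l) /\ is_lim_seq (fun n => Im (u n)) (Im l).

Lemma Clim_eps (u : nat -> C) (l : C) :
  Clim u l <-> forall eps, 0 < eps -> exists N, forall n, (N <= n)%nat -> Cmod (u n - l) < eps.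
Proof.
  unfold Clim. split.
  - intros [H1 H2] eps He. apply is_lim_seq_spec in H1, H2.
    assert (He2 : 0 < eps / 2) by lra.
    destruct (H1 (mkposreal _ He2)) as [N1 K1]. destruct (H2 (mkposreal _ He2)) as [N2 K2].
    simpl in *. exists (N1 + N2)%nat. intros n Hn.
    apply Rle_lt_trans with (1 := Cmod_le_abs _).
    specialize (K1 n ltac:(lia)). specialize (K2 n ltac:(lia)).
    unfold Re, Im, Cminus, Cplus, Copp in *; simpl in *; unfold Rminus in *. lra.
  - intros H. split; apply is_lim_seq_spec; intros eps; destruct (H eps (cond_pos eps)) as [N HN]; exists N; intros n Hn.
    + apply Rle_lt_trans with (2 := HN n Hn). apply (re_le_Cmod (u n - l)%C).
    + apply Rle_lt_trans with (2 := HN n Hn). apply (im_le_Cmod (u n - l)%C).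
Qed.

Lemma CLim_seq_eq (u : nat -> C) (l : C) : Clim u l -> CLim_seq u = l.
Proof.
  intros [H1 H2]. unfold CLim_seq. apply is_lim_seq_unique in H1, H2.
  rewrite H1, H2. simpl. symmetry. apply surjective_pairing.
Qed.

Lemma Clim_unique (u : nat -> C) (l m : C) : Clim u l -> Clim u m -> l = m.
Proof. intros H K. rewrite <- (CLim_seq_eq u l H). apply CLim_seq_eq, K. Qed.

Lemma Clim_ext_loc (u v : nat -> C) (l : C) (N : nat) :
  (forall n, (N <= n)%nat -> u n = v n) -> Clim u l -> Clim v l.
Proof.
  rewrite !Clim_eps. intros H K eps He. destruct (K eps He) as [M HM].
  exists (N + M)%nat. intros n Hn. rewrite <- H by lia. apply HM. lia.
Qed.

Lemma Clim_const (l : C) : Clim (fun _ => l) l.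
Proof. split; apply is_lim_seq_const. Qed.

Lemma Clim_plus (u v : nat -> C) (l m : C) : Clim u l -> Clim v m ->
  Clim (fun n => u n + v n)%C (l + m).
Proof. intros [H1 H2] [K1 K2]. split; apply is_lim_seq_plus'; assumption. Qed.

Lemma Clim_mult (u v : nat -> C) (l m : C) : Clim u l -> Clim v m ->
  Clim (fun n => u n * v n)%C (l * m).
Proof.
  intros [H1 H2] [K1 K2]. split.
  - apply is_lim_seq_minus'; apply is_lim_seq_mult'; assumption.
  - apply is_lim_seq_plus'; apply is_lim_seq_mult'; assumption.
Qed.

Lemma Clim_scal (c : C) (u : nat -> C) (l : C) : Clim u l -> Clim (fun n => c * u n)%C (c * l).
Proof. intros H. apply Clim_mult; [apply Clim_const|exact H]. Qed.

Lemma Clim_opp (u : nat -> C) (l : C) : Clim u l -> Clim (fun n => - u n)%C (- l).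
Proof.
  intros H. replace (- l)%C with (-1 * l)%C by ring.
  apply (Clim_ext_loc (fun n => -1 * u n)%C) with (N := 0%nat); [intros; ring|]. apply Clim_scal, H.
Qed.

Lemma Clim_cont (f : C -> C) (u : nat -> C) (l : C) : continuous f l -> Clim u l ->
  Clim (fun n => f (u n)) (f l).
Proof.
  intros Hf Hu. apply Clim_eps. intros eps He.
  pose proof (proj1 (cont_C _ _) Hf eps He) as L. apply locally_C in L.
  destruct L as [d [Hd L]]. destruct (proj1 (Clim_eps _ _) Hu d Hd) as [N HN].
  exists N. intros n Hn. apply L, HN, Hn.
Qed.

Lemma Clim_subseq (u : nat -> C) (l : C) (k : nat -> nat) : (forall n, (n <= k n)%nat) ->
  Clim u l -> Clim (fun n => u (k n)) l.
Proof.
  rewrite !Clim_eps. intros Hk H eps He. destruct (H eps He) as [N HN].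
  exists N. intros n Hn. apply HN. specialize (Hk n). lia.
Qed.

Lemma Clim_RtoC (u : nat -> R) (l : R) : is_lim_seq u l -> Clim (fun n => RtoC (u n)) l.
Proof. intros H. split; [exact H|]. apply is_lim_seq_const. Qed.

Lemma Clim_bound (u : nat -> C) (l c : C) (M : R) (N : nat) : Clim u l ->
  (forall n, (N <= n)%nat -> Cmod (u n - c) <= M) -> Cmod (l - c) <= M.
Proof.
  intros Hu HM. apply Rnot_lt_le. intros Hlt.
  destruct (proj1 (Clim_eps _ _) Hu (Cmod (l - c) - M) ltac:(lra)) as [N2 HN].
  specialize (HN (N + N2)%nat ltac:(lia)). specialize (HM (N + N2)%nat ltac:(lia)).
  assert (K := Cmod_triangle (u (N + N2)%nat - c) (- (u (N + N2)%nat - l))).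
  replace (u (N + N2)%nat - c + - (u (N + N2)%nat - l))%C with (l - c)%C in K by ring.
  rewrite Cmod_opp in K. lra.
Qed.

Lemma Clim_cauchy (u : nat -> C) :
  (forall eps, 0 < eps -> exists N, forall n m, (N <= n)%nat -> (n <= m)%nat -> Cmod (u m - u n) < eps) ->
  exists l, Clim u l.
Proof.
  intros H.
  assert (E : forall p : C -> R, (forall x y, Rabs (p x - p y) <= Cmod (x - y)) ->
     ex_finite_lim_seq (fun n => p (u n))).
  { intros p Hp. apply ex_lim_seq_cauchy_corr. intros eps.
    destruct (H eps (cond_pos eps)) as [N HN]. exists N. intros n m Hn Hm.
    destruct (Nat.le_ge_cases n m) as [L|L].
    - rewrite Rabs_minus_sym. apply Rle_lt_trans with (1 := Hp _ _). apply HN; assumption.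
    - apply Rle_lt_trans with (1 := Hp _ _). apply HN; assumption. }
  destruct (E Re) as [a Ha]; [intros x y; apply (re_le_Cmod (x - y)%C)|].
  destruct (E Im) as [b Hb]; [intros x y; apply (im_le_Cmod (x - y)%C)|].
  exists (a, b). split; assumption.
Qed.

Lemma Clog_pos (x : R) : 0 < x -> Clog x = ln x.
Proof.
  intros Hx. unfold Clog, Carg. rewrite Cmod_R, Rabs_pos_eq by lra. simpl.
  destruct (Rlt_dec 0 (x + x)) as [_|N]; [|lra].
  unfold Rdiv. rewrite Rmult_0_l, atan_0, Rmult_0_r. reflexivity.
Qed.

Lemma Cpower_pos (x : R) (w : C) : 0 < x -> Cpower x w = Cexp (w * ln x).
Proof. intros Hx. unfold Cpower. rewrite Clog_pos by exact Hx. reflexivity. Qed.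

Lemma pochhammer_S_left (w : C) (n : nat) :
  pochhammer w (S n) = (w * pochhammer (w + 1) n)%C.
Proof.
  induction n as [|n IH].
  - simpl. ring.
  - change (pochhammer w (S (S n))) with (pochhammer w (S n) * (w + INR (S n)))%C.
    rewrite IH. cbn [pochhammer]. rewrite S_INR, RtoC_plus. ring.
Qed.

Lemma Hol_pochhammer (n : nat) : Hol Cuniv (fun w => pochhammer w n).
Proof.
  induction n as [|n IH].
  - apply (Hol_const Cuniv (RtoC 1)), copen_all.
  - apply (Hol_mult Cuniv (fun w => pochhammer w n)); [exact copen_all|exact IH|].
    apply (Hol_plus Cuniv (fun w => w) (fun _ => RtoC (INR n))); [exact copen_all| |].
    + apply Hol_id, copen_all.
    + apply Hol_const, copen_all.
Qed.

(** * The reciprocal Gamma function *)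

Definition euler_gamma (n : nat) (w : C) : C :=
  (pochhammer w (S n) / (INR (fact n) * Cpower (INR n) w))%C.

Lemma INR_S_pos (n : nat) : 0 < INR (S n).
Proof. apply lt_0_INR. lia. Qed.

Lemma RtoC_neq0 (x : R) : x <> 0 -> RtoC x <> 0.
Proof. intros H E. apply H, RtoC_inj, E. Qed.

(** From index 1 on the power is an honest exponential; at index 0 it would involve the logarithm of
    0. *)
Lemma euler_gamma_S (n : nat) (w : C) :
  euler_gamma (S n) w =
    (pochhammer w (S (S n)) / INR (fact (S n)) * Cexp (- (w * ln (INR (S n)))))%C.
Proof.
  unfold euler_gamma. rewrite Cpower_pos by apply INR_S_pos. rewrite Cexp_opp.
  field. split; [apply Cexp_neq0|]. apply RtoC_neq0, INR_fact_neq_0.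
Qed.

Lemma Hol_euler_gamma (n : nat) : Hol Cuniv (euler_gamma (S n)).
Proof.
  apply (Hol_ext Cuniv (fun w => pochhammer w (S (S n)) * / INR (fact (S n)) *
      Cexp ((- ln (INR (S n)))%R * w))%C).
  - exact copen_all.
  - intros w _. rewrite euler_gamma_S. unfold Cdiv. f_equal. f_equal.
    rewrite RtoC_opp. ring.
  - apply (Hol_mult Cuniv (fun w => pochhammer w (S (S n)) * / INR (fact (S n)))%C); [exact copen_all| |].
    + apply (Hol_mult Cuniv (fun w => pochhammer w (S (S n)))); [exact copen_all|apply Hol_pochhammer|].
      apply (Hol_const Cuniv (/ INR (fact (S n)))%C), copen_all.
    + apply (Hol_comp Cuniv Cuniv Cexp (fun w => (- ln (INR (S n)))%R * w)%C);
        [exact copen_all|exact Hol_Cexp| |intros; exact I].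
      apply (Hol_mult Cuniv (fun _ => RtoC (- ln (INR (S n))))); [exact copen_all|apply Hol_const, copen_all|apply Hol_id, copen_all].
Qed.

Lemma ln_step_bounds (n : nat) :
  / INR (S (S n)) <= ln (INR (S (S n))) - ln (INR (S n)) <= / INR (S n).
Proof.
  assert (P1 := INR_S_pos n). assert (P2 := INR_S_pos (S n)).
  assert (E : INR (S (S n)) = INR (S n) + 1) by apply S_INR.
  assert (L : forall x, 0 < x -> ln x <= x - 1).
  { intros x Hx. rewrite <- (exp_ln x Hx) at 2. generalize (exp_ineq1_le (ln x)). lra. }
  rewrite <- ln_div by assumption. split.
  - generalize (L (INR (S n) / INR (S (S n))) (Rdiv_lt_0_compat _ _ P1 P2)).
    rewrite !ln_div by assumption. intros K.
    assert (INR (S n) / INR (S (S n)) - 1 = - / INR (S (S n))) by (rewrite E; field; lra). lra.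
  - generalize (L (INR (S (S n)) / INR (S n)) (Rdiv_lt_0_compat _ _ P2 P1)).
    rewrite !ln_div by assumption. intros K.
    assert (INR (S (S n)) / INR (S n) - 1 = / INR (S n)) by (rewrite E; field; lra). lra.
Qed.

Lemma euler_gamma_ratio (n : nat) (w : C) :
  euler_gamma (S (S n)) w =
  (euler_gamma (S n) w *
    ((1 + w * (/ INR (S (S n)))%R) *
     Cexp (- (w * (ln (INR (S (S n))) - ln (INR (S n)))%R))))%C.
Proof.
  rewrite !euler_gamma_S.
  change (pochhammer w (S (S (S n)))) with (pochhammer w (S (S n)) * (w + INR (S (S n))))%C.
  change (fact (S (S n))) with (S (S n) * fact (S n))%nat. rewrite mult_INR, RtoC_mult.
  replace (- (w * ln (INR (S (S n)))))%C with
    (- (w * ln (INR (S n))) + - (w * (ln (INR (S (S n))) - ln (INR (S n)))%R))%C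
    by (rewrite RtoC_minus; ring).
  rewrite Cexp_add, RtoC_inv. field.
  repeat split; apply RtoC_neq0; (apply INR_fact_neq_0 || apply Rgt_not_eq, INR_S_pos).
  apply Rgt_not_eq, INR_S_pos.
Qed.

(** The summands bound, in this order, the mismatch of the two first-order terms, their product, and
    the second-order remainder of the exponential in [step_bound]. *)
Definition step_const (M : R) : R := M + M * M + (1 + M) * (exp M * M * M).

Lemma step_const_pos (M : R) : 0 <= M -> 0 <= step_const M.
Proof.
  intros HM. unfold step_const. generalize (exp_pos M). intros He.
  assert (0 <= M * M) by nra. assert (0 <= exp M * M * M).
  { rewrite Rmult_assoc. apply Rmult_le_pos; lra. }
  assert (0 <= (1 + M) * (exp M * M * M)) by (apply Rmult_le_pos; lra). lra.
Qed.

(** The quotient of consecutive approximants is (1 + w e) exp(- w dl) with e = 1/(N + 1) and dl =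
    ln(N + 1) - ln N, where N = n + 1. As dl lies between 1/(N + 1) and 1/N, the first-order terms
    cancel up to 1/N^2, and everything else is of second order. *)
Lemma step_bound (n : nat) (w : C) (M : R) : Cmod w <= M ->
  Cmod ((1 + w * (/ INR (S (S n)))%R) *
     Cexp (- (w * (ln (INR (S (S n))) - ln (INR (S n)))%R)) - 1) <=
  step_const M / (INR (S n) * INR (S n)).
Proof.
  intros Hw. assert (HM : 0 <= M) by (generalize (Cmod_ge_0 w); lra).
  destruct (ln_step_bounds n) as [B1 B2].
  assert (P1 := INR_S_pos n). assert (P2 := INR_S_pos (S n)).
  assert (E : INR (S (S n)) = INR (S n) + 1) by apply S_INR.
  assert (H1 : 1 <= INR (S n)) by (rewrite S_INR; generalize (pos_INR n); lra).
  set (N := INR (S n)) in *. set (dl := ln (INR (S (S n))) - ln N) in *.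
  set (e := / INR (S (S n))) in *.
  assert (I0 : 0 < / N) by (apply Rinv_0_lt_compat; lra).
  assert (I1 : / N <= 1) by (rewrite <- Rinv_1; apply Rinv_le_contravar; lra).
  assert (e0 : 0 < e) by (apply Rinv_0_lt_compat; lra).
  assert (ed : / N - e <= / N * / N).
  { unfold e. rewrite E.
    replace (/ N - / (N + 1)) with (/ N * / (N + 1)) by (field; lra).
    apply Rmult_le_compat_l; [lra|]. apply Rinv_le_contravar; lra. }
  set (v := (w * dl)%C). 
  assert (Hv : Cmod v <= M * / N).
  { unfold v. rewrite Cmod_mult, Cmod_R, Rabs_pos_eq by lra.
    apply Rmult_le_compat; try lra; apply Cmod_ge_0. }
  assert (HvM : Cmod v <= M) by nra.
  replace ((1 + w * e) * Cexp (- v) - 1)%C with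
    (w * RtoC (e - dl) - (w * e) * v + (1 + w * e) * (Cexp (- v) - 1 - (- v)))%C
    by (unfold v; rewrite RtoC_minus; ring).
  assert (T1 : Cmod (w * RtoC (e - dl)) <= M * (/ N * / N)).
  { rewrite Cmod_mult, Cmod_R. apply Rmult_le_compat; try apply Cmod_ge_0; try apply Rabs_pos; auto.
    apply Rabs_le. lra. }
  assert (Hwe : Cmod (w * e) <= M * / N).
  { rewrite Cmod_mult, Cmod_R, Rabs_pos_eq by lra. apply Rmult_le_compat; try lra; apply Cmod_ge_0. }
  assert (T2 : Cmod ((w * e) * v) <= M * M * (/ N * / N)).
  { rewrite Cmod_mult. replace (M * M * (/ N * / N)) with ((M * / N) * (M * / N)) by ring.
    apply Rmult_le_compat; auto; apply Cmod_ge_0. }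
  assert (T3 : Cmod ((1 + w * e) * (Cexp (- v) - 1 - (- v))) <=
     (1 + M) * (exp M * M * M) * (/ N * / N)).
  { rewrite Cmod_mult. rewrite Rmult_assoc. apply Rmult_le_compat; try apply Cmod_ge_0.
    - eapply Rle_trans; [apply Cmod_triangle|]. rewrite Cmod_1. nra.
    - eapply Rle_trans; [apply Cexp_bound2|]. rewrite Cmod_opp.
      replace (exp M * M * M * (/ N * / N)) with (exp M * (M * / N) * (M * / N)) by ring.
      assert (exp (Cmod v) <= exp M).
      { destruct HvM as [L|L]; [left; apply exp_increasing, L|rewrite L; lra]. }
      apply Rmult_le_compat; auto; try apply Cmod_ge_0.
      + apply Rmult_le_pos; [left; apply exp_pos|apply Cmod_ge_0].
      + apply Rmult_le_compat; auto; try apply Cmod_ge_0. left; apply exp_pos. }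
  eapply Rle_trans; [apply Cmod_triangle|].
  eapply Rle_trans; [apply Rplus_le_compat_r, Cmod_triangle|]. rewrite Cmod_opp.
  unfold step_const, Rdiv. rewrite Rinv_mult. lra.
Qed.

Lemma inv_sq_tele (n : nat) : / (INR (S n) * INR (S n)) <= 2 * (/ INR (S n) - / INR (S (S n))).
Proof.
  assert (P1 := INR_S_pos n).
  assert (E : INR (S (S n)) = INR (S n) + 1) by apply S_INR.
  assert (H1 : 1 <= INR (S n)) by (rewrite S_INR; generalize (pos_INR n); lra).
  rewrite E. set (N := INR (S n)) in *.
  replace (2 * (/ N - / (N + 1))) with (/ (N * N) * (2 * N / (N + 1))) by (field; lra).
  rewrite <- (Rmult_1_r (/ (N * N))) at 1. apply Rmult_le_compat_l.
  - left. apply Rinv_0_lt_compat. nra.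
  - apply Rmult_le_reg_r with (N + 1); [lra|]. unfold Rdiv. rewrite Rmult_assoc, Rinv_l; lra.
Qed.

(** 1/N^2 is dominated by the telescoping 2 (1/N - 1/(N + 1)), so a product of step factors is at
    most the exponential of a telescoped sum. *)
Lemma euler_gamma_growth (n k : nat) (w : C) (M : R) : Cmod w <= M ->
  Cmod (euler_gamma (S (n + k)) w) <=
  Cmod (euler_gamma (S n) w) * exp (2 * step_const M * (/ INR (S n) - / INR (S (n + k)))).
Proof.
  intros Hw. assert (HM : 0 <= M) by (generalize (Cmod_ge_0 w); lra).
  assert (HK := step_const_pos M HM).
  induction k as [|k IH].
  - rewrite Nat.add_0_r. rewrite Rminus_diag, Rmult_0_r, exp_0. lra.
  - rewrite <- plus_n_Sm. rewrite euler_gamma_ratio, Cmod_mult.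
    assert (S1 := step_bound (n + k) w M Hw).
    set (a := ((1 + w * (/ INR (S (S (n + k))))%R) *
     Cexp (- (w * (ln (INR (S (S (n + k)))) - ln (INR (S (n + k))))%R)))%C) in *.
    assert (S2 : Cmod a <= 1 + step_const M / (INR (S (n + k)) * INR (S (n + k)))).
    { replace a with (1 + (a - 1))%C by ring. eapply Rle_trans; [apply Cmod_triangle|].
      rewrite Cmod_1. lra. }
    assert (S3 : Cmod a <= exp (2 * step_const M * (/ INR (S (n + k)) - / INR (S (S (n + k)))))).
    { eapply Rle_trans; [exact S2|]. eapply Rle_trans; [apply exp_ineq1_le|].
      assert (S4 : step_const M / (INR (S (n + k)) * INR (S (n + k))) <=
         2 * step_const M * (/ INR (S (n + k)) - / INR (S (S (n + k))))).
      { generalize (inv_sq_tele (n + k)). intros T. unfold Rdiv.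
        apply Rle_trans with (step_const M * (2 * (/ INR (S (n + k)) - / INR (S (S (n + k)))))).
        - apply Rmult_le_compat_l; assumption.
        - lra. }
      destruct S4 as [L|L]; [left; apply exp_increasing, L|rewrite L; lra]. }
    replace (2 * step_const M * (/ INR (S n) - / INR (S (S (n + k))))) with
      (2 * step_const M * (/ INR (S n) - / INR (S (n + k))) +
       2 * step_const M * (/ INR (S (n + k)) - / INR (S (S (n + k))))) by ring.
    rewrite exp_plus, <- Rmult_assoc. apply Rmult_le_compat; auto; apply Cmod_ge_0.
Qed.

(** Each increment is an approximant, of size controlled by [euler_gamma_growth], times a step
    error, and the bounds on the step errors telescope. *)
Lemma euler_gamma_cauchy (n k : nat) (w : C) (M : R) : Cmod w <= M ->
  Cmod (euler_gamma (S (n + k)) w - euler_gamma (S n) w) <=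
  Cmod (euler_gamma (S n) w) * exp (2 * step_const M) * (2 * step_const M) *
    (/ INR (S n) - / INR (S (n + k))).
Proof.
  intros Hw. assert (HM : 0 <= M) by (generalize (Cmod_ge_0 w); lra).
  assert (HK := step_const_pos M HM).
  induction k as [|k IH].
  - rewrite Nat.add_0_r. replace (euler_gamma (S n) w - euler_gamma (S n) w)%C with (RtoC 0) by ring.
    rewrite Cmod_0, Rminus_diag. lra.
  - rewrite <- plus_n_Sm.
    replace (euler_gamma (S (S (n + k))) w - euler_gamma (S n) w)%C with
      ((euler_gamma (S (n + k)) w - euler_gamma (S n) w) +
       (euler_gamma (S (S (n + k))) w - euler_gamma (S (n + k)) w))%C by ring.
    eapply Rle_trans; [apply Cmod_triangle|].
    assert (S1 := step_bound (n + k) w M Hw).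
    rewrite euler_gamma_ratio.
    set (a := ((1 + w * (/ INR (S (S (n + k))))%R) *
     Cexp (- (w * (ln (INR (S (S (n + k)))) - ln (INR (S (n + k))))%R)))%C) in *.
    replace (euler_gamma (S (n + k)) w * a - euler_gamma (S (n + k)) w)%C with
      (euler_gamma (S (n + k)) w * (a - 1))%C by ring.
    rewrite Cmod_mult.
    assert (G := euler_gamma_growth n k w M Hw).
    assert (T := inv_sq_tele (n + k)).
    assert (S3 : Cmod (a - 1) <= (2 * step_const M) * (/ INR (S (n + k)) - / INR (S (S (n + k))))).
    { eapply Rle_trans; [exact S1|]. unfold Rdiv.
      apply Rle_trans with (step_const M * (2 * (/ INR (S (n + k)) - / INR (S (S (n + k)))))).
      - apply Rmult_le_compat_l; assumption.
      - lra. }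
    assert (G2 : Cmod (euler_gamma (S (n + k)) w) <= Cmod (euler_gamma (S n) w) * exp (2 * step_const M)).
    { eapply Rle_trans; [exact G|]. apply Rmult_le_compat_l; [apply Cmod_ge_0|].
      assert (L : 2 * step_const M * (/ INR (S n) - / INR (S (n + k))) <= 2 * step_const M).
      { rewrite <- (Rmult_1_r (2 * step_const M)) at 2. apply Rmult_le_compat_l; [lra|].
        assert (/ INR (S n) <= 1).
        { rewrite <- Rinv_1. apply Rinv_le_contravar; [lra|]. rewrite S_INR. generalize (pos_INR n); lra. }
        assert (0 < / INR (S (n + k))) by (apply Rinv_0_lt_compat, INR_S_pos). lra. }
      destruct L as [L|L]; [left; apply exp_increasing, L|rewrite L; lra]. }
    assert (Hp : Cmod (euler_gamma (S (n + k)) w) * Cmod (a - 1) <=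
      Cmod (euler_gamma (S n) w) * exp (2 * step_const M) *
      ((2 * step_const M) * (/ INR (S (n + k)) - / INR (S (S (n + k)))))).
    { apply Rmult_le_compat; auto; apply Cmod_ge_0. }
    lra.
Qed.

Lemma rGamma_lim (w : C) : Clim (fun n => euler_gamma n w) (rGamma w).
Proof.
  assert (E : exists l, Clim (fun n => euler_gamma n w) l).
  2:{ destruct E as [l Hl]. replace (rGamma w) with l; [exact Hl|].
      symmetry. apply CLim_seq_eq, Hl. }
  apply Clim_cauchy. intros eps He.
  set (M := Cmod w). assert (HK := step_const_pos M (Cmod_ge_0 w)).
  set (B := Cmod (euler_gamma 1 w) * exp (2 * step_const M) * exp (2 * step_const M) * (2 * step_const M)).
  assert (HB : 0 <= B).
  { unfold B. repeat apply Rmult_le_pos; try lra; try apply Cmod_ge_0; left; apply exp_pos. }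
  assert (Hsmall : exists N, B * / INR (S N) < eps).
  { destruct (nfloor_ex (B / eps)) as [N HN].
    { apply Rmult_le_pos; [exact HB|left; apply Rinv_0_lt_compat, He]. }
    exists N. rewrite S_INR.
    apply Rmult_lt_reg_r with (INR N + 1); [generalize (pos_INR N); lra|].
    rewrite Rmult_assoc, Rinv_l by (generalize (pos_INR N); lra).
    apply Rmult_lt_reg_r with (/ eps); [apply Rinv_0_lt_compat, He|].
    replace (eps * (INR N + 1) * / eps) with (INR N + 1) by (field; lra). lra. }
  destruct Hsmall as [N HN]. exists (S N). intros n m Hn Hm.
  destruct n as [|n]; [lia|]. destruct m as [|m]; [lia|].
  replace m with (n + (m - n))%nat by lia.
  eapply Rle_lt_trans; [apply (euler_gamma_cauchy n (m - n) w M (Rle_refl _))|].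
  assert (G := euler_gamma_growth 0 n w M (Rle_refl _)). rewrite Nat.add_0_l in G.
  assert (G2 : Cmod (euler_gamma (S n) w) <= Cmod (euler_gamma 1 w) * exp (2 * step_const M)).
  { eapply Rle_trans; [exact G|]. apply Rmult_le_compat_l; [apply Cmod_ge_0|].
    assert (L : 2 * step_const M * (/ INR 1 - / INR (S n)) <= 2 * step_const M).
    { rewrite <- (Rmult_1_r (2 * step_const M)) at 2. apply Rmult_le_compat_l; [lra|].
      simpl INR at 1. rewrite Rinv_1.
      assert (0 < / INR (S n)) by (apply Rinv_0_lt_compat, INR_S_pos). lra. }
    destruct L as [L|L]; [left; apply exp_increasing, L|rewrite L; lra]. }
  apply Rle_lt_trans with (B * / INR (S N)); [|exact HN].
  unfold B. apply Rmult_le_compat.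
  - repeat apply Rmult_le_pos; try lra; try apply Cmod_ge_0; left; apply exp_pos.
  - assert (/ INR (S (n + (m - n))) <= / INR (S n)); [|lra].
    apply Rinv_le_contravar; [apply INR_S_pos|]. apply le_INR. lia.
  - apply Rmult_le_compat_r; [lra|]. apply Rmult_le_compat_r; [left; apply exp_pos|exact G2].
  - assert (0 < / INR (S (n + (m - n)))) by (apply Rinv_0_lt_compat, INR_S_pos).
    assert (/ INR (S n) <= / INR (S N)); [|lra].
    apply Rinv_le_contravar; [apply INR_S_pos|]. apply le_INR. lia.
Qed.

(** The error is relative to the size of the approximant. It therefore yields local uniform
    convergence and also shows that the limit does not vanish where the approximants do not. *)
Lemma euler_gamma_approx (n : nat) (w : C) (M : R) : Cmod w <= M ->
  Cmod (rGamma w - euler_gamma (S n) w) <=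
  Cmod (euler_gamma (S n) w) * exp (2 * step_const M) * (2 * step_const M) * / INR (S n).
Proof.
  intros Hw. assert (HM : 0 <= M) by (generalize (Cmod_ge_0 w); lra).
  assert (HK := step_const_pos M HM).
  apply (Clim_bound (fun k => euler_gamma k w)) with (N := S n); [apply rGamma_lim|].
  intros m Hm. destruct m as [|m]; [lia|]. replace m with (n + (m - n))%nat by lia.
  eapply Rle_trans; [apply (euler_gamma_cauchy n (m - n) w M Hw)|].
  apply Rmult_le_compat_l.
  - repeat apply Rmult_le_pos; try lra; try apply Cmod_ge_0; left; apply exp_pos.
  - assert (0 < / INR (S (n + (m - n)))) by (apply Rinv_0_lt_compat, INR_S_pos). lra.
Qed.

Lemma Hol_rGamma : Hol Cuniv rGamma.
Proof.
  apply (Hol_limit Cuniv (fun n => euler_gamma (S n)) rGamma copen_all Hol_euler_gamma).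
  intros a _. exists 1. split; [lra|]. split; [intros; exact I|]. intros eps He.
  set (M := Cmod a + 1). assert (HM : 0 <= M) by (generalize (Cmod_ge_0 a); unfold M; lra).
  assert (HK := step_const_pos M HM).
  set (B := (M * (M + 1)) * exp (2 * step_const M) * exp (2 * step_const M) * (2 * step_const M)).
  assert (HB : 0 <= B).
  { unfold B. repeat apply Rmult_le_pos; try lra; left; apply exp_pos. }
  destruct (nfloor_ex (B / eps)) as [N HN].
  { apply Rmult_le_pos; [exact HB|left; apply Rinv_0_lt_compat, He]. }
  exists N. intros n Hn s Hs.
  assert (HsM : Cmod s <= M).
  { unfold M. replace s with ((s - a) + a)%C by ring. eapply Rle_trans; [apply Cmod_triangle|]. lra. }
  replace (euler_gamma (S n) s - rGamma s)%C with (- (rGamma s - euler_gamma (S n) s))%C by ring.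
  rewrite Cmod_opp. eapply Rle_lt_trans; [apply (euler_gamma_approx n s M HsM)|].
  assert (G := euler_gamma_growth 0 n s M HsM). rewrite Nat.add_0_l in G.
  assert (G0 : Cmod (euler_gamma 1 s) <= M * (M + 1)).
  { rewrite euler_gamma_S. change (INR 1) with 1. rewrite ln_1.
    replace (- (s * 0))%C with (RtoC 0) by ring. rewrite Cexp_0, Cmult_1_r.
    simpl. replace ((1 * (s + 0) * (s + 1)) / 1)%C with (s * (s + 1))%C by field.
    rewrite Cmod_mult. apply Rmult_le_compat; try apply Cmod_ge_0; auto.
    eapply Rle_trans; [apply Cmod_triangle|]. rewrite Cmod_1. lra. }
  assert (G2 : Cmod (euler_gamma (S n) s) <= (M * (M + 1)) * exp (2 * step_const M)).
  { eapply Rle_trans; [exact G|]. apply Rmult_le_compat; auto; try apply Cmod_ge_0; [left; apply exp_pos|].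
    assert (L : 2 * step_const M * (/ INR 1 - / INR (S n)) <= 2 * step_const M).
    { rewrite <- (Rmult_1_r (2 * step_const M)) at 2. apply Rmult_le_compat_l; [lra|].
      simpl INR at 1. rewrite Rinv_1.
      assert (0 < / INR (S n)) by (apply Rinv_0_lt_compat, INR_S_pos). lra. }
    destruct L as [L|L]; [left; apply exp_increasing, L|rewrite L; lra]. }
  apply Rle_lt_trans with (B * / INR (S n)).
  - unfold B. apply Rmult_le_compat_r; [left; apply Rinv_0_lt_compat, INR_S_pos|].
    apply Rmult_le_compat_r; [lra|]. apply Rmult_le_compat_r; [left; apply exp_pos|exact G2].
  - assert (INR N <= INR n) by (apply le_INR, Hn). rewrite S_INR.
    assert (P := pos_INR n).
    apply Rmult_lt_reg_r with (INR n + 1); [lra|].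
    rewrite Rmult_assoc, Rinv_l by lra.
    apply Rmult_lt_reg_r with (/ eps); [apply Rinv_0_lt_compat, He|].
    replace (eps * (INR n + 1) * / eps) with (INR n + 1) by (field; lra). lra.
Qed.

Lemma INR_inv_lim : is_lim_seq (fun n => / INR n) 0.
Proof.
  replace (Finite 0) with (Rbar_inv p_infty) by reflexivity.
  apply is_lim_seq_inv; [apply is_lim_seq_INR|discriminate].
Qed.

(** The approximants satisfy it up to the factor 1 + (w + 1) / n, which tends to 1. *)
Lemma rGamma_rec (w : C) : rGamma w = (w * rGamma (w + 1))%C.
Proof.
  apply (Clim_unique (fun n => w * euler_gamma n (w + 1))%C).
  2:{ apply Clim_scal, rGamma_lim. }
  replace (rGamma w) with (rGamma w * (1 + (w + 1) * 0))%C by ring.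
  apply (Clim_ext_loc (fun n => euler_gamma n w * (1 + (w + 1) * (/ INR n)%R))%C) with (N := 1%nat).
  2:{ apply Clim_mult; [apply rGamma_lim|]. apply Clim_plus; [apply Clim_const|].
      apply Clim_scal, Clim_RtoC, INR_inv_lim. }
  intros n Hn. destruct n as [|n]; [lia|]. rewrite !euler_gamma_S.
  assert (E : (w * pochhammer (w + 1) (S (S n)) = pochhammer w (S (S n)) * (w + INR (S (S n))))%C).
  { rewrite <- pochhammer_S_left. reflexivity. }
  assert (N1 : RtoC (INR (S n)) <> 0) by (apply RtoC_neq0, Rgt_not_eq, INR_S_pos).
  assert (N2 : RtoC (INR (fact (S n))) <> 0) by (apply RtoC_neq0, INR_fact_neq_0).
  replace (- ((w + 1) * ln (INR (S n))))%C with (- (w * ln (INR (S n))) + RtoC (- ln (INR (S n))))%C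
    by (rewrite RtoC_opp; ring).
  rewrite Cexp_add, Cexp_RtoC, exp_Ropp, exp_ln by apply INR_S_pos.
  rewrite RtoC_inv by (apply Rgt_not_eq, INR_S_pos).
  replace (w * (pochhammer (w + 1) (S (S n)) / INR (fact (S n)) *
     (Cexp (- (w * ln (INR (S n)))) * / INR (S n))))%C with
    ((w * pochhammer (w + 1) (S (S n))) / INR (fact (S n)) *
     (Cexp (- (w * ln (INR (S n)))) * / INR (S n)))%C by (field; auto).
  rewrite E. rewrite (S_INR (S n)), RtoC_plus. field. auto.
Qed.

Lemma rGamma_1 : rGamma 1 = 1.
Proof.
  apply (Clim_unique (fun n => euler_gamma n 1)); [apply rGamma_lim|].
  assert (L : Clim (fun n => 1 + RtoC (/ INR n))%C (1 + 0)).
  { apply Clim_plus; [apply Clim_const|apply Clim_RtoC, INR_inv_lim]. }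
  rewrite Cplus_0_r in L.
  apply (Clim_ext_loc (fun n => 1 + RtoC (/ INR n))%C) with (N := 1%nat).
  2:{ exact L. }
  intros n Hn. destruct n as [|n]; [lia|]. rewrite euler_gamma_S.
  assert (E : forall k, pochhammer 1 k = RtoC (INR (fact k))).
  { induction k as [|k IH]; [reflexivity|]. cbn [pochhammer]. rewrite IH.
    change (fact (S k)) with (S k * fact k)%nat. rewrite mult_INR, S_INR, RtoC_mult, RtoC_plus. ring. }
  rewrite E. change (fact (S (S n))) with (S (S n) * fact (S n))%nat.
  rewrite mult_INR, RtoC_mult, (S_INR (S n)), RtoC_plus.
  rewrite Cmult_1_l, <- RtoC_opp, Cexp_RtoC, exp_Ropp, exp_ln by apply INR_S_pos.
  rewrite RtoC_inv by (apply Rgt_not_eq, INR_S_pos). field.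
  repeat split; apply RtoC_neq0; (apply INR_fact_neq_0 || apply Rgt_not_eq, INR_S_pos).
Qed.

Lemma rGamma_pole (k : nat) : rGamma (- INR k) = 0.
Proof.
  induction k as [|k IH].
  - rewrite rGamma_rec. simpl. ring.
  - rewrite rGamma_rec. replace (- INR (S k) + 1)%C with (- INR k)%C.
    + rewrite IH. ring.
    + rewrite S_INR, RtoC_plus. ring.
Qed.

Lemma pochhammer_neq0 (w : C) (n : nat) :
  (forall k, (k < n)%nat -> w <> - INR k)%C -> pochhammer w n <> 0.
Proof.
  induction n as [|n IH]; intros H.
  - simpl. apply RtoC_neq0. lra.
  - cbn [pochhammer]. apply Cmult_neq_0.
    + apply IH. intros k Hk. apply H. lia.
    + intros E. apply (H n ltac:(lia)). replace w with (w + INR n - INR n)%C by ring.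
      rewrite E. ring.
Qed.

(** If the limit were 0, a relative error below 1 would force a late approximant to vanish; but off
    the poles of Gamma its Pochhammer factor is a product of nonzero terms. *)
Lemma rGamma_neq0 (w : C) : (forall k, w <> - INR k)%C -> rGamma w <> 0.
Proof.
  intros H.
  set (M := Cmod w). assert (HK := step_const_pos M (Cmod_ge_0 w)).
  set (B := exp (2 * step_const M) * (2 * step_const M)).
  assert (HB : 0 <= B) by (apply Rmult_le_pos; [left; apply exp_pos|lra]).
  destruct (nfloor_ex (2 * B) ltac:(lra)) as [N HN].
  assert (A := euler_gamma_approx N w M (Rle_refl _)).
  intros E. rewrite E in A.
  replace (0 - euler_gamma (S N) w)%C with (- euler_gamma (S N) w)%C in A by ring.
  rewrite Cmod_opp in A.
  assert (P : 0 < Cmod (euler_gamma (S N) w)).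
  { apply Cmod_gt_0. rewrite euler_gamma_S. apply Cmult_neq_0; [|apply Cexp_neq0].
    apply Cmult_neq_0; [apply pochhammer_neq0; auto|].
    intros K. apply (RtoC_neq0 (INR (fact (S N)))); [apply INR_fact_neq_0|].
    rewrite <- (Cmult_1_r (INR (fact (S N)))). 
    replace (RtoC 1) with (INR (fact (S N)) * / INR (fact (S N)))%C.
    - rewrite K. ring.
    - apply Cinv_r, RtoC_neq0, INR_fact_neq_0. }
  rewrite Rmult_assoc in A. rewrite (Rmult_assoc (Cmod _)) in A.
  assert (L : exp (2 * step_const M) * (2 * step_const M * / INR (S N)) < 1).
  { rewrite <- Rmult_assoc. fold B. rewrite S_INR. assert (Q := pos_INR N).
    apply Rmult_lt_reg_r with (INR N + 1); [lra|]. rewrite Rmult_assoc, Rinv_l by lra. lra. }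
  nra.
Qed.

(** * Legendre's duplication formula *)

Lemma pochhammer_double (w : C) (n : nat) :
  pochhammer (2 * w) (2 * n) = (4 ^ n * (pochhammer w n * pochhammer (w + /2) n))%C.
Proof.
  induction n as [|n IH].
  - simpl. ring.
  - replace (2 * S n)%nat with (S (S (2 * n))) by lia. cbn [pochhammer]. rewrite IH.
    rewrite S_INR, mult_INR, !RtoC_plus, RtoC_mult. simpl (INR 2). 
    rewrite Cpow_S. replace (1 + 1) with 2 by ring. field.
Qed.

Lemma pochhammer_1 (k : nat) : pochhammer 1 k = RtoC (INR (fact k)).
Proof.
  induction k as [|k IH]; [reflexivity|]. cbn [pochhammer]. rewrite IH.
  change (fact (S k)) with (S k * fact k)%nat. rewrite mult_INR, S_INR, RtoC_mult, RtoC_plus. ring.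
Qed.

Lemma INR_fact_C_neq0 (n : nat) : RtoC (INR (fact n)) <> 0.
Proof. apply RtoC_neq0, INR_fact_neq_0. Qed.

(** [pochhammer_double] at w = 1/2, where 2 w and w + 1/2 are both 1, with a common factor n + 1
    cancelled. *)
Lemma half_poch_fact (n : nat) :
  (4 ^ (S n) * pochhammer (/ 2) (S n) * INR (fact n) = 2 * INR (fact (S (2 * n))))%C.
Proof.
  assert (E := pochhammer_double (/ 2) (S n)).
  replace (2 * / 2)%C with (RtoC 1) in E by field.
  replace (/ 2 + / 2)%C with (RtoC 1) in E by field.
  rewrite !pochhammer_1 in E.
  replace (2 * S n)%nat with (S (S (2 * n))) in E by lia.
  change (fact (S (S (2 * n)))) with (S (S (2 * n)) * fact (S (2 * n)))%nat in E.
  change (fact (S n)) with (S n * fact n)%nat in E.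
  rewrite !mult_INR in E.
  replace (INR (S (S (2 * n)))) with (2 * INR (S n)) in E.
  2:{ rewrite !S_INR, mult_INR. simpl. ring. }
  rewrite !RtoC_mult in E.
  assert (N : RtoC (INR (S n)) <> 0) by (apply RtoC_neq0, Rgt_not_eq, INR_S_pos).
  assert (E2 : (INR (S n) * (4 ^ (S n) * pochhammer (/ 2) (S n) * INR (fact n)) =
     INR (S n) * (2 * INR (fact (S (2 * n)))))%C).
  { replace (INR (S n) * (2 * INR (fact (S (2 * n)))))%C with
      (2 * INR (S n) * INR (fact (S (2 * n))))%C by ring. rewrite E. ring. }
  apply (f_equal (fun u => / INR (S n) * u)%C) in E2.
  rewrite !Cmult_assoc, Cinv_l, !Cmult_1_l in E2 by exact N.
  rewrite <- E2. ring.
Qed.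

(** An exact identity between approximants. Expressing the factorials through the Pochhammer symbol
    of 1/2 makes the constant of the duplication formula appear as an approximant of 1/Gamma(1/2),
    so neither Stirling's nor Wallis' formula is needed. *)
Lemma euler_gamma_dup (n : nat) (w : C) :
  (euler_gamma (S n) w * euler_gamma (S n) (w + / 2) =
   euler_gamma (S (2 * S n)) (2 * w) * (euler_gamma (S n) (/ 2) * / 2) *
   Cexp (2 * w * RtoC (ln (INR (S (2 * S n))) - ln (INR (S n)))))%C.
Proof.
  rewrite !euler_gamma_S.
  replace (S (S (2 * S n))) with (2 * S (S n))%nat by lia.
  rewrite pochhammer_double.
  set (L := ln (INR (S n))). set (L2 := ln (INR (S (2 * S n)))).
  set (a := pochhammer w (S (S n))). set (b := pochhammer (w + / 2) (S (S n))).
  assert (H := half_poch_fact (S n)). set (h := pochhammer (/ 2) (S (S n))) in *.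
  assert (N1 := INR_fact_C_neq0 (S n)). assert (N2 := INR_fact_C_neq0 (S (2 * S n))).
  set (F := RtoC (INR (fact (S n)))) in *. set (F2 := RtoC (INR (fact (S (2 * S n))))) in *.
  transitivity (a * b / (F * F) * Cexp (- (2 * w * L) - / 2 * L))%C.
  { replace (- (2 * w * L) - / 2 * L)%C with (- (w * L) + - ((w + / 2) * L))%C by ring.
    rewrite Cexp_add. field. exact N1. }
  transitivity ((4 ^ S (S n) * h * F) / (2 * F2) * (a * b / (F * F)) * Cexp (- (2 * w * L) - / 2 * L))%C.
  { rewrite H. field. auto. }
  replace (- (2 * w * L) - / 2 * L)%C with
     (- (2 * w * L2) + - (/ 2 * L) + 2 * w * RtoC (L2 - L))%C by (rewrite RtoC_minus; ring).
  rewrite !Cexp_add. field. auto.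
Qed.

Lemma ln_ratio_lim : is_lim_seq (fun n => ln (INR (S (2 * S n))) - ln (INR (S n))) (ln 2).
Proof.
  apply (is_lim_seq_ext (fun n => ln (2 + / INR (S n)))).
  - intros n. rewrite <- ln_div by apply INR_S_pos. f_equal.
    rewrite (S_INR (2 * S n)), mult_INR. simpl (INR 2). field. apply Rgt_not_eq, INR_S_pos.
  - apply (is_lim_seq_continuous ln).
    + apply continuity_pt_filterlim, continuous_ln. lra.
    + assert (L : is_lim_seq (fun n => 2 + / INR (S n)) (2 + 0)).
      { apply is_lim_seq_plus'; [apply is_lim_seq_const|].
        apply (is_lim_seq_incr_1 (fun n => / INR n)), INR_inv_lim. }
      rewrite Rplus_0_r in L. exact L.
Qed.

Lemma rGamma_dup (w : C) :
  (rGamma w * rGamma (w + / 2) = rGamma (2 * w) * (rGamma (/ 2) * / 2) * Cexp (2 * w * ln 2))%C.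
Proof.
  apply (Clim_unique (fun n => euler_gamma (S n) w * euler_gamma (S n) (w + / 2))%C).
  - apply Clim_mult; apply (Clim_subseq (fun n => euler_gamma n _) _ S); try (intros; lia); apply rGamma_lim.
  - apply (Clim_ext_loc (fun n => euler_gamma (S (2 * S n)) (2 * w) * (euler_gamma (S n) (/ 2) * / 2) *
      Cexp (2 * w * RtoC (ln (INR (S (2 * S n))) - ln (INR (S n)))))%C) with (N := 0%nat).
    { intros n _. symmetry. apply euler_gamma_dup. }
    apply Clim_mult; [apply Clim_mult; [|apply Clim_mult; [|apply Clim_const]]|].
    + apply (Clim_subseq (fun n => euler_gamma n (2 * w)) _ (fun n => S (2 * S n))); [intros; lia|apply rGamma_lim].
    + apply (Clim_subseq (fun n => euler_gamma n (/ 2)) _ S); [intros; lia|apply rGamma_lim].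
    + apply (Clim_cont Cexp); [apply (Hol_cont Cuniv); [apply Hol_Cexp|exact I]|].
      apply Clim_scal, Clim_RtoC, ln_ratio_lim.
Qed.

(** * The sine product and the reflection formula *)

(* The recursion of these integrals in [n] produces the factors of Euler's product for the sine. *)
Definition cosint (x : R) (n : nat) : R := RInt (fun t => cos (x * t) * cos t ^ n) 0 (PI / 2).

Lemma PI2_ge0 : 0 <= PI / 2.
Proof. generalize PI_RGT_0. lra. Qed.

Lemma cont_cosint (x : R) (n : nat) (t : R) : continuous (fun t => cos (x * t) * cos t ^ n) t.
Proof.
  apply continuity_pt_filterlim. reg.
Qed.

Lemma ex_cosint (x : R) (n : nat) : ex_RInt (fun t => cos (x * t) * cos t ^ n) 0 (PI / 2).
Proof. apply (ex_RInt_continuous (V := R_CompleteNormedModule)). intros t _. apply cont_cosint. Qed.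

(** With N = n + 2, integrate the derivative of N cos(x t) sin t cos(t)^(N - 1) - x sin(x t)
    cos(t)^N, which vanishes at both ends of [0, PI / 2]. *)
Lemma cosint_rec (x : R) (n : nat) :
  INR (S (S n)) * INR (S n) * cosint x n = (INR (S (S n)) ^ 2 - x ^ 2) * cosint x (S (S n)).
Proof.
  set (N := INR (S (S n))).
  assert (EN : INR (S n) = N - 1) by (unfold N; rewrite (S_INR (S n)); ring).
  assert (H : is_RInt (fun t => (N ^ 2 - x ^ 2) * (cos (x * t) * cos t ^ (S (S n)))
       - N * (N - 1) * (cos (x * t) * cos t ^ n)) 0 (PI / 2)
     (minus (N * cos (x * (PI/2)) * sin (PI/2) * cos (PI/2) ^ (S n) - x * sin (x * (PI/2)) * cos (PI/2) ^ (S (S n)))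
     (N * cos (x * 0) * sin 0 * cos 0 ^ (S n) - x * sin (x * 0) * cos 0 ^ (S (S n))))).
  { apply (is_RInt_derive (V := R_CompleteNormedModule)
      (fun t => N * cos (x * t) * sin t * cos t ^ (S n) - x * sin (x * t) * cos t ^ (S (S n)))).
    - intros t _. auto_derive; [exact I|].
      change (Init.Nat.pred (S (S n))) with (S n). change (Init.Nat.pred (S n)) with n.
      assert (E : sin t * sin t = 1 - cos t * cos t).
      { generalize (sin2_cos2 t). unfold Rsqr. lra. }
      fold N. change (match n with O => 1 | S _ => INR n + 1 end) with (INR (S n)).
      rewrite EN. simpl pow.
      transitivity (N * cos (x * t) * (cos t * (cos t * cos t ^ n)) - N * (N - 1) * cos (x * t) * (sin t * sin t) * cos t ^ n
          - x * x * cos (x * t) * (cos t * (cos t * cos t ^ n))).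
      + ring.
      + rewrite E. ring.
    - intros t _. apply continuity_pt_filterlim. reg. }
  rewrite cos_PI2, sin_0, (Rmult_0_r x), sin_0, !(pow_i (S _)) in H by lia.
  assert (H2 : is_RInt (fun t => (N ^ 2 - x ^ 2) * (cos (x * t) * cos t ^ (S (S n)))
       - N * (N - 1) * (cos (x * t) * cos t ^ n)) 0 (PI / 2)
       ((N ^ 2 - x ^ 2) * cosint x (S (S n)) - N * (N - 1) * cosint x n)).
  { apply (is_RInt_minus (V := R_NormedModule) (fun t => (N ^ 2 - x ^ 2) * (cos (x * t) * cos t ^ (S (S n)))));
    apply (is_RInt_scal (V := R_NormedModule) (fun t => cos (x * t) * cos t ^ _));
    apply (RInt_correct (V := R_CompleteNormedModule)), ex_cosint. }
  apply (is_RInt_unique (V := R_CompleteNormedModule)) in H.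
  apply (is_RInt_unique (V := R_CompleteNormedModule)) in H2.
  assert (Em : forall a b : R, minus a b = a - b) by reflexivity.
  rewrite H, Em in H2. rewrite EN.
  clearbody N. generalize dependent (cosint x (S (S n))). generalize dependent (cosint x n).
  intros. lra.
Qed.

Lemma cosint_0_pos (n : nat) : 0 < cosint 0 n.
Proof.
  unfold cosint. apply RInt_gt_0.
  - generalize PI_RGT_0; lra.
  - intros t Ht. rewrite Rmult_0_l, cos_0, Rmult_1_l. apply pow_lt, cos_gt_0; lra.
  - intros t _. apply cont_cosint.
Qed.

Lemma cos_ge_quad (y : R) : 1 - y ^ 2 / 2 <= cos y.
Proof.
  replace y with (2 * (y / 2)) at 2 by field. rewrite cos_2a_sin.
  assert (H : sin (y / 2) ^ 2 <= (y / 2) ^ 2).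
  { rewrite <- !Rsqr_pow2. apply Rsqr_le_abs_1.
    destruct (Rtotal_order (y / 2) 0) as [L|[L|L]].
    - rewrite <- (Rabs_Ropp (sin _)), <- sin_neg, <- (Rabs_Ropp (y / 2)).
      apply Rabs_le. rewrite (Rabs_pos_eq (- (y/2))) by lra. 
      assert (A := sin_lt_x (- (y/2)) ltac:(lra)).
      split; [|lra]. destruct (Rle_lt_dec (- (y/2)) 1) as [Q|Q].
      + assert (0 <= sin (- (y / 2))); [|lra]. apply sin_ge_0; [lra|]. generalize PI_RGT_0, PI2_1. lra.
      + generalize (SIN_bound (- (y/2))). lra.
    - rewrite L, sin_0. lra.
    - rewrite (Rabs_pos_eq (y / 2)) by lra. apply Rabs_le.
      assert (A := sin_lt_x (y/2) ltac:(lra)).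
      split; [|lra]. destruct (Rle_lt_dec (y/2) 1) as [Q|Q].
      + assert (0 <= sin (y / 2)); [|lra]. apply sin_ge_0; [lra|]. generalize PI_RGT_0, PI2_1. lra.
      + generalize (SIN_bound (y/2)). lra. }
  nra.
Qed.

Lemma tcos_le_sin (t : R) : 0 <= t <= PI / 2 -> t * cos t <= sin t.
Proof.
  intros Ht. destruct (Req_dec t 0) as [->|Hn]; [rewrite sin_0; lra|].
  destruct (MVT_gen (fun t => sin t - t * cos t) 0 t (fun t => t * sin t)) as [c [Hc E]].
  - intros u _. auto_derive; [exact I|ring].
  - intros u _. reg.
  - rewrite Rmin_left, Rmax_right in Hc by lra. rewrite sin_0 in E.
    assert (0 <= c * sin c).
    { apply Rmult_le_pos; [lra|]. apply sin_ge_0; [lra|]. generalize PI_RGT_0; lra. }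
    assert (0 <= c * sin c * (t - 0)) by (apply Rmult_le_pos; lra). lra.
Qed.

(** Since 1 - cos(x t) <= (x t)^2 / 2 and t cos t <= sin t, the integrand is at most x^2 / 2 times
    sin(t)^2 cos(t)^n, and sin^2 = 1 - cos^2 produces the difference of two integrals without
    oscillation. *)
Lemma cosint_diff (x : R) (n : nat) :
  Rabs (cosint x (S (S n)) - cosint 0 (S (S n))) <= x ^ 2 / 2 * (cosint 0 n - cosint 0 (S (S n))).
Proof.
  assert (B := PI2_ge0).
  unfold cosint.
  rewrite <- (RInt_minus (V := R_CompleteNormedModule)) by apply ex_cosint.
  rewrite <- (RInt_minus (V := R_CompleteNormedModule) (fun t => cos (0 * t) * cos t ^ n)) by apply ex_cosint.
  assert (EX : forall k m y z, ex_RInt (fun t => minus (cos (y * t) * cos t ^ k) (cos (z * t) * cos t ^ m)) 0 (PI / 2)).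
  { intros. apply (ex_RInt_minus (V := R_NormedModule)); apply ex_cosint. }
  rewrite <- (RInt_scal (V := R_CompleteNormedModule) (fun t => minus (cos (0 * t) * cos t ^ n) (cos (0 * t) * cos t ^ S (S n)))) by apply EX.
  eapply Rle_trans; [apply abs_RInt_le; [exact B|apply EX]|].
  apply RInt_le; [exact B| | |].
  - apply ex_RInt_norm, EX.
  - apply (ex_RInt_scal (V := R_NormedModule)), EX.
  - intros t Ht. unfold minus, plus, opp, scal; simpl. unfold mult; simpl.
    rewrite Rmult_0_l, cos_0.
    assert (Hc : 0 <= cos t) by (apply cos_ge_0; lra).
    assert (Hp : 0 <= cos t ^ n) by (apply pow_le, Hc).
    assert (H1 := cos_ge_quad (x * t)). assert (H2 := COS_bound (x * t)).
    assert (H3 := tcos_le_sin t ltac:(lra)).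
    assert (H4 : (t * cos t) ^ 2 <= 1 - cos t * cos t).
    { replace (1 - cos t * cos t) with (sin t ^ 2) by (generalize (sin2_cos2 t); unfold Rsqr; nra).
      apply pow_incr. split; [apply Rmult_le_pos; lra|exact H3]. }
    set (q := cos t ^ n) in *. set (c := cos t) in *. set (k := cos (x * t)) in *.
    replace (k * (c * (c * q)) + - (1 * (c * (c * q)))) with (- ((1 - k) * (c * c * q))) by ring.
    rewrite Rabs_Ropp, Rabs_pos_eq.
    2:{ apply Rmult_le_pos; [lra|]. apply Rmult_le_pos; [|exact Hp]. apply Rmult_le_pos; exact Hc. }
    replace (x * (x * 1) / 2 * (1 * q + - (1 * (c * (c * q))))) with ((x ^ 2 / 2 * (1 - c * c)) * q) by (simpl; field).
    rewrite <- Rmult_assoc. apply Rmult_le_compat_r; [exact Hp|].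
    apply Rle_trans with ((x * t) ^ 2 / 2 * (c * c)).
    + apply Rmult_le_compat_r; [apply Rmult_le_pos; exact Hc|lra].
    + replace ((x * t) ^ 2 / 2 * (c * c)) with (x ^ 2 / 2 * (t * c) ^ 2) by field.
      apply Rmult_le_compat_l; [|exact H4]. generalize (pow2_ge_0 x). lra.
Qed.

Fixpoint sine_prod (x : R) (m : nat) : R :=
  match m with O => 1 | S k => sine_prod x k * (1 - x ^ 2 / INR (S k) ^ 2) end.

(** The recursion at 2 x divided by the recursion at 0 leaves (4 N^2 - 4 x^2) / (4 N^2), the N-th
    factor of Euler's product. *)
Lemma sine_prod_cosint (x : R) (m : nat) :
  cosint (2 * x) 0 / cosint 0 0 = cosint (2 * x) (2 * m) / cosint 0 (2 * m) * sine_prod x m.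
Proof.
  induction m as [|m IH]; [simpl; ring|].
  rewrite IH. replace (2 * S m)%nat with (S (S (2 * m))) by lia. cbn [sine_prod].
  assert (R1 := cosint_rec (2 * x) (2 * m)). assert (R2 := cosint_rec 0 (2 * m)).
  assert (P1 := cosint_0_pos (2 * m)). assert (P2 := cosint_0_pos (S (S (2 * m)))).
  set (a := cosint (2 * x) (2 * m)) in *. set (b := cosint 0 (2 * m)) in *.
  set (a' := cosint (2 * x) (S (S (2 * m)))) in *. set (b' := cosint 0 (S (S (2 * m)))) in *.
  assert (K : INR (S (S (2 * m))) = 2 * INR (S m)).
  { rewrite !S_INR, mult_INR. simpl. ring. }
  rewrite K in *. assert (Q := INR_S_pos m). assert (Q2 := INR_S_pos (2 * m)).
  set (N := INR (S m)) in *. set (N1 := INR (S (2 * m))) in *.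
  assert (E1 : a = (4 * N ^ 2 - 4 * x ^ 2) / (2 * N * N1) * a').
  { apply Rmult_eq_reg_l with (2 * N * N1); [|nra]. rewrite R1. field. split; lra. }
  assert (E2 : b = 4 * N ^ 2 / (2 * N * N1) * b').
  { apply Rmult_eq_reg_l with (2 * N * N1); [|nra]. rewrite R2. field. split; lra. }
  rewrite E1, E2. field. repeat split; lra.
Qed.

(** The recursion at 0 turns the difference on the right of [cosint_diff] into [cosint 0 (n + 2)]
    divided by n + 1, so the relative error is of order 1 / m. *)
Lemma cosint_ratio_lim (x : R) : is_lim_seq (fun m => cosint (2 * x) (2 * S m) / cosint 0 (2 * S m)) 1.
Proof.
  apply is_lim_seq_le_le with (u := fun m => 1 - 2 * x ^ 2 * / INR (S m)) (w := fun m => 1 + 2 * x ^ 2 * / INR (S m)).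
  - intros m. replace (2 * S m)%nat with (S (S (2 * m))) by lia.
    assert (R2 := cosint_rec 0 (2 * m)). assert (Df := cosint_diff (2 * x) (2 * m)).
    assert (P1 := cosint_0_pos (2 * m)). assert (P2 := cosint_0_pos (S (S (2 * m)))).
    set (b := cosint 0 (2 * m)) in *.
    set (a' := cosint (2 * x) (S (S (2 * m)))) in *. set (b' := cosint 0 (S (S (2 * m)))) in *.
    assert (Q2 := INR_S_pos (2 * m)). assert (Q3 := INR_S_pos m).
    assert (K : INR (S (2 * m)) >= INR (S m)) by (apply Rle_ge, le_INR; lia).
    rewrite (S_INR (S (2 * m))) in R2.
    set (N := INR (S (2 * m))) in *. set (N1 := INR (S m)) in *.
    assert (E : b - b' = b' / N).
    { apply Rmult_eq_reg_l with ((N + 1) * N); [|nra].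
      rewrite Rmult_minus_distr_l, R2. field. lra. }
    rewrite E in Df.
    assert (Df2 : Rabs (a' / b' - 1) <= 2 * x ^ 2 * / N1).
    { replace (a' / b' - 1) with ((a' - b') * / b') by (field; lra).
      rewrite Rabs_mult, (Rabs_pos_eq (/ b')) by (left; apply Rinv_0_lt_compat, P2).
      apply Rmult_le_reg_r with b'; [exact P2|]. rewrite Rmult_assoc, Rinv_l, Rmult_1_r by lra.
      eapply Rle_trans; [exact Df|].
      replace ((2 * x) ^ 2 / 2 * (b' / N)) with (2 * x ^ 2 * b' * / N) by (field; lra).
      replace (2 * x ^ 2 * / N1 * b') with (2 * x ^ 2 * b' * / N1) by ring.
      apply Rmult_le_compat_l; [|apply Rinv_le_contravar; lra].
      apply Rmult_le_pos; [|lra]. generalize (pow2_ge_0 x). lra. }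
    apply Rabs_le_between in Df2. lra.
  - assert (E : Finite 1 = Finite (1 - 2 * x ^ 2 * 0)) by (f_equal; ring). rewrite E. apply is_lim_seq_minus'; [apply is_lim_seq_const|]. apply is_lim_seq_mult'; [apply is_lim_seq_const|].
    apply (is_lim_seq_incr_1 (fun n => / INR n)), INR_inv_lim.
  - assert (E : Finite 1 = Finite (1 + 2 * x ^ 2 * 0)) by (f_equal; ring). rewrite E. apply is_lim_seq_plus'; [apply is_lim_seq_const|]. apply is_lim_seq_mult'; [apply is_lim_seq_const|].
    apply (is_lim_seq_incr_1 (fun n => / INR n)), INR_inv_lim.
Qed.

Lemma cosint_base (x : R) : x <> 0 -> cosint (2 * x) 0 / cosint 0 0 = sin (PI * x) / (PI * x).
Proof.
  intros Hx. assert (P0 := PI_RGT_0).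
  assert (E1 : cosint 0 0 = PI / 2).
  { unfold cosint. rewrite (RInt_ext _ (fun _ => 1)).
    - rewrite RInt_const. unfold scal; simpl. unfold mult; simpl. ring.
    - intros t _. rewrite Rmult_0_l, cos_0. simpl. ring. }
  assert (E2 : cosint (2 * x) 0 = sin (PI * x) / (2 * x)).
  { unfold cosint. apply is_RInt_unique.
    replace (sin (PI * x) / (2 * x)) with (minus (sin (2 * x * (PI / 2)) / (2 * x)) (sin (2 * x * 0) / (2 * x))).
    - apply (is_RInt_derive (V := R_CompleteNormedModule) (fun t => sin (2 * x * t) / (2 * x))).
      + intros t _. auto_derive; [exact I|]. field. exact Hx.
      + intros t _. apply cont_cosint.
    - unfold minus, plus, opp; simpl. rewrite Rmult_0_r, sin_0.
      replace (2 * x * (PI / 2)) with (PI * x) by field. field. exact Hx. }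
  rewrite E1, E2. field. split; lra.
Qed.

Lemma sine_prod_lim (x : R) : x <> 0 -> is_lim_seq (sine_prod x) (sin (PI * x) / (PI * x)).
Proof.
  intros Hx. apply is_lim_seq_incr_1.
  assert (L := cosint_ratio_lim x).
  (* The ratio tends to 1, so it can be inverted from some index on. *)
  apply is_lim_seq_ext_loc with (fun m => cosint (2 * x) 0 / cosint 0 0 * / (cosint (2 * x) (2 * S m) / cosint 0 (2 * S m))).
  - assert (Hh : 0 < / 2) by lra.
    assert (K : eventually (fun m => / 2 < cosint (2 * x) (2 * S m) / cosint 0 (2 * S m))).
    { apply is_lim_seq_spec in L. destruct (L (mkposreal (/ 2) Hh)) as [N HN]. exists N.
      intros m Hm. specialize (HN m Hm). simpl in HN. apply Rabs_lt_between in HN. simpl. lra. }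
    revert K. apply filter_imp. intros m Hm. rewrite (sine_prod_cosint x (S m)). 
    set (q := cosint (2 * x) (2 * S m) / cosint 0 (2 * S m)) in *. field. lra.
  - rewrite <- cosint_base by exact Hx.
    assert (E : Finite (cosint (2 * x) 0 / cosint 0 0) =
       Finite (cosint (2 * x) 0 / cosint 0 0 * / 1)) by (rewrite Rinv_1, Rmult_1_r; reflexivity).
    rewrite E.
    apply is_lim_seq_mult'; [apply is_lim_seq_const|].
    apply (is_lim_seq_inv _ 1 L). intros K. injection K. lra.
Qed.

Lemma pochhammer_sine (x : R) (n : nat) :
  (pochhammer x (S n) * pochhammer (- x) (S n) =
   RtoC (- x ^ 2 * sine_prod x n * INR (fact n) ^ 2))%C.
Proof.
  induction n as [|n IH].
  - simpl. rewrite <- !RtoC_opp, <- !RtoC_plus, <- !RtoC_mult. f_equal. ring.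
  - change (pochhammer ?w (S (S n))) with (pochhammer w (S n) * (w + INR (S n)))%C.
    transitivity ((pochhammer x (S n) * pochhammer (- x) (S n)) * ((x + INR (S n)) * (- x + INR (S n))))%C; [ring|].
    rewrite IH. cbn [sine_prod]. change (fact (S n)) with (S n * fact n)%nat. rewrite mult_INR.
    rewrite <- !RtoC_opp, <- !RtoC_plus, <- !RtoC_mult. f_equal. field.
    apply Rgt_not_eq, INR_S_pos.
Qed.

(** In the product of the approximants at x and -x the powers of n cancel and the Pochhammer symbols
    combine to the partial sine product. Real arguments suffice, since the orders are real. *)
Lemma rGamma_reflect (x : R) : x <> 0 ->
  (rGamma (1 + x) * rGamma (1 - x) = RtoC (sin (PI * x) / (PI * x)))%C.
Proof.
  intros Hx.
  assert (E : (rGamma x * rGamma (- x) = RtoC (- x ^ 2 * (sin (PI * x) / (PI * x))))%C).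
  { apply (Clim_unique (fun n => euler_gamma n x * euler_gamma n (- x))%C).
    - apply Clim_mult; apply rGamma_lim.
    - apply (Clim_ext_loc (fun n => RtoC (- x ^ 2 * sine_prod x n))) with (N := 1%nat).
      + intros n Hn. destruct n as [|n]; [lia|]. rewrite !euler_gamma_S.
        assert (N := INR_fact_C_neq0 (S n)).
        transitivity ((pochhammer x (S (S n)) * pochhammer (- x) (S (S n))) / (INR (fact (S n)) * INR (fact (S n))) *
          (Cexp (- (x * ln (INR (S n)))) * Cexp (- (- x * ln (INR (S n))))))%C; [|field; exact N].
        rewrite <- Cexp_add.
        replace (- (x * ln (INR (S n))) + - (- x * ln (INR (S n))))%C with (RtoC 0) by ring.
        rewrite Cexp_0, pochhammer_sine, !RtoC_mult, !RtoC_pow. field. exact N.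
      + apply Clim_RtoC. apply is_lim_seq_mult'; [apply is_lim_seq_const|]. apply sine_prod_lim, Hx. }
  rewrite (rGamma_rec x), (rGamma_rec (- x)) in E.
  assert (N : RtoC x <> 0) by (apply RtoC_neq0, Hx).
  rewrite (Cplus_comm 1 x). replace (1 - x)%C with (- x + 1)%C by ring.
  transitivity (- / (x * x) * (x * rGamma (x + 1) * (- x * rGamma (- x + 1))))%C; [field; exact N|].
  rewrite E, RtoC_mult, RtoC_opp, RtoC_pow. field. exact N.
Qed.

Lemma pochhammer_real (x : R) (n : nat) : 0 < x -> exists y, 0 < y /\ pochhammer x n = RtoC y.
Proof.
  intros Hx. induction n as [|n [y [Hy IH]]].
  - exists 1. split; [lra|reflexivity].
  - exists (y * (x + INR n)). cbn [pochhammer]. rewrite IH, <- RtoC_plus, <- RtoC_mult.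
    split; [|reflexivity]. apply Rmult_lt_0_compat; [exact Hy|]. generalize (pos_INR n). lra.
Qed.

Lemma rGamma_real (x : R) : 0 < x -> exists y, 0 <= y /\ rGamma x = RtoC y.
Proof.
  intros Hx. assert (L := rGamma_lim x).
  assert (K : forall n, exists y, 0 <= y /\ euler_gamma (S n) x = RtoC y).
  { intros n. rewrite euler_gamma_S. destruct (pochhammer_real x (S (S n)) Hx) as [y [Hy ->]].
    rewrite <- RtoC_mult, <- RtoC_opp, Cexp_RtoC.
    exists (y / INR (fact (S n)) * exp (- (x * ln (INR (S n))))). split.
    - apply Rmult_le_pos; [|left; apply exp_pos]. apply Rmult_le_pos; [lra|].
      left. apply Rinv_0_lt_compat, INR_fact_lt_0.
    - unfold Rdiv. rewrite !RtoC_mult, RtoC_inv; [reflexivity|apply INR_fact_neq_0]. }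
  destruct L as [L1 L2]. apply is_lim_seq_incr_1 in L1, L2.
  exists (Re (rGamma x)). split.
  - apply (is_lim_seq_le (fun _ => 0) (fun n => Re (euler_gamma (S n) x)) 0 (Re (rGamma x))).
    + intros n. destruct (K n) as [y [Hy ->]]. exact Hy.
    + apply is_lim_seq_const.
    + exact L1.
  - assert (E : Im (rGamma x) = 0).
    { assert (Q : Finite (Im (rGamma x)) = Finite 0).
      { rewrite <- (is_lim_seq_unique _ _ L2).
        apply is_lim_seq_unique. apply (is_lim_seq_ext (fun _ => 0)); [|apply is_lim_seq_const].
        intros n. destruct (K n) as [y [Hy ->]]. reflexivity. }
      injection Q. auto. }
    rewrite (surjective_pairing (rGamma x)). unfold RtoC. f_equal. exact E.
Qed.

(** Reflection at 1/2 determines only the square; [rGamma_real] selects the nonnegative root. *)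
Lemma rGamma_half : rGamma (/ 2) = RtoC (/ sqrt PI).
Proof.
  assert (P0 := PI_RGT_0).
  assert (H : / 2 <> 0) by lra.
  assert (E := rGamma_reflect (/ 2) H).
  replace (PI * / 2) with (PI / 2) in E by field. rewrite sin_PI2 in E.
  rewrite RtoC_inv in E by lra.
  replace (1 - / 2)%C with (/ 2)%C in E by field.
  assert (E2 := rGamma_rec (/ 2)). rewrite Cplus_comm in E2.
  destruct (rGamma_real (/ 2) ltac:(lra)) as [y [Hy Ey]]. rewrite RtoC_inv in Ey by lra.
  assert (E3 : (RtoC (y * y) = RtoC (/ PI))%C).
  { rewrite RtoC_mult, <- Ey. rewrite E2 at 1.
    transitivity (/ 2 * (rGamma (1 + / 2) * rGamma (/ 2)))%C; [ring|]. rewrite E.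
    rewrite <- RtoC_inv by lra. rewrite <- RtoC_mult. f_equal. field. lra. }
  apply RtoC_inj in E3. rewrite Ey. f_equal.
  rewrite <- sqrt_inv. symmetry. apply sqrt_lem_1; [left; apply Rinv_0_lt_compat, P0|exact Hy|exact E3].
Qed.

(** * Complex series *)

Fixpoint csum (a : nat -> C) (n : nat) : C :=
  match n with O => RtoC 0 | S m => (csum a m + a m)%C end.

Lemma csum_ext (a b : nat -> C) (n : nat) :
  (forall k, (k < n)%nat -> a k = b k) -> csum a n = csum b n.
Proof.
  induction n as [|n IH]; intros H; [reflexivity|]. simpl. rewrite IH by (intros; apply H; lia).
  rewrite H by lia. reflexivity.
Qed.

Lemma csum_plus (a b : nat -> C) (n : nat) :
  csum (fun k => a k + b k)%C n = (csum a n + csum b n)%C.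
Proof. induction n as [|n IH]; simpl; [ring|]. rewrite IH. ring. Qed.

Lemma csum_scal (c : C) (a : nat -> C) (n : nat) :
  csum (fun k => c * a k)%C n = (c * csum a n)%C.
Proof. induction n as [|n IH]; simpl; [ring|]. rewrite IH. ring. Qed.

Lemma csum_S_left (a : nat -> C) (n : nat) :
  csum a (S n) = (a 0%nat + csum (fun k => a (S k)) n)%C.
Proof.
  induction n as [|n IH]; [simpl; ring|].
  change (csum a (S (S n))) with (csum a (S n) + a (S n))%C. rewrite IH. simpl. ring.
Qed.

Definition is_Cseries (a : nat -> C) (l : C) : Prop := Clim (csum a) l.

Lemma csum_comps (a : nat -> C) (n : nat) :
  Re (csum a (S n)) = sum_n (fun k => Re (a k)) n /\ Im (csum a (S n)) = sum_n (fun k => Im (a k)) n.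
Proof.
  induction n as [|n [IH1 IH2]].
  - rewrite !sum_O. simpl. unfold Re, Im. lra.
  - rewrite !sum_Sn, <- IH1, <- IH2. split; reflexivity.
Qed.

Lemma is_Cseries_comps (a : nat -> C) (l : C) :
  is_Cseries a l <-> is_series (fun k => Re (a k)) (Re l) /\ is_series (fun k => Im (a k)) (Im l).
Proof.
  assert (E : forall u x, is_series u x <-> is_lim_seq (sum_n u) (Finite x)) by (intros; reflexivity).
  rewrite !E. unfold is_Cseries, Clim. rewrite (is_lim_seq_incr_1 (fun n => Re (csum a n))),
    (is_lim_seq_incr_1 (fun n => Im (csum a n))).
  split; intros [H1 H2]; split.
  - revert H1. apply is_lim_seq_ext. intros n. apply csum_comps.
  - revert H2. apply is_lim_seq_ext. intros n. apply csum_comps.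
  - revert H1. apply is_lim_seq_ext. intros n. symmetry. apply csum_comps.
  - revert H2. apply is_lim_seq_ext. intros n. symmetry. apply csum_comps.
Qed.

Lemma CSeries_eq (a : nat -> C) (l : C) : is_Cseries a l -> CSeries a = l.
Proof.
  intros H. apply is_Cseries_comps in H. destruct H as [H1 H2]. unfold CSeries.
  rewrite (is_series_unique _ _ H1), (is_series_unique _ _ H2). symmetry. apply surjective_pairing.
Qed.

Lemma CSeries_ext (a b : nat -> C) : (forall k, a k = b k) -> CSeries a = CSeries b.
Proof.
  intros H. unfold CSeries. f_equal; apply Series_ext; intros n; rewrite H; reflexivity.
Qed.

Lemma is_Cseries_ext (a b : nat -> C) (l : C) :
  (forall k, a k = b k) -> is_Cseries a l -> is_Cseries b l.
Proof. intros H. apply Clim_ext_loc with (N := 0%nat). intros n _. apply csum_ext. auto. Qed.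

Lemma is_Cseries_plus (a b : nat -> C) (l m : C) :
  is_Cseries a l -> is_Cseries b m -> is_Cseries (fun k => a k + b k)%C (l + m).
Proof.
  intros H K. apply (Clim_ext_loc (fun n => csum a n + csum b n)%C) with (N := 0%nat).
  - intros n _. symmetry. apply csum_plus.
  - apply Clim_plus; assumption.
Qed.

Lemma is_Cseries_scal (c : C) (a : nat -> C) (l : C) :
  is_Cseries a l -> is_Cseries (fun k => c * a k)%C (c * l).
Proof.
  intros H. apply (Clim_ext_loc (fun n => c * csum a n)%C) with (N := 0%nat).
  - intros n _. symmetry. apply csum_scal.
  - apply Clim_scal, H.
Qed.

Lemma is_Cseries_decr (a : nat -> C) (l : C) :
  is_Cseries (fun k => a (S k)) l -> is_Cseries a (a 0%nat + l).
Proof.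
  intros H. apply Clim_eps. intros eps He.
  destruct (proj1 (Clim_eps _ _) H eps He) as [N HN]. exists (S N). intros n Hn.
  destruct n as [|n]; [lia|]. rewrite csum_S_left.
  replace (a 0%nat + csum (fun k => a (S k)) n - (a 0%nat + l))%C with
    (csum (fun k => a (S k)) n - l)%C by ring. apply HN. lia.
Qed.

(** * Majorisation by exponential series *)

Definition expterm (q : R) (k : nat) : R := q ^ k / INR (fact k).

Lemma ex_series_expterm (q : R) : is_series (expterm q) (exp q).
Proof.
  generalize (is_exp_Reals q). unfold is_pseries. apply is_series_ext. intros n.
  unfold expterm, scal; simpl. unfold mult; simpl. rewrite pow_n_pow. reflexivity.
Qed.

Lemma expterm_pos (q : R) (k : nat) : 0 <= q -> 0 <= expterm q k.
Proof.
  intros Hq. apply Rmult_le_pos; [apply pow_le, Hq|]. left. apply Rinv_0_lt_compat, INR_fact_lt_0.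
Qed.

Lemma sum_n_le_exp (q : R) (n : nat) : 0 <= q -> sum_n (expterm q) n <= exp q.
Proof.
  intros Hq. apply (is_lim_seq_incr_compare (sum_n (expterm q)) (exp q)).
  - apply ex_series_expterm.
  - intros k. rewrite sum_Sn. unfold plus; simpl. generalize (expterm_pos q (S k) Hq). lra.
Qed.

Lemma expterm_le_exp (q : R) (n : nat) : 0 <= q -> expterm q n <= exp q.
Proof.
  intros Hq. apply Rle_trans with (2 := sum_n_le_exp q n Hq).
  destruct n as [|n]; [rewrite sum_O; lra|]. rewrite sum_Sn. unfold plus; simpl.
  assert (0 <= sum_n (expterm q) n); [|lra].
  clear -Hq. induction n as [|n IH].
  - rewrite sum_O. apply expterm_pos, Hq.
  - rewrite sum_Sn. unfold plus; simpl. generalize (expterm_pos q (S n) Hq). lra.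
Qed.

(** All series in the order have a factorial in their denominators, so this one majorant serves
    convergence, uniformity on discs and Cauchy products. *)
Definition expmaj (a : nat -> C) (K q : R) : Prop :=
  0 <= K /\ 0 <= q /\ forall k, Cmod (a k) <= K * expterm q k.

Lemma csum_tail (a : nat -> C) (K q : R) (n m : nat) : expmaj a K q -> (n <= m)%nat ->
  Cmod (csum a (S m) - csum a (S n)) <= K * (sum_n (expterm q) m - sum_n (expterm q) n).
Proof.
  intros [HK [Hq H]] Hnm. induction Hnm as [|m Hnm IH].
  - replace (csum a (S n) - csum a (S n))%C with (RtoC 0) by ring. rewrite Cmod_0. lra.
  - rewrite sum_Sn. change (plus (sum_n (expterm q) m) (expterm q (S m))) with (sum_n (expterm q) m + expterm q (S m)).
    replace (csum a (S (S m)) - csum a (S n))%C with ((csum a (S m) - csum a (S n)) + a (S m))%C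
      by (simpl; ring).
    eapply Rle_trans; [apply Cmod_triangle|]. specialize (H (S m)). lra.
Qed.

Lemma csum_tail_exp (a : nat -> C) (l : C) (K q : R) (n : nat) : expmaj a K q -> is_Cseries a l ->
  Cmod (l - csum a (S n)) <= K * (exp q - sum_n (expterm q) n).
Proof.
  intros Ha Hl. apply (Clim_bound (csum a)) with (N := S n); [exact Hl|].
  intros m Hm. destruct m as [|m]; [lia|].
  eapply Rle_trans; [apply (csum_tail a K q n m Ha); lia|].
  destruct Ha as [HK [Hq _]]. apply Rmult_le_compat_l; [exact HK|].
  generalize (sum_n_le_exp q m Hq). lra.
Qed.

Lemma exp_tail_small (K q eps : R) : 0 <= K -> 0 <= q -> 0 < eps ->
  exists N, forall n, (N <= n)%nat -> K * (exp q - sum_n (expterm q) n) < eps.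
Proof.
  intros HK Hq He.
  assert (L : is_lim_seq (sum_n (expterm q)) (exp q)) by apply ex_series_expterm.
  apply is_lim_seq_spec in L.
  assert (He2 : 0 < eps / (K + 1)) by (apply Rdiv_lt_0_compat; lra).
  destruct (L (mkposreal _ He2)) as [N HN]. exists N. intros n Hn. specialize (HN n Hn). simpl in HN.
  assert (P := sum_n_le_exp q n Hq).
  rewrite Rabs_left1 in HN by lra.
  apply Rle_lt_trans with ((K + 1) * (exp q - sum_n (expterm q) n)).
  - apply Rmult_le_compat_r; lra.
  - apply Rmult_lt_reg_r with (/ (K + 1)); [apply Rinv_0_lt_compat; lra|].
    replace ((K + 1) * (exp q - sum_n (expterm q) n) * / (K + 1)) with (exp q - sum_n (expterm q) n)
      by (field; lra). unfold Rdiv in HN. lra.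
Qed.

Lemma expmaj_converges (a : nat -> C) (K q : R) : expmaj a K q -> is_Cseries a (CSeries a).
Proof.
  intros Ha. assert (E : exists l, Clim (csum a) l).
  2:{ destruct E as [l Hl]. rewrite (CSeries_eq a l Hl). exact Hl. }
  apply Clim_cauchy. intros eps He. assert (Ha' := Ha). destruct Ha' as [HK [Hq _]].
  destruct (exp_tail_small K q eps HK Hq He) as [N HN]. exists (S N). intros n m Hn Hm.
  destruct n as [|n]; [lia|]. destruct m as [|m]; [lia|].
  eapply Rle_lt_trans; [apply (csum_tail a K q n m Ha); lia|].
  eapply Rle_lt_trans; [|apply (HN n); lia].
  apply Rmult_le_compat_l; [exact HK|]. generalize (sum_n_le_exp q m Hq). lra.
Qed.

(** One majorant for a whole disc makes the partial sums converge uniformly on it. *)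
Lemma Hol_CSeries (F : nat -> C -> C) :
  (forall k, Hol Cuniv (F k)) ->
  (forall M, 0 <= M -> exists K q, forall s, Cmod s <= M -> expmaj (fun k => F k s) K q) ->
  Hol Cuniv (fun s => CSeries (fun k => F k s)).
Proof.
  intros HF HM.
  apply (Hol_limit Cuniv (fun n s => csum (fun k => F k s) (S n))); [exact copen_all| |].
  - intros n. generalize (S n). clear n. intros n. induction n as [|n IH].
    + apply (Hol_const Cuniv (RtoC 0)), copen_all.
    + apply (Hol_plus Cuniv (fun s => csum (fun k => F k s) n)); auto using copen_all.
  - intros a _. exists 1. split; [lra|]. split; [intros; exact I|]. intros eps He.
    destruct (HM (Cmod a + 1)) as [K [q H]]; [generalize (Cmod_ge_0 a); lra|].
    assert (H0 : expmaj (fun k => F k 0) K q).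
    { apply H. rewrite Cmod_0. generalize (Cmod_ge_0 a); lra. }
    destruct H0 as [HK [Hq _]].
    destruct (exp_tail_small K q eps HK Hq He) as [N HN]. exists N. intros n Hn s Hs.
    assert (Hs' : Cmod s <= Cmod a + 1).
    { replace s with ((s - a) + a)%C by ring. eapply Rle_trans; [apply Cmod_triangle|]. lra. }
    assert (Hmaj := H s Hs').
    replace (csum (fun k => F k s) (S n) - CSeries (fun k => F k s))%C with
      (- (CSeries (fun k => F k s) - csum (fun k => F k s) (S n)))%C by ring.
    rewrite Cmod_opp. eapply Rle_lt_trans; [apply (csum_tail_exp _ _ K q n Hmaj)|apply HN, Hn].
    apply (expmaj_converges _ K q Hmaj).
Qed.

(** The majorants make the component series absolutely convergent, so four real Cauchy products can
    be combined. *)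
Lemma Cseries_mult (a b : nat -> C) (K q K' q' : R) : expmaj a K q -> expmaj b K' q' ->
  is_Cseries (fun n => csum (fun k => a k * b (n - k)%nat)%C (S n)) (CSeries a * CSeries b).
Proof.
  intros Ha Hb.
  assert (Ea := expmaj_converges _ _ _ Ha). assert (Eb := expmaj_converges _ _ _ Hb).
  apply is_Cseries_comps in Ea, Eb. destruct Ea as [A1 A2]. destruct Eb as [B1 B2].
  assert (X : forall (c : nat -> C) Kc qc, expmaj c Kc qc ->
     ex_series (fun k => Rabs (Re (c k))) /\ ex_series (fun k => Rabs (Im (c k)))).
  { intros c Kc qc [HK [Hq Hc]].
    assert (Y : ex_series (fun k => Kc * expterm qc k)).
    { apply (ex_series_scal (V := R_NormedModule) Kc (expterm qc)). exists (exp qc). apply ex_series_expterm. }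
    split; apply (ex_series_le (V := R_CompleteNormedModule)) with (2 := Y); intros k;
    unfold norm; simpl; unfold abs; simpl; rewrite Rabs_Rabsolu.
    - apply Rle_trans with (2 := Hc k). apply re_le_Cmod.
    - apply Rle_trans with (2 := Hc k). apply im_le_Cmod. }
  destruct (X _ _ _ Ha) as [XA1 XA2]. destruct (X _ _ _ Hb) as [XB1 XB2].
  assert (M11 := is_series_mult _ _ _ _ A1 B1 XA1 XB1).
  assert (M22 := is_series_mult _ _ _ _ A2 B2 XA2 XB2).
  assert (M12 := is_series_mult _ _ _ _ A1 B2 XA1 XB2).
  assert (M21 := is_series_mult _ _ _ _ A2 B1 XA2 XB1).
  assert (E : forall n N, Re (csum (fun k => a k * b (n - k)%nat)%C (S N)) =
      sum_f_R0 (fun k => Re (a k) * Re (b (n - k)%nat)) N - sum_f_R0 (fun k => Im (a k) * Im (b (n - k)%nat)) N /\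
      Im (csum (fun k => a k * b (n - k)%nat)%C (S N)) =
      sum_f_R0 (fun k => Re (a k) * Im (b (n - k)%nat)) N + sum_f_R0 (fun k => Im (a k) * Re (b (n - k)%nat)) N).
  { intros n N. induction N as [|N [IH1 IH2]].
    - simpl. unfold Re, Im, Cplus, Cmult; simpl. split; ring.
    - change (csum (fun k => a k * b (n - k)%nat)%C (S (S N))) with
        (csum (fun k => a k * b (n - k)%nat)%C (S N) + a (S N) * b (n - S N)%nat)%C.
      cbn [sum_f_R0]. split.
      + transitivity (Re (csum (fun k => a k * b (n - k)%nat)%C (S N)) + Re (a (S N) * b (n - S N)%nat)%C); [reflexivity|].
        rewrite IH1. unfold Re at 5, Cmult; simpl. unfold Re, Im. ring.
      + transitivity (Im (csum (fun k => a k * b (n - k)%nat)%C (S N)) + Im (a (S N) * b (n - S N)%nat)%C); [reflexivity|].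
        rewrite IH2. unfold Im at 5, Cmult; simpl. unfold Re, Im. ring. }
  apply is_Cseries_comps. split.
  - apply (is_series_ext (fun n => minus (sum_f_R0 (fun k => Re (a k) * Re (b (n - k)%nat)) n)
             (sum_f_R0 (fun k => Im (a k) * Im (b (n - k)%nat)) n))).
    { intros n. symmetry. apply E. }
    apply (is_series_minus (V := R_NormedModule) _ _ _ _ M11 M22).
  - apply (is_series_ext (fun n => plus (sum_f_R0 (fun k => Re (a k) * Im (b (n - k)%nat)) n)
             (sum_f_R0 (fun k => Im (a k) * Re (b (n - k)%nat)) n))).
    { intros n. symmetry. apply E. }
    apply (is_series_plus (V := R_NormedModule) _ _ _ _ M12 M21).
Qed.

(** * Vandermonde convolution *)

(** The falling factorial a (a - 1) ... (a - n + 1). *)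
Fixpoint ff (a : C) (n : nat) : C :=
  match n with O => RtoC 1 | S m => (a * ff (a - 1) m)%C end.

Lemma ff_S_right (a : C) (n : nat) : ff a (S n) = (ff a n * (a - INR n))%C.
Proof.
  revert a. induction n as [|n IH]; intros a; [simpl; ring|].
  change (ff a (S (S n))) with (a * ff (a - 1) (S n))%C. rewrite IH. simpl ff.
  rewrite S_INR, RtoC_plus. ring.
Qed.

Lemma ff_pochhammer (a : C) (n : nat) : ff (a + INR n) n = pochhammer (a + 1) n.
Proof.
  induction n as [|n IH]; [reflexivity|].
  cbn [ff pochhammer]. rewrite <- IH. rewrite S_INR, RtoC_plus.
  replace (a + (INR n + 1) - 1)%C with (a + INR n)%C by ring. ring.
Qed.

(** The binomial coefficient with complex upper index a. *)
Definition fu (a : C) (k : nat) : C := (ff a k / INR (fact k))%C.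

Lemma fu_S (a : C) (k : nat) : (INR (S k) * fu a (S k) = a * fu (a - 1) k)%C.
Proof.
  unfold fu. change (fact (S k)) with (S k * fact k)%nat. rewrite mult_INR, RtoC_mult. simpl ff.
  field. split; [apply INR_fact_C_neq0|]. apply RtoC_neq0, Rgt_not_eq, INR_S_pos.
Qed.

Definition conv (u v : nat -> C) (n : nat) : C := csum (fun j => u j * v (n - j)%nat)%C (S n).

Lemma conv_weight (a : C) (v : nat -> C) (n : nat) :
  conv (fun j => INR j * fu a j)%C v (S n) = (a * conv (fu (a - 1)) v n)%C.
Proof.
  unfold conv. rewrite csum_S_left. simpl (INR 0). rewrite !Cmult_0_l, Cplus_0_l.
  rewrite <- csum_scal. apply csum_ext. intros k _. rewrite fu_S. simpl Nat.sub. ring.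
Qed.

Lemma conv_rev (u v : nat -> C) (n : nat) : conv u v n = conv v u n.
Proof.
  assert (R : forall (w : nat -> C) m, csum w m = csum (fun j => w (m - 1 - j)%nat) m).
  { intros w m. induction m as [|m IH]; [reflexivity|].
    rewrite (csum_S_left (fun j => w (S m - 1 - j)%nat)). change (csum w (S m)) with (csum w m + w m)%C. rewrite IH.
    replace (S m - 1 - 0)%nat with m by lia. rewrite Cplus_comm. f_equal. apply csum_ext.
    intros k Hk. f_equal. lia. }
  unfold conv. rewrite R. apply csum_ext. intros k Hk.
  replace (n - (S n - 1 - k))%nat with k by lia. replace (S n - 1 - k)%nat with (n - k)%nat by lia. ring.
Qed.

(** Multiply by n + 1 = j + (n + 1 - j): by [conv_weight] each weight lowers one upper index by 1,
    and both resulting convolutions have the sum a + b - 1 of upper indices, to which the induction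
    hypothesis applies. *)
Lemma vandermonde (a b : C) (n : nat) : conv (fu a) (fu b) n = fu (a + b) n.
Proof.
  revert a b. induction n as [|n IH]; intros a b.
  - unfold conv, fu. simpl. field.
  - assert (N : RtoC (INR (S n)) <> 0) by (apply RtoC_neq0, Rgt_not_eq, INR_S_pos).
    assert (E : (INR (S n) * conv (fu a) (fu b) (S n) = INR (S n) * fu (a + b) (S n))%C).
    { rewrite fu_S.
      transitivity (conv (fun j => INR j * fu a j)%C (fu b) (S n) + conv (fun j => INR j * fu b j)%C (fu a) (S n))%C.
      - rewrite (conv_rev (fun j => INR j * fu b j)%C). unfold conv. rewrite <- csum_scal, <- csum_plus.
        apply csum_ext. intros k Hk. replace (INR (S n)) with (INR k + INR (S n - k)).
        + rewrite RtoC_plus. ring.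
        + rewrite <- plus_INR. f_equal. lia.
      - rewrite !conv_weight, !IH.
        replace (a - 1 + b)%C with (a + b - 1)%C by ring. replace (b - 1 + a)%C with (a + b - 1)%C by ring. ring. }
    apply (f_equal (fun u => / INR (S n) * u)%C) in E.
    rewrite !Cmult_assoc, !Cinv_l, !Cmult_1_l in E by exact N. exact E.
Qed.

(* The convolution behind the product [I_mu (z I_sigma') - (z I_mu') I_sigma], with [a = mu + n], [b = sigma + n]. *)
Lemma vandermonde_weighted (a b : C) (n : nat) :
  csum (fun j => (b - a + 2 * INR (S n - j) - 2 * INR j) * (fu b j * fu a (S n - j)))%C (S (S n)) =
  ((b - a) * (a + b - 2 * INR (S n)) * (fu (a + b - 1) n / INR (S n)))%C.
Proof.
  assert (N : RtoC (INR (S n)) <> 0) by (apply RtoC_neq0, Rgt_not_eq, INR_S_pos).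
  (* The weight b - a + 2 (n + 1 - j) - 2 j equals b - a + 2 (n + 1) - 4 j: one plain and one
     weighted convolution. *)
  transitivity ((b - a + 2 * INR (S n)) * conv (fu b) (fu a) (S n) +
      (-4) * conv (fun j => INR j * fu b j)%C (fu a) (S n))%C.
  - unfold conv. rewrite <- !csum_scal.
    rewrite <- csum_plus. apply csum_ext. intros k Hk.
    replace (INR (S n)) with (INR k + INR (S n - k)).
    + rewrite RtoC_plus. ring.
    + rewrite <- plus_INR. f_equal. lia.
  - rewrite conv_weight, !vandermonde.
    assert (E := fu_S (a + b) n).
    replace (b - 1 + a)%C with (a + b - 1)%C by ring. replace (b + a)%C with (a + b)%C by ring.
    replace (fu (a + b) (S n)) with ((a + b) * fu (a + b - 1) n / INR (S n))%C.
    + field. exact N.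
    + rewrite <- E. field. exact N.
Qed.

(** * The Bessel functions as entire functions of the order *)

Definition rg (k : nat) (mu : C) : C := rGamma (mu + INR k + 1).

Lemma rg_rec (k : nat) (mu : C) : rg k mu = ((mu + INR k + 1) * rg (S k) mu)%C.
Proof.
  unfold rg. rewrite (rGamma_rec (mu + INR k + 1)). rewrite S_INR, RtoC_plus. do 2 f_equal. ring.
Qed.

(** Used with j + m fixed: it gives all terms of a convolution the common factor [rg n] and leaves
    falling factorials. *)
Lemma rg_ff (j m : nat) (mu : C) : rg j mu = (rg (j + m) mu * ff (mu + INR (j + m)) m)%C.
Proof.
  revert j. induction m as [|m IH]; intros j.
  - rewrite Nat.add_0_r. simpl. ring.
  - rewrite IH. rewrite <- plus_n_Sm. rewrite (rg_rec (j + m)). cbn [ff].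
    rewrite (S_INR (j + m)), RtoC_plus.
    replace (mu + (INR (j + m) + 1) - 1)%C with (mu + INR (j + m))%C by ring. ring.
Qed.

Lemma Hol_shift (f : C -> C) (c : C) : Hol Cuniv f -> Hol Cuniv (fun s => f (s + c)%C).
Proof.
  intros Hf. apply (Hol_comp Cuniv Cuniv f (fun s => s + c)%C); auto using copen_all.
  apply Hol_plus; [exact copen_all|apply Hol_id, copen_all|apply Hol_const, copen_all].
Qed.

Lemma Hol_rg (k : nat) : Hol Cuniv (rg k).
Proof.
  apply (Hol_ext Cuniv (fun mu => rGamma (mu + (INR k + 1)))%C); [exact copen_all| |].
  - intros s _. unfold rg. f_equal. ring.
  - apply Hol_shift, Hol_rGamma.
Qed.

Lemma rGamma_bounded (M : R) : 0 <= M -> exists B, 0 <= B /\ forall w, Cmod w <= M -> Cmod (rGamma w) <= B.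
Proof.
  intros HM. assert (HK := step_const_pos M HM).
  exists (M * (M + 1) + (M * (M + 1)) * exp (2 * step_const M) * (2 * step_const M) * / INR 1).
  assert (HP : 0 <= (M * (M + 1))) by (apply Rmult_le_pos; lra).
  assert (HQ : 0 <= (M * (M + 1)) * exp (2 * step_const M) * (2 * step_const M) * / INR 1).
  { simpl. rewrite Rinv_1. repeat apply Rmult_le_pos; try lra. left; apply exp_pos. }
  split; [lra|]. intros w Hw.
  assert (A := euler_gamma_approx 0 w M Hw).
  assert (G0 : Cmod (euler_gamma 1 w) <= M * (M + 1)).
  { rewrite euler_gamma_S. change (INR 1) with 1. rewrite ln_1.
    replace (- (w * 0))%C with (RtoC 0) by ring. rewrite Cexp_0, Cmult_1_r.
    simpl. replace ((1 * (w + 0) * (w + 1)) / 1)%C with (w * (w + 1))%C by field.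
    rewrite Cmod_mult. apply Rmult_le_compat; try apply Cmod_ge_0; auto.
    eapply Rle_trans; [apply Cmod_triangle|]. rewrite Cmod_1. lra. }
  replace (rGamma w) with (euler_gamma 1 w + (rGamma w - euler_gamma 1 w))%C by ring.
  eapply Rle_trans; [apply Cmod_triangle|].
  apply Rplus_le_compat; [exact G0|]. eapply Rle_trans; [exact A|].
  apply Rmult_le_compat_r; [simpl; rewrite Rinv_1; lra|].
  apply Rmult_le_compat_r; [lra|]. apply Rmult_le_compat_r; [left; apply exp_pos|exact G0].
Qed.

Lemma expterm_S (q : R) (k : nat) : expterm q (S k) = expterm q k * q / INR (S k).
Proof.
  unfold expterm. change (fact (S k)) with (S k * fact k)%nat. rewrite mult_INR. simpl pow. field.
  split; [apply INR_fact_neq_0|apply Rgt_not_eq, INR_S_pos].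
Qed.

(** For n > 2 M the factor mu + n + 1 of the recurrence has modulus at least (n + 1) / 2, which
    costs a factor 2 per step against 1 / n!; the finitely many earlier terms are bounded by
    compactness, with (N + 1)! absorbed in the constant. *)
Lemma rg_bound (M : R) : 0 <= M ->
  exists K, 0 <= K /\ forall mu n, Cmod mu <= M -> Cmod (rg n mu) <= K * expterm 2 n.
Proof.
  intros HM. destruct (nfloor_ex (2 * M) ltac:(lra)) as [N [_ HN]].
  destruct (rGamma_bounded (M + INR (S N) + 1)) as [B [HB HBd]].
  { generalize (pos_INR (S N)); lra. }
  exists (B * INR (fact (S N))).
  assert (HF : 1 <= INR (fact (S N))).
  { change 1 with (INR 1). apply le_INR. generalize (lt_O_fact (S N)). lia. }
  split; [apply Rmult_le_pos; lra|]. intros mu n Hmu.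
  assert (Small : forall n, (n <= S N)%nat -> Cmod (rg n mu) <= B * INR (fact (S N)) * expterm 2 n).
  { intros k Hk. apply Rle_trans with B.
    - apply HBd. eapply Rle_trans; [apply Cmod_triangle|]. rewrite Cmod_1.
      assert (A := Cmod_triangle mu (INR k)). rewrite Cmod_R, Rabs_pos_eq in A by apply pos_INR.
      apply le_INR in Hk. lra.
    - rewrite Rmult_assoc. rewrite <- (Rmult_1_r B) at 1. apply Rmult_le_compat_l; [exact HB|].
      unfold expterm. assert (P := INR_fact_lt_0 k).
      apply Rmult_le_reg_r with (INR (fact k)); [exact P|].
      replace (INR (fact (S N)) * (2 ^ k / INR (fact k)) * INR (fact k)) with (2 ^ k * INR (fact (S N)))
        by (field; lra).
      rewrite Rmult_1_l. apply Rle_trans with (1 * INR (fact (S N))).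
      + rewrite Rmult_1_l. apply le_INR, fact_le, Hk.
      + apply Rmult_le_compat_r; [lra|]. apply pow_R1_Rle. lra. }
  destruct (Nat.le_ge_cases n (S N)) as [L|L]; [apply Small, L|].
  induction L as [|n L IH]; [apply Small; lia|].
  rewrite rg_rec, Cmod_mult in IH.
  assert (Hn : INR (S n) / 2 <= Cmod (mu + INR n + 1)).
  { assert (A := Cmod_triangle (mu + INR n + 1) (- mu)).
    replace (mu + INR n + 1 + - mu)%C with (RtoC (INR (S n))) in A by (rewrite S_INR, RtoC_plus; ring).
    rewrite Cmod_opp, Cmod_R, Rabs_pos_eq in A by apply pos_INR.
    apply le_INR in L. rewrite S_INR in L. rewrite S_INR in A |- *. lra. }
  rewrite expterm_S. assert (P := INR_S_pos n).
  apply Rmult_le_reg_l with (INR (S n) / 2); [lra|].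
  apply Rle_trans with (Cmod (mu + INR n + 1) * Cmod (rg (S n) mu)).
  - apply Rmult_le_compat_r; [apply Cmod_ge_0|exact Hn].
  - eapply Rle_trans; [exact IH|]. right. field. lra.
Qed.

Definition bessel_term (t : C) (k : nat) (mu : C) : C := (t ^ k / INR (fact k) * rg k mu)%C.

Lemma Cmod_fact (k : nat) : Cmod (INR (fact k)) = INR (fact k).
Proof. rewrite Cmod_R, Rabs_pos_eq; [reflexivity|]. left. apply INR_fact_lt_0. Qed.

(** Of the factor 4 in q, one 2 comes from [rg_bound] and the other absorbs the weight mu + 2 k,
    which is at most (M + 2) 2^k. *)
Lemma bessel_term_maj (t : C) (M : R) : 0 <= M ->
  exists K q, forall mu, Cmod mu <= M -> expmaj (fun k => bessel_term t k mu) K q /\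
     expmaj (fun k => (mu + 2 * INR k) * bessel_term t k mu)%C K q.
Proof.
  intros HM. destruct (rg_bound M HM) as [K [HK H]].
  exists ((M + 2) * K), (4 * Cmod t). intros mu Hmu.
  assert (Ht := Cmod_ge_0 t).
  assert (B1 : forall k, Cmod (bessel_term t k mu) <= K * expterm (2 * Cmod t) k).
  { intros k. unfold bessel_term. rewrite Cmod_mult, Cmod_div by apply INR_fact_C_neq0.
    rewrite Cmod_pow, Cmod_fact.
    apply Rle_trans with (Cmod t ^ k / INR (fact k) * (K * expterm 2 k)).
    - apply Rmult_le_compat_l; [apply (expterm_pos (Cmod t) k Ht)|auto].
    - unfold expterm. rewrite Rpow_mult_distr.
      replace (Cmod t ^ k / INR (fact k) * (K * (2 ^ k / INR (fact k)))) with
        (K * (2 ^ k * Cmod t ^ k / INR (fact k)) * / INR (fact k)) by (field; apply INR_fact_neq_0).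
      rewrite <- (Rmult_1_r (K * _)) at 2. apply Rmult_le_compat_l.
      + apply Rmult_le_pos; [exact HK|]. apply Rmult_le_pos; [|left; apply Rinv_0_lt_compat, INR_fact_lt_0].
        apply Rmult_le_pos; apply pow_le; lra.
      + rewrite <- Rinv_1. apply Rinv_le_contravar; [lra|]. change 1 with (INR 1). apply le_INR.
        generalize (lt_O_fact k). lia. }
  assert (B2 : forall k, 2 ^ k * expterm (2 * Cmod t) k = expterm (4 * Cmod t) k).
  { intros k. unfold expterm. replace (4 * Cmod t) with (2 * (2 * Cmod t)) by ring.
    rewrite (Rpow_mult_distr 2 (2 * Cmod t)). field. apply INR_fact_neq_0. }
  assert (B3 : forall k, 1 <= 2 ^ k) by (intros k; apply pow_R1_Rle; lra).
  assert (B5 : forall k, 0 <= expterm (2 * Cmod t) k) by (intros; apply expterm_pos; lra).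
  assert (B6 : 0 <= (M + 2) * K) by (apply Rmult_le_pos; lra).
  split; (split; [exact B6|]); (split; [lra|]); intros k.
  - eapply Rle_trans; [apply B1|]. rewrite <- B2. specialize (B3 k). specialize (B5 k).
    apply Rle_trans with (K * (2 ^ k * expterm (2 * Cmod t) k)).
    + apply Rmult_le_compat_l; [exact HK|]. nra.
    + apply Rmult_le_compat_r; [nra|]. nra.
  - rewrite Cmod_mult. rewrite <- B2.
    replace ((M + 2) * K * (2 ^ k * expterm (2 * Cmod t) k)) with
      (((M + 2) * 2 ^ k) * (K * expterm (2 * Cmod t) k)) by ring.
    apply Rmult_le_compat; try apply Cmod_ge_0; auto.
    eapply Rle_trans; [apply Cmod_triangle|]. rewrite Cmod_mult, !Cmod_R, (Rabs_pos_eq (INR k)), Rabs_pos_eq by (try apply pos_INR; lra).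
    assert (B4 : INR k <= 2 ^ k).
    { clear. induction k as [|k IH]; [simpl; lra|]. rewrite S_INR. simpl.
      assert (1 <= 2 ^ k) by (apply pow_R1_Rle; lra). lra. }
    specialize (B3 k). nra.
Qed.

Lemma Hol_bessel_term (t : C) (k : nat) : Hol Cuniv (bessel_term t k).
Proof.
  apply (Hol_mult Cuniv (fun _ => t ^ k / INR (fact k))%C (rg k)); auto using copen_all, Hol_rg.
  apply Hol_const, copen_all.
Qed.

Lemma Hol_linear (c d : C) : Hol Cuniv (fun mu => c * mu + d)%C.
Proof.
  apply Hol_plus; [exact copen_all| |apply Hol_const, copen_all].
  apply Hol_mult; [exact copen_all|apply Hol_const, copen_all|apply Hol_id, copen_all].
Qed.

(* With l = Log (z / 2) and t = (z / 2)^2, [bessel l t mu] is I_mu(z) and [zbessel l t mu] is z I_mu'(z). *)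
Definition bessel_sum (t mu : C) : C := CSeries (fun k => bessel_term t k mu).
Definition zbessel_sum (t mu : C) : C := CSeries (fun k => (mu + 2 * INR k) * bessel_term t k mu)%C.
Definition bessel (l t mu : C) : C := (Cexp (mu * l) * bessel_sum t mu)%C.
Definition zbessel (l t mu : C) : C := (Cexp (mu * l) * zbessel_sum t mu)%C.

Lemma Hol_bessel_sum (t : C) : Hol Cuniv (bessel_sum t).
Proof.
  apply (Hol_CSeries (bessel_term t)).
  - apply Hol_bessel_term.
  - intros M HM. destruct (bessel_term_maj t M HM) as [K [q H]]. exists K, q. intros s Hs. apply H, Hs.
Qed.

Lemma Hol_zbessel_sum (t : C) : Hol Cuniv (zbessel_sum t).
Proof.
  apply (Hol_CSeries (fun k mu => (mu + 2 * INR k) * bessel_term t k mu)%C).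
  - intros k. apply Hol_mult; [exact copen_all| |apply Hol_bessel_term].
    apply Hol_plus; [exact copen_all|apply Hol_id, copen_all|apply (Hol_const Cuniv (2 * INR k)%C), copen_all].
  - intros M HM. destruct (bessel_term_maj t M HM) as [K [q H]]. exists K, q. intros s Hs. apply H, Hs.
Qed.

Lemma Hol_Cexp_lin (l c : C) : Hol Cuniv (fun mu => Cexp ((mu + c) * l)).
Proof.
  apply (Hol_comp Cuniv Cuniv Cexp (fun mu => (mu + c) * l)%C); auto using copen_all, Hol_Cexp.
  apply (Hol_ext Cuniv (fun mu => l * mu + c * l)%C); [exact copen_all|intros; ring|apply Hol_linear].
Qed.

Lemma Hol_Cexp_mul (l : C) : Hol Cuniv (fun mu => Cexp (mu * l)).
Proof.
  apply (Hol_ext Cuniv (fun mu => Cexp ((mu + 0) * l))); [exact copen_all| |apply Hol_Cexp_lin].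
  intros s _. f_equal. ring.
Qed.

Lemma Hol_bessel (l t : C) : Hol Cuniv (bessel l t).
Proof. apply (Hol_mult Cuniv (fun mu => Cexp (mu * l)) (bessel_sum t)); auto using copen_all, Hol_Cexp_mul, Hol_bessel_sum. Qed.

Lemma Hol_zbessel (l t : C) : Hol Cuniv (zbessel l t).
Proof. apply (Hol_mult Cuniv (fun mu => Cexp (mu * l)) (zbessel_sum t)); auto using copen_all, Hol_Cexp_mul, Hol_zbessel_sum. Qed.

(** * The cross product of two Bessel functions *)

(** The part of degree m + 1 in t of the cross product, after division by sigma^2 - mu^2 and without
    the exponential prefactor. *)
Definition cross_term (t : C) (m : nat) (mu sigma : C) : C :=
  (fu (mu + sigma + 2 * INR (S m) - 1) m / INR (S m) * (rg (S m) mu * rg (S m) sigma) * t ^ (S m))%C.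

Definition cross_sum (t mu sigma : C) : C := CSeries (fun m => cross_term t m mu sigma).

(* At mu = sigma = nu this is the hypergeometric term of the theorem. *)
Definition cross_fun (l t mu sigma : C) : C :=
  (Cexp ((mu + sigma) * l) * (rg 0 mu * rg 0 sigma + (mu + sigma) * cross_sum t mu sigma))%C.

Lemma ff_bound (c : C) (n : nat) (X : R) : Cmod c + INR n <= X -> Cmod (ff c n) <= X ^ n.
Proof.
  revert c. induction n as [|n IH]; intros c H.
  - simpl. rewrite Cmod_1. lra.
  - simpl. rewrite Cmod_mult. rewrite S_INR in H. assert (P := pos_INR n).
    apply Rmult_le_compat; try apply Cmod_ge_0; [lra|].
    apply IH. assert (A := Cmod_triangle c (- (1))). rewrite Cmod_opp, Cmod_1 in A.
    unfold Cminus. lra.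
Qed.

(** X^n / n! is a single term of the series of exp X. *)
Lemma fu_bound (c : C) (n : nat) (X : R) : Cmod c + INR n <= X -> Cmod (fu c n) <= exp X.
Proof.
  intros H. assert (HX : 0 <= X) by (generalize (Cmod_ge_0 c) (pos_INR n); lra).
  unfold fu. rewrite Cmod_div by apply INR_fact_C_neq0. rewrite Cmod_fact.
  apply Rle_trans with (expterm X n); [|apply expterm_le_exp, HX].
  apply Rmult_le_compat_r; [left; apply Rinv_0_lt_compat, INR_fact_lt_0|]. apply ff_bound, H.
Qed.

Lemma exp_INR_mult (n : nat) (x : R) : exp (INR n * x) = exp x ^ n.
Proof.
  induction n as [|n IH]; [rewrite Rmult_0_l; apply exp_0|].
  rewrite S_INR, Rmult_plus_distr_r, exp_plus, IH, Rmult_1_l. simpl. ring.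
Qed.

Lemma cross_term_maj (t sigma : C) (M : R) : 0 <= M ->
  exists K q, forall mu, Cmod mu <= M -> expmaj (fun m => cross_term t m mu sigma) K q.
Proof.
  intros HM. destruct (rg_bound M HM) as [K1 [HK1 H1]].
  destruct (rg_bound (Cmod sigma) (Cmod_ge_0 _)) as [K2 [HK2 H2]].
  assert (Ht := Cmod_ge_0 t). assert (Hs := Cmod_ge_0 sigma).
  (* With this L, the modulus of mu + sigma + 2 (m + 1) - 1 plus m is at most L + 3 m; hence exp L
     and exp 3 in the majorant. *)
  set (L := M + Cmod sigma + 3).
  exists (exp L * (K1 * K2 * 4) * Cmod t), (exp 3 * 4 * Cmod t).
  intros mu Hmu. assert (E3 := exp_pos 3). assert (EL := exp_pos L).
  assert (HK : 0 <= K1 * K2) by (apply Rmult_le_pos; assumption).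
  split; [repeat apply Rmult_le_pos; lra|]. split; [repeat apply Rmult_le_pos; lra|].
  intros m. unfold cross_term.
  assert (NZ : RtoC (INR (S m)) <> 0) by (apply RtoC_neq0, Rgt_not_eq, INR_S_pos).
  rewrite Cmod_mult, (Cmod_mult (_ / _)), Cmod_div, Cmod_mult, Cmod_pow by exact NZ.
  rewrite Cmod_R, (Rabs_pos_eq (INR (S m))) by apply pos_INR.
  assert (HS : 1 <= INR (S m)) by (rewrite S_INR; generalize (pos_INR m); lra).
  assert (F : Cmod (fu (mu + sigma + 2 * INR (S m) - 1) m) / INR (S m) <= exp L * exp 3 ^ m).
  { apply Rle_trans with (Cmod (fu (mu + sigma + 2 * INR (S m) - 1) m)).
    - rewrite <- (Rmult_1_r (Cmod _)) at 2. apply Rmult_le_compat_l; [apply Cmod_ge_0|].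
      rewrite <- Rinv_1. apply Rinv_le_contravar; lra.
    - rewrite <- exp_INR_mult, <- exp_plus. apply fu_bound.
      assert (A1 := Cmod_triangle (mu + sigma + 2 * INR (S m)) (- (1))).
      assert (A2 := Cmod_triangle (mu + sigma) (2 * INR (S m))).
      assert (A3 := Cmod_triangle mu sigma).
      rewrite Cmod_opp, Cmod_1 in A1. rewrite Cmod_mult, !Cmod_R, !Rabs_pos_eq in A2 by lra.
      unfold Cminus, L. rewrite S_INR in *. assert (P := pos_INR m). lra. }
  assert (G : Cmod (rg (S m) mu) * Cmod (rg (S m) sigma) <= K1 * K2 * 4 * (4 ^ m / INR (fact m))).
  { apply Rle_trans with ((K1 * expterm 2 (S m)) * (K2 * expterm 2 (S m))).
    - apply Rmult_le_compat; try apply Cmod_ge_0; auto. apply H2. lra.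
    - replace (K1 * expterm 2 (S m) * (K2 * expterm 2 (S m))) with (K1 * K2 * (expterm 2 (S m) * expterm 2 (S m))) by ring.
      replace (K1 * K2 * 4 * (4 ^ m / INR (fact m))) with (K1 * K2 * (4 * (4 ^ m / INR (fact m)))) by ring.
      apply Rmult_le_compat_l; [exact HK|].
      assert (F1 : 1 <= INR (fact m)).
      { change 1 with (INR 1). apply le_INR. generalize (lt_O_fact m). lia. }
      assert (F2 : INR (fact m) <= INR (fact (S m))) by (apply le_INR, fact_le; lia).
      unfold expterm.
      replace (2 ^ S m / INR (fact (S m)) * (2 ^ S m / INR (fact (S m)))) with
        (4 ^ S m * (/ INR (fact (S m)) * / INR (fact (S m)))).
      2:{ replace 4 with (2 * 2) by ring. rewrite Rpow_mult_distr. field. lra. }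
      simpl pow. unfold Rdiv. rewrite !Rmult_assoc.
      apply Rmult_le_compat_l; [lra|]. apply Rmult_le_compat_l; [apply pow_le; lra|].
      rewrite <- (Rmult_1_r (/ INR (fact m))).
      apply Rmult_le_compat; try (left; apply Rinv_0_lt_compat; lra).
      + apply Rinv_le_contravar; lra.
      + rewrite <- Rinv_1. apply Rinv_le_contravar; lra. }
  assert (P4 : 0 <= 4 ^ m / INR (fact m)).
  { apply Rmult_le_pos; [apply pow_le; lra|left; apply Rinv_0_lt_compat, INR_fact_lt_0]. }
  apply Rle_trans with ((exp L * exp 3 ^ m) * (K1 * K2 * 4 * (4 ^ m / INR (fact m))) * Cmod t ^ (S m)).
  - apply Rmult_le_compat_r; [apply pow_le, Ht|].
    apply Rmult_le_compat; auto.
    + apply Rmult_le_pos; [apply Cmod_ge_0|left; apply Rinv_0_lt_compat; lra].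
    + apply Rmult_le_pos; apply Cmod_ge_0.
  - right. unfold expterm. rewrite !Rpow_mult_distr. simpl pow. field. apply INR_fact_neq_0.
Qed.

Lemma Hol_fu (k : nat) : Hol Cuniv (fun c => fu c k).
Proof.
  apply (Hol_mult Cuniv (fun c => ff c k) (fun _ => / INR (fact k))%C); [exact copen_all| |apply Hol_const, copen_all].
  induction k as [|k IH].
  - apply (Hol_const Cuniv (RtoC 1)), copen_all.
  - apply (Hol_mult Cuniv (fun c => c) (fun c => ff (c - 1) k)); [exact copen_all|apply Hol_id, copen_all|].
    apply (Hol_shift (fun c => ff c k) (- (1))%C IH).
Qed.

Lemma Hol_cross_sum (t sigma : C) : Hol Cuniv (fun mu => cross_sum t mu sigma).
Proof.
  apply (Hol_CSeries (fun m mu => cross_term t m mu sigma)).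
  - intros m. unfold cross_term.
    apply (Hol_ext Cuniv (fun mu => fu (mu + (sigma + 2 * INR (S m) - 1)) m *
       ((/ INR (S m) * rg (S m) sigma * t ^ (S m)) * rg (S m) mu))%C); [exact copen_all| |].
    + intros s _. replace (s + (sigma + 2 * INR (S m) - 1))%C with (s + sigma + 2 * INR (S m) - 1)%C by ring.
      unfold Cdiv. ring.
    + apply Hol_mult; [exact copen_all|apply (Hol_shift (fun c => fu c m)), Hol_fu|].
      apply Hol_mult; [exact copen_all|apply (Hol_const Cuniv (/ INR (S m) * rg (S m) sigma * t ^ S m)%C), copen_all|apply Hol_rg].
  - intros M HM. apply cross_term_maj, HM.
Qed.

(** By [rg_ff] every product of coefficients of total degree n is [rg n mu * rg n sigma] times two
    falling factorials, and with the factorials these are the binomial coefficients of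
    [vandermonde_weighted]. *)
Lemma cross_coeff (t mu sigma : C) (n : nat) :
  (csum (fun k => bessel_term t k mu * ((sigma + 2 * INR (n - k)) * bessel_term t (n - k) sigma)) (S n) -
   csum (fun k => ((mu + 2 * INR k) * bessel_term t k mu) * bessel_term t (n - k) sigma) (S n) =
   t ^ n * (rg n mu * rg n sigma) *
   csum (fun j => ((sigma + INR n) - (mu + INR n) + 2 * INR (n - j) - 2 * INR j) *
      (fu (sigma + INR n) j * fu (mu + INR n) (n - j))) (S n))%C.
Proof.
  rewrite <- csum_scal. unfold Cminus at 1.
  replace (- csum (fun k => (mu + 2 * INR k) * bessel_term t k mu * bessel_term t (n - k) sigma) (S n))%C with
    (csum (fun k => (-1) * ((mu + 2 * INR k) * bessel_term t k mu * bessel_term t (n - k) sigma)) (S n))%C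
    by (rewrite csum_scal; ring).
  rewrite <- csum_plus. apply csum_ext. intros k Hk.
  assert (E1 : rg k mu = (rg n mu * ff (mu + INR n) (n - k))%C).
  { rewrite (rg_ff k (n - k)). replace (k + (n - k))%nat with n by lia. reflexivity. }
  assert (E2 : rg (n - k) sigma = (rg n sigma * ff (sigma + INR n) k)%C).
  { rewrite (rg_ff (n - k) k). replace (n - k + k)%nat with n by lia. reflexivity. }
  assert (E3 : (t ^ n = t ^ k * t ^ (n - k))%C).
  { rewrite <- Cpow_add_r. f_equal. lia. }
  unfold bessel_term, fu. rewrite E1, E2, E3. field. split; apply INR_fact_C_neq0.
Qed.

Lemma bessel_cross (l t mu sigma : C) :
  (bessel l t mu * zbessel l t sigma - zbessel l t mu * bessel l t sigma = (sigma - mu) * cross_fun l t mu sigma)%C.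
Proof.
  destruct (bessel_term_maj t (Cmod mu) (Cmod_ge_0 _)) as [K1 [q1 H1]].
  destruct (bessel_term_maj t (Cmod sigma) (Cmod_ge_0 _)) as [K2 [q2 H2]].
  destruct (H1 mu (Rle_refl _)) as [M1 M2]. destruct (H2 sigma (Rle_refl _)) as [M3 M4].
  assert (S1 := Cseries_mult _ _ _ _ _ _ M1 M4). assert (S2 := Cseries_mult _ _ _ _ _ _ M2 M3).
  fold (bessel_sum t mu) (zbessel_sum t sigma) in S1. fold (zbessel_sum t mu) (bessel_sum t sigma) in S2.
  destruct (cross_term_maj t sigma (Cmod mu) (Cmod_ge_0 _)) as [K3 [q3 H3]].
  assert (S3 := expmaj_converges _ _ _ (H3 mu (Rle_refl _))). fold (cross_sum t mu sigma) in S3.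
  assert (S4 : is_Cseries (fun n => (sigma - mu) * (match n with O => rg 0 mu * rg 0 sigma | S m =>
       (mu + sigma) * cross_term t m mu sigma end))%C
     ((sigma - mu) * (rg 0 mu * rg 0 sigma + (mu + sigma) * cross_sum t mu sigma))).
  { apply is_Cseries_scal.
    apply (is_Cseries_decr (fun n => match n with O => rg 0 mu * rg 0 sigma | S m =>
       (mu + sigma) * cross_term t m mu sigma end)%C). apply is_Cseries_scal, S3. }
  assert (E : (bessel_sum t mu * zbessel_sum t sigma - zbessel_sum t mu * bessel_sum t sigma =
    (sigma - mu) * (rg 0 mu * rg 0 sigma + (mu + sigma) * cross_sum t mu sigma))%C).
  { eapply Clim_unique; [|exact S4].
    assert (S5 := is_Cseries_plus _ _ _ _ S1 (is_Cseries_scal (-1) _ _ S2)).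
    replace (bessel_sum t mu * zbessel_sum t sigma - zbessel_sum t mu * bessel_sum t sigma)%C with
      (bessel_sum t mu * zbessel_sum t sigma + -1 * (zbessel_sum t mu * bessel_sum t sigma))%C by ring.
    revert S5. apply is_Cseries_ext. intros n.
    assert (X := cross_coeff t mu sigma n). 
    match type of X with (?a - ?b = ?c)%C => transitivity (a - b)%C; [ring|]; rewrite X end.
    (* The constant term stands alone; from degree one on, a + b - 2 (n + 1) = mu + sigma supplies
       the second factor of sigma^2 - mu^2. *)
    destruct n as [|n].
    - unfold fu. simpl. field.
    - rewrite vandermonde_weighted. unfold cross_term.
      replace (mu + INR (S n) + (sigma + INR (S n)) - 1)%C with (mu + sigma + 2 * INR (S n) - 1)%C by ring.
      field. apply RtoC_neq0, Rgt_not_eq, INR_S_pos. }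
  unfold bessel, zbessel, cross_fun.
  transitivity (Cexp (mu * l) * Cexp (sigma * l) * (bessel_sum t mu * zbessel_sum t sigma - zbessel_sum t mu * bessel_sum t sigma))%C; [ring|].
  rewrite E, <- Cexp_add. replace (mu * l + sigma * l)%C with ((mu + sigma) * l)%C by ring. ring.
Qed.

Lemma CD_cross (l t mu sigma : C) :
  CD (fun m => (sigma - m) * cross_fun l t m sigma)%C mu
    (D (bessel l t) mu * zbessel l t sigma - D (zbessel l t) mu * bessel l t sigma).
Proof.
  apply (CD_ext (fun m => bessel l t m * zbessel l t sigma - zbessel l t m * bessel l t sigma)%C).
  { intros m. apply bessel_cross. }
  eapply CD_eq.
  - apply CD_minus.
    + apply (CD_mult (bessel l t) (fun _ => zbessel l t sigma)); [apply Hol_bessel; exact I|apply CD_const].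
    + apply (CD_mult (zbessel l t) (fun _ => bessel l t sigma)); [apply Hol_zbessel; exact I|apply CD_const].
  - ring.
Qed.

Lemma Hol_cross_fun (l t sigma : C) : Hol Cuniv (fun mu => cross_fun l t mu sigma).
Proof.
  apply Hol_mult; [exact copen_all|apply Hol_Cexp_lin|].
  apply Hol_plus; [exact copen_all| |].
  - apply Hol_mult; [exact copen_all|apply Hol_rg|apply Hol_const, copen_all].
  - apply Hol_mult; [exact copen_all| |apply Hol_cross_sum].
    apply Hol_plus; [exact copen_all|apply Hol_id, copen_all|apply Hol_const, copen_all].
Qed.

Lemma cross_deriv_same (l t nu : C) :
  (D (bessel l t) nu * zbessel l t nu - D (zbessel l t) nu * bessel l t nu = - cross_fun l t nu nu)%C.
Proof.
  eapply CD_unique; [apply CD_cross|]. eapply CD_eq.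
  - apply (CD_mult (fun m => nu - m)%C (fun m => cross_fun l t m nu)).
    + apply CD_minus; [apply CD_const|apply CD_id].
    + apply Hol_cross_fun. exact I.
  - ring.
Qed.

(** The derivative of (- nu - mu) T(mu, - nu) at mu = nu, written out. The factor mu + sigma of the
    series vanishes at this point, so [cross_sum] enters undifferentiated. *)
Definition cross_opp (l t nu : C) : C :=
  (- (rg 0 (- nu) * (rg 0 nu * (1 + 2 * nu * l) + 2 * nu * D (rg 0) nu)) - 2 * nu * cross_sum t nu (- nu))%C.

Lemma cross_deriv_opp (l t nu : C) :
  (D (bessel l t) nu * zbessel l t (- nu) - D (zbessel l t) nu * bessel l t (- nu) = cross_opp l t nu)%C.
Proof.
  eapply CD_unique; [apply CD_cross|].
  set (f := fun m => (Cexp ((m + - nu) * l))%C).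
  assert (Hf : CD f nu l).
  { eapply CD_eq.
    - apply (CD_comp Cexp (fun m => (m + - nu) * l)%C); [apply CD_Cexp|].
      apply (CD_mult (fun m => m + - nu)%C (fun _ => l)); [apply CD_plus; [apply CD_id|apply CD_const]|apply CD_const].
    - replace ((nu + - nu) * l)%C with (RtoC 0) by ring. rewrite Cexp_0. ring. }
  apply (CD_ext (fun m => (((- nu - m) * f m) * rg 0 m) * rg 0 (- nu) +
     (m + - nu) * (((- nu - m) * f m) * cross_sum t m (- nu)))%C).
  { intros m. unfold cross_fun, f. ring. }
  assert (H1 : CD (fun m => (- nu - m) * f m)%C nu (- (1) * f nu + (- nu - nu) * l)%C).
  { eapply CD_eq.
    - apply (CD_mult (fun m => - nu - m)%C f); [apply CD_minus; [apply CD_const|apply CD_id]|exact Hf].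
    - ring. }
  eapply CD_eq.
  - apply CD_plus.
    + apply CD_mult; [|apply CD_const]. apply CD_mult; [exact H1|apply Hol_rg; exact I].
    + apply (CD_mult (fun m => m + - nu)%C); [apply CD_plus; [apply CD_id|apply CD_const]|].
      apply CD_mult; [exact H1|apply (Hol_cross_sum t (- nu)); exact I].
  - cbv beta. unfold f. replace ((nu + - nu) * l)%C with (RtoC 0) by ring. rewrite Cexp_0. unfold cross_opp. ring.
Qed.

(** For sigma = - mu the factor mu + sigma removes the whole series and the exponential is 1, so
    only the constant term of the cross product survives. *)
Lemma bessel_wronskian (l t nu : C) :
  (zbessel l t nu * bessel l t (- nu) - zbessel l t (- nu) * bessel l t nu = 2 * nu * (rg 0 nu * rg 0 (- nu)))%C.
Proof.
  assert (E := bessel_cross l t nu (- nu)).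
  transitivity (- (bessel l t nu * zbessel l t (- nu) - zbessel l t nu * bessel l t (- nu)))%C; [ring|]. rewrite E.
  unfold cross_fun. replace ((nu + - nu) * l)%C with (RtoC 0) by ring. rewrite Cexp_0. ring.
Qed.

Lemma DBI_solve (l t nu : C) :
  (D (bessel l t) nu * (2 * nu * (rg 0 nu * rg 0 (- nu))) =
   - cross_fun l t nu nu * bessel l t (- nu) - cross_opp l t nu * bessel l t nu)%C.
Proof.
  rewrite <- (bessel_wronskian l t nu), <- cross_deriv_opp, <- cross_deriv_same. ring.
Qed.

(** * Path functionals and residues *)

Definition cont_on (Ga : C -> Prop) (f : C -> C) : Prop := forall s, Ga s -> continuous f s.

(* What the residue calculus needs to know about integration along a path from [a] to [b] inside [Ga]. *)
Record pathfun (Ga : C -> Prop) (I : (C -> C) -> C) (a b : C) : Prop := {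
  pf_ext : forall f g, (forall s, Ga s -> f s = g s) -> I f = I g;
  pf_plus : forall f g, cont_on Ga f -> cont_on Ga g -> I (fun s => f s + g s)%C = (I f + I g)%C;
  pf_scal : forall c f, cont_on Ga f -> I (fun s => c * f s)%C = (c * I f)%C;
  pf_prim : forall G g, (forall s, Ga s -> CD G s (g s)) -> cont_on Ga g -> I g = (G b - G a)%C }.

Lemma pathfun_cat (Ga : C -> Prop) (I J : (C -> C) -> C) (a b c : C) :
  pathfun Ga I a b -> pathfun Ga J b c -> pathfun Ga (fun f => I f + J f)%C a c.
Proof.
  intros [E1 P1 S1 Q1] [E2 P2 S2 Q2]. split.
  - intros f g H. rewrite (E1 f g H), (E2 f g H). reflexivity.
  - intros f g Hf Hg. rewrite P1, P2 by assumption. ring.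
  - intros k f Hf. rewrite S1, S2 by assumption. ring.
  - intros G g HG Hg. rewrite (Q1 G g), (Q2 G g) by assumption. ring.
Qed.

Lemma pathfun_rev (Ga : C -> Prop) (I : (C -> C) -> C) (a b : C) :
  pathfun Ga I a b -> pathfun Ga (fun f => - I f)%C b a.
Proof.
  intros [E1 P1 S1 Q1]. split.
  - intros f g H. rewrite (E1 f g H). reflexivity.
  - intros f g Hf Hg. rewrite P1 by assumption. ring.
  - intros k f Hf. rewrite S1 by assumption. ring.
  - intros G g HG Hg. rewrite (Q1 G g) by assumption. ring.
Qed.

Definition path_int (L dL : R -> C) (a b : R) (f : C -> C) : C :=
  CInt (fun t => f (L t) * dL t)%C a b.

Lemma pathfun_path_int (Ga : C -> Prop) (L dL : R -> C) (a b : R) : a <= b ->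
  (forall t, a <= t <= b -> Ga (L t) /\ PD L t (dL t) /\ continuous dL t) ->
  pathfun Ga (path_int L dL a b) (L a) (L b).
Proof.
  intros Hab H.
  assert (X : forall f, cont_on Ga f -> pcont (fun t => f (L t) * dL t)%C a b).
  { intros f Hf t Ht. destruct (H t Ht) as [H1 [H2 H3]]. apply cont_mult; [|exact H3].
    apply (continuous_comp L f); [apply (PD_cont _ _ _ H2)|apply Hf, H1]. }
  split; unfold path_int.
  - intros f g E. apply CInt_ext; [exact Hab|]. intros t Ht. rewrite E; [reflexivity|apply H, Ht].
  - intros f g Hf Hg. rewrite <- CInt_plus by auto. apply CInt_ext; [exact Hab|]. intros; ring.
  - intros c f Hf. rewrite <- CInt_scal by auto. apply CInt_ext; [exact Hab|]. intros; ring.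
  - intros G g HG Hg. apply (CInt_FTC (fun t => G (L t))); [exact Hab| |apply X, Hg].
    intros t Ht. destruct (H t Ht) as [H1 [H2 H3]]. apply (CD_PD_comp G L); auto.
Qed.

(** As a denominator: a repeated entry of the list is a multiple pole. *)
Fixpoint lprod (l : list C) (s : C) : C :=
  match l with [] => RtoC 1 | p :: l' => ((s - p) * lprod l' s)%C end.

Lemma lprod_app (l1 l2 : list C) (s : C) : lprod (l1 ++ l2) s = (lprod l1 s * lprod l2 s)%C.
Proof. induction l1 as [|p l IH]; simpl; [ring|]. rewrite IH. ring. Qed.

Lemma lprod_neq0 (l : list C) (s : C) : ~ In s l -> lprod l s <> 0.
Proof.
  induction l as [|p l IH]; intros H; simpl.
  - intros E. apply RtoC_inj in E. lra.
  - apply Cmult_neq_0.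
    + apply Cminus_neq0. intros ->. apply H. left. reflexivity.
    + apply IH. intros K. apply H. right. exact K.
Qed.

Lemma Hol_lprod (U : C -> Prop) (l : list C) : copen U -> Hol U (lprod l).
Proof.
  intros Uo. induction l as [|p l IH].
  - apply (Hol_const U (RtoC 1)), Uo.
  - apply (Hol_mult U (fun s => s - p)%C (lprod l)); [exact Uo| |exact IH].
    apply Hol_minus; [exact Uo|apply Hol_id, Uo|apply Hol_const, Uo].
Qed.

Lemma lprod_const (p : C) (l : list C) (s : C) : (forall q, In q l -> q = p) ->
  lprod l s = ((s - p) ^ length l)%C.
Proof.
  induction l as [|q l IH]; intros H; [reflexivity|]. simpl. rewrite IH.
  - rewrite (H q); [reflexivity|left; reflexivity].
  - intros r Hr. apply H. right. exact Hr.
Qed.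

Lemma CD_pow_shift (p s : C) (n : nat) :
  CD (fun s => (s - p) ^ S n)%C s (INR (S n) * (s - p) ^ n).
Proof.
  induction n as [|n IH].
  - apply (CD_ext (fun s => s - p)%C); [intros; simpl; ring|].
    eapply CD_eq; [apply CD_minus; [apply CD_id|apply CD_const]|simpl; ring].
  - eapply CD_eq.
    + apply (CD_mult (fun s => s - p)%C (fun s => (s - p) ^ S n)%C); [|exact IH].
      apply CD_minus; [apply CD_id|apply CD_const].
    + rewrite (S_INR (S n)), RtoC_plus. rewrite !Cpow_S. ring.
Qed.

Lemma cont_on_quot (Ga U : C -> Prop) (H : C -> C) (l : list C) : copen U -> Hol U H ->
  (forall s, Ga s -> U s) -> (forall s, Ga s -> ~ In s l) ->
  cont_on Ga (fun s => H s / lprod l s)%C.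
Proof.
  intros Uo HH HU Hl s Hs. apply cont_mult; [apply (Hol_cont U); auto|].
  apply cont_inv; [apply (Hol_cont U); auto using Hol_lprod|apply lprod_neq0; auto].
Qed.

Lemma pathfun_inv_pow (Ga : C -> Prop) (I : (C -> C) -> C) (a p : C) (n : nat) :
  pathfun Ga I a a -> ~ Ga p -> I (fun s => / (s - p) ^ S (S n))%C = 0.
Proof.
  intros HI Hp.
  assert (N : forall s, Ga s -> (s - p <> 0)%C).
  { intros s Hs. apply Cminus_neq0. intros ->. exact (Hp Hs). }
  rewrite (pf_prim _ _ _ _ HI (fun s => - / INR (S n) * / (s - p) ^ S n)%C).
  - ring.
  - intros s Hs. eapply CD_eq.
    + apply CD_scal. apply (CD_inv (fun s => (s - p) ^ S n)%C); [apply CD_pow_shift|].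
      apply Cpow_nz, N, Hs.
    + rewrite !Cpow_S. field. repeat split; try apply (N s Hs); try apply (Cpow_nz _ _ (N s Hs)).
      intros E. apply RtoC_inj in E. generalize (lt_0_INR (S n) ltac:(lia)). lra.
  - intros s Hs. apply cont_inv; [|apply Cpow_nz, N, Hs].
    apply cont_pow. apply cont_minus; [apply continuous_id|apply continuous_const].
Qed.

(* A closed path functional kills [H / prod (s - p)] as soon as it kills every [1 / (s - p)]: split off two
   distinct poles by partial fractions, or lower the order of a single pole by the quotient (H s - H p) / (s - p). *)
Lemma pathfun_zero (Ga U : C -> Prop) (I : (C -> C) -> C) (a c : C) :
  pathfun Ga I a a -> copen U -> star U c -> (forall s, Ga s -> U s) ->
  forall n (l : list C), length l = n ->
  (forall p, In p l -> ~ Ga p /\ (U p -> I (fun s => / (s - p))%C = 0)) ->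
  forall H, Hol U H -> I (fun s => H s / lprod l s)%C = 0.
Proof.
  intros HI Uo Hst HGU n. induction n as [n IH] using lt_wf_ind. intros l Hlen Hl H HH.
  destruct l as [|p l].
  - destruct (Hol_primitive U c H Uo Hst HH) as [G HG].
    rewrite (pf_ext _ _ _ _ HI _ H).
    + rewrite (pf_prim _ _ _ _ HI G H); [ring| |].
      * intros s Hs. apply HG, HGU, Hs.
      * intros s Hs. apply (Hol_cont U); auto.
    + intros s _. simpl. field.
  - simpl in Hlen. assert (Hp := Hl p (or_introl eq_refl)). destruct Hp as [Hp1 Hp2].
    assert (Np : forall s, Ga s -> (s - p <> 0)%C).
    { intros s Hs. apply Cminus_neq0. intros ->. exact (Hp1 Hs). }
    assert (Hl' : forall q, In q l -> ~ Ga q /\ (U q -> I (fun s => / (s - q))%C = 0)).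
    { intros q Hq. apply Hl. right. exact Hq. }
    assert (Hnl : forall s, Ga s -> ~ In s l).
    { intros s Hs K. destruct (Hl' s K) as [K1 _]. exact (K1 Hs). }
    (* A linear factor whose zero lies outside [U] is invertible there and moves into the
       numerator. *)
    destruct (classic (U p)) as [HUp|HUp].
    2:{ rewrite (pf_ext _ _ _ _ HI _ (fun s => (H s / (s - p)) / lprod l s)%C).
        - apply (IH (length l)); auto; [lia|].
          apply Hol_mult; [exact Uo|exact HH|]. apply Hol_inv; [exact Uo| |].
          + apply Hol_minus; [exact Uo|apply Hol_id, Uo|apply Hol_const, Uo].
          + intros s Hs. apply Cminus_neq0. intros ->. exact (HUp Hs).
        - intros s Hs. simpl. field. split; (apply (Np s Hs) || apply (lprod_neq0 _ _ (Hnl s Hs))). }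
    destruct (classic (exists q, In q l /\ q <> p)) as [[q [Hq Hqp]]|Hall].
    + apply in_split in Hq. destruct Hq as [l1 [l2 ->]].
      assert (Hq := Hl' q ltac:(apply in_or_app; right; left; reflexivity)). destruct Hq as [Hq1 Hq2].
      rewrite length_app in Hlen. simpl in Hlen.
      assert (Hl12 : forall r, In r (l1 ++ l2) -> ~ Ga r /\ (U r -> I (fun s => / (s - r))%C = 0)).
      { intros r Hr. apply Hl'. apply in_or_app. apply in_app_or in Hr. destruct Hr; [left|right; right]; assumption. }
      assert (Ip : I (fun s => H s / lprod (p :: l1 ++ l2) s)%C = 0).
      { apply (IH (length (p :: l1 ++ l2))); auto.
        - simpl. rewrite length_app. lia.
        - intros r [<-|Hr]; auto. }
      assert (Iq : I (fun s => H s / lprod (q :: l1 ++ l2) s)%C = 0).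
      { apply (IH (length (q :: l1 ++ l2))); auto.
        - simpl. rewrite length_app. lia.
        - intros r [<-|Hr]; auto. }
      assert (Cp : cont_on Ga (fun s => H s / lprod (p :: l1 ++ l2) s)%C).
      { apply (cont_on_quot Ga U); auto. intros s Hs [K|K]; [subst; exact (Hp1 Hs)|].
        destruct (Hl12 s K) as [K1 _]. exact (K1 Hs). }
      assert (Cq : cont_on Ga (fun s => H s / lprod (q :: l1 ++ l2) s)%C).
      { apply (cont_on_quot Ga U); auto. intros s Hs [K|K]; [subst; exact (Hq1 Hs)|].
        destruct (Hl12 s K) as [K1 _]. exact (K1 Hs). }
      assert (Npq : (p - q <> 0)%C) by (apply Cminus_neq0; auto).
      rewrite (pf_ext _ _ _ _ HI _ (fun s => / (p - q) * (H s / lprod (p :: l1 ++ l2) s) +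
          - / (p - q) * (H s / lprod (q :: l1 ++ l2) s))%C).
      * rewrite (pf_plus _ _ _ _ HI (fun s => / (p - q) * (H s / lprod (p :: l1 ++ l2) s))%C
            (fun s => - / (p - q) * (H s / lprod (q :: l1 ++ l2) s))%C).
        -- rewrite (pf_scal _ _ _ _ HI _ (fun s => H s / lprod (p :: l1 ++ l2) s)%C Cp).
           rewrite (pf_scal _ _ _ _ HI _ (fun s => H s / lprod (q :: l1 ++ l2) s)%C Cq).
           rewrite Ip, Iq. ring.
        -- intros s Hs. apply cont_mult; [apply continuous_const|apply Cp, Hs].
        -- intros s Hs. apply cont_mult; [apply continuous_const|apply Cq, Hs].
      * intros s Hs. simpl lprod. rewrite !lprod_app. simpl lprod.
        assert (N12 : lprod (l1 ++ l2) s <> 0).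
        { apply lprod_neq0. intros K. destruct (Hl12 s K) as [K1 _]. exact (K1 Hs). }
        rewrite lprod_app in N12.
        assert (Nq : (s - q <> 0)%C) by (apply Cminus_neq0; intros ->; exact (Hq1 Hs)).
        assert (Na : lprod l1 s <> 0) by (intros E; apply N12; rewrite E; ring).
        assert (Nb : lprod l2 s <> 0) by (intros E; apply N12; rewrite E; ring).
        field. repeat split; auto.
    + assert (Hc : forall q, In q l -> q = p).
      { intros q Hq. apply NNPP. intros K. apply Hall. exists q. auto. }
      assert (CH : cont_on Ga (fun s => / lprod (p :: l) s)%C).
      { intros s Hs. apply cont_inv; [apply (Hol_cont U); auto using Hol_lprod|].
        apply lprod_neq0. intros [K|K]; [subst; exact (Hp1 Hs)|exact (Hnl s Hs K)]. }
      rewrite (pf_ext _ _ _ _ HI _ (fun s => H p * (/ lprod (p :: l) s) + dquot H p s / lprod l s)%C).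
      * rewrite (pf_plus _ _ _ _ HI (fun s => H p * (/ lprod (p :: l) s))%C (fun s => dquot H p s / lprod l s)%C).
        -- rewrite (pf_scal _ _ _ _ HI _ (fun s => / lprod (p :: l) s)%C CH).
           rewrite (IH (length l) ltac:(lia) l eq_refl Hl' (dquot H p)) by (apply Hol_dquot; auto).
           replace (I (fun s => / lprod (p :: l) s)%C) with (RtoC 0); [ring|]. symmetry.
           destruct l as [|q l].
           ++ rewrite (pf_ext _ _ _ _ HI _ (fun s => / (s - p))%C); [apply Hp2, HUp|].
              intros s _. simpl. rewrite Cmult_1_r. reflexivity.
           ++ rewrite (pf_ext _ _ _ _ HI _ (fun s => / (s - p) ^ S (S (length l)))%C).
              ** apply (pathfun_inv_pow Ga I a); assumption.
              ** intros s _. rewrite (lprod_const p); [reflexivity|].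
                 intros r [<-|Hr]; auto.
        -- intros s Hs. apply cont_mult; [apply continuous_const|apply CH, Hs].
        -- apply (cont_on_quot Ga U); auto. apply Hol_dquot; auto.
      * intros s Hs. simpl lprod. rewrite (dquot_spec H p s) at 1. field.
        split; (apply (Np s Hs) || apply (lprod_neq0 _ _ (Hnl s Hs))).
Qed.

Fixpoint lsum (c : C -> C) (l : list C) : C :=
  match l with [] => RtoC 0 | p :: l' => (c p + lsum c l')%C end.

Lemma lprod_in (l : list C) (s : C) : In s l -> lprod l s = 0.
Proof.
  induction l as [|p l IH]; [intros []|]; intros [E|H]; simpl.
  - rewrite E. ring.
  - rewrite IH by exact H. ring.
Qed.

(** Splitting off c(p) / (s - p) leaves the numerator H - c(p) [lprod l], which vanishes at p; its
    quotient by s - p is holomorphic and has one pole fewer beneath it. The other residues do not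
    change, because [lprod l] vanishes at the other poles. *)
Lemma pathfun_residues (Ga U : C -> Prop) (I : (C -> C) -> C) (a b w : C) :
  pathfun Ga I a a -> copen U -> star U b -> (forall s, Ga s -> U s) ->
  forall (l : list C), NoDup l ->
  (forall p, In p l -> ~ Ga p /\ U p /\ I (fun s => / (s - p))%C = w) ->
  forall H c, Hol U H ->
  (forall l1 p l2, l = l1 ++ p :: l2 -> (c p * lprod (l1 ++ l2) p = H p)%C) ->
  I (fun s => H s / lprod l s)%C = (w * lsum c l)%C.
Proof.
  intros HI Uo Hst HGU l. induction l as [|p l IH]; intros Hnd Hl H c HH Hc.
  - simpl lsum. rewrite Cmult_0_r.
    apply (pathfun_zero Ga U I a b HI Uo Hst HGU 0 []); auto. intros p [].
  - destruct (Hl p (or_introl eq_refl)) as [Hp1 [Hp2 Hp3]].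
    inversion Hnd as [|p' l' Hpl Hnd']; subst p' l'.
    assert (Hl' : forall q, In q l -> ~ Ga q /\ U q /\ I (fun s => / (s - q))%C = w).
    { intros q Hq. apply Hl. right. exact Hq. }
    assert (Hnl : forall s, Ga s -> ~ In s l).
    { intros s Hs K. destruct (Hl' s K) as [K1 _]. exact (K1 Hs). }
    assert (Np : forall s, Ga s -> (s - p <> 0)%C).
    { intros s Hs. apply Cminus_neq0. intros ->. exact (Hp1 Hs). }
    set (K := fun s => (H s - c p * lprod l s)%C).
    assert (HK : Hol U K).
    { apply Hol_minus; [exact Uo|exact HH|]. apply Hol_mult; [exact Uo|apply Hol_const, Uo|apply Hol_lprod, Uo]. }
    assert (Kp : K p = 0).
    { unfold K. rewrite <- (Hc [] p l eq_refl). simpl. ring. }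
    assert (C1 : cont_on Ga (fun s => / (s - p))%C).
    { intros s Hs. apply cont_inv; [|apply Np, Hs].
      apply cont_minus; [apply continuous_id|apply continuous_const]. }
    rewrite (pf_ext _ _ _ _ HI _ (fun s => c p * / (s - p) + dquot K p s / lprod l s)%C).
    + rewrite (pf_plus _ _ _ _ HI (fun s => c p * / (s - p))%C (fun s => dquot K p s / lprod l s)%C).
      * rewrite (pf_scal _ _ _ _ HI _ (fun s => / (s - p))%C C1), Hp3.
        rewrite (IH Hnd' Hl' (dquot K p) c).
        -- simpl. ring.
        -- apply Hol_dquot; auto.
        -- intros l1 q l2 E.
           assert (Hq : In q l) by (rewrite E; apply in_or_app; right; left; reflexivity).
           assert (Nqp : q <> p) by (intros ->; exact (Hpl Hq)).
           rewrite dquot_off by exact Nqp. rewrite Kp. unfold K. rewrite (lprod_in l q Hq).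
           rewrite <- (Hc (p :: l1) q l2); [|simpl; rewrite E; reflexivity].
           simpl. field. apply Cminus_neq0, Nqp.
      * intros s Hs. apply cont_mult; [apply continuous_const|apply C1, Hs].
      * apply (cont_on_quot Ga U); auto. apply Hol_dquot; auto.
    + intros s Hs. assert (E := dquot_spec K p s). rewrite Kp in E.
      assert (N1 := Np s Hs). assert (N2 := lprod_neq0 l s (Hnl s Hs)).
      replace (dquot K p s) with (K s / (s - p))%C by (rewrite E; field; exact N1).
      unfold K. simpl. field. auto.
Qed.

Lemma punctured_eq (f g : C -> C) (p : C) : continuous f p -> continuous g p ->
  locally p (fun s : C => s <> p -> f s = g s) -> f p = g p.
Proof.
  intros Hf Hg HL. apply NNPP. intros N.
  assert (Hd : continuous (fun s => f s - g s)%C p) by (apply cont_minus; assumption).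
  assert (N0 : (f p - g p <> 0)%C) by (apply Cminus_neq0, N).
  generalize (filter_and _ _ HL (cont_neq0 (fun s => f s - g s)%C p Hd N0)). intros K.
  apply locally_C in K. destruct K as [d [Hd0 K]].
  destruct (K (p + RtoC (d / 2))%C) as [K1 K2].
  - replace (p + RtoC (d / 2) - p)%C with (RtoC (d / 2)) by ring. rewrite Cmod_R, Rabs_pos_eq; lra.
  - apply K2. rewrite K1; [ring|]. intros E. assert (Z : RtoC (d / 2) = 0).
    { replace (RtoC (d / 2)) with (p + RtoC (d / 2) - p)%C by ring. rewrite E. ring. }
    apply RtoC_inj in Z. lra.
Qed.

(** The case met by the G-function: a double pole at 0 and simple poles elsewhere. Subtracting a
    multiple of s^(-2), whose integral is 0, makes the pole at 0 simple. The residues are prescribed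
    through local factorizations of F and not through H, so that they can be computed directly from
    the Gamma factors. *)
Lemma residue_theorem (Ga U : C -> Prop) (I : (C -> C) -> C) (a b w : C) (F H : C -> C) (l : list C)
  (res : C -> C) (g0 : C -> C) (r0 : C) :
  pathfun Ga I a a -> copen U -> star U b -> (forall s, Ga s -> U s) -> Hol U H ->
  NoDup (RtoC 0 :: l) ->
  (forall p, In p (RtoC 0 :: l) -> ~ Ga p /\ U p /\ I (fun s => / (s - p))%C = w) ->
  (forall s, U s -> ~ In s (RtoC 0 :: l) -> F s = (H s / (s * s * lprod l s))%C) ->
  CD g0 0 r0 -> locally (RtoC 0) (fun s : C => s <> 0 -> (s * s * F s)%C = g0 s) ->
  (forall p, In p l -> exists g : C -> C, continuous g p /\ g p = res p /\
     locally p (fun s : C => s <> p -> ((s - p) * F s)%C = g s)) ->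
  I F = (w * (r0 + lsum res l))%C.
Proof.
  intros HI Uo Hst HGU HH Hnd Hpol HF Hg0 Hg0l Hres.
  destruct (Hpol 0 (or_introl eq_refl)) as [P1 [P2 P3]].
  inversion Hnd as [|p' l' H0l Hnd']; subst p' l'.
  assert (Hnl : forall s, Ga s -> ~ In s (RtoC 0 :: l)).
  { intros s Hs K. destruct (Hpol s K) as [K1 _]. exact (K1 Hs). }
  assert (N0 : forall s, Ga s -> s <> 0).
  { intros s Hs E. apply (Hnl s Hs). left. symmetry. exact E. }
  assert (Nl : forall s, Ga s -> lprod l s <> 0).
  { intros s Hs. apply lprod_neq0. intros K. apply (Hnl s Hs). right. exact K. }
  assert (away : forall p (l' : list C), ~ In p l' -> locally p (fun s : C => ~ In s l')).
  { intros p l'. induction l' as [|q l' IH]; intros Hp.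
    - apply filter_forall. intros s [].
    - assert (E1 : locally p (fun s : C => (s - q <> 0)%C)).
      { apply (cont_neq0 (fun s => s - q)%C).
        - apply cont_minus; [apply continuous_id|apply continuous_const].
        - apply Cminus_neq0. intros ->. apply Hp. left. reflexivity. }
      assert (E2 := IH (fun K => Hp (or_intror K))).
      generalize (filter_and _ _ E1 E2). apply filter_imp. intros s [K1 K2] [K|K]; [|exact (K2 K)].
      subst q. apply K1. ring. }
  assert (CP : forall l' s, continuous (lprod l') s).
  { intros l' s. apply (Hol_cont Cuniv); [apply Hol_lprod, copen_all|exact Logic.I]. }
  assert (Hnear : locally (RtoC 0) (fun s : C => H s = (lprod l s * g0 s)%C)).
  { assert (E0 : H 0 = (lprod l 0 * g0 0)%C).
    { apply (punctured_eq H (fun s => lprod l s * g0 s)%C).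
      - apply (Hol_cont U); auto.
      - apply cont_mult; [apply CP|apply (CD_cont _ _ _ Hg0)].
      - generalize (filter_and _ _ (filter_and _ _ Hg0l (Uo _ P2)) (away (RtoC 0) l H0l)).
        apply filter_imp. intros s [[K1 K2] K3] K4. uncast. rewrite <- K1 by exact K4.
        rewrite HF; [|exact K2|intros [K|K]; [apply K4; symmetry; exact K|exact (K3 K)]].
        cfield. split; (exact K4 || apply (lprod_neq0 _ _ K3)). }
    generalize (filter_and _ _ (filter_and _ _ Hg0l (Uo _ P2)) (away (RtoC 0) l H0l)).
    apply filter_imp. intros s [[K1 K2] K3]. uncast. destruct (classic (s = 0)) as [->|K4]; [exact E0|].
    rewrite <- K1 by exact K4.
    rewrite HF; [|exact K2|intros [K|K]; [apply K4; symmetry; exact K|exact (K3 K)]].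
    cfield. split; (exact K4 || apply (lprod_neq0 _ _ K3)). }
  assert (DP : CD (lprod l) 0 (D (lprod l) 0)).
  { apply (Hol_lprod Cuniv l copen_all). exact Logic.I. }
  set (d := g0 0). set (K := fun s => (H s - d * lprod l s)%C).
  assert (DK : CD K 0 (lprod l 0 * r0)).
  { apply (CD_ext_loc (fun s => lprod l s * g0 s - d * lprod l s)%C).
    - revert Hnear. apply filter_imp. intros s E. unfold K. rewrite E. reflexivity.
    - eapply CD_eq.
      + apply CD_minus; [apply (CD_mult (lprod l) g0); [exact DP|exact Hg0]|apply CD_scal, DP].
      + unfold d. ring. }
  assert (HK : Hol U K).
  { apply Hol_minus; [exact Uo|exact HH|]. apply Hol_mult; [exact Uo|apply Hol_const, Uo|apply Hol_lprod, Uo]. }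
  assert (K0 : K 0 = 0).
  { unfold K, d. rewrite (locally_singleton _ _ Hnear). ring. }
  set (c := fun s : C => if excluded_middle_informative (s = 0) then r0 else res s).
  assert (c0 : c 0 = r0).
  { unfold c. destruct (excluded_middle_informative _) as [_|N]; [reflexivity|]. exfalso. apply N. reflexivity. }
  assert (cl : forall p, In p l -> c p = res p).
  { intros p Hp. unfold c. destruct (excluded_middle_informative _) as [Z|_]; [subst p; contradiction|reflexivity]. }
  assert (M := pathfun_residues Ga U I a b w HI Uo Hst HGU (RtoC 0 :: l) Hnd Hpol (dquot K 0) c
     (Hol_dquot U K 0 Uo P2 HK)).
  assert (Mc : forall l1 p l2, RtoC 0 :: l = l1 ++ p :: l2 -> (c p * lprod (l1 ++ l2) p = dquot K 0 p)%C).
  { intros l1 p l2 E. destruct l1 as [|q l1].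
    - simpl in E. injection E as Ep El. subst p l2. simpl. rewrite c0, dquot_diag, (D_eq _ _ _ DK). ring.
    - simpl in E. injection E as Eq El. subst q.
      assert (Hp : In p l) by (rewrite El; apply in_or_app; right; left; reflexivity).
      assert (Np0 : p <> 0) by (intros ->; contradiction).
      rewrite dquot_off by exact Np0. rewrite K0. unfold K. rewrite (lprod_in l p Hp), (cl p Hp).
      destruct (Hres p Hp) as [g [G1 [G2 G3]]].
      destruct (Hpol p (or_intror Hp)) as [_ [HUp _]].
      assert (Hn12 : ~ In p (l1 ++ l2)).
      { apply (NoDup_remove_2 l1 l2 p). rewrite <- El. exact Hnd'. }
      assert (EH : H p = (p * p * lprod (l1 ++ l2) p * g p)%C).
      { apply (punctured_eq H (fun s => s * s * lprod (l1 ++ l2) s * g s)%C).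
        - apply (Hol_cont U); auto.
        - apply cont_mult; [|exact G1]. apply cont_mult; [|apply CP].
          apply cont_mult; apply continuous_id.
        - assert (A0 : ~ In p [RtoC 0]) by (intros [Z|[]]; apply Np0; symmetry; exact Z).
          generalize (filter_and _ _ (filter_and _ _ G3 (Uo _ HUp)) (filter_and _ _ (away p _ Hn12) (away p _ A0))).
          apply filter_imp. intros s [[Q1 Q2] [Q3 Q4]] Q5. uncast. rewrite <- Q1 by exact Q5.
          assert (Ns0 : s <> 0) by (intros Z; apply Q4; left; symmetry; exact Z).
          assert (Nsl : ~ In s l).
          { rewrite El. intros Z. apply in_app_or in Z. destruct Z as [Z|[Z|Z]].
            - apply Q3, in_or_app. left; exact Z.
            - apply Q5. symmetry. exact Z.
            - apply Q3, in_or_app. right; exact Z. }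
          rewrite HF; [|exact Q2|intros [Z|Z]; [apply Ns0; symmetry; exact Z|exact (Nsl Z)]].
          assert (Npr : (lprod l s = (s - p) * lprod (l1 ++ l2) s)%C).
          { rewrite El, !lprod_app. simpl. ring. }
          rewrite Npr. assert (Nd := lprod_neq0 _ _ Q3). cfield. repeat split; auto. apply Cminus_neq0, Q5. }
      rewrite EH, G2. simpl. field. exact Np0. }
  specialize (M Mc).
  assert (Cinv2 : cont_on Ga (fun s => / (s - 0) ^ 2)%C).
  { intros s Hs. apply cont_inv.
    - apply (cont_pow (fun s => s - 0)%C). apply cont_minus; [apply continuous_id|apply continuous_const].
    - apply Cpow_nz. replace (s - 0)%C with s by ring. apply N0, Hs. }
  rewrite (pf_ext _ _ _ _ HI F (fun s => d * / (s - 0) ^ 2 + dquot K 0 s / lprod (RtoC 0 :: l) s)%C).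
  - rewrite (pf_plus _ _ _ _ HI (fun s => d * / (s - 0) ^ 2)%C (fun s => dquot K 0 s / lprod (RtoC 0 :: l) s)%C).
    + rewrite (pf_scal _ _ _ _ HI d (fun s => / (s - 0) ^ 2)%C Cinv2).
      rewrite (pathfun_inv_pow Ga I a 0 0 HI P1), M.
      simpl lsum. rewrite c0.
      assert (El : forall l', (forall p, In p l' -> c p = res p) -> lsum c l' = lsum res l').
      { induction l' as [|p l' IHl]; intros Hc'; simpl; [reflexivity|].
        rewrite IHl by (intros q Hq; apply Hc'; right; exact Hq).
        rewrite (Hc' p (or_introl eq_refl)). reflexivity. }
      rewrite (El l cl). ring.
    + intros s Hs. apply cont_mult; [apply continuous_const|apply Cinv2, Hs].
    + apply (cont_on_quot Ga U); auto. apply Hol_dquot; auto.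
  - intros s Hs. rewrite HF; [|apply HGU, Hs|apply Hnl, Hs].
    rewrite dquot_off by (apply N0, Hs). rewrite K0. unfold K. simpl.
    field. split; (apply (N0 s Hs) || apply (Nl s Hs)).
Qed.

(** * Logarithms along paths *)

(** The plane cut along the ray (-oo, 0], expressed by the test made in [Carg]. *)
Definition slit (w : C) : Prop := 0 < Cmod w + Re w.

Lemma slit_neq0 (w : C) : slit w -> w <> 0.
Proof. intros H ->. unfold slit in H. rewrite Cmod_0 in H. simpl in H. lra. Qed.

Lemma slit_im (w : C) : Im w <> 0 -> slit w.
Proof.
  intros H. unfold slit. assert (K := re_le_Cmod w).
  assert (N : Cmod w <> - Re w).
  { intros E. assert (E2 : Cmod w ^ 2 = Re w ^ 2) by (rewrite E; ring).
    unfold Cmod in E2. rewrite pow2_sqrt in E2 by nra. unfold Re, Im in *. nra. }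
  apply Rabs_le_between in K. lra.
Qed.

Lemma slit_re (w : C) : 0 < Re w -> slit w.
Proof. intros H. unfold slit. generalize (Cmod_ge_0 w). lra. Qed.

Lemma cont_slit {T : UniformSpace} (g : T -> C) (t : T) : continuous g t -> slit (g t) ->
  locally t (fun u => slit (g u)).
Proof.
  intros Hg H. unfold slit in *.
  assert (Hc : continuous (fun u => Cmod (g u) + Re (g u)) t).
  { apply (continuous_plus (fun u => Cmod (g u)) (fun u => Re (g u))).
    - apply cont_Cmod, Hg.
    - apply cont_comps, Hg. }
  generalize (proj1 (filterlim_locally _ _) Hc (mkposreal _ H)). apply filter_imp.
  intros u Hu. unfold ball in Hu; simpl in Hu. unfold AbsRing_ball, abs, minus, plus, opp in Hu; simpl in Hu.
  apply Rabs_lt_between in Hu. lra.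
Qed.

Lemma is_derive_ln_mod (x y : R -> R) (t dx dy : R) :
  is_derive x t dx -> is_derive y t dy -> 0 < x t ^ 2 + y t ^ 2 ->
  is_derive (fun u => ln (sqrt (x u ^ 2 + y u ^ 2))) t
    ((x t * dx + y t * dy) / (x t ^ 2 + y t ^ 2)).
Proof.
  intros H1 H2 H3. auto_derive.
  - split; [eexists; exact H1|]. split; [eexists; exact H2|]. split; [|split; [apply sqrt_lt_R0|exact I]]; simpl in H3; exact H3.
  - rewrite (is_derive_unique (fun u : R => x u) t _ H1), (is_derive_unique (fun u : R => y u) t _ H2).
    set (u := x t) in *. set (v := y t) in *.
    replace (u * (u * 1) + v * (v * 1)) with (u ^ 2 + v ^ 2) by ring.
    assert (S1 : sqrt (u ^ 2 + v ^ 2) * sqrt (u ^ 2 + v ^ 2) = u ^ 2 + v ^ 2) by (apply sqrt_sqrt; lra).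
    assert (S2 : 0 < sqrt (u ^ 2 + v ^ 2)) by (apply sqrt_lt_R0, H3).
    rewrite <- S1 at 3. field. lra.
Qed.

(** The identity (r + x)^2 + y^2 = 2 r (r + x) simplifies the derivative of the half-angle
    arctangent. *)
Lemma is_derive_arg (x y : R -> R) (t dx dy : R) :
  is_derive x t dx -> is_derive y t dy -> 0 < sqrt (x t ^ 2 + y t ^ 2) ->
  0 < sqrt (x t ^ 2 + y t ^ 2) + x t ->
  is_derive (fun u => 2 * atan (y u / (sqrt (x u ^ 2 + y u ^ 2) + x u))) t
    ((x t * dy - y t * dx) / (x t ^ 2 + y t ^ 2)).
Proof.
  intros H1 H2 N0 Hs.
  assert (H3 : 0 < x t ^ 2 + y t ^ 2).
  { destruct (Rlt_le_dec 0 (x t ^ 2 + y t ^ 2)) as [L|L]; [exact L|].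
    rewrite (sqrt_neg_0 _ L) in N0. lra. }
  auto_derive.
  - simpl in H3, Hs. repeat split; try (eexists; eassumption); try exact H3; lra.
  - rewrite (is_derive_unique (fun u : R => x u) t _ H1), (is_derive_unique (fun u : R => y u) t _ H2).
    set (u := x t) in *. set (v := y t) in *.
    replace (u * (u * 1) + v * (v * 1)) with (u ^ 2 + v ^ 2) by ring.
    assert (S1 : sqrt (u ^ 2 + v ^ 2) * sqrt (u ^ 2 + v ^ 2) = u ^ 2 + v ^ 2) by (apply sqrt_sqrt; lra).
    set (r := sqrt (u ^ 2 + v ^ 2)) in *.
    assert (K : (r + u) * (r + u) + v * v = 2 * r * (r + u)) by nra.
    assert (Q1 : 1 + (v / (r + u)) * (v / (r + u) * 1) = 2 * r / (r + u)).
    { transitivity (((r + u) * (r + u) + v * v) / ((r + u) * (r + u))); [field; lra|]. rewrite K. field. lra. }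
    match goal with |- context [/ (1 + ?Z)] => replace (1 + Z) with (2 * r / (r + u)) by (rewrite <- Q1; reflexivity) end.
    rewrite <- S1.
    assert (V2 : v * v = r * r - u * u) by lra.
    transitivity ((r * (dy * (r + u) - v * dx) - v * u * dx - (v * v) * dy) / (r * r * (r + u))); [field; lra|].
    rewrite V2. field. lra.
Qed.

Lemma div_comps (d g : C) : g <> 0 ->
  Re (d / g)%C = (Re g * Re d + Im g * Im d) / (Re g ^ 2 + Im g ^ 2) /\
  Im (d / g)%C = (Re g * Im d - Im g * Re d) / (Re g ^ 2 + Im g ^ 2).
Proof.
  intros H. assert (N := Cmod_neq0_sq g H). destruct d as [a b], g as [u v].
  unfold Cdiv, Cinv, Cmult, Re, Im in *; simpl in *. split; field; intros K; apply N; lra.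
Qed.

Lemma is_derive_ln_Cmod (g : R -> C) (t : R) (d : C) : PD g t d -> g t <> 0 ->
  is_derive (fun u => ln (Cmod (g u))) t (Re (d / g t)).
Proof.
  intros Hg H0. apply PD_comps in Hg. destruct Hg as [H1 H2].
  rewrite (proj1 (div_comps d (g t) H0)).
  apply (is_derive_ln_mod (fun u => Re (g u)) (fun u => Im (g u)) t _ _ H1 H2).
  assert (N := Cmod_neq0_sq _ H0). nra.
Qed.

Lemma is_derive_Carg (g : R -> C) (t : R) (d : C) : PD g t d -> slit (g t) ->
  is_derive (fun u => Carg (g u)) t (Im (d / g t)).
Proof.
  intros Hg Hs. assert (Cg := PD_cont _ _ _ Hg). assert (N0 := slit_neq0 _ Hs).
  apply (is_derive_ext_loc (fun u => 2 * atan (Im (g u) / (sqrt (Re (g u) ^ 2 + Im (g u) ^ 2) + Re (g u))))).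
  { generalize (cont_slit g t Cg Hs). apply filter_imp. intros u Hu. unfold slit in Hu.
    unfold Carg. destruct (Rlt_dec 0 (Cmod (g u) + Re (g u))); [reflexivity|lra]. }
  apply PD_comps in Hg. destruct Hg as [H1 H2].
  rewrite (proj2 (div_comps d (g t) N0)).
  apply (is_derive_arg (fun u => Re (g u)) (fun u => Im (g u)) t _ _ H1 H2).
  - apply Cmod_gt_0 in N0. exact N0.
  - exact Hs.
Qed.

(** Changing w to - w replaces the tangent of the half angle by minus its inverse, so the two
    arctangents differ by PI / 2, with the sign of the imaginary part. *)
Lemma Carg_opp (w : C) : Im w <> 0 ->
  Carg (- w) = if Rlt_dec 0 (Im w) then Carg w - PI else Carg w + PI.
Proof.
  intros H. assert (S1 := slit_im w H).
  assert (S2 : slit (- w)) by (apply slit_im; destruct w; simpl in *; lra).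
  unfold slit in *. unfold Carg. rewrite Cmod_opp in *.
  destruct (Rlt_dec 0 (Cmod w + Re w)) as [_|]; [|lra].
  destruct (Rlt_dec 0 (Cmod w + Re (- w))) as [_|]; [|lra].
  assert (Hsq : Cmod w * Cmod w = Re w ^ 2 + Im w ^ 2).
  { unfold Cmod. rewrite sqrt_sqrt; [reflexivity|]. unfold Re, Im. nra. }
  replace (Re (- w)) with (- Re w) in * by (destruct w; reflexivity).
  replace (Im (- w)) with (- Im w) by (destruct w; reflexivity).
  set (r := Cmod w) in *. set (u := Re w) in *. set (v := Im w) in *.
  assert (E : - v / (r + - u) = - / (v / (r + u))).
  { assert (V : v * v = (r + - u) * (r + u)) by lra.
    assert (v <> 0) by exact H.
    apply Rmult_eq_reg_l with (v * (r + - u)); [|apply Rmult_integral_contrapositive; split; lra].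
    transitivity (- (v * v)); [field; lra|]. rewrite V. field. repeat split; lra. }
  rewrite E, atan_opp.
  destruct (Rlt_dec 0 v) as [L|L].
  - rewrite atan_inv by (apply Rdiv_lt_0_compat; lra). field.
  - replace (v / (r + u)) with (- (- v / (r + u))) by (field; lra).
    rewrite Rinv_opp, !atan_opp, atan_inv by (apply Rdiv_lt_0_compat; lra). field.
Qed.

Lemma Carg_small (w : C) : 0 < Re w -> Rabs (Carg w) <= Rabs (Im w) / Re w.
Proof.
  intros H. unfold Carg. assert (G := re_le_Cmod w). rewrite Rabs_pos_eq in G by lra.
  destruct (Rlt_dec 0 (Cmod w + Re w)) as [_|]; [|lra].
  assert (A : forall x, Rabs (atan x) <= Rabs x).
  { assert (A1 : forall x, 0 <= x -> 0 <= atan x <= x).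
    { intros x Hx. destruct (Req_dec x 0) as [->|Hx0]; [rewrite atan_0; lra|].
      destruct (MVT_gen atan 0 x (fun y => / (1 + y ^ 2))) as [c [Hc E]].
      - intros y _. apply is_derive_Reals. apply derivable_pt_lim_atan.
      - intros y _. apply derivable_continuous_pt, derivable_pt_atan.
      - rewrite atan_0, !Rminus_0_r in E.
        assert (0 < / (1 + c ^ 2) <= 1).
        { split; [apply Rinv_0_lt_compat; nra|]. rewrite <- Rinv_1. apply Rinv_le_contravar; nra. }
        rewrite E. split; nra. }
    intros x. destruct (Rle_lt_dec 0 x) as [L|L].
    - specialize (A1 x L). rewrite !Rabs_pos_eq; lra.
    - specialize (A1 (- x) ltac:(lra)). rewrite atan_opp in A1. rewrite !Rabs_left1; lra. }
  rewrite Rabs_mult, (Rabs_pos_eq 2) by lra. eapply Rle_trans; [apply Rmult_le_compat_l; [lra|apply A]|].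
  unfold Rdiv. rewrite Rabs_mult, (Rabs_pos_eq (/ _)) by (left; apply Rinv_0_lt_compat; lra).
  replace (2 * (Rabs (Im w) * / (Cmod w + Re w))) with (Rabs (Im w) * (2 * / (Cmod w + Re w))) by ring.
  apply Rmult_le_compat_l; [apply Rabs_pos|].
  apply Rmult_le_reg_r with (Cmod w + Re w); [lra|]. rewrite Rmult_assoc, Rinv_l, Rmult_1_r by lra.
  apply Rmult_le_reg_l with (Re w); [lra|]. rewrite <- Rmult_assoc, Rinv_r by lra. lra.
Qed.

(** * Improper integrals over the line *)

Definition line_lim {V : NormedModule R_AbsRing} (f : R -> V) (v : V) : Prop :=
  is_RInt_gen f (Rbar_locally m_infty) (Rbar_locally p_infty) v.

Lemma line_lim_elim {V : NormedModule R_AbsRing} (f : R -> V) (v : V) (eps : posreal) : line_lim f v ->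
  exists T, forall a b, a <= - T -> T <= b -> exists y, is_RInt f a b y /\ ball_norm v eps y.
Proof.
  intros H. destruct (H (ball_norm v eps)) as [Q1 Q2 HQ1 HQ2 HQ].
  { apply locally_le_locally_norm, locally_norm_ball_norm. }
  destruct HQ1 as [M1 K1]. destruct HQ2 as [M2 K2].
  exists (Rmax (1 - M1) (1 + M2)). intros a b Ha Hb.
  assert (A1 := Rmax_l (1 - M1) (1 + M2)). assert (A2 := Rmax_r (1 - M1) (1 + M2)).
  apply (HQ a b); [apply K1; lra|apply K2; lra].
Qed.

Lemma line_lim_intro {V : NormedModule R_AbsRing} (f : R -> V) (v : V) :
  (forall eps : posreal, exists T, forall a b, a <= - T -> T <= b ->
     exists y, is_RInt f a b y /\ ball_norm v eps y) -> line_lim f v.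
Proof.
  intros H P HP. apply locally_norm_le_locally in HP. destruct HP as [eps HP].
  destruct (H eps) as [T HT].
  exists (fun x => x < - T) (fun x => T < x).
  - exists (- T). auto.
  - exists T. auto.
  - intros a b Ha Hb. destruct (HT a b) as [y [Hy1 Hy2]]; [lra|lra|]. exists y. split; [exact Hy1|]. apply HP, Hy2.
Qed.

Lemma ball_norm_C (v : C) (eps : posreal) (y : C) :
  @ball_norm R_AbsRing C_R_NormedModule v eps y <-> Cmod (y - v) < eps.
Proof. unfold ball_norm. rewrite norm_C_R. reflexivity. Qed.

Lemma Cline_elim (f : R -> C) (v : C) : line_lim (V := C_R_NormedModule) f v ->
  forall eps, 0 < eps -> exists T, forall a b, a <= - T -> T <= b -> Cmod (CInt f a b - v) < eps.
Proof.
  intros H eps He. destruct (line_lim_elim _ _ (mkposreal eps He) H) as [T HT].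
  exists T. intros a b Ha Hb. destruct (HT a b Ha Hb) as [y [H1 H2]].
  rewrite (is_RInt_CInt_eq f a b y H1). apply ball_norm_C in H2. exact H2.
Qed.

Lemma Cline_intro (f : R -> C) (v : C) : (forall t, continuous f t) ->
  (forall eps, 0 < eps -> exists T, forall a b, a <= - T -> T <= b -> a <= b -> Cmod (CInt f a b - v) < eps) ->
  line_lim (V := C_R_NormedModule) f v.
Proof.
  intros Hf H. apply line_lim_intro. intros eps. destruct (H eps (cond_pos eps)) as [T HT].
  exists (Rmax T 0). intros a b Ha Hb. assert (M1 := Rmax_l T 0). assert (M2 := Rmax_r T 0).
  exists (CInt f a b). split.
  - apply is_RInt_CInt; [lra|]. intros t _. apply Hf.
  - apply ball_norm_C. apply HT; lra.
Qed.

Lemma line_lim_unique_R (f : R -> R) (v w : R) :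
  line_lim (V := R_NormedModule) f v -> line_lim (V := R_NormedModule) f w -> v = w.
Proof.
  intros H K.
  rewrite <- (is_RInt_gen_unique (V := R_CompleteNormedModule) f v H).
  apply (is_RInt_gen_unique (V := R_CompleteNormedModule) f w K).
Qed.

Lemma Rline_elim (f : R -> R) (v : R) : line_lim (V := R_NormedModule) f v ->
  forall eps, 0 < eps -> exists T, forall a b, a <= - T -> T <= b -> Rabs (RInt f a b - v) < eps.
Proof.
  intros H eps He. destruct (line_lim_elim _ _ (mkposreal eps He) H) as [T HT].
  exists T. intros a b Ha Hb. destruct (HT a b Ha Hb) as [y [H1 H2]].
  rewrite (is_RInt_unique (V := R_CompleteNormedModule) f a b y H1). exact H2.
Qed.

Definition lim_p (A : R -> R) (l : R) : Prop :=
  forall eps, 0 < eps -> exists T, forall t, T <= t -> Rabs (A t - l) < eps.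
Definition lim_m (A : R -> R) (l : R) : Prop :=
  forall eps, 0 < eps -> exists T, forall t, t <= - T -> Rabs (A t - l) < eps.

Lemma line_lim_antideriv (A f : R -> R) (a1 a0 : R) :
  (forall t, is_derive A t (f t)) -> (forall t, continuous f t) -> lim_p A a1 -> lim_m A a0 ->
  line_lim (V := R_NormedModule) f (a1 - a0).
Proof.
  intros HA Hf H1 H0. apply line_lim_intro. intros eps.
  assert (He : 0 < eps / 2) by (generalize (cond_pos eps); lra).
  destruct (H1 _ He) as [T1 K1]. destruct (H0 _ He) as [T0 K0].
  exists (Rmax T1 T0). intros a b Ha Hb. assert (M1 := Rmax_l T1 T0). assert (M2 := Rmax_r T1 T0).
  exists (A b - A a). split.
  - apply (is_RInt_derive (V := R_CompleteNormedModule) A f); intros; auto.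
  - unfold ball_norm, norm, minus, plus, opp; simpl. unfold abs; simpl.
    specialize (K1 b ltac:(lra)). specialize (K0 a ltac:(lra)).
    apply Rabs_lt_between in K1, K0. apply Rabs_lt_between. lra.
Qed.

Definition rays (L : R -> C) (T h0 h1 : R) : Prop :=
  (forall t, t <= - T -> L t = (- t, h0)) /\ (forall t, T <= t -> L t = (t, h1)).

Lemma Carg_ray_lim (h p eps : R) : 0 < eps ->
  exists T, forall t, T <= t -> Rabs (Carg ((t, h) - p)%C) < eps.
Proof.
  intros He. exists (p + 1 + Rabs h / eps). intros t Ht.
  assert (P : 0 <= Rabs h / eps) by (apply Rmult_le_pos; [apply Rabs_pos|left; apply Rinv_0_lt_compat, He]).
  eapply Rle_lt_trans; [apply Carg_small|].
  - unfold Re, Cminus, Cplus, Copp, RtoC; simpl. lra.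
  - replace (Im ((t, h) - p)%C) with h by (unfold Im; simpl; ring).
    replace (Re ((t, h) - p)%C) with (t - p) by (unfold Re; simpl; ring).
    apply Rmult_lt_reg_r with (t - p); [lra|]. unfold Rdiv. rewrite Rmult_assoc, Rinv_l, Rmult_1_r by lra.
    apply Rmult_lt_reg_r with (/ eps); [apply Rinv_0_lt_compat, He|].
    replace (eps * (t - p) * / eps) with (t - p) by (field; lra). unfold Rdiv in *. lra.
Qed.

Lemma Carg_rays_lim (L : R -> C) (T h0 h1 p : R) : rays L T h0 h1 ->
  lim_p (fun t => Carg (L t - p)%C) 0 /\ lim_m (fun t => Carg (L t - p)%C) 0.
Proof.
  intros [R0 R1]. split; intros eps He.
  - destruct (Carg_ray_lim h1 p eps He) as [X HX]. exists (Rmax X T). intros t Ht.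
    rewrite Rminus_0_r, R1 by (generalize (Rmax_r X T); lra). apply HX. generalize (Rmax_l X T). lra.
  - destruct (Carg_ray_lim h0 p eps He) as [X HX]. exists (Rmax X T). intros t Ht.
    rewrite Rminus_0_r, R0 by (generalize (Rmax_r X T); lra). apply HX. generalize (Rmax_l X T). lra.
Qed.

Definition c1path (L dL : R -> C) : Prop :=
  (forall t, PD L t (dL t)) /\ (forall t, continuous dL t).

Lemma PD_shift (L : R -> C) (t : R) (d p : C) : PD L t d -> PD (fun t => L t - p)%C t d.
Proof.
  intros H. replace d with (1 * d)%C by ring. apply (CD_PD_comp (fun s => s - p)%C L); [|exact H].
  eapply CD_eq; [apply CD_minus; [apply CD_id|apply CD_const]|ring].
Qed.

Lemma PD_shift_opp (L : R -> C) (t : R) (d p : C) : PD L t d -> PD (fun t => p - L t)%C t (- d).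
Proof.
  intros H. replace (- d)%C with (- (1) * d)%C by ring. apply (CD_PD_comp (fun s => p - s)%C L); [|exact H].
  eapply CD_eq; [apply CD_minus; [apply CD_const|apply CD_id]|ring].
Qed.

Lemma cont_turn (L dL : R -> C) (p : C) (t : R) : c1path L dL -> L t <> p ->
  continuous (fun t => dL t / (L t - p))%C t.
Proof.
  intros [H1 H2] N. apply cont_mult; [apply H2|]. apply cont_inv; [|apply Cminus_neq0, N].
  apply (PD_cont _ _ _ (PD_shift L t _ p (H1 t))).
Qed.

(** [Carg (L t - p)] is a continuous argument along the whole loop and tends to 0 on both rays. *)
Lemma turn_left (L dL : R -> C) (T h0 h1 p : R) : c1path L dL -> rays L T h0 h1 ->
  (forall t, slit (L t - p)%C) -> total_turn L dL p 0.
Proof.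
  intros HL HR Hs. destruct (Carg_rays_lim L T h0 h1 p HR) as [L1 L0].
  replace 0 with (0 - 0) by ring.
  apply (line_lim_antideriv (fun t => Carg (L t - p)%C)); auto.
  - intros t. apply (is_derive_Carg (fun t => L t - p)%C t (dL t)); [|apply Hs]. apply PD_shift, HL.
  - intros t. apply (cont_comps (fun t => dL t / (L t - p))%C). apply cont_turn; [exact HL|].
    intros E. apply (slit_neq0 _ (Hs t)). rewrite E. ring.
Qed.

(** Here [Carg (p - L t)] is a continuous argument along the whole loop. On a ray it differs from
    [Carg (L t - p)], which tends to 0, by PI with a sign opposite to that of the height of the
    ray. *)
Lemma turn_right (L dL : R -> C) (T h0 h1 p : R) : c1path L dL -> rays L T h0 h1 ->
  h0 <> 0 -> h1 <> 0 -> (forall t, slit (p - L t)%C) ->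
  total_turn L dL p ((if Rlt_dec 0 h1 then - PI else PI) - (if Rlt_dec 0 h0 then - PI else PI)).
Proof.
  intros HL HR N0 N1 Hs. destruct (Carg_rays_lim L T h0 h1 p HR) as [L1 L0].
  assert (E : forall t h, h <> 0 -> L t = (Re (L t), h) ->
     Carg (p - L t)%C = Carg (L t - p)%C + (if Rlt_dec 0 h then - PI else PI)).
  { intros t h Hh Et. replace (p - L t)%C with (- (L t - p))%C by ring.
    assert (I : Im (L t - p)%C = h) by (rewrite Et; unfold Im; simpl; ring).
    rewrite Carg_opp by (rewrite I; exact Hh). rewrite I. destruct (Rlt_dec 0 h); ring. }
  destruct HR as [R0 R1].
  apply (line_lim_antideriv (fun t => Carg (p - L t)%C)).
  - intros t.
    assert (N : L t <> p). { intros K. apply (slit_neq0 _ (Hs t)). rewrite K. ring. }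
    replace (dL t / (L t - p))%C with (- dL t / (p - L t))%C.
    + apply (is_derive_Carg (fun t => p - L t)%C t (- dL t)); [|apply Hs]. apply PD_shift_opp, HL.
    + field. split; apply Cminus_neq0; auto.
  - intros t. apply (cont_comps (fun t => dL t / (L t - p))%C). apply cont_turn; [exact HL|].
    intros K. apply (slit_neq0 _ (Hs t)). rewrite K. ring.
  - intros eps He. destruct (L1 eps He) as [X HX]. exists (Rmax X T). intros t Ht.
    assert (M1 := Rmax_l X T). assert (M2 := Rmax_r X T).
    rewrite (E t h1 N1) by (rewrite R1 by lra; reflexivity).
    specialize (HX t ltac:(lra)). rewrite Rminus_0_r in HX.
    replace (Carg (L t - p)%C + _ - _) with (Carg (L t - p)%C) by ring. exact HX.
  - intros eps He. destruct (L0 eps He) as [X HX]. exists (Rmax X T). intros t Ht.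
    assert (M1 := Rmax_l X T). assert (M2 := Rmax_r X T).
    rewrite (E t h0 N0) by (rewrite R0 by lra; reflexivity).
    specialize (HX t ltac:(lra)). rewrite Rminus_0_r in HX.
    replace (Carg (L t - p)%C + _ - _) with (Carg (L t - p)%C) by ring. exact HX.
Qed.

Lemma path_int_Clog (L dL : R -> C) (a b : R) (p : C) : a <= b -> c1path L dL ->
  (forall t, a <= t <= b -> slit (L t - p)%C) ->
  path_int L dL a b (fun s => / (s - p))%C = (Clog (L b - p) - Clog (L a - p))%C.
Proof.
  intros Hab HL Hs. unfold path_int.
  assert (N : forall t, a <= t <= b -> L t <> p).
  { intros t Ht K. apply (slit_neq0 _ (Hs t Ht)). rewrite K. ring. }
  rewrite (CInt_ext _ (fun t => dL t / (L t - p))%C); [|exact Hab|intros; unfold Cdiv; ring].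
  apply (CInt_FTC (fun t => Clog (L t - p)%C)); [exact Hab| |].
  - intros t Ht. apply PD_comps. unfold Clog; simpl. split.
    + apply (is_derive_ln_Cmod (fun t => L t - p)%C); [apply PD_shift, HL|apply Cminus_neq0, N, Ht].
    + apply (is_derive_Carg (fun t => L t - p)%C); [apply PD_shift, HL|apply Hs, Ht].
  - intros t Ht. apply cont_turn; [exact HL|apply N, Ht].
Qed.

(** The real part is the increment of ln |L - p|. For the imaginary part the total turn is known,
    and the tails lie on rays off the real axis, where [Carg] measures the turn exactly. *)
Lemma winding_truncated (L dL : R -> C) (T h0 h1 p theta a : R) : c1path L dL -> rays L T h0 h1 ->
  h0 <> 0 -> h1 <> 0 -> (forall t, L t <> p) -> total_turn L dL p theta -> T <= a -> 0 <= a ->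
  path_int L dL (- a) a (fun s => / (s - p))%C =
    (Clog ((a, h1) - p) - Clog ((a, h0) - p) + theta * Ci)%C.
Proof.
  intros HL HR N0 N1 Hp Hth HTa Ha. assert (HR' := HR). destruct HR' as [R0 R1].
  unfold path_int.
  rewrite (CInt_ext _ (fun t => dL t / (L t - p))%C); [|lra|intros; unfold Cdiv; ring].
  set (f := fun t => (dL t / (L t - p))%C).
  assert (Cf : forall t, continuous f t) by (intros t; apply cont_turn; auto).
  assert (Hi : forall t, t <= - T \/ T <= t -> slit (L t - p)%C).
  { intros t [Ht|Ht]; apply slit_im.
    - rewrite R0 by lra. unfold Im; simpl. lra.
    - rewrite R1 by lra. unfold Im; simpl. lra. }
  destruct (Carg_rays_lim L T h0 h1 p HR) as [L1 L0].
  assert (ex : forall u v, u <= v -> ex_RInt (fun t => Im (f t)) u v).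
  { intros u v Huv. apply ex_RInt_pcont; [exact Huv|]. intros t _. apply Cf. }
  assert (Seg : forall u v, u <= v -> (v <= - T \/ T <= u) ->
     RInt (fun t => Im (f t)) u v = Carg (L v - p)%C - Carg (L u - p)%C).
  { intros u v Huv Hd. apply (is_RInt_unique (V := R_CompleteNormedModule)).
    apply (is_RInt_derive (V := R_CompleteNormedModule) (fun t => Carg (L t - p)%C));
    rewrite Rmin_left, Rmax_right by exact Huv; intros t Ht.
    - apply (is_derive_Carg (fun t => L t - p)%C); [apply PD_shift, HL|]. apply Hi. lra.
    - apply (cont_comps f), Cf. }
  (* Extending [- a, a] to a large [- b, b] adds known differences of [Carg]; the extended integral
     is close to [theta] and the values of [Carg] at its ends are small. *)
  assert (EI : RInt (fun t => Im (f t)) (- a) a = theta + Carg (L a - p)%C - Carg (L (- a)%R - p)%C).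
  { apply Rminus_diag_uniq. apply NNPP. intros Hne.
    set (e := Rabs (RInt (fun t => Im (f t)) (- a) a - (theta + Carg (L a - p)%C - Carg (L (- a)%R - p)%C))).
    assert (He : 0 < e / 4) by (generalize (Rabs_pos_lt _ Hne); fold e; lra).
    destruct (Rline_elim _ _ Hth _ He) as [X1 K1]. destruct (L1 _ He) as [X2 K2]. destruct (L0 _ He) as [X3 K3].
    set (b := Rmax a (Rmax X1 (Rmax X2 X3))).
    assert (B1 : a <= b) by apply Rmax_l.
    assert (B2 : Rmax X1 (Rmax X2 X3) <= b) by apply Rmax_r.
    assert (B3 := Rmax_l X1 (Rmax X2 X3)). assert (B4 := Rmax_r X1 (Rmax X2 X3)).
    assert (B5 := Rmax_l X2 X3). assert (B6 := Rmax_r X2 X3).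
    specialize (K1 (- b) b ltac:(lra) ltac:(lra)). specialize (K2 b ltac:(lra)). specialize (K3 (- b) ltac:(lra)).
    change (fun t => Im (dL t / (L t - p))%C) with (fun t => Im (f t)) in K1.
    assert (Ch : RInt (fun t => Im (f t)) (- b) b = RInt (fun t => Im (f t)) (- b) (- a) +
       RInt (fun t => Im (f t)) (- a) a + RInt (fun t => Im (f t)) a b).
    { rewrite <- (RInt_Chasles (V := R_CompleteNormedModule) _ (- b) a b) by (apply ex; lra).
      rewrite <- (RInt_Chasles (V := R_CompleteNormedModule) _ (- b) (- a) a) by (apply ex; lra). reflexivity. }
    rewrite Ch, (Seg (- b) (- a)), (Seg a b) in K1 by lra.
    rewrite Rminus_0_r in K2, K3. apply Rabs_lt_between in K1, K2, K3.
    assert (e < e / 4 + e / 4 + e / 4); [|lra]. apply Rabs_def1; lra. }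
  assert (ER : RInt (fun t => Re (f t)) (- a) a = ln (Cmod (L a - p)) - ln (Cmod (L (- a)%R - p))).
  { apply (is_RInt_unique (V := R_CompleteNormedModule)).
    apply (is_RInt_derive (V := R_CompleteNormedModule) (fun t => ln (Cmod (L t - p)))).
    - intros t _. apply (is_derive_ln_Cmod (fun t => L t - p)%C); [apply PD_shift, HL|apply Cminus_neq0, Hp].
    - intros t _. apply (cont_comps f), Cf. }
  unfold CInt. rewrite EI, ER. rewrite (R1 a), (R0 (- a)) by lra. rewrite Ropp_involutive.
  unfold Clog, Ci, Cplus, Cminus, Copp, Cmult, RtoC; simpl. f_equal; ring.
Qed.

(** * A standard loop *)

Lemma PD_glue (f g h : R -> C) (c : R) (d : C) : (forall t, t <= c -> f t = g t) ->
  (forall t, c <= t -> f t = h t) -> PD g c d -> PD h c d -> PD f c d.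
Proof.
  intros E1 E2. rewrite !PD_slope. intros H1 H2 eps He.
  generalize (filter_and _ _ (H1 eps He) (H2 eps He)). apply filter_imp. intros u [K1 K2].
  destruct (Rle_lt_dec u c) as [L|L].
  - rewrite (E1 u L), (E1 c) by lra. exact K1.
  - rewrite (E2 u), (E2 c) by lra. exact K2.
Qed.

Lemma cont_glue (f g h : R -> C) (c : R) : (forall t, t <= c -> f t = g t) ->
  (forall t, c <= t -> f t = h t) -> continuous g c -> continuous h c -> continuous f c.
Proof.
  intros E1 E2. rewrite !cont_C. intros H1 H2 eps He.
  generalize (filter_and _ _ (H1 eps He) (H2 eps He)). apply filter_imp. intros u [K1 K2]. uncast.
  destruct (Rle_lt_dec u c) as [L|L].
  - rewrite (E1 u L), (E1 c) by lra. exact K1.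
  - rewrite (E2 u), (E2 c) by lra. exact K2.
Qed.

(* The polynomials match the rays at t = -1 and t = 1 to first order, and the curve crosses the real axis only at
   -1/4, between the poles at -1/2 and 0. *)
Definition mid (t : R) : C := (- (3 / 4) * t ^ 4 + 2 * t ^ 2 - / 4, (3 * t - t ^ 3) / 2).
Definition dmid (t : R) : C := (- 3 * t ^ 3 + 4 * t, (3 - 3 * t ^ 2) / 2).

Definition loop0 (t : R) : C :=
  if Rle_dec t (- 1) then (- t, - 1) else if Rle_dec t 1 then mid t else (t, 1).
Definition dloop0 (t : R) : C :=
  if Rle_dec t (- 1) then RtoC (- 1) else if Rle_dec t 1 then dmid t else RtoC 1.

Lemma PD_mid (t : R) : PD mid t (dmid t).
Proof.
  apply PD_comps. unfold mid, dmid; simpl. split; auto_derive; try exact I; field.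
Qed.

Lemma cont_dmid (t : R) : continuous dmid t.
Proof.
  apply cont_comps. unfold dmid; simpl. split; apply continuity_pt_filterlim; reg.
Qed.

Lemma mid_1 : mid 1 = (1, 1).
Proof. unfold mid. f_equal; field. Qed.
Lemma mid_m1 : mid (- 1) = (1, - 1).
Proof. unfold mid. f_equal; field. Qed.
Lemma dmid_1 : dmid 1 = RtoC 1.
Proof. unfold dmid, RtoC. f_equal; field. Qed.
Lemma dmid_m1 : dmid (- 1) = RtoC (- 1).
Proof. unfold dmid, RtoC. f_equal; field. Qed.

Lemma loop0_low (t : R) : t <= - 1 -> loop0 t = (- t, - 1).
Proof. intros H. unfold loop0. destruct (Rle_dec t (- 1)); [reflexivity|lra]. Qed.
Lemma loop0_mid (t : R) : - 1 <= t <= 1 -> loop0 t = mid t.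
Proof.
  intros H. unfold loop0. destruct (Rle_dec t (- 1)).
  - replace t with (- 1) by lra. rewrite mid_m1. f_equal. ring.
  - destruct (Rle_dec t 1); [reflexivity|lra].
Qed.
Lemma loop0_high (t : R) : 1 <= t -> loop0 t = (t, 1).
Proof.
  intros H. unfold loop0. destruct (Rle_dec t (- 1)); [lra|].
  destruct (Rle_dec t 1); [|reflexivity]. replace t with 1 by lra. apply mid_1.
Qed.
Lemma dloop0_low (t : R) : t <= - 1 -> dloop0 t = RtoC (- 1).
Proof. intros H. unfold dloop0. destruct (Rle_dec t (- 1)); [reflexivity|lra]. Qed.
Lemma dloop0_mid (t : R) : - 1 <= t <= 1 -> dloop0 t = dmid t.
Proof.
  intros H. unfold dloop0. destruct (Rle_dec t (- 1)).
  - replace t with (- 1) by lra. rewrite dmid_m1. reflexivity.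
  - destruct (Rle_dec t 1); [reflexivity|lra].
Qed.
Lemma dloop0_high (t : R) : 1 <= t -> dloop0 t = RtoC 1.
Proof.
  intros H. unfold dloop0. destruct (Rle_dec t (- 1)); [lra|].
  destruct (Rle_dec t 1); [|reflexivity]. replace t with 1 by lra. apply dmid_1.
Qed.

Lemma PD_low (t : R) : PD (fun t => (- t, - 1)) t (RtoC (- 1)).
Proof. apply PD_comps. simpl. split; auto_derive; try exact I; ring. Qed.
Lemma PD_high (t : R) : PD (fun t => (t, 1)) t (RtoC 1).
Proof. apply PD_comps. simpl. split; auto_derive; try exact I; ring. Qed.

Lemma PD_ext_loc (f g : R -> C) (t : R) (d : C) : locally t (fun u => f u = g u) -> PD f t d -> PD g t d.
Proof.
  intros H. rewrite !PD_slope. intros K eps He. assert (E := locally_singleton _ _ H).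
  generalize (filter_and _ _ H (K eps He)). apply filter_imp. intros u [-> K2]. rewrite <- E. exact K2.
Qed.

Lemma loc_lt (t c : R) : t < c -> locally t (fun u => u < c).
Proof. intros H. apply (open_lt c t H). Qed.
Lemma loc_gt (t c : R) : c < t -> locally t (fun u => c < u).
Proof. intros H. apply (open_gt c t H). Qed.

Lemma c1path_loop0 : c1path loop0 dloop0.
Proof.
  split; intros t.
  - destruct (Rtotal_order t (- 1)) as [H|[H|H]].
    + rewrite dloop0_low by lra. apply (PD_ext_loc (fun t => (- t, - 1))); [|apply PD_low].
      generalize (loc_lt t (- 1) H). apply filter_imp. intros u Hu. symmetry. apply loop0_low. lra.
    + subst t. rewrite dloop0_low by lra.
      assert (PM := PD_mid (-1)). rewrite dmid_m1 in PM.
      apply (PD_glue loop0 (fun t => (- t, - 1)) (fun t => if Rle_dec t 1 then mid t else (t, 1))).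
      * intros u Hu. apply loop0_low, Hu.
      * intros u Hu. destruct (Rle_dec u 1); [apply loop0_mid; lra|apply loop0_high; lra].
      * apply PD_low.
      * apply (PD_ext_loc mid); [|exact PM].
        assert (M0 : -1 < 1) by lra.
        generalize (loc_lt (-1) 1 M0). apply filter_imp. intros u Hu. uncast. destruct (Rle_dec u 1); [reflexivity|lra].
    + destruct (Rtotal_order t 1) as [K|[K|K]].
      * rewrite dloop0_mid by lra. apply (PD_ext_loc mid); [|apply PD_mid].
        generalize (filter_and _ _ (loc_lt t 1 K) (loc_gt t (- 1) H)). apply filter_imp. intros u [H1 H2].
        symmetry. apply loop0_mid. lra.
      * subst t. rewrite dloop0_high by lra.
        assert (PM := PD_mid 1). rewrite dmid_1 in PM.
        apply (PD_glue loop0 (fun t => if Rle_dec t (-1) then (- t, -1) else mid t) (fun t => (t, 1))).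
        -- intros u Hu. destruct (Rle_dec u (-1)); [apply loop0_low; lra|apply loop0_mid; lra].
        -- intros u Hu. apply loop0_high, Hu.
        -- apply (PD_ext_loc mid); [|exact PM].
           assert (M0 : -1 < 1) by lra.
           generalize (loc_gt 1 (-1) M0). apply filter_imp. intros u Hu. uncast. destruct (Rle_dec u (-1)); [lra|reflexivity].
        -- apply PD_high.
      * rewrite dloop0_high by lra. apply (PD_ext_loc (fun t => (t, 1))); [|apply PD_high].
        generalize (loc_gt t 1 K). apply filter_imp. intros u Hu. symmetry. apply loop0_high. lra.
  - destruct (Rtotal_order t (- 1)) as [H|[H|H]].
    + apply (cont_ext_loc (fun _ => RtoC (- 1))); [|apply continuous_const].
      generalize (loc_lt t (- 1) H). apply filter_imp. intros u Hu. symmetry. apply dloop0_low. lra.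
    + subst t.
      apply (cont_glue dloop0 (fun t => RtoC (- 1)) (fun t => if Rle_dec t 1 then dmid t else RtoC 1)).
      * intros u Hu. apply dloop0_low, Hu.
      * intros u Hu. destruct (Rle_dec u 1); [apply dloop0_mid; lra|apply dloop0_high; lra].
      * apply continuous_const.
      * apply (cont_ext_loc dmid); [|apply cont_dmid].
        assert (M0 : -1 < 1) by lra.
        generalize (loc_lt (-1) 1 M0). apply filter_imp. intros u Hu. uncast. destruct (Rle_dec u 1); [reflexivity|lra].
    + destruct (Rtotal_order t 1) as [K|[K|K]].
      * apply (cont_ext_loc dmid); [|apply cont_dmid].
        generalize (filter_and _ _ (loc_lt t 1 K) (loc_gt t (- 1) H)). apply filter_imp. intros u [H1 H2].
        symmetry. apply dloop0_mid. lra.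
      * subst t.
        apply (cont_glue dloop0 (fun t => if Rle_dec t (-1) then RtoC (-1) else dmid t) (fun t => RtoC 1)).
        -- intros u Hu. destruct (Rle_dec u (-1)); [apply dloop0_low; lra|apply dloop0_mid; lra].
        -- intros u Hu. apply dloop0_high, Hu.
        -- apply (cont_ext_loc dmid); [|apply cont_dmid].
           assert (M0 : -1 < 1) by lra.
           generalize (loc_gt 1 (-1) M0). apply filter_imp. intros u Hu. uncast. destruct (Rle_dec u (-1)); [lra|reflexivity].
        -- apply continuous_const.
      * apply (cont_ext_loc (fun _ => RtoC 1)); [|apply continuous_const].
        generalize (loc_gt t 1 K). apply filter_imp. intros u Hu. symmetry. apply dloop0_high. lra.
Qed.

Lemma rays_loop0 : rays loop0 1 (- 1) 1.
Proof. split; [apply loop0_low|apply loop0_high]. Qed.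

Lemma loop0_real (t : R) : Im (loop0 t) = 0 -> loop0 t = RtoC (- / 4).
Proof.
  intros H. destruct (Rle_lt_dec t (- 1)) as [K|K].
  - rewrite loop0_low in H by lra. simpl in H. lra.
  - destruct (Rle_lt_dec 1 t) as [Q|Q].
    + rewrite loop0_high in H by lra. simpl in H. lra.
    + rewrite loop0_mid in H |- * by lra. unfold mid in *. simpl in H.
      assert (t = 0). { assert (t * (3 - t * t) = 0) by lra. assert (3 - t * t > 0) by nra. nra. }
      subst t. unfold RtoC. f_equal; field.
Qed.

Lemma loop0_re (t : R) : - / 4 <= Re (loop0 t).
Proof.
  destruct (Rle_lt_dec t (- 1)) as [K|K].
  - rewrite loop0_low by lra. simpl. lra.
  - destruct (Rle_lt_dec 1 t) as [Q|Q].
    + rewrite loop0_high by lra. simpl. lra.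
    + rewrite loop0_mid by lra. simpl. assert (0 <= t * t <= 1) by nra. nra.
Qed.

(** p - [loop0 t] is real only where the loop crosses the axis, at -1/4, and there it is
    positive. *)
Lemma slit_loop0_right (p t : R) : - / 4 < p -> slit (p - loop0 t)%C.
Proof.
  intros Hp. destruct (Req_dec (Im (loop0 t)) 0) as [E|E].
  - rewrite (loop0_real t E). apply slit_re. unfold Re; simpl. lra.
  - apply slit_im. unfold Im in *; simpl. lra.
Qed.

Lemma slit_loop0_left (p t : R) : p < - / 4 -> slit (loop0 t - p)%C.
Proof.
  intros Hp. apply slit_re. assert (H := loop0_re t). unfold Re in *; simpl. lra.
Qed.

Lemma turn_loop0_right (p : R) : - / 4 < p -> total_turn loop0 dloop0 p (- (2 * PI)).
Proof.
  intros Hp. assert (N1 : - 1 <> 0) by lra. assert (N2 : 1 <> 0) by lra.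
  assert (H := turn_right loop0 dloop0 1 (- 1) 1 p c1path_loop0 rays_loop0 N1 N2
     (fun t => slit_loop0_right p t Hp)).
  destruct (Rlt_dec 0 1) as [_|]; [|lra]. destruct (Rlt_dec 0 (- 1)) as [|_]; [lra|].
  replace (- (2 * PI)) with (- PI - PI) by ring. exact H.
Qed.

Lemma turn_loop0_left (p : R) : p < - / 4 -> total_turn loop0 dloop0 p 0.
Proof.
  intros Hp. apply (turn_left loop0 dloop0 1 (- 1) 1 p c1path_loop0 rays_loop0).
  intros t. apply slit_loop0_left, Hp.
Qed.

(** * The integrand of the G-function *)

(* [lam] stands for [Clog x]. *)
Definition G_integrand (lam : C) (nu : R) (s : C) : C :=
  (/ rGamma (- s) * / rGamma (- s) * / rGamma (nu - s) * / rGamma (/ 2 + s) *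
   rGamma (1 + nu + s) * rGamma (1 - s) * Cexp (s * lam))%C.

Lemma meijer_integrand_G_integrand (nu : R) (x s : C) :
  meijer_integrand 3 1 [RtoC (1 / 2); RtoC 1] [RtoC 0; RtoC 0; RtoC nu; RtoC (- nu)] x s =
  G_integrand (Clog x) nu s.
Proof.
  unfold meijer_integrand, G_integrand, Gamma, Cpower. cbn [firstn skipn map Cprod fold_right].
  replace (0 - s)%C with (- s)%C by ring.
  replace (1 - (1 / 2)%R + s)%C with (/ 2 + s)%C.
  2:{ rewrite RtoC_div by lra. field. }
  replace (1 - (- nu)%R + s)%C with (1 + nu + s)%C by (rewrite RtoC_opp; ring). ring.
Qed.

(* Outside the zeros of the reciprocal Gamma factors that [G_integrand] inverts. *)
Definition off (nu : R) (s : C) : Prop :=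
  (forall k, s <> INR k) /\ (forall k, s <> nu + INR k)%C /\ (forall k, s <> - / 2 - INR k)%C.

Lemma off_im (nu : R) (s : C) : Im s <> 0 -> off nu s.
Proof.
  intros H. repeat split; intros k E; apply H; rewrite E; unfold Im; simpl; try ring.
  unfold Cinv, RtoC; simpl. field.
Qed.

Lemma off_re (nu : R) (s : C) : 0 <= Re s -> (forall k, Re s <> INR k) -> (forall k, Re s <> nu + INR k) -> off nu s.
Proof.
  intros H0 H1 H2. repeat split; intros k E.
  - apply (H1 k). rewrite E. reflexivity.
  - apply (H2 k). rewrite E. reflexivity.
  - rewrite E in H0. assert (P := pos_INR k). unfold Re, Cminus, Cplus, Copp, Cinv, RtoC in H0; simpl in H0. 
    replace (2 / (2 * (2 * 1) + 0 * (0 * 1))) with (/ 2) in H0 by field. lra.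
Qed.

Lemma off_nonzero (nu : R) (s : C) : off nu s ->
  rGamma (- s) <> 0 /\ rGamma (nu - s) <> 0 /\ rGamma (/ 2 + s) <> 0.
Proof.
  intros [H1 [H2 H3]]. repeat split; apply rGamma_neq0; intros k E.
  - apply (H1 k). replace s with (- - s)%C by ring. rewrite E. ring.
  - apply (H2 k). replace s with (nu - (nu - s))%C by ring. rewrite E. ring.
  - apply (H3 k). replace s with ((/ 2 + s) - / 2)%C by ring. rewrite E. ring.
Qed.

Lemma cont_rGamma_comp {T : UniformSpace} (g : T -> C) (t : T) :
  continuous g t -> continuous (fun u => rGamma (g u)) t.
Proof.
  intros H. apply (continuous_comp g rGamma); [exact H|]. apply (Hol_cont Cuniv); [apply Hol_rGamma|exact I].
Qed.

Lemma cont_Cexp_comp {T : UniformSpace} (g : T -> C) (t : T) :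
  continuous g t -> continuous (fun u => Cexp (g u)) t.
Proof.
  intros H. apply (continuous_comp g Cexp); [exact H|]. apply (Hol_cont Cuniv); [apply Hol_Cexp|exact I].
Qed.

Ltac cmult := lazymatch goal with |- continuous (fun x => (@?f x * @?g x)%C) _ => apply (cont_mult f g) end.

Lemma cont_G_integrand (lam : C) (nu : R) (s : C) : off nu s -> continuous (G_integrand lam nu) s.
Proof.
  intros H. destruct (off_nonzero nu s H) as [N1 [N2 N3]]. unfold G_integrand.
  assert (C1 : continuous (fun s => - s)%C s) by (apply cont_opp, continuous_id).
  assert (C0 : forall c : C, continuous (fun _ : C => c) s) by (intros; apply continuous_const).
  assert (Ci : continuous (fun s : C => s) s) by apply continuous_id.
  repeat cmult.
  - apply cont_inv; [apply cont_rGamma_comp, C1|exact N1].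
  - apply cont_inv; [apply cont_rGamma_comp, C1|exact N1].
  - apply cont_inv; [apply cont_rGamma_comp, cont_minus; auto|exact N2].
  - apply cont_inv; [apply cont_rGamma_comp, cont_plus; auto|exact N3].
  - apply cont_rGamma_comp. apply cont_plus; auto.
  - apply cont_rGamma_comp. apply cont_minus; auto.
  - apply cont_Cexp_comp, cont_mult; auto.
Qed.

(** Every Gamma factor is shifted by its recurrence; [rGamma (1 - s)] at s + 1 becomes
    [rGamma (- s)], which cancels one of the recurrences. The second alternative is the case where
    the last division would be by 0. *)
Lemma G_integrand_step (lam : C) (nu : R) (s : C) : off nu s -> off nu (s + 1) ->
  G_integrand lam nu (s + 1) = (G_integrand lam nu s *
    (Cexp lam * (- s) * (/ 2 + s) / ((s + 1) * (s + 1) * (nu - s - 1) * (1 + nu + s))))%C \/ (1 + nu + s = 0)%C.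
Proof.
  intros H K. destruct (off_nonzero nu s H) as [N1 [N2 N3]].
  destruct (off_nonzero nu (s + 1) K) as [M1 [M2 M3]].
  destruct (classic (1 + nu + s = 0)%C) as [Z|Z]; [right; exact Z|left].
  assert (E1 := rGamma_rec (- (s + 1))). replace (- (s + 1) + 1)%C with (- s)%C in E1 by ring.
  assert (E2 := rGamma_rec (nu - (s + 1))). replace (nu - (s + 1) + 1)%C with (nu - s)%C in E2 by ring.
  assert (E3 := rGamma_rec (/ 2 + s)). replace (/ 2 + s + 1)%C with (/ 2 + (s + 1))%C in E3 by ring.
  assert (E4 := rGamma_rec (1 + nu + s)). replace (1 + nu + s + 1)%C with (1 + nu + (s + 1))%C in E4 by ring.
  assert (E5 := rGamma_rec (- s)). replace (- s + 1)%C with (1 - s)%C in E5 by ring.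
  unfold G_integrand. replace (1 - (s + 1))%C with (- s)%C by ring.
  replace ((s + 1) * lam)%C with (s * lam + lam)%C by ring. rewrite Cexp_add.
  rewrite E1, E2 in *. rewrite E3 in N3. rewrite E3, E4.
  set (a := rGamma (- s)) in *. set (b := rGamma (nu - s)) in *.
  set (c := rGamma (/ 2 + (s + 1))) in *. set (d := rGamma (1 + nu + (s + 1))) in *.
  set (e := rGamma (1 - s)) in *.
  assert (Q1 : (- (s + 1) <> 0)%C) by (intros Q; apply M1; rewrite Q; ring).
  assert (Q2 : (nu - (s + 1) <> 0)%C) by (intros Q; apply M2; rewrite Q; ring).
  assert (Q3 : (/ 2 + s <> 0)%C) by (intros Q; apply N3; rewrite Q; ring).
  assert (Q4 : (s + 1 <> 0)%C) by (intros Q; apply Q1; rewrite Q; ring).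
  assert (Q5 : (nu - s - 1 <> 0)%C).
  { intros Q. apply Q2. replace (nu - (s + 1))%C with (nu - s - 1)%C by ring. exact Q. }
  assert (Q6 : (1 + 2 * s <> 0)%C).
  { intros Q. apply Q3. replace (/ 2 + s)%C with ((1 + 2 * s) / 2)%C by field. rewrite Q. field. }
  assert (Ha : (- s * e = a)%C) by (symmetry; exact E5).
  transitivity (/ (- (s + 1) * a) * / (- (s + 1) * a) * / ((nu - (s + 1)) * b) * / c * d * a * (Cexp (s * lam) * Cexp lam))%C;
    [reflexivity|].
  rewrite <- Ha at 3. field. repeat split; auto.
  intros Q. apply Q6. rewrite <- Q. ring.
Qed.

(** * Decay of the integrand to the right *)

Lemma Cmod_le_shift (s : C) (c : R) : 0 <= Re s -> 0 <= c -> Cmod s <= Cmod (s + c).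
Proof.
  intros H Hc. unfold Cmod. apply sqrt_le_1_alt. destruct s as [a b]. unfold Re in H. simpl in *. nra.
Qed.

Lemma Re_le_Cmod' (s : C) : Re s <= Cmod s.
Proof. generalize (re_le_Cmod s). intros H. apply Rabs_le_between in H. lra. Qed.

(** In the step factor |s| is absorbed by |s + 1| and |1/2 + s| by |1 + nu + s|. What remains is
    |exp(lam)| / (|s + 1| |nu - s - 1|), where |s + 1| >= 1 and |nu - s - 1| >= 4 |exp(lam)| + 1. *)
Lemma G_integrand_step_bound (lam : C) (nu : R) (s : C) : 0 < nu -> off nu s -> off nu (s + 1) ->
  nu + 4 * Cmod (Cexp lam) + 1 <= Re s -> Cmod (G_integrand lam nu (s + 1)) <= Cmod (G_integrand lam nu s) / 4.
Proof.
  intros Hnu H K Hs. assert (P := Cmod_ge_0 (Cexp lam)).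
  destruct (G_integrand_step lam nu s H K) as [E|Z].
  2:{ exfalso. apply (f_equal Re) in Z. unfold Re, Cminus, Cplus, Copp, RtoC in *; simpl in *. lra. }
  rewrite E, Cmod_mult. unfold Rdiv. apply Rmult_le_compat_l; [apply Cmod_ge_0|].
  assert (A1 : Cmod s <= Cmod (s + 1)) by (apply Cmod_le_shift; lra).
  assert (A2 : Cmod (/ 2 + s) <= Cmod (1 + nu + s)).
  { replace (1 + nu + s)%C with ((/ 2 + s) + (/ 2 + nu)%R)%C.
    - apply Cmod_le_shift; [|lra]. unfold Re, Cplus, Cinv, RtoC in *; simpl in *.
      replace (2 / (2 * (2 * 1) + 0 * (0 * 1))) with (/ 2) by field. lra.
    - rewrite RtoC_plus, RtoC_inv by lra. field. }
  assert (A3 : 1 <= Cmod (s + 1)).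
  { apply Rle_trans with (2 := Re_le_Cmod' _). unfold Re, Cminus, Cplus, Copp, RtoC in *; simpl in *. lra. }
  assert (A4 : 4 * Cmod (Cexp lam) + 1 <= Cmod (nu - s - 1)).
  { rewrite <- (Cmod_opp (nu - s - 1)). apply Rle_trans with (2 := Re_le_Cmod' _). clear E A1 A2 A3. generalize dependent (Cmod (Cexp lam)). intros q Hs P.
    unfold Re, Cminus, Cplus, Copp, RtoC in *; simpl in *. lra. }
  assert (A5 : 1 <= Cmod (1 + nu + s)).
  { apply Rle_trans with (2 := Re_le_Cmod' _). unfold Re, Cminus, Cplus, Copp, RtoC in *; simpl in *. lra. }
  rewrite Cmod_div.
  2:{ repeat apply Cmult_neq_0; intros Q; [rewrite Q, Cmod_0 in A3; lra|rewrite Q, Cmod_0 in A3; lra|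
        rewrite Q, Cmod_0 in A4; lra|rewrite Q, Cmod_0 in A5; lra]. }
  rewrite !Cmod_mult, Cmod_opp.
  set (q := Cmod (Cexp lam)) in *. set (m1 := Cmod s) in *. set (m2 := Cmod (s + 1)) in *.
  set (m3 := Cmod (/ 2 + s)) in *. set (m4 := Cmod (1 + nu + s)) in *. set (m5 := Cmod (nu - s - 1)) in *.
  assert (P1 : 0 <= m1) by apply Cmod_ge_0. assert (P3 : 0 <= m3) by apply Cmod_ge_0.
  apply Rmult_le_reg_r with (m2 * m2 * m5 * m4); [repeat apply Rmult_lt_0_compat; lra|].
  unfold Rdiv. rewrite Rmult_assoc, Rinv_l, Rmult_1_r by (repeat apply Rmult_integral_contrapositive_currified; lra).
  apply Rle_trans with (q * m2 * m4).
  - apply Rmult_le_compat; try lra; [apply Rmult_le_pos; lra|]. apply Rmult_le_compat; lra.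
  - replace (/ 4 * (m2 * m2 * m5 * m4)) with ((m2 * m4) * (/ 4 * (m2 * m5))) by ring.
    replace (q * m2 * m4) with ((m2 * m4) * q) by ring.
    apply Rmult_le_compat_l; [apply Rmult_le_pos; lra|]. 
    assert (1 * m5 <= m2 * m5) by (apply Rmult_le_compat_r; lra). lra.
Qed.

Lemma G_integrand_decay (lam : C) (nu : R) (s : C) (k : nat) : 0 < nu -> (forall j, off nu (s + INR j)) ->
  nu + 4 * Cmod (Cexp lam) + 1 <= Re s -> Cmod (G_integrand lam nu (s + INR k)) <= Cmod (G_integrand lam nu s) * (/ 4) ^ k.
Proof.
  intros Hnu H Hs. induction k as [|k IH].
  - simpl. replace (s + 0)%C with s by ring. lra.
  - assert (E : (s + INR (S k) = s + INR k + 1)%C) by (rewrite S_INR, RtoC_plus; ring).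
    rewrite E. eapply Rle_trans.
    + apply G_integrand_step_bound; [exact Hnu|apply H|rewrite <- E; apply H|].
      assert (Pk := pos_INR k). unfold Re, Cminus, Cplus, Copp, RtoC in *; simpl in *. lra.
    + simpl pow. lra.
Qed.

Lemma quarter_pow_exp (y : R) (k : nat) : y < INR k + 1 -> (/ 4) ^ k <= 4 * exp (- y).
Proof.
  intros H. assert (E : exp (- (INR k + 1)) <= exp (- y)).
  { left. apply exp_increasing. lra. }
  apply Rle_trans with (4 * exp (- (INR k + 1))); [|lra].
  assert (E4 : / 4 <= exp (Ropp 1)).
  { rewrite exp_Ropp. apply Rinv_le_contravar; [apply exp_pos|]. generalize exp_le_3. lra. }
  replace (- (INR k + 1)) with (INR (S k) * Ropp 1) by (rewrite S_INR; ring).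
  rewrite exp_INR_mult. apply Rle_trans with (4 * (/ 4) ^ S k).
  - simpl. lra.
  - apply Rmult_le_compat_l; [lra|]. apply pow_incr. lra.
Qed.

Definition hline (h : R) (u : R) : C := (u, h).
Definition vline (a : R) (y : R) : C := (a, y).

Lemma cont_hline (h u : R) : continuous (hline h) u.
Proof. apply cont_comps. split; [apply continuous_id|apply continuous_const]. Qed.
Lemma cont_vline (a u : R) : continuous (vline a) u.
Proof. apply cont_comps. split; [apply continuous_const|apply continuous_id]. Qed.

(** A point of the ray is an integer translate of one with abscissa u in [R0, R0 + 1], and the decay
    per unit step does the rest. For uniformity in nu, the two factors that contain it depend only
    on nu - u and nu + u, which range over compact intervals. *)
Lemma G_integrand_horizontal (lam : C) (h nu1 nu2 : R) : h <> 0 -> 0 < nu1 -> nu1 <= nu2 ->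
  exists B R0, 0 <= B /\ 0 <= R0 /\ forall nu t, nu1 <= nu <= nu2 -> R0 <= t ->
    Cmod (G_integrand lam nu (t, h)) <= B * exp (- t).
Proof.
  intros Hh H1 H12. set (R0 := nu2 + 4 * Cmod (Cexp lam) + 1).
  assert (P := Cmod_ge_0 (Cexp lam)).
  set (f := fun t => (/ rGamma (- hline h t) * / rGamma (- hline h t) * / rGamma (/ 2 + hline h t) *
      rGamma (1 - hline h t) * Cexp (hline h t * lam))%C).
  assert (NI : forall (w : C), Im w <> 0 -> rGamma w <> 0).
  { intros w Hw. apply rGamma_neq0. intros k E. apply Hw. rewrite E. unfold Im; simpl. ring. }
  assert (Cf : pcont f R0 (R0 + 1)).
  { intros t _. assert (Ch := cont_hline h t).
    assert (C0 : forall c : C, continuous (fun _ : R => c) t) by (intros; apply continuous_const).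
    unfold f. repeat cmult.
    - apply cont_inv; [apply cont_rGamma_comp, cont_opp, Ch|apply NI; simpl; lra].
    - apply cont_inv; [apply cont_rGamma_comp, cont_opp, Ch|apply NI; simpl; lra].
    - apply cont_inv; [apply cont_rGamma_comp, cont_plus; auto|apply NI; simpl]. 
      replace (- 0 / (2 * (2 * 1) + 0 * (0 * 1)) + h) with h by field. exact Hh.
    - apply cont_rGamma_comp, cont_minus; auto.
    - apply cont_Cexp_comp, cont_mult; auto. }
  assert (Cg : pcont (fun u => / rGamma (hline (- h) u))%C (nu1 - R0 - 1) (nu2 - R0)).
  { intros t _. apply cont_inv; [apply cont_rGamma_comp, cont_hline|apply NI; simpl; lra]. }
  assert (Ck : pcont (fun u => rGamma (1 + hline h u))%C (nu1 + R0) (nu2 + R0 + 1)).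
  { intros t _. apply cont_rGamma_comp, cont_plus; [apply continuous_const|apply cont_hline]. }
  assert (HR : R0 <= R0 + 1) by lra.
  destruct (pcont_bounded f R0 (R0 + 1) HR Cf) as [Kf [Kf0 HKf]].
  assert (HRg : nu1 - R0 - 1 <= nu2 - R0) by lra.
  destruct (pcont_bounded _ _ _ HRg Cg) as [Kg [Kg0 HKg]].
  assert (HRk : nu1 + R0 <= nu2 + R0 + 1) by lra.
  destruct (pcont_bounded _ _ _ HRk Ck) as [Kk [Kk0 HKk]].
  exists (Kf * Kg * Kk * 4 * exp R0), R0.
  assert (HK : 0 < Kf * Kg * Kk) by (repeat apply Rmult_lt_0_compat; assumption).
  split; [generalize (exp_pos R0); nra|]. split; [unfold R0; lra|].
  intros nu t Hnu Ht.
  destruct (nfloor_ex (t - R0) ltac:(lra)) as [k [Hk1 Hk2]].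
  set (u := t - INR k). assert (Hu : R0 <= u <= R0 + 1) by (unfold u; lra).
  assert (Es : (t, h) = ((u, h) + INR k)%C).
  { unfold Cplus, RtoC; simpl. unfold u. f_equal; ring. }
  rewrite Es. eapply Rle_trans.
  - apply G_integrand_decay; [lra| |unfold Re; simpl; unfold R0 in Hu; lra].
    intros j. apply off_im. unfold Im; simpl. lra.
  - assert (B0 : Cmod (G_integrand lam nu (u, h)) <= Kf * Kg * Kk).
    { replace (G_integrand lam nu (u, h)) with (f u * / rGamma (hline (- h) (nu - u)) * rGamma (1 + hline h (nu + u)))%C.
      - rewrite !Cmod_mult. apply Rmult_le_compat; try apply Cmod_ge_0.
        + apply Rmult_le_pos; apply Cmod_ge_0.
        + apply Rmult_le_compat; try apply Cmod_ge_0; [apply HKf, Hu|apply HKg; lra].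
        + apply HKk; lra.
      - unfold G_integrand, f. change (hline h u) with ((u, h) : C).
        replace (hline (- h) (nu - u)) with (nu - (u, h))%C.
        2:{ unfold hline, Cminus, Cplus, Copp, RtoC; simpl. f_equal; ring. }
        replace (1 + hline h (nu + u))%C with (1 + nu + (u, h))%C.
        2:{ unfold hline, Cplus, RtoC; simpl. f_equal; ring. }
        ring. }
    assert (Q := quarter_pow_exp (t - R0) k ltac:(lra)).
    assert (Ex : exp (- (t - R0)) = exp R0 * exp (- t)) by (rewrite <- exp_plus; f_equal; ring).
    rewrite Ex in Q.
    apply Rle_trans with ((Kf * Kg * Kk) * (4 * (exp R0 * exp (- t)))).
    + apply Rmult_le_compat; auto; [apply Cmod_ge_0|apply pow_le; lra].
    + right. ring.
Qed.

Lemma G_integrand_vertical (lam : C) (nu sig a b : R) : 0 < nu -> a <= b ->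
  nu + 4 * Cmod (Cexp lam) + 1 <= sig ->
  (forall y k, a <= y <= b -> off nu (sig + INR k, y)) ->
  exists B, 0 <= B /\ forall k y, a <= y <= b -> Cmod (G_integrand lam nu (sig + INR k, y)) <= B * (/ 4) ^ k.
Proof.
  intros Hnu Hab Hs Hoff.
  assert (Cf : pcont (fun y => G_integrand lam nu (vline sig y)) a b).
  { intros y Hy. apply (continuous_comp (vline sig) (G_integrand lam nu)); [apply cont_vline|].
    apply cont_G_integrand. specialize (Hoff y 0%nat Hy). simpl in Hoff. rewrite Rplus_0_r in Hoff. exact Hoff. }
  destruct (pcont_bounded _ _ _ Hab Cf) as [B [HB HBd]].
  exists B. split; [lra|]. intros k y Hy.
  assert (E : forall j, (sig + INR j, y) = (vline sig y + INR j)%C).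
  { intros j. unfold vline, Cplus, RtoC; simpl. f_equal; ring. }
  rewrite E. eapply Rle_trans.
  - apply G_integrand_decay; [exact Hnu| |exact Hs]. intros j. rewrite <- E. apply Hoff, Hy.
  - apply Rmult_le_compat_r; [apply pow_le; lra|]. apply HBd, Hy.
Qed.

(** The integrals over [- n, n] form a Cauchy sequence; the factor 2 counts the two tails, each at
    most B exp(- a). *)
Lemma line_tail (f : R -> C) (B R0 : R) : (forall t, continuous f t) -> 0 <= B -> 0 <= R0 ->
  (forall t, R0 <= Rabs t -> Cmod (f t) <= B * exp (- Rabs t)) ->
  exists v, line_lim (V := C_R_NormedModule) f v /\
    forall a, R0 <= a -> Cmod (v - CInt f (- a) a) <= 2 * B * exp (- a).
Proof.
  intros Cf HB HR Hd.
  assert (pc : forall a b, pcont f a b) by (intros a b t _; apply Cf).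
  assert (Tp : forall a b, R0 <= a -> a <= b -> Cmod (CInt f a b) <= B * exp (- a)).
  { intros a b Ha Hab.
    apply Rle_trans with (B * exp (- a) - B * exp (- b)); [|generalize (exp_pos (- b)); nra].
    apply (CInt_norm_le f (fun t => B * exp (- t))); [exact Hab|apply pc| |].
    - intros t Ht. specialize (Hd t). rewrite Rabs_pos_eq in Hd by lra. apply Hd. lra.
    - replace (B * exp (- a) - B * exp (- b)) with (minus (- B * exp (- b)) (- B * exp (- a)))
        by (unfold minus, plus, opp; simpl; ring).
      apply (is_RInt_derive (V := R_CompleteNormedModule) (fun t => - B * exp (- t))).
      + intros t _. auto_derive; [exact I|ring].
      + intros t _. apply continuity_pt_filterlim. reg. }
  assert (Tm : forall a b, R0 <= a -> a <= b -> Cmod (CInt f (- b) (- a)) <= B * exp (- a)).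
  { intros a b Ha Hab.
    apply Rle_trans with (B * exp (- a) - B * exp (- b)); [|generalize (exp_pos (- b)); nra].
    apply (CInt_norm_le f (fun t => B * exp t)); [lra|apply pc| |].
    - intros t Ht. specialize (Hd t). rewrite Rabs_left1 in Hd by lra. rewrite Ropp_involutive in Hd. apply Hd. lra.
    - apply (is_RInt_derive (V := R_CompleteNormedModule) (fun t => B * exp t)).
      + intros t _. auto_derive; [exact I|ring].
      + intros t _. apply continuity_pt_filterlim. reg. }
  assert (Tb : forall a a' b, R0 <= a -> a' <= - a -> a <= b ->
     Cmod (CInt f a' b - CInt f (- a) a) <= 2 * B * exp (- a)).
  { intros a a' b Ha Ha' Hb.
    rewrite <- (CInt_Chasles f a' (- a) b), <- (CInt_Chasles f (- a) a b) by (try apply pc; lra).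
    replace (CInt f a' (- a)%R + (CInt f (- a)%R a + CInt f a b) - CInt f (- a)%R a)%C with
      (CInt f a' (- a)%R + CInt f a b)%C by ring.
    eapply Rle_trans; [apply Cmod_triangle|]. replace a' with (- - a') by ring.
    assert (X1 := Tp a b Ha Hb). assert (X2 := Tm a (- a') Ha ltac:(lra)). lra. }
  assert (Ex : forall eps, 0 < eps -> exists N, forall n, (N <= n)%nat -> 2 * B * exp (- INR n) < eps).
  { intros eps He. destruct (nfloor_ex (2 * B / eps)) as [N [_ HN]].
    { apply Rmult_le_pos; [lra|left; apply Rinv_0_lt_compat, He]. }
    exists (S N). intros n Hn. apply le_INR in Hn. rewrite S_INR in Hn.
    rewrite exp_Ropp. assert (Q := exp_ineq1_le (INR n)).
    apply Rmult_lt_reg_r with (exp (INR n)); [apply exp_pos|].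
    rewrite Rmult_assoc, Rinv_l, Rmult_1_r by (apply Rgt_not_eq, exp_pos).
    assert (2 * B < eps * INR n); [|nra].
    apply Rmult_lt_reg_r with (/ eps); [apply Rinv_0_lt_compat, He|].
    replace (eps * INR n * / eps) with (INR n) by (field; lra). unfold Rdiv in HN. lra. }
  destruct (nfloor_ex R0 HR) as [N0 [_ HN0]].
  assert (big : forall n, (S N0 <= n)%nat -> R0 <= INR n).
  { intros n Hn. apply le_INR in Hn. rewrite S_INR in Hn. lra. }
  destruct (Clim_cauchy (fun n => CInt f (- INR n) (INR n))) as [v Hv].
  { intros eps He. destruct (Ex eps He) as [N HN]. exists (N + S N0)%nat. intros n m Hn Hm.
    eapply Rle_lt_trans; [apply Tb|].
    - apply big. lia.
    - apply le_INR in Hm. lra.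
    - apply le_INR in Hm. lra.
    - apply HN. lia. }
  assert (Hb : forall a, R0 <= a -> Cmod (v - CInt f (- a) a) <= 2 * B * exp (- a)).
  { intros a Ha. destruct (nfloor_ex a ltac:(lra)) as [N [_ HN]].
    apply (Clim_bound (fun n => CInt f (- INR n) (INR n))) with (N := S N); [exact Hv|].
    intros n Hn. apply le_INR in Hn. rewrite S_INR in Hn. apply Tb; lra. }
  exists v. split; [|exact Hb].
  apply Cline_intro; [exact Cf|]. intros eps He.
  assert (He2 : 0 < eps / 2) by lra.
  destruct (Ex _ He2) as [N HN]. set (n := (N + S N0)%nat).
  assert (Hn : R0 <= INR n) by (apply big; unfold n; lia).
  exists (INR n). intros a b Ha Hbb Hab.
  replace (CInt f a b - v)%C with ((CInt f a b - CInt f (- INR n)%R (INR n)) + - (v - CInt f (- INR n)%R (INR n)))%C by ring.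
  eapply Rle_lt_trans; [apply Cmod_triangle|]. rewrite Cmod_opp.
  assert (X1 := Tb (INR n) a b Hn Ha Hbb). assert (X2 := Hb (INR n) Hn).
  assert (X3 := HN n ltac:(unfold n; lia)). lra.
Qed.

(** * The poles of the integrand in a strip *)

Lemma pochhammer_split (w : C) (n : nat) : rGamma w = (pochhammer w n * rGamma (w + INR n))%C.
Proof.
  induction n as [|n IH].
  - simpl. replace (w + 0)%C with w by ring. ring.
  - rewrite IH, (rGamma_rec (w + INR n)). cbn [pochhammer]. rewrite S_INR, RtoC_plus.
    replace (w + (INR n + 1))%C with (w + INR n + 1)%C by ring. ring.
Qed.

Lemma rGamma_re_pos (w : C) : 0 < Re w -> rGamma w <> 0.
Proof.
  intros H. apply rGamma_neq0. intros k E. rewrite E in H. unfold Re in H; simpl in H.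
  generalize (pos_INR k). lra.
Qed.

Lemma lprod_pochhammer (f : nat -> C) (c : C) (n : nat) (s : C) : (forall k, f k = c + INR k)%C ->
  pochhammer (c - s) n = ((- (1)) ^ n * lprod (map f (seq 0 n)) s)%C.
Proof.
  intros Hf. induction n as [|n IH].
  - simpl. ring.
  - rewrite seq_S, map_app, lprod_app. cbn [pochhammer]. rewrite IH. simpl. rewrite Hf. ring.
Qed.

Lemma lprod_pochhammer_neg (f : nat -> C) (c : C) (n : nat) (s : C) : (forall k, f k = - c - INR k)%C ->
  pochhammer (c + s) n = lprod (map f (seq 0 n)) s.
Proof.
  intros Hf. induction n as [|n IH].
  - reflexivity.
  - rewrite seq_S, map_app, lprod_app. cbn [pochhammer]. rewrite IH. simpl. rewrite Hf. ring.
Qed.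

(** One of the two factors 1 / [rGamma (- s)] cancels against [rGamma (1 - s)] up to - 1 / s. The
    positive integers are therefore listed once, and the origin, a double pole, is kept apart. *)
Definition poles0 (n : nat) : list C := map (fun k => RtoC (INR (S k))) (seq 0 n).
Definition poles1 (nu : R) (n : nat) : list C := map (fun k => (nu + INR k)%C) (seq 0 n).
Definition poles2 (n : nat) : list C := map (fun k => (- / 2 - INR k)%C) (seq 0 n).

Definition strip (lo hi : R) (s : C) : Prop := lo < Re s < hi.

Lemma copen_strip (lo hi : R) : copen (strip lo hi).
Proof.
  intros s [H1 H2]. apply locally_C. exists (Rmin (Re s - lo) (hi - Re s)). split; [apply Rmin_pos; lra|].
  intros u Hu. assert (M1 := Rmin_l (Re s - lo) (hi - Re s)). assert (M2 := Rmin_r (Re s - lo) (hi - Re s)).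
  assert (K := re_le_Cmod (u - s)%C). replace (Re (u - s)%C) with (Re u - Re s) in K by (destruct u, s; reflexivity).
  assert (K2 : Rabs (Re u - Re s) < Rmin (Re s - lo) (hi - Re s)) by lra.
  apply Rabs_lt_between in K2. unfold strip. lra.
Qed.

Lemma star_strip (lo hi : R) : lo < 0 < hi -> star (strip lo hi) 0.
Proof.
  intros H w u [H1 H2] Hu. unfold strip in *.
  replace (Re (0 + RtoC u * (w - 0))%C) with (u * Re w) by (destruct w; unfold Re; simpl; ring).
  set (x := Re w) in *. destruct (Rle_lt_dec 0 x) as [Hx|Hx].
  - assert (0 <= u * x) by (apply Rmult_le_pos; lra).
    assert (u * x <= 1 * x) by (apply Rmult_le_compat_r; lra). lra.
  - assert (0 <= u * - x) by (apply Rmult_le_pos; lra).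
    assert (u * - x <= 1 * - x) by (apply Rmult_le_compat_r; lra). lra.
Qed.

(* The integrand times the linear factors of its poles in a strip, hence holomorphic there. *)
Definition numer (lam : C) (nu : R) (N n M : nat) (s : C) : C :=
  ((- (1)) ^ N * (- (1)) ^ n * rGamma (s + (1 + nu)) * Cexp (lam * s + 0) * / rGamma (- (1) * s + INR (S N)) *
   / rGamma (- (1) * s + (nu + INR n)) * / rGamma (s + (/ 2 + INR M)))%C.

Lemma Hol_numer (lam : C) (nu : R) (N n M : nat) (hi : R) : hi <= INR (S N) -> hi <= nu + INR n ->
  Hol (strip (- / 2 - INR M) hi) (numer lam nu N n M).
Proof.
  intros H1 H2. assert (Uo := copen_strip (- / 2 - INR M) hi).
  assert (HS : forall f, Hol Cuniv f -> Hol (strip (- / 2 - INR M) hi) f).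
  { intros f. apply Hol_sub. intros; exact I. }
  assert (HL : forall c d, Hol Cuniv (fun s => rGamma (c * s + d))).
  { intros c d. apply (Hol_comp Cuniv Cuniv rGamma (fun s => c * s + d)%C); auto using copen_all, Hol_rGamma, Hol_linear. }
  assert (HLi : forall c d, (forall s, strip (- / 2 - INR M) hi s -> 0 < Re (c * s + d)%C) ->
     Hol (strip (- / 2 - INR M) hi) (fun s => / rGamma (c * s + d))%C).
  { intros c d Hp. apply Hol_inv; [exact Uo|apply HS, HL|]. intros s Hs. apply rGamma_re_pos, Hp, Hs. }
  unfold numer. repeat (apply Hol_mult; [exact Uo| |]).
  - apply (Hol_const _ ((- (1)) ^ N)%C), Uo.
  - apply (Hol_const _ ((- (1)) ^ n)%C), Uo.
  - apply HS, (Hol_shift rGamma), Hol_rGamma.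
  - apply HS. apply (Hol_comp Cuniv Cuniv Cexp (fun s => lam * s + 0)%C); auto using copen_all, Hol_Cexp, Hol_linear.
  - apply HLi. intros s [K1 K2]. unfold Re in *; simpl in *. lra.
  - apply HLi. intros s [K1 K2]. unfold Re in *; simpl in *. lra.
  - apply Hol_inv; [exact Uo|apply HS, (Hol_shift rGamma), Hol_rGamma|].
    intros s [K1 K2]. apply rGamma_re_pos. unfold Re in *; simpl in *.
    replace (2 / (2 * (2 * 1) + 0 * (0 * 1))) with (/ 2) by field. lra.
Qed.

(** [pochhammer_split] takes enough linear factors out of each inverted Gamma factor for the
    remaining argument to have positive real part in the strip. *)
Lemma G_integrand_decomp (lam : C) (nu : R) (N n M : nat) (hi : R) (s : C) :
  hi <= INR (S N) -> hi <= nu + INR n -> strip (- / 2 - INR M) hi s ->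
  ~ In s (RtoC 0 :: (poles0 N ++ poles1 nu n ++ poles2 M)) ->
  G_integrand lam nu s = (numer lam nu N n M s / (s * s * lprod (poles0 N ++ poles1 nu n ++ poles2 M) s))%C.
Proof.
  intros H1 H2 [S1 S2] Hin.
  assert (N0 : s <> 0) by (intros E; apply Hin; left; symmetry; exact E).
  assert (Nl : lprod (poles0 N ++ poles1 nu n ++ poles2 M) s <> 0).
  { apply lprod_neq0. intros K. apply Hin. right. exact K. }
  rewrite !lprod_app in *.
  assert (D0 : lprod (poles0 N) s <> 0) by (intros E; apply Nl; rewrite E; ring).
  assert (D1 : lprod (poles1 nu n) s <> 0) by (intros E; apply Nl; rewrite E; ring).
  assert (D2 : lprod (poles2 M) s <> 0) by (intros E; apply Nl; rewrite E; ring).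
  assert (P0 : pochhammer (1 - s) N = ((- (1)) ^ N * lprod (poles0 N) s)%C).
  { apply lprod_pochhammer. intros k. rewrite S_INR, RtoC_plus. ring. }
  assert (P1 : pochhammer (nu - s) n = ((- (1)) ^ n * lprod (poles1 nu n) s)%C).
  { apply lprod_pochhammer. reflexivity. }
  assert (P2 : pochhammer (/ 2 + s) M = lprod (poles2 M) s).
  { apply lprod_pochhammer_neg. reflexivity. }
  assert (E0 := pochhammer_split (1 - s) N). assert (E1 := pochhammer_split (nu - s) n).
  assert (E2 := pochhammer_split (/ 2 + s) M).
  assert (E3 := rGamma_rec (- s)). replace (- s + 1)%C with (1 - s)%C in E3 by ring.
  rewrite P0 in E0. rewrite P1 in E1. rewrite P2 in E2.
  unfold numer, G_integrand. rewrite E3, E0, E1, E2.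
  replace (s + (1 + nu))%C with (1 + nu + s)%C by ring.
  replace (lam * s + 0)%C with (s * lam)%C by ring.
  replace (- (1) * s + INR (S N))%C with (1 - s + INR N)%C by (rewrite S_INR, RtoC_plus; ring).
  replace (- (1) * s + (nu + INR n))%C with (nu - s + INR n)%C by ring.
  replace (s + (/ 2 + INR M))%C with (/ 2 + s + INR M)%C by ring.
  assert (G0 : rGamma (1 - s + INR N) <> 0).
  { apply rGamma_re_pos. rewrite S_INR in H1. unfold Re in *; simpl in *. lra. }
  assert (G1 : rGamma (nu - s + INR n) <> 0).
  { apply rGamma_re_pos. unfold Re in *; simpl in *. lra. }
  assert (G2 : rGamma (/ 2 + s + INR M) <> 0).
  { apply rGamma_re_pos. unfold Re in *; simpl in *. replace (2 / (2 * (2 * 1) + 0 * (0 * 1))) with (/ 2) by field. lra. }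
  assert (Sg : forall k, ((- (1)) ^ k * (- (1)) ^ k = 1)%C).
  { induction k as [|k IHk]; [simpl; ring|]. rewrite !Cpow_S.
    transitivity ((- (1)) ^ k * (- (1)) ^ k)%C; [ring|exact IHk]. }
  assert (Sn : forall k, ((- (1)) ^ k <> 0)%C).
  { intros k. apply Cpow_nz. intros E. apply (f_equal Re) in E. unfold Re in E; simpl in E. lra. }
  set (a := ((- (1)) ^ N)%C) in *. set (b := ((- (1)) ^ n)%C) in *.
  assert (Ea : (/ a = a)%C). { rewrite <- (Cmult_1_r (/ a)), <- (Sg N). unfold a. field. apply Sn. }
  assert (Eb : (/ b = b)%C). { rewrite <- (Cmult_1_r (/ b)), <- (Sg n). unfold b. field. apply Sn. }
  assert (Na : a <> 0) by apply Sn. assert (Nb : b <> 0) by apply Sn.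
  set (g := rGamma (1 + nu + s)). set (E := Cexp (s * lam)).
  transitivity (/ a * / b * (g * E) / (s * s * (lprod (poles0 N) s * (lprod (poles1 nu n) s * lprod (poles2 M) s)))
    * / rGamma (1 - s + INR N) * / rGamma (nu - s + INR n) * / rGamma (/ 2 + s + INR M))%C.
  - field. repeat split; auto.
  - rewrite Ea, Eb. field. repeat split; auto.
Qed.

(** * Independence of the loop *)

Definition vpath (a y0 y1 : R) (u : R) : C := (a, y0 + u * (y1 - y0)).

Lemma c1path_vpath (a y0 y1 : R) : c1path (vpath a y0 y1) (fun _ => (0, y1 - y0)).
Proof.
  split; intros t; [|apply continuous_const].
  apply PD_comps. unfold vpath; simpl. split; auto_derive; try exact I; ring.
Qed.

Lemma path_int_vpath (a y0 y1 : R) (p : C) : (forall u, 0 <= u <= 1 -> slit (vpath a y0 y1 u - p)%C) ->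
  path_int (vpath a y0 y1) (fun _ => (0, y1 - y0)) 0 1 (fun s => / (s - p))%C =
  (Clog ((a, y1) - p) - Clog ((a, y0) - p))%C.
Proof.
  intros H. rewrite path_int_Clog; auto using c1path_vpath; [|lra].
  unfold vpath. replace (y0 + 1 * (y1 - y0)) with y1 by ring. replace (y0 + 0 * (y1 - y0)) with y0 by ring.
  reflexivity.
Qed.

Lemma path_int_vpath_bound (a y0 y1 B : R) (f : C -> C) :
  (forall u, 0 <= u <= 1 -> continuous f (vpath a y0 y1 u)) ->
  (forall u, 0 <= u <= 1 -> Cmod (f (vpath a y0 y1 u)) <= B) ->
  Cmod (path_int (vpath a y0 y1) (fun _ => (0, y1 - y0)) 0 1 f) <= B * Rabs (y1 - y0).
Proof.
  intros Cf HB. replace (B * Rabs (y1 - y0)) with ((1 - 0) * (B * Rabs (y1 - y0))) by ring.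
  unfold path_int. apply CInt_norm; [lra| |].
  - intros t Ht. apply cont_mult; [|apply continuous_const].
    apply (continuous_comp (vpath a y0 y1) f); [|apply Cf, Ht].
    apply (PD_cont _ _ _ (proj1 (c1path_vpath a y0 y1) t)).
  - intros t Ht. rewrite Cmod_mult. apply Rmult_le_compat; try apply Cmod_ge_0; [apply HB, Ht|].
    eapply Rle_trans; [apply Cmod_le_abs|]. simpl. rewrite Rabs_R0. lra.
Qed.

Lemma between_sign (y0 y1 u : R) : 0 <= u <= 1 -> 0 < y0 * y1 -> y0 + u * (y1 - y0) <> 0.
Proof.
  assert (Pos : forall a b, 0 < a -> 0 < b -> 0 <= u <= 1 -> 0 < a + u * (b - a)).
  { intros a b Ha Hb Hu. replace (a + u * (b - a)) with ((1 - u) * a + u * b) by ring.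
    destruct (Req_dec u 1) as [->|Hu1]; [lra|].
    assert (0 < (1 - u) * a) by (apply Rmult_lt_0_compat; lra).
    assert (0 <= u * b) by (apply Rmult_le_pos; lra). lra. }
  intros Hu H. destruct (Rlt_le_dec 0 y0) as [L|L].
  - assert (0 < y1) by nra. generalize (Pos y0 y1 L H0 Hu). lra.
  - assert (y0 <> 0) by (intros ->; lra). assert (y1 < 0) by nra.
    assert (Q := Pos (- y0) (- y1) ltac:(lra) ltac:(lra) Hu). lra.
Qed.

Definition in_path (L : R -> C) (a b : R) (s : C) : Prop := exists t, a <= t <= b /\ s = L t.

Lemma pathfun_in (Ga : C -> Prop) (L dL : R -> C) (a b : R) : a <= b -> c1path L dL ->
  (forall s, in_path L a b s -> Ga s) -> pathfun Ga (path_int L dL a b) (L a) (L b).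
Proof.
  intros Hab HL HG. apply pathfun_path_int; [exact Hab|].
  intros t Ht. split; [apply HG; exists t; auto|]. split; apply HL.
Qed.


(* Two loops with the same winding numbers, truncated at abscissa [a] and joined by vertical segments, bound
   no residue of the integrand. *)
Lemma loops_truncated (lam : C) (nu : R) (L dL L' dL' : R -> C) (T h0 h1 h0' h1' a : R) : 0 < nu ->
  c1path L dL -> rays L T h0 h1 -> c1path L' dL' -> rays L' T h0' h1' ->
  h0 < 0 -> 0 < h1 -> h0' < 0 -> 0 < h1' -> T <= a -> 0 < a ->
  (forall t, off nu (L t)) -> (forall t, off nu (L' t)) ->
  (forall p : R, (exists k, RtoC p = INR k \/ RtoC p = nu + INR k \/ RtoC p = - / 2 - INR k)%C ->
     exists theta, total_turn L dL p theta /\ total_turn L' dL' p theta) ->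
  (path_int L dL (- a) a (G_integrand lam nu) + path_int (vpath a h1 h1') (fun _ => (0, h1' - h1)%R) 0 1 (G_integrand lam nu)
   + - path_int L' dL' (- a) a (G_integrand lam nu) + path_int (vpath a h0' h0) (fun _ => (0, h0 - h0')%R) 0 1 (G_integrand lam nu) = 0)%C.
Proof.
  intros Hnu HL HR HL' HR' H0 H1 H0' H1' HTa Ha Hoff Hoff' Hturn.
  set (Ga := fun s => in_path L (- a) a s \/ in_path (vpath a h1 h1') 0 1 s \/
                      in_path L' (- a) a s \/ in_path (vpath a h0' h0) 0 1 s).
  assert (Haa : - a <= a) by lra.
  assert (E1 : L a = (a, h1)) by (apply HR; lra).
  assert (E0 : L (- a)%R = (a, h0)) by (rewrite (proj1 HR) by lra; f_equal; ring).
  assert (E1' : L' a = (a, h1')) by (apply HR'; lra).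
  assert (E0' : L' (- a)%R = (a, h0')) by (rewrite (proj1 HR') by lra; f_equal; ring).
  assert (V1 : vpath a h1 h1' 0 = (a, h1)) by (unfold vpath; f_equal; ring).
  assert (V1' : vpath a h1 h1' 1 = (a, h1')) by (unfold vpath; f_equal; ring).
  assert (V0 : vpath a h0' h0 0 = (a, h0')) by (unfold vpath; f_equal; ring).
  assert (V0' : vpath a h0' h0 1 = (a, h0)) by (unfold vpath; f_equal; ring).
  set (I := fun f => (path_int L dL (- a) a f + path_int (vpath a h1 h1') (fun _ => (0, h1' - h1)%R) 0 1 f
   + - path_int L' dL' (- a) a f + path_int (vpath a h0' h0) (fun _ => (0, h0 - h0')%R) 0 1 f)%C).
  assert (PF : pathfun Ga I (a, h0) (a, h0)).
  { unfold I. apply (pathfun_cat Ga _ _ _ (a, h0')).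
    - apply (pathfun_cat Ga _ _ _ (a, h1')).
      + apply (pathfun_cat Ga _ _ _ (a, h1)).
        * rewrite <- E0, <- E1. apply pathfun_in; auto. intros s Hs. left. exact Hs.
        * rewrite <- V1, <- V1'. apply pathfun_in; auto using c1path_vpath; [lra|]. intros s Hs. right; left. exact Hs.
      + apply pathfun_rev. rewrite <- E0', <- E1'. apply pathfun_in; auto. intros s Hs. right; right; left. exact Hs.
    - rewrite <- V0, <- V0'. apply pathfun_in; auto using c1path_vpath; [lra|]. intros s Hs. right; right; right. exact Hs. }
  assert (Him1 : forall u, 0 <= u <= 1 -> Im (vpath a h1 h1' u) <> 0).
  { intros u Hu. apply (between_sign h1 h1' u Hu). nra. }
  assert (Him0 : forall u, 0 <= u <= 1 -> Im (vpath a h0' h0 u) <> 0).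
  { intros u Hu. apply (between_sign h0' h0 u Hu). nra. }
  assert (GaOff : forall s, Ga s -> off nu s).
  { intros s [[t [Ht ->]]|[[t [Ht ->]]|[[t [Ht ->]]|[t [Ht ->]]]]]; auto; apply off_im; auto. }
  assert (Cpath : forall (l dl : R -> C), c1path l dl -> exists K, 0 < K /\ forall t, - a <= t <= a -> Cmod (l t) <= K).
  { intros l dl [Hl _]. apply pcont_bounded; [exact Haa|]. intros t _. apply (PD_cont _ _ _ (Hl t)). }
  destruct (Cpath L dL HL) as [K1 [K1p HK1]]. destruct (Cpath L' dL' HL') as [K2 [K2p HK2]].
  (* N decides how many poles of each family are split off: enough for a strip that contains the
     bounded parts of both loops. *)
  destruct (nfloor_ex (K1 + K2 + a)) as [N [_ HN]]; [lra|].
  set (hi := K1 + K2 + a + / 2).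
  assert (Hhi1 : hi <= INR (S (S N))) by (rewrite !S_INR; unfold hi; lra).
  assert (Hhi2 : hi <= nu + INR (S (S N))) by lra.
  set (U := strip (- / 2 - INR (S N)) hi).
  assert (GaU : forall s, Ga s -> U s).
  { assert (Bd : forall s K, Cmod s <= K -> K <= K1 + K2 + a -> U s).
    { intros s K Hs HK. assert (Q := re_le_Cmod s). apply Rabs_le_between in Q.
      unfold U, strip, hi. rewrite S_INR. lra. }
    intros s [[t [Ht ->]]|[[t [Ht ->]]|[[t [Ht ->]]|[t [Ht ->]]]]].
    - apply (Bd _ K1); [apply HK1, Ht|lra].
    - unfold U, strip, vpath, hi, Re; simpl fst. rewrite S_INR. generalize (pos_INR N). lra.
    - apply (Bd _ K2); [apply HK2, Ht|lra].
    - unfold U, strip, vpath, hi, Re; simpl fst. rewrite S_INR. generalize (pos_INR N). lra. }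
  set (l := poles0 (S N) ++ poles1 nu (S (S N)) ++ poles2 (S N)).
  (* The origin is listed twice, as a double pole. Further repetitions in the list are harmless for
     [pathfun_zero], so integral nu is covered. *)
  assert (Hpol : forall p, In p (RtoC 0 :: RtoC 0 :: l) ->
     exists x, p = RtoC x /\ exists k, (RtoC x = INR k \/ RtoC x = nu + INR k \/ RtoC x = - / 2 - INR k)%C).
  { intros p [<-|[<-|Hp]].
    - exists 0. split; [reflexivity|]. exists 0%nat. left. reflexivity.
    - exists 0. split; [reflexivity|]. exists 0%nat. left. reflexivity.
    - unfold l in Hp. rewrite !in_app_iff in Hp. unfold poles0, poles1, poles2 in Hp. rewrite !in_map_iff in Hp.
      destruct Hp as [[k [<- _]]|[[k [<- _]]|[k [<- _]]]].
      + exists (INR (S k)). split; [reflexivity|]. exists (S k). left. reflexivity.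
      + exists (nu + INR k). split; [rewrite RtoC_plus; reflexivity|]. exists k. right; left. rewrite RtoC_plus. reflexivity.
      + exists (- / 2 - INR k). 
        assert (Z : RtoC (- / 2 - INR k) = (- / 2 - INR k)%C) by (rewrite RtoC_minus, RtoC_opp, RtoC_inv by lra; reflexivity).
        split; [symmetry; exact Z|]. exists k. right; right. exact Z. }
  assert (offp : forall x k, (RtoC x = INR k \/ RtoC x = nu + INR k \/ RtoC x = - / 2 - INR k)%C -> ~ off nu x).
  { intros x k [K|[K|K]] [O1 [O2 O3]]; [exact (O1 k K)|exact (O2 k K)|exact (O3 k K)]. }
  assert (Wind : forall p, In p (RtoC 0 :: RtoC 0 :: l) -> ~ Ga p /\ (U p -> I (fun s => / (s - p))%C = 0)).
  { intros p Hp. destruct (Hpol p Hp) as [x [-> [k Hk]]]. split.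
    - intros HG. exact (offp x k Hk (GaOff _ HG)).
    - intros _. destruct (Hturn x (ex_intro _ k Hk)) as [theta [Th Th']].
      unfold I.
      rewrite (winding_truncated L dL T h0 h1 x theta a HL HR ltac:(lra) ltac:(lra)); auto; [|intros t Q; apply (offp x k Hk); rewrite <- Q; apply Hoff|lra].
      rewrite (winding_truncated L' dL' T h0' h1' x theta a HL' HR' ltac:(lra) ltac:(lra)); auto; [|intros t Q; apply (offp x k Hk); rewrite <- Q; apply Hoff'|lra].
      (* The logarithms at the four corners cancel in pairs, and so do the two equal total turns. *)
      rewrite (path_int_vpath a h1 h1'), (path_int_vpath a h0' h0).
      + ring.
      + intros u Hu. apply slit_im. specialize (Him0 u Hu). unfold Im in *; simpl in *. lra.
      + intros u Hu. apply slit_im. specialize (Him1 u Hu). unfold Im in *; simpl in *. lra. }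
  assert (HRES := pathfun_zero Ga U I (a, h0) 0 PF (copen_strip _ _)).
  assert (Hst : star U 0).
  { apply star_strip. unfold hi. generalize (pos_INR (S N)). lra. }
  specialize (HRES Hst GaU _ (RtoC 0 :: RtoC 0 :: l) eq_refl Wind (numer lam nu (S N) (S (S N)) (S N))
     (Hol_numer lam nu (S N) (S (S N)) (S N) hi Hhi1 Hhi2)).
  change (I (G_integrand lam nu) = 0). rewrite <- HRES. apply (pf_ext _ _ _ _ PF).
  intros s Hs.
  rewrite (G_integrand_decomp lam nu (S N) (S (S N)) (S N) hi s Hhi1 Hhi2 (GaU s Hs)).
  - fold l. cbn [lprod]. replace (s - 0)%C with s by ring. rewrite Cmult_assoc. reflexivity.
  - intros Hin. destruct (Hpol s) as [x [-> [k Hk]]]; [right; exact Hin|]. exact (offp x k Hk (GaOff _ Hs)).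
Qed.

Lemma off_loop0 (nu t : R) : 0 < nu -> off nu (loop0 t).
Proof.
  intros Hnu. destruct (Req_dec (Im (loop0 t)) 0) as [E|E]; [|apply off_im, E].
  rewrite (loop0_real t E).
  repeat split; intros k K; apply (f_equal Re) in K; unfold Re, Cminus, Cplus, Copp, Cinv, RtoC in K; simpl in K;
  generalize (pos_INR k).
  - lra.
  - lra.
  - replace (2 / (2 * (2 * 1) + 0 * (0 * 1))) with (/ 2) in K by field. lra.
Qed.

(** * The value of the G-function on the standard loop *)

Definition loop_fun (lam : C) (nu : R) (t : R) : C := (G_integrand lam nu (loop0 t) * dloop0 t)%C.

Lemma cont_path_fun (lam : C) (nu : R) (L dL : R -> C) (t : R) : c1path L dL -> off nu (L t) ->
  continuous (fun t => G_integrand lam nu (L t) * dL t)%C t.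
Proof.
  intros [H1 H2] Ho. apply cont_mult; [|apply H2].
  apply (continuous_comp L (G_integrand lam nu)); [apply (PD_cont _ _ _ (H1 t))|apply cont_G_integrand, Ho].
Qed.

Lemma cont_loop_fun (lam : C) (nu t : R) : 0 < nu -> continuous (loop_fun lam nu) t.
Proof. intros H. apply cont_path_fun; [apply c1path_loop0|apply off_loop0, H]. Qed.

Lemma loop_fun_decay (lam : C) (nu1 nu2 : R) : 0 < nu1 -> nu1 <= nu2 ->
  exists B R0, 0 <= B /\ 0 <= R0 /\ forall nu t, nu1 <= nu <= nu2 -> R0 <= Rabs t ->
    Cmod (loop_fun lam nu t) <= B * exp (- Rabs t).
Proof.
  intros H1 H12.
  destruct (G_integrand_horizontal lam 1 nu1 nu2 ltac:(lra) H1 H12) as [B1 [R1 [HB1 [HR1 K1]]]].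
  destruct (G_integrand_horizontal lam (-1) nu1 nu2 ltac:(lra) H1 H12) as [B2 [R2 [HB2 [HR2 K2]]]].
  exists (B1 + B2), (1 + R1 + R2). split; [lra|]. split; [lra|].
  intros nu t Hnu Ht. assert (P := exp_pos (- Rabs t)). unfold loop_fun. rewrite Cmod_mult.
  destruct (Rle_lt_dec 0 t) as [L|L].
  - rewrite Rabs_pos_eq in * by lra. rewrite loop0_high, dloop0_high by lra. rewrite Cmod_1, Rmult_1_r.
    eapply Rle_trans; [apply K1; lra|]. apply Rmult_le_compat_r; lra.
  - rewrite Rabs_left in * by lra. rewrite loop0_low, dloop0_low by lra. replace (Cmod (RtoC (-1))) with 1 by (rewrite Cmod_R, Rabs_left; lra). rewrite Rmult_1_r.
    eapply Rle_trans; [apply K2; lra|]. apply Rmult_le_compat_r; lra.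
Qed.

Definition loop_int (lam : C) (nu : R) : C :=
  epsilon (inhabits (RtoC 0)) (fun v => line_lim (V := C_R_NormedModule) (loop_fun lam nu) v).

Lemma line_lim_unique_C (f : R -> C) (v w : C) :
  line_lim (V := C_R_NormedModule) f v -> line_lim (V := C_R_NormedModule) f w -> v = w.
Proof.
  intros H K. apply NNPP. intros N. assert (P : 0 < Cmod (v - w)) by (apply Cmod_gt_0, Cminus_neq0, N).
  assert (P2 : 0 < Cmod (v - w) / 2) by lra.
  destruct (Cline_elim _ _ H _ P2) as [T1 K1]. destruct (Cline_elim _ _ K _ P2) as [T2 K2].
  set (T := Rmax T1 T2). assert (M1 := Rmax_l T1 T2). assert (M2 := Rmax_r T1 T2). fold T in M1, M2.
  specialize (K1 (- T) T ltac:(lra) ltac:(lra)). specialize (K2 (- T) T ltac:(lra) ltac:(lra)).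
  assert (Q := Cmod_triangle (- (CInt f (- T)%R T - v)) (CInt f (- T)%R T - w)).
  rewrite Cmod_opp in Q. replace (- (CInt f (- T)%R T - v) + (CInt f (- T)%R T - w))%C with (v - w)%C in Q by ring. lra.
Qed.

(** Stated uniformly for nu in a compact interval, as the continuity of [loop_int] in nu
    requires. *)
Lemma loop_int_tail (lam : C) (nu1 nu2 : R) : 0 < nu1 -> nu1 <= nu2 ->
  exists B R0, 0 <= B /\ 0 <= R0 /\ forall nu, nu1 <= nu <= nu2 ->
    line_lim (V := C_R_NormedModule) (loop_fun lam nu) (loop_int lam nu) /\
    forall a, R0 <= a -> Cmod (loop_int lam nu - CInt (loop_fun lam nu) (- a) a) <= B * exp (- a).
Proof.
  intros H1 H12. destruct (loop_fun_decay lam nu1 nu2 H1 H12) as [B [R0 [HB [HR0 Hd]]]].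
  exists (2 * B), R0. split; [lra|]. split; [lra|]. intros nu Hnu.
  destruct (line_tail (loop_fun lam nu) B R0) as [v [Hv1 Hv2]]; auto.
  { intros t. apply cont_loop_fun. lra. }
  assert (S : line_lim (V := C_R_NormedModule) (loop_fun lam nu) (loop_int lam nu)).
  { unfold loop_int. apply (epsilon_spec (inhabits (RtoC 0))
      (fun v => line_lim (V := C_R_NormedModule) (loop_fun lam nu) v)). exists v. exact Hv1. }
  rewrite <- (line_lim_unique_C _ _ _ S Hv1) in Hv2. auto.
Qed.

(** The abscissae advance by whole steps, for which the decay of the integrand is known, while [sig]
    remains free for avoiding the poles. *)
Lemma Cline_seq (f : R -> C) (v : C) (sig : R) : line_lim (V := C_R_NormedModule) f v ->
  Clim (fun k => CInt f (- (sig + INR k)) (sig + INR k)) v.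
Proof.
  intros H. apply Clim_eps. intros eps He. destruct (Cline_elim _ _ H eps He) as [T HT].
  destruct (nfloor_ex (Rmax 0 (T - sig)) (Rmax_l _ _)) as [N [_ HN]].
  exists (S N). intros k Hk. apply le_INR in Hk. rewrite S_INR in Hk.
  assert (M := Rmax_r 0 (T - sig)). apply HT; lra.
Qed.

Lemma Clim_geom (u : nat -> C) (B : R) : 0 <= B -> (forall k, Cmod (u k) <= B * (/ 4) ^ k) -> Clim u 0.
Proof.
  intros HB H. apply Clim_eps. intros eps He.
  assert (L : is_lim_seq (fun k => B * (/ 4) ^ k) (B * 0)).
  { apply is_lim_seq_mult'; [apply is_lim_seq_const|]. apply is_lim_seq_geom. rewrite Rabs_pos_eq; lra. }
  rewrite Rmult_0_r in L. apply is_lim_seq_spec in L. destruct (L (mkposreal eps He)) as [N HN].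
  exists N. intros n Hn. replace (u n - 0)%C with (u n) by ring. specialize (HN n Hn). simpl in HN.
  rewrite Rminus_0_r in HN. apply Rabs_lt_between in HN. specialize (H n). lra.
Qed.

Lemma vseg_lim (lam : C) (nu sig y0 y1 : R) : 0 < nu -> nu + 4 * Cmod (Cexp lam) + 1 <= sig ->
  (forall u k, 0 <= u <= 1 -> off nu (vpath (sig + INR k) y0 y1 u)) ->
  Clim (fun k => path_int (vpath (sig + INR k) y0 y1) (fun _ => (0, y1 - y0)%R) 0 1 (G_integrand lam nu)) 0.
Proof.
  intros Hnu Hs Hoff.
  assert (Hy : forall y, Rmin y0 y1 <= y <= Rmax y0 y1 -> exists u, 0 <= u <= 1 /\ y = y0 + u * (y1 - y0)).
  { intros y Hy. destruct (Req_dec y0 y1) as [<-|N].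
    - exists 0. rewrite Rmin_left, Rmax_left in Hy by lra. split; [lra|lra].
    - exists ((y - y0) / (y1 - y0)). split; [|field; lra].
      destruct (Rle_lt_dec y0 y1) as [L|L].
      + rewrite Rmin_left, Rmax_right in Hy by lra. split.
        * apply Rmult_le_pos; [lra|left; apply Rinv_0_lt_compat; lra].
        * apply Rmult_le_reg_r with (y1 - y0); [lra|]. unfold Rdiv. rewrite Rmult_assoc, Rinv_l; lra.
      + rewrite Rmin_right, Rmax_left in Hy by lra.
        replace ((y - y0) / (y1 - y0)) with ((y0 - y) / (y0 - y1)) by (field; lra). split.
        * apply Rmult_le_pos; [lra|left; apply Rinv_0_lt_compat; lra].
        * apply Rmult_le_reg_r with (y0 - y1); [lra|]. unfold Rdiv. rewrite Rmult_assoc, Rinv_l; lra. }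
  destruct (G_integrand_vertical lam nu sig (Rmin y0 y1) (Rmax y0 y1)) as [B [HB HBd]]; auto.
  { apply Rle_trans with y0; [apply Rmin_l|apply Rmax_l]. }
  { intros y k Hyk. destruct (Hy y Hyk) as [u [Hu ->]]. apply (Hoff u k Hu). }
  apply (Clim_geom _ (B * Rabs (y1 - y0))); [apply Rmult_le_pos; [lra|apply Rabs_pos]|].
  intros k. replace (B * Rabs (y1 - y0) * (/ 4) ^ k) with (B * (/ 4) ^ k * Rabs (y1 - y0)) by ring.
  apply path_int_vpath_bound.
  - intros u Hu. apply cont_G_integrand, Hoff, Hu.
  - intros u Hu. unfold vpath. apply HBd.
    assert (A1 := Rmin_l y0 y1). assert (A2 := Rmin_r y0 y1). assert (A3 := Rmax_l y0 y1). assert (A4 := Rmax_r y0 y1).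
    assert (Y0 : 0 <= (1 - u) * (y0 - Rmin y0 y1)) by (apply Rmult_le_pos; lra).
    assert (Y1 : 0 <= u * (y1 - Rmin y0 y1)) by (apply Rmult_le_pos; lra).
    assert (Y2 : 0 <= (1 - u) * (Rmax y0 y1 - y0)) by (apply Rmult_le_pos; lra).
    assert (Y3 : 0 <= u * (Rmax y0 y1 - y1)) by (apply Rmult_le_pos; lra). lra.
Qed.

(** The definition of a loop does not say on which side of the real axis its rays lie. The turn
    about one far pole decides this; after that [loops_truncated] applies at every large abscissa,
    and the vertical segments vanish in the limit. *)
Lemma loop_value (lam : C) (nu : R) (L dL : R -> C) (T h0 h1 : R) (v : C) : 0 < nu ->
  c1path L dL -> rays L T h0 h1 -> (forall t, off nu (L t)) ->
  (forall k, total_turn L dL (INR k) (- (2 * PI))) ->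
  (forall k, total_turn L dL (nu + INR k)%R (- (2 * PI))) ->
  (forall k, total_turn L dL (- / 2 - INR k)%R 0) ->
  line_lim (V := C_R_NormedModule) (fun t => G_integrand lam nu (L t) * dL t)%C v -> v = loop_int lam nu.
Proof.
  intros Hnu HL HR0 Hoff Ht0 Ht1 Ht2 Hv.
  set (T' := Rmax 1 T). assert (M1 := Rmax_l 1 T). assert (M2 := Rmax_r 1 T). fold T' in M1, M2.
  assert (HR : rays L T' h0 h1). { destruct HR0 as [A1 A2]. split; intros t Ht; [apply A1|apply A2]; lra. }
  destruct (nfloor_ex T' ltac:(lra)) as [N [_ HN]].
  (* A ray on the real axis would run through the poles at large integers. *)
  assert (N0 : h0 <> 0).
  { intros E. destruct (Hoff (- INR (S N))%R) as [O _]. apply (O (S N)).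
    rewrite (proj1 HR); [|rewrite S_INR; lra]. rewrite E, Ropp_involutive. reflexivity. }
  assert (N1 : h1 <> 0).
  { intros E. destruct (Hoff (INR (S N))) as [O _]. apply (O (S N)).
    rewrite (proj2 HR); [|rewrite S_INR; lra]. rewrite E. reflexivity. }
  (* For an integer to the right of the bounded part of the loop, the turn can be read off from the
     rays alone. *)
  assert (Hs : exists k, forall t, slit (INR k - L t)%C).
  { destruct (pcont_bounded L (- T') T') as [K [HK HKb]]; [lra|intros t _; apply (PD_cont _ _ _ (proj1 HL t))|].
    destruct (nfloor_ex K ltac:(lra)) as [k [_ Hk]]. exists (S k). intros t.
    destruct (Rle_lt_dec t (- T')) as [Q|Q].
    - apply slit_im. rewrite (proj1 HR t Q). unfold Im; simpl. lra.
    - destruct (Rle_lt_dec T' t) as [Q'|Q'].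
      + apply slit_im. rewrite (proj2 HR t Q'). unfold Im; simpl. lra.
      + apply slit_re. specialize (HKb t ltac:(lra)). assert (Z := Re_le_Cmod' (L t)).
        replace (Re (INR (S k) - L t)%C) with (INR (S k) - Re (L t)) by (destruct (L t); reflexivity).
        rewrite S_INR. lra. }
  destruct Hs as [k0 Hs].
  assert (Tr := turn_right L dL T' h0 h1 (INR k0) HL HR N0 N1 Hs).
  assert (Eq := line_lim_unique_R _ _ _ (Ht0 k0) Tr). assert (PP := PI_RGT_0).
  (* Of the sign patterns of h0 and h1 only h0 < 0 < h1 gives the turn - 2 PI. *)
  assert (H1 : 0 < h1) by (destruct (Rlt_dec 0 h1) as [Q|Q]; [exact Q|destruct (Rlt_dec 0 h0); lra]).
  assert (H0 : h0 < 0) by (destruct (Rlt_dec 0 h0) as [Q|Q]; [destruct (Rlt_dec 0 h1); lra|lra]).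
  destruct (loop_int_tail lam nu nu Hnu (Rle_refl _)) as [B [R0 [_ [_ HV]]]].
  destruct (HV nu ltac:(lra)) as [Hv0 _]. clear HV.
  set (sig := T' + nu + 4 * Cmod (Cexp lam) + 1).
  assert (P := Cmod_ge_0 (Cexp lam)).
  assert (S1 := Cline_seq _ _ sig Hv). assert (S0 := Cline_seq _ _ sig Hv0).
  assert (V1 : Clim (fun k => path_int (vpath (sig + INR k) h1 1) (fun _ => (0, 1 - h1)%R) 0 1 (G_integrand lam nu)) 0).
  { apply vseg_lim; [exact Hnu|unfold sig; lra|]. intros u k Hu. apply off_im. apply (between_sign h1 1 u Hu). lra. }
  assert (V0 : Clim (fun k => path_int (vpath (sig + INR k) (-1) h0) (fun _ => (0, h0 - -1)%R) 0 1 (G_integrand lam nu)) 0).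
  { apply vseg_lim; [exact Hnu|unfold sig; lra|]. intros u k Hu. apply off_im. apply (between_sign (-1) h0 u Hu). lra. }
  assert (SUM := Clim_plus _ _ _ _ (Clim_plus _ _ _ _ (Clim_plus _ _ _ _ S1 V1) (Clim_opp _ _ S0)) V0).
  assert (Z : (v + 0 + - loop_int lam nu + 0 = 0)%C).
  { eapply Clim_unique; [exact SUM|]. apply (Clim_ext_loc (fun _ => RtoC 0)) with (N := 0%nat); [|apply Clim_const].
    intros k _. symmetry.
    assert (HR1 : rays loop0 T' (-1) 1).
    { destruct rays_loop0 as [A1 A2]. split; intros t Ht; [apply A1|apply A2]; lra. }
    apply (loops_truncated lam nu L dL loop0 dloop0 T' h0 h1 (-1) 1 (sig + INR k)); auto using c1path_loop0; try lra.
    - unfold sig. generalize (pos_INR k). lra.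
    - unfold sig. generalize (pos_INR k). lra.
    - intros t. apply off_loop0, Hnu.
    - intros p [j [E|[E|E]]].
      + apply RtoC_inj in E. subst p. exists (- (2 * PI)). split; [apply Ht0|]. apply turn_loop0_right.
        generalize (pos_INR j). lra.
      + rewrite <- RtoC_plus in E. apply RtoC_inj in E. subst p. exists (- (2 * PI)). split; [apply Ht1|].
        apply turn_loop0_right. generalize (pos_INR j). lra.
      + assert (Q : RtoC (- / 2 - INR j) = (- / 2 - INR j)%C) by (rewrite RtoC_minus, RtoC_opp, RtoC_inv by lra; reflexivity).
        rewrite <- Q in E. apply RtoC_inj in E. subst p. exists 0. split; [apply Ht2|].
        apply turn_loop0_left. generalize (pos_INR j). lra. }
  replace v with (v + 0 + - loop_int lam nu + 0 + loop_int lam nu)%C by ring. rewrite Z. ring.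
Qed.

Lemma meijerG_loop_int (nu : R) (x : C) : 0 < nu ->
  meijerG 3 1 [RtoC (1 / 2); RtoC 1] [RtoC 0; RtoC 0; RtoC nu; RtoC (- nu)] x =
  (loop_int (Clog x) nu / (2 * PI * Ci))%C.
Proof.
  intros Hnu.
  set (a := [RtoC (1 / 2); RtoC 1]). set (b := [RtoC 0; RtoC 0; RtoC nu; RtoC (- nu)]).
  assert (Ext : forall L dL v, 
     @is_RInt_gen C_R_NormedModule (fun t => meijer_integrand 3 1 a b x (L t) * dL t)%C
        (Rbar_locally m_infty) (Rbar_locally p_infty) v <->
     line_lim (V := C_R_NormedModule) (fun t => G_integrand (Clog x) nu (L t) * dL t)%C v).
  { intros L dL v. unfold line_lim.
    assert (E : forall t : R, (meijer_integrand 3 1 a b x (L t) * dL t = G_integrand (Clog x) nu (L t) * dL t)%C).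
    { intros t. unfold a, b. rewrite meijer_integrand_G_integrand. reflexivity. }
    split; apply is_RInt_gen_ext; exists (fun _ => True) (fun _ => True); try (exists 0; auto);
    intros u w _ _ t _; rewrite E; reflexivity. }
  assert (half : forall k, (RtoC (1 / 2) - 1 - INR k)%C = RtoC (- / 2 - INR k)).
  { intros k. rewrite <- !RtoC_minus. f_equal. field. }
  assert (halfC : forall k, RtoC (- / 2 - INR k) = (- / 2 - INR k)%C).
  { intros k. rewrite RtoC_minus, RtoC_opp, RtoC_inv by lra. reflexivity. }
  assert (zer : forall k, (RtoC 0 + INR k)%C = RtoC (INR k)) by (intros; ring).
  unfold meijerG.
  (* The standard loop provides the existence that gives the chosen value its meaning; the loop
     behind that value is then compared with the standard one. *)
  assert (Spec := epsilon_spec (inhabits (RtoC 0)) (is_meijerG 3 1 a b x)).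
  destruct Spec as [L [dL [HL [v [Hv Hg]]]]].
  - exists (loop_int (Clog x) nu / (2 * PI * Ci))%C. exists loop0, dloop0. split.
    + split; [intros t; apply PD_is_derive, c1path_loop0|]. split; [apply c1path_loop0|].
      split; [exists 1, (-1), 1; apply rays_loop0|].
      assert (Ho := fun t => off_loop0 nu t Hnu).
      split.
      * intros be k Hin. unfold b in Hin. cbn [firstn] in Hin.
        assert (Hbe : be = RtoC 0 \/ be = RtoC nu) by (destruct Hin as [E|[E|[E|[]]]]; auto).
        destruct Hbe as [-> | ->].
        -- rewrite zer. split; [intros t; apply (Ho t)|apply turn_loop0_right; generalize (pos_INR k); lra].
        -- split; [intros t; apply (Ho t)|]. rewrite <- RtoC_plus. apply turn_loop0_right. generalize (pos_INR k); lra.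
      * intros al k Hin. unfold a in Hin. cbn [firstn] in Hin. destruct Hin as [<-|[]].
        rewrite half. split; [intros t; rewrite halfC; apply (Ho t)|apply turn_loop0_left; generalize (pos_INR k); lra].
    + exists (loop_int (Clog x) nu). split; [|reflexivity]. apply (proj2 (Ext loop0 dloop0 _)).
      destruct (loop_int_tail (Clog x) nu nu Hnu (Rle_refl _)) as [B [R0 [_ [_ HV]]]]. apply HV. lra.
  - rewrite Hg. apply (proj1 (Ext L dL v)) in Hv.
    cut (v = loop_int (Clog x) nu); [intros ->; reflexivity|].
    destruct HL as [D1 [D2 [[T [h0 [h1 [Ra Rb]]]] [P1 P2]]]].
    assert (In0 : In (RtoC 0) (firstn 3 b)) by (left; reflexivity).
    assert (In1 : In (RtoC nu) (firstn 3 b)) by (right; right; left; reflexivity).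
    assert (In2 : In (RtoC (1 / 2)) (firstn 1 a)) by (left; reflexivity).
    apply (loop_value (Clog x) nu L dL T h0 h1); auto.
    + split; [intros t; apply PD_is_derive, D1|exact D2].
    + split; assumption.
    + intros t. repeat split; intros k.
      * rewrite <- (zer k). apply (P1 _ k In0).
      * apply (P1 _ k In1).
      * rewrite <- halfC, <- half. apply (P2 _ k In2).
    + intros k. rewrite <- (zer k). apply (P1 _ k In0).
    + intros k. rewrite RtoC_plus. apply (P1 _ k In1).
    + intros k. rewrite <- half. apply (P2 _ k In2).
Qed.

(* The residue at a simple pole; unspecified elsewhere. *)
Definition Res (F : C -> C) (p : C) : C :=
  epsilon (inhabits (RtoC 0)) (fun r => exists g : C -> C, continuous g p /\ g p = r /\
     locally p (fun s : C => s <> p -> ((s - p) * F s)%C = g s)).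

Lemma Res_eq (F g : C -> C) (p : C) : continuous g p ->
  locally p (fun s : C => s <> p -> ((s - p) * F s)%C = g s) -> Res F p = g p.
Proof.
  intros Hg HL.
  assert (S : exists g' : C -> C, continuous g' p /\ g' p = Res F p /\
     locally p (fun s : C => s <> p -> ((s - p) * F s)%C = g' s)).
  { unfold Res. apply epsilon_spec. exists (g p), g. auto. }
  destruct S as [g' [H1 [<- H3]]]. apply punctured_eq; auto.
  generalize (filter_and _ _ HL H3). apply filter_imp. intros s [K1 K2] N. rewrite <- K1, <- K2 by exact N. reflexivity.
Qed.

(** * Residues of the integrand *)

Lemma lsum_app (c : C -> C) (l1 l2 : list C) : lsum c (l1 ++ l2) = (lsum c l1 + lsum c l2)%C.
Proof. induction l1 as [|p l IH]; simpl; [ring|]. rewrite IH. ring. Qed.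

Lemma lsum_seq (c : C -> C) (f : nat -> C) (n : nat) :
  lsum c (map f (seq 0 n)) = csum (fun k => c (f k)) n.
Proof.
  induction n as [|n IH]; [reflexivity|]. rewrite seq_S, map_app, lsum_app, IH. simpl. ring.
Qed.

Lemma near_neq0 (f : C -> C) (p : C) : Hol Cuniv f -> f p <> 0 -> locally p (fun s => f s <> 0).
Proof. intros Hf H. apply cont_neq0; [|exact H]. apply (Hol_cont Cuniv); [exact Hf|exact I]. Qed.

Lemma Hol_rG_lin (c d : C) : Hol Cuniv (fun s => rGamma (c * s + d)).
Proof.
  apply (Hol_comp Cuniv Cuniv rGamma (fun s => c * s + d)%C); auto using copen_all, Hol_rGamma, Hol_linear.
Qed.

Lemma Hol_poch_lin (c d : C) (n : nat) : Hol Cuniv (fun s => pochhammer (c * s + d) n).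
Proof.
  apply (Hol_comp Cuniv Cuniv (fun w => pochhammer w n) (fun s => c * s + d)%C);
  auto using copen_all, Hol_pochhammer, Hol_linear.
Qed.

Lemma sgn_neq0 (k : nat) : ((- (1)) ^ k <> 0)%C.
Proof. apply Cpow_nz. intros E. apply (f_equal Re) in E. unfold Re in E; simpl in E. lra. Qed.

Lemma sgn_sq (k : nat) : ((- (1)) ^ k * (- (1)) ^ k = 1)%C.
Proof.
  induction k as [|k IH]; [simpl; ring|]. rewrite !Cpow_S.
  transitivity ((- (1)) ^ k * (- (1)) ^ k)%C; [ring|exact IH].
Qed.

Lemma pochhammer_opp (w : C) (n : nat) : pochhammer (- w) n = ((- (1)) ^ n * ff w n)%C.
Proof.
  induction n as [|n IH]; [simpl; ring|]. rewrite ff_S_right. cbn [pochhammer]. rewrite IH, Cpow_S. ring.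
Qed.

Lemma ff_fact (n : nat) : ff (INR n) n = INR (fact n).
Proof.
  rewrite <- (Cplus_0_l (INR n)), ff_pochhammer. replace (0 + 1)%C with (RtoC 1) by ring. apply pochhammer_1.
Qed.


(** By [rGamma (- s)] = - s [rGamma (1 - s)] one of the two zeros in the denominator cancels, so the
    pole at K = k + 1 is simple. The vanishing factor of the other [rGamma (- s)] is isolated by
    splitting off K + 1 linear factors; [rGamma (nu - K)] is nonzero because nu is not an
    integer. *)
Lemma G_integrand_residue_int (lam : C) (nu : R) (k : nat) : (forall j : nat, nu <> INR j) -> 0 < nu ->
  exists g : C -> C, continuous g (RtoC (INR (S k))) /\
   g (INR (S k)) = (Cexp (INR (S k) * lam) * rGamma (1 + nu + INR (S k)) /
     (INR (S k) * ((- (1)) ^ S k * INR (fact (S k))) * rGamma (nu - INR (S k)) * rGamma (/ 2 + INR (S k))))%C /\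
   locally (RtoC (INR (S k))) (fun s : C => s <> INR (S k) -> ((s - INR (S k)) * G_integrand lam nu s)%C = g s).
Proof.
  intros Hni Hnu. set (K := S k). set (p := RtoC (INR K)).
  assert (Np : p <> 0) by (apply RtoC_neq0, Rgt_not_eq, INR_S_pos).
  assert (Npoch : pochhammer (- (1) * p + 0) K = ((- (1)) ^ K * INR (fact K))%C).
  { replace (- (1) * p + 0)%C with (- INR K)%C by (unfold p; ring). rewrite pochhammer_opp, ff_fact. reflexivity. }
  assert (N1 : pochhammer (- (1) * p + 0) K <> 0).
  { rewrite Npoch. apply Cmult_neq_0; [apply sgn_neq0|apply INR_fact_C_neq0]. }
  assert (E2 : (- (1) * p + (INR K + 1) = 1)%C) by (unfold p; ring).
  assert (N2 : rGamma (- (1) * p + (INR K + 1)) <> 0).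
  { rewrite E2, rGamma_1. intros Q. apply RtoC_inj in Q. lra. }
  assert (N3 : rGamma (nu - p) <> 0).
  { apply rGamma_neq0. intros j Q. destruct (Nat.le_gt_cases K j) as [L|L].
    - apply (f_equal Re) in Q. unfold p in Q. unfold Re, Cminus, Cplus, Copp, RtoC in Q. cbn [fst snd] in Q.
      apply le_INR in L. lra.
    - apply (Hni (K - j)%nat). apply (f_equal Re) in Q. unfold p in Q. unfold Re, Cminus, Cplus, Copp, RtoC in Q. cbn [fst snd] in Q.
      rewrite minus_INR by lia. lra. }
  assert (N4 : rGamma (/ 2 + p) <> 0).
  { apply rGamma_re_pos. unfold p, Re. cbn -[INR]. replace (2 / (2 * (2 * 1) + 0 * (0 * 1))) with (/ 2) by field.
    generalize (pos_INR K). lra. }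
  exists (fun s => (/ (s * pochhammer (- (1) * s + 0) K * rGamma (- (1) * s + (INR K + 1))) *
     (/ rGamma (nu - s) * / rGamma (/ 2 + s) * rGamma (1 + nu + s) * Cexp (s * lam)))%C).
  assert (Ci : continuous (fun s : C => s) p) by apply continuous_id.
  assert (C0 : forall c : C, continuous (fun _ : C => c) p) by (intros; apply continuous_const).
  split; [|split].
  - repeat cmult.
    + apply cont_inv; [|exact (Cmult_neq_0 _ _ (Cmult_neq_0 _ _ Np N1) N2)].
      repeat cmult; [exact Ci| |].
      * apply (Hol_cont Cuniv); [apply Hol_poch_lin|exact I].
      * apply (Hol_cont Cuniv); [apply Hol_rG_lin|exact I].
    + apply cont_inv; [apply cont_rGamma_comp, cont_minus; auto|exact N3].
    + apply cont_inv; [apply cont_rGamma_comp, cont_plus; auto|exact N4].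
    + apply cont_rGamma_comp, cont_plus; auto.
    + apply cont_Cexp_comp, cont_mult; auto.
  - rewrite Npoch, E2, rGamma_1. field. repeat split; auto using sgn_neq0, INR_fact_C_neq0.
  - generalize (filter_and _ _ (copen_neq0 p Np) (filter_and _ _ (near_neq0 _ p (Hol_poch_lin (- (1)) 0 K) N1)
      (near_neq0 _ p (Hol_rG_lin (- (1)) (INR K + 1)) N2))).
    apply filter_imp. intros s [Q0 [Q1 Q2]] Q3. uncast. cbv beta in *.
    assert (E3 := pochhammer_split (- s) (S K)). cbn [pochhammer] in E3.
    replace (- (1) * s + 0)%C with (- s)%C in * by ring.
    replace (- (1) * s + (INR K + 1))%C with (- s + INR (S K))%C in * by (rewrite (S_INR K), RtoC_plus; ring).
    assert (E4 := rGamma_rec (- s)). replace (- s + 1)%C with (1 - s)%C in E4 by ring.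
    assert (Q4 : (- s + INR K <> 0)%C).
    { intros Q. apply Q3. unfold p. replace s with (INR K - (- s + INR K))%C by ring. rewrite Q. ring. }
    assert (Q5 : rGamma (- s) <> 0) by (rewrite E3; exact (Cmult_neq_0 _ _ (Cmult_neq_0 _ _ Q1 Q4) Q2)).
    assert (Q6 : rGamma (1 - s) <> 0) by (intros Q; apply Q5; rewrite E4, Q; ring).
    unfold G_integrand. set (R1 := (/ rGamma (nu - s))%C). set (R2 := (/ rGamma (/ 2 + s))%C).
    transitivity ((s - p) * (/ rGamma (- s) * (/ rGamma (- s) * rGamma (1 - s)) * R1 * R2 * rGamma (1 + nu + s) * Cexp (s * lam)))%C; [cring|].
    replace (/ rGamma (- s) * rGamma (1 - s))%C with (- / s)%C by (rewrite E4; field; auto).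
    rewrite E3. fold K. change (s - p)%C with (s - INR K)%C.
    cfield. repeat split; auto.
Qed.

(** The zero sits in [rGamma (nu - s)], from which k + 1 linear factors are split off; the last one,
    nu - s + k, is minus s - (nu + k), hence the sign. *)
Lemma G_integrand_residue_shift (lam : C) (nu : R) (k : nat) : (forall j : nat, nu <> INR j) -> 0 < nu ->
  exists g : C -> C, continuous g (nu + INR k)%C /\
   g (nu + INR k)%C = (- (Cexp ((nu + INR k) * lam) * rGamma (1 + nu + (nu + INR k)) * rGamma (1 - (nu + INR k))) /
     (((- (1)) ^ k * INR (fact k)) * rGamma (- (nu + INR k)) * rGamma (- (nu + INR k)) * rGamma (/ 2 + (nu + INR k))))%C /\
   locally (nu + INR k)%C (fun s : C => s <> (nu + INR k)%C -> ((s - (nu + INR k)) * G_integrand lam nu s)%C = g s).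
Proof.
  intros Hni Hnu. set (p := (nu + INR k)%C).
  assert (Npoch : pochhammer (- (1) * p + nu) k = ((- (1)) ^ k * INR (fact k))%C).
  { replace (- (1) * p + nu)%C with (- INR k)%C by (unfold p; ring). rewrite pochhammer_opp, ff_fact. reflexivity. }
  assert (N1 : pochhammer (- (1) * p + nu) k <> 0).
  { rewrite Npoch. apply Cmult_neq_0; [apply sgn_neq0|apply INR_fact_C_neq0]. }
  assert (E2 : (- (1) * p + (nu + INR k + 1) = 1)%C) by (unfold p; ring).
  assert (N2 : rGamma (- (1) * p + (nu + INR k + 1)) <> 0).
  { rewrite E2, rGamma_1. intros Q. apply RtoC_inj in Q. lra. }
  assert (N3 : rGamma (- p) <> 0).
  { apply rGamma_neq0. intros j Q. unfold p in Q.
    apply (f_equal Re) in Q. unfold Re, Cminus, Cplus, Copp, RtoC in Q. cbn [fst snd] in Q.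
    destruct (Nat.le_gt_cases k j) as [L|L].
    - apply (Hni (j - k)%nat). rewrite minus_INR by lia. lra.
    - apply lt_INR in L. lra. }
  assert (N4 : rGamma (/ 2 + p) <> 0).
  { apply rGamma_re_pos. unfold p, Re. cbn -[INR]. replace (2 / (2 * (2 * 1) + 0 * (0 * 1))) with (/ 2) by field.
    generalize (pos_INR k). lra. }
  assert (N3' : rGamma (- (1) * p + 0) <> 0) by (replace (- (1) * p + 0)%C with (- p)%C by ring; exact N3).
  exists (fun s => (- / (pochhammer (- (1) * s + nu) k * rGamma (- (1) * s + (nu + INR k + 1))) *
     (/ rGamma (- s) * / rGamma (- s) * / rGamma (/ 2 + s) * rGamma (1 + nu + s) * rGamma (1 - s) * Cexp (s * lam)))%C).
  assert (Ci : continuous (fun s : C => s) p) by apply continuous_id.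
  assert (C0 : forall c : C, continuous (fun _ : C => c) p) by (intros; apply continuous_const).
  split; [|split].
  - repeat cmult.
    + apply cont_opp, cont_inv; [|exact (Cmult_neq_0 _ _ N1 N2)].
      repeat cmult.
      * apply (Hol_cont Cuniv); [apply Hol_poch_lin|exact I].
      * apply (Hol_cont Cuniv); [apply Hol_rG_lin|exact I].
    + apply cont_inv; [apply cont_rGamma_comp, cont_opp; auto|exact N3].
    + apply cont_inv; [apply cont_rGamma_comp, cont_opp; auto|exact N3].
    + apply cont_inv; [apply cont_rGamma_comp, cont_plus; auto|exact N4].
    + apply cont_rGamma_comp, cont_plus; auto.
    + apply cont_rGamma_comp, cont_minus; auto.
    + apply cont_Cexp_comp, cont_mult; auto.
  - rewrite Npoch, E2, rGamma_1. fold p. field. repeat split; auto using sgn_neq0, INR_fact_C_neq0.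
  - generalize (filter_and _ _ (near_neq0 _ p (Hol_poch_lin (- (1)) nu k) N1)
      (filter_and _ _ (near_neq0 _ p (Hol_rG_lin (- (1)) (nu + INR k + 1)) N2)
        (near_neq0 _ p (Hol_rG_lin (- (1)) 0) N3'))).
    apply filter_imp. intros s [Q1 [Q2 Q0]] Q3. uncast. cbv beta in *.
    assert (E3 := pochhammer_split (nu - s) (S k)). cbn [pochhammer] in E3.
    replace (- (1) * s + nu)%C with (nu - s)%C in * by ring.
    replace (- (1) * s + (nu + INR k + 1))%C with (nu - s + INR (S k))%C in * by (rewrite (S_INR k), RtoC_plus; ring).
    assert (Q4 : (nu - s + INR k <> 0)%C).
    { intros Q. apply Q3. unfold p. replace s with (nu + INR k - (nu - s + INR k))%C by ring. rewrite Q. ring. }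
    unfold G_integrand. set (R1 := (/ rGamma (- s))%C). set (R2 := (/ rGamma (/ 2 + s))%C).
    rewrite E3. unfold p. cfield. repeat split; auto.
Qed.

(* Near its double pole at 0 the integrand is [origin_num / (s^2 origin_den)], so that the residue there is the
   derivative of the quotient. *)
Definition origin_num (lam : C) (nu : R) (s : C) : C := (Cexp (s * lam) * rGamma (s + (1 + nu)))%C.
Definition origin_den (nu : R) (s : C) : C :=
  (rGamma (- (1) * s + 1) * rGamma (- (1) * s + nu) * rGamma (1 * s + / 2))%C.

Lemma G_integrand_origin (lam : C) (nu : R) (s : C) : s <> 0 -> rGamma (1 - s) <> 0 -> rGamma (nu - s) <> 0 -> rGamma (/ 2 + s) <> 0 ->
  (s * s * G_integrand lam nu s)%C = (origin_num lam nu s / origin_den nu s)%C.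
Proof.
  intros H0 H1 H2 H3. unfold G_integrand, origin_num, origin_den.
  assert (E4 := rGamma_rec (- s)). replace (- s + 1)%C with (1 - s)%C in E4 by ring.
  replace (- (1) * s + 1)%C with (1 - s)%C by ring. replace (- (1) * s + nu)%C with (nu - s)%C by ring.
  replace (1 * s + / 2)%C with (/ 2 + s)%C by ring. replace (s + (1 + nu))%C with (1 + nu + s)%C by ring.
  rewrite E4. field. repeat split; auto.
Qed.

(** The contour runs along the standard loop out to abscissa a and is closed by a downward segment.
    The conditions on a, [N] and [n] say that exactly the listed poles lie to its left, and each is
    encircled once clockwise. *)
Lemma loop0_closed (lam : C) (nu : R) (N n : nat) (a hi : R) (g0 : C -> C) (r0 : C) :
  0 < nu -> (forall j : nat, nu <> INR j) ->
  hi <= INR (S N) -> hi <= nu + INR n -> INR N < a -> nu + INR n - 1 < a -> a < hi -> 1 <= a ->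
  (forall u, 0 <= u <= 1 -> off nu (vpath a 1 (-1) u)) ->
  CD g0 0 r0 -> locally (RtoC 0) (fun s : C => s <> 0 -> (s * s * G_integrand lam nu s)%C = g0 s) ->
  (path_int loop0 dloop0 (- a) a (G_integrand lam nu) + path_int (vpath a 1 (-1)) (fun _ => (0, -1 - 1)%R) 0 1 (G_integrand lam nu) =
   - (2 * PI * Ci) * (r0 + (csum (fun k => Res (G_integrand lam nu) (INR (S k))) N + csum (fun k => Res (G_integrand lam nu) (nu + INR k)) n)))%C.
Proof.
  intros Hnu Hni Hhi1 Hhi2 HaN Han Hahi Ha1 Hoffv Hg0 Hg0l.
  set (Ga := fun s => in_path loop0 (- a) a s \/ in_path (vpath a 1 (-1)) 0 1 s).
  assert (Haa : - a <= a) by lra.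
  assert (E1 : loop0 a = (a, 1)) by (apply loop0_high; lra).
  assert (E0 : loop0 (- a)%R = (a, -1)) by (rewrite loop0_low by lra; f_equal; ring).
  assert (V1 : vpath a 1 (-1) 0 = (a, 1)) by (unfold vpath; f_equal; ring).
  assert (V1' : vpath a 1 (-1) 1 = (a, -1)) by (unfold vpath; f_equal; ring).
  set (I := fun f => (path_int loop0 dloop0 (- a) a f + path_int (vpath a 1 (-1)) (fun _ => (0, -1 - 1)%R) 0 1 f)%C).
  assert (PF : pathfun Ga I (a, -1) (a, -1)).
  { unfold I. apply (pathfun_cat Ga _ _ _ (a, 1)).
    - rewrite <- E0, <- E1. apply pathfun_in; auto using c1path_loop0. intros s Hs. left. exact Hs.
    - rewrite <- V1, <- V1'. apply pathfun_in; auto using c1path_vpath; [lra|]. intros s Hs. right. exact Hs. }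
  assert (GaOff : forall s, Ga s -> off nu s).
  { intros s [[t [Ht ->]]|[t [Ht ->]]]; [apply off_loop0, Hnu|apply Hoffv, Ht]. }
  (* The loop stays to the right of -1/4, so the strip can begin at -1/2 and contains none of the
     left poles; [poles2 0] is empty. *)
  set (U := strip (- / 2 - INR 0) hi).
  assert (GaU : forall s, Ga s -> U s).
  { intros s [[t [Ht ->]]|[t [Ht ->]]].
    - split; [generalize (loop0_re t); simpl; lra|].
      destruct (Rle_lt_dec t (- 1)) as [K|K].
      + rewrite loop0_low by lra. simpl. lra.
      + destruct (Rle_lt_dec 1 t) as [Q|Q].
        * rewrite loop0_high by lra. simpl. lra.
        * rewrite loop0_mid by lra. simpl. assert (0 <= t * t <= 1) by nra. nra.
    - unfold U, strip, vpath; simpl. lra. }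
  set (l := poles0 N ++ poles1 nu n ++ poles2 0).
  assert (Hpol : forall p, In p (RtoC 0 :: l) ->
     exists x, p = RtoC x /\ 0 <= x < a /\ exists k, (RtoC x = INR k \/ RtoC x = nu + INR k)%C).
  { intros p [<-|Hp].
    - exists 0. split; [reflexivity|]. split; [lra|]. exists 0%nat. left. reflexivity.
    - unfold l in Hp. rewrite !in_app_iff in Hp. unfold poles0, poles1, poles2 in Hp. rewrite !in_map_iff in Hp.
      destruct Hp as [[k [<- Hk]]|[[k [<- Hk]]|[k [<- []]]]]; apply in_seq in Hk.
      + exists (INR (S k)). split; [reflexivity|]. split.
        * split; [apply pos_INR|]. apply Rle_lt_trans with (2 := HaN). apply le_INR. lia.
        * exists (S k). left. reflexivity.
      + exists (nu + INR k). split; [rewrite RtoC_plus; reflexivity|]. split.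
        * split; [generalize (pos_INR k); lra|].
          assert (Q : INR k <= INR (n - 1)) by (apply le_INR; lia). rewrite minus_INR in Q by lia. simpl in Q. lra.
        * exists k. right. rewrite RtoC_plus. reflexivity. }
  assert (offp : forall x k, (RtoC x = INR k \/ RtoC x = nu + INR k)%C -> ~ off nu x).
  { intros x k [K|K] [O1 [O2 O3]]; [exact (O1 k K)|exact (O2 k K)]. }
  assert (Wind : forall p, In p (RtoC 0 :: l) -> ~ Ga p /\ U p /\ I (fun s => / (s - p))%C = (- (2 * PI * Ci))%C).
  { intros p Hp. destruct (Hpol p Hp) as [x [-> [Hx [k Hk]]]]. split; [|split].
    - intros HG. exact (offp x k Hk (GaOff _ HG)).
    - unfold U, strip; simpl. lra.
    - unfold I.
      rewrite (winding_truncated loop0 dloop0 1 (-1) 1 x (- (2 * PI)) a c1path_loop0 rays_loop0); try lra.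
      + rewrite path_int_vpath.
        * rewrite RtoC_opp, RtoC_mult. ring.
        * intros u Hu. apply slit_re. unfold Re; simpl. lra.
      + intros t Q. apply (offp x k Hk). rewrite <- Q. apply off_loop0, Hnu.
      + apply turn_loop0_right. lra. }
  assert (Hst : star U 0) by (apply star_strip; simpl; lra).
  (* The poles off the origin must be simple: the integers and the translates of nu are disjoint
     because nu is not an integer. *)
  assert (Hnd : NoDup (RtoC 0 :: l)).
  { assert (ND : forall f : nat -> C, (forall i j, f i = f j -> i = j) -> forall m, NoDup (map f (seq 0 m))).
    { intros f Hf m. apply NoDup_map_NoDup_ForallPairs; [intros i j _ _; apply Hf|apply seq_NoDup]. }
    constructor.
    - intros Hin. unfold l in Hin. rewrite !in_app_iff in Hin. unfold poles0, poles1, poles2 in Hin. rewrite !in_map_iff in Hin.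
      destruct Hin as [[k [Q Hk]]|[[k [Q Hk]]|[k [Q []]]]].
      + apply RtoC_inj in Q. generalize (INR_S_pos k). lra.
      + rewrite <- RtoC_plus in Q. apply RtoC_inj in Q. generalize (pos_INR k). lra.
    - unfold l, poles2. simpl. rewrite app_nil_r. apply NoDup_app.
      + apply ND. intros i j Q. apply RtoC_inj, INR_eq in Q. lia.
      + apply ND. intros i j Q. rewrite <- !RtoC_plus in Q. apply RtoC_inj in Q. apply INR_eq. lra.
      + intros q Hq1 Hq2. unfold poles0, poles1 in *. rewrite in_map_iff in *.
        destruct Hq1 as [i [<- _]]. destruct Hq2 as [j [Q _]]. rewrite <- RtoC_plus in Q. apply RtoC_inj in Q.
        destruct (Nat.le_gt_cases j (S i)) as [L|L].
        * apply (Hni (S i - j)%nat). rewrite minus_INR by lia. lra.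
        * apply lt_INR in L. lra. }
  assert (RT := residue_theorem Ga U I (a, -1) 0 (- (2 * PI * Ci)) (G_integrand lam nu) (numer lam nu N n 0) l
     (Res (G_integrand lam nu)) g0 r0 PF (copen_strip _ _) Hst GaU (Hol_numer lam nu N n 0 hi Hhi1 Hhi2) Hnd Wind).
  change (I (G_integrand lam nu) = (- (2 * PI * Ci) * (r0 + (csum (fun k => Res (G_integrand lam nu) (INR (S k))) N + csum (fun k => Res (G_integrand lam nu) (nu + INR k)) n)))%C).
  rewrite RT; auto.
  - unfold l. rewrite !lsum_app. unfold poles0, poles1, poles2. rewrite !lsum_seq. simpl (csum _ 0). ring.
  - intros s Hs Hin. apply (G_integrand_decomp lam nu N n 0 hi); auto.
  - intros p Hp. unfold l in Hp. rewrite !in_app_iff in Hp. unfold poles0, poles1, poles2 in Hp. rewrite !in_map_iff in Hp.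
    destruct Hp as [[k [<- _]]|[[k [<- _]]|[k [<- []]]]].
    + destruct (G_integrand_residue_int lam nu k Hni Hnu) as [g [G1 [_ G3]]]. exists g. split; [exact G1|]. split; [|exact G3].
      symmetry. apply Res_eq; assumption.
    + destruct (G_integrand_residue_shift lam nu k Hni Hnu) as [g [G1 [_ G3]]]. exists g. split; [exact G1|]. split; [|exact G3].
      symmetry. apply Res_eq; assumption.
Qed.

Lemma rGamma_pos_real (x : R) : 0 < x -> rGamma x <> 0.
Proof. intros H. apply rGamma_re_pos. exact H. Qed.

Lemma rGamma_half_neq0 : rGamma (/ 2) <> 0.
Proof. replace (/ 2)%C with (RtoC (/ 2)) by (rewrite RtoC_inv by lra; reflexivity). apply rGamma_pos_real. lra. Qed.

(** * Evaluation of the residues *)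

Lemma rGamma_dup_half (p : C) :
  (rGamma (/ 2 + p) * rGamma (p + 1) = rGamma (2 * p + 1) * rGamma (/ 2) * Cexp (2 * p * ln 2))%C.
Proof.
  assert (E := rGamma_dup (p + / 2)).
  replace (p + / 2 + / 2)%C with (p + 1)%C in E by field.
  replace (2 * (p + / 2))%C with (2 * p + 1)%C in E by field.
  replace ((2 * p + 1) * ln 2)%C with (2 * p * ln 2 + ln 2)%C in E by ring.
  rewrite Cexp_add, Cexp_RtoC, exp_ln in E by lra.
  replace (/ 2 + p)%C with (p + / 2)%C by ring. rewrite E. field.
Qed.

Lemma rGamma_reflect_shift (w : C) (k : nat) :
  (rGamma (w - INR k) * rg k (- w) = (- (1)) ^ k * (w * rg 0 w * rg 0 (- w)))%C.
Proof.
  induction k as [|k IH].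
  - unfold rg at 2. simpl (INR 0). simpl. rewrite (rGamma_rec (w - 0)).
    replace (w - 0 + 1)%C with (w + 0 + 1)%C by ring. unfold rg. simpl (INR 0). ring.
  - rewrite Cpow_S.
    transitivity (- (1) * (rGamma (w - INR k) * rg k (- w)))%C; [|rewrite IH; ring].
    rewrite (rg_rec k), (rGamma_rec (w - INR (S k))).
    replace (w - INR (S k) + 1)%C with (w - INR k)%C by (rewrite S_INR, RtoC_plus; ring).
    rewrite S_INR, RtoC_plus. ring.
Qed.

Lemma rGamma_ff (a : C) (m : nat) :
  (rGamma (a + INR (S m) + 1) =
   (a + 2 * INR (S m)) * ff (a + 2 * INR (S m) - 1) m * rGamma (a + 2 * INR (S m) + 1))%C.
Proof.
  rewrite (pochhammer_split _ (S m)), <- ff_pochhammer. cbn [ff].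
  replace (a + INR (S m) + INR (S m))%C with (a + 2 * INR (S m))%C by ring.
  replace (a + INR (S m) + 1 + INR (S m))%C with (a + 2 * INR (S m) + 1)%C by ring. reflexivity.
Qed.

Lemma rg0_neq0 (x : R) : (forall k, x <> - INR (S k)) -> rg 0 x <> 0.
Proof.
  intros H. unfold rg. apply rGamma_neq0. intros k E. apply (H k).
  apply (f_equal Re) in E. unfold Re, Cplus, Copp, RtoC in E. cbn [fst snd] in E. rewrite S_INR.
  change (INR 0) with 0 in E. lra.
Qed.

Lemma rGamma_fact (n : nat) : (rGamma (INR n + 1) * INR (fact n) = 1)%C.
Proof.
  induction n as [|n IH]; [change (INR 0) with 0; change (INR (fact 0)) with 1; rewrite Cplus_0_l, rGamma_1; ring|].
  transitivity (rGamma (INR n + 1) * INR (fact n))%C; [|exact IH]. rewrite (rGamma_rec (INR n + 1)).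
  change (fact (S n)) with (S n * fact n)%nat. rewrite mult_INR, S_INR, !RtoC_mult, !RtoC_plus. ring.
Qed.

(** In the application 2 (l + ln 2) is the logarithm of z^2. The power of 2 from the duplication
    formula cancels its ln 2, so the residues become powers of z / 2. *)
Lemma exp_half_quot (l p : C) : rGamma (/ 2 + p) <> 0 -> rGamma (2 * p + 1) <> 0 ->
  (Cexp (p * (2 * (l + ln 2))) / rGamma (/ 2 + p) =
   Cexp (2 * p * l) * rGamma (p + 1) / (rGamma (2 * p + 1) * rGamma (/ 2)))%C.
Proof.
  intros H1 H2. assert (E := rGamma_dup_half p).
  assert (H3 : rGamma (/ 2) <> 0).
  { apply rGamma_re_pos. unfold Re; simpl. replace (2 / (2 * (2 * 1) + 0 * (0 * 1))) with (/ 2) by field. lra. }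
  replace (p * (2 * (l + ln 2)))%C with (2 * p * l + 2 * p * ln 2)%C by ring. rewrite Cexp_add.
  transitivity (Cexp (2 * p * l) * (rGamma (2 * p + 1) * rGamma (/ 2) * Cexp (2 * p * ln 2)) /
     (rGamma (2 * p + 1) * rGamma (/ 2) * rGamma (/ 2 + p)))%C; [field; auto|].
  rewrite <- E. field. auto.
Qed.

Lemma Cexp_mult_nat (w : C) (n : nat) : Cexp (INR n * w) = (Cexp w ^ n)%C.
Proof.
  induction n as [|n IH]; [simpl; rewrite Cmult_0_l; apply Cexp_0|].
  rewrite S_INR, RtoC_plus, Cmult_plus_distr_r, Cexp_add, IH, Cpow_S, Cmult_1_l. ring.
Qed.

(* Multiplied by nu^2 / (Gamma (1 + nu) Gamma (1 - nu)), the residues become multiples of [cross_term]. *)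
Definition res_scale (nu : R) : C := (nu * nu * rg 0 nu * rg 0 (- nu))%C.

(** Duplication removes the factor with argument 1/2 + K, and reflection turns 1 / [rGamma (nu - K)]
    into a multiple of [rg K (- nu)]; the residues at the integers thus form the series of
    [cross_sum] at sigma = - nu. *)
Lemma residue_int_cross_term (l : C) (nu : R) (m : nat) : 0 < nu -> (forall j : nat, nu <> INR j) ->
  (res_scale nu * Res (G_integrand (2 * (l + ln 2)) nu) (INR (S m)) =
   2 * nu * / rGamma (/ 2) * cross_term (Cexp (2 * l)) m nu (- nu))%C.
Proof.
  intros Hnu Hni. set (lam := (2 * (l + ln 2))%C).
  destruct (G_integrand_residue_int lam nu m Hni Hnu) as [g [G1 [G2 G3]]].
  rewrite (Res_eq _ g _ G1 G3), G2. clear g G1 G2 G3.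
  set (K := S m). assert (NK : RtoC (INR K) <> 0) by (apply RtoC_neq0, Rgt_not_eq, INR_S_pos).
  assert (N1 : rGamma (/ 2 + INR K) <> 0).
  { replace (/ 2 + INR K)%C with (RtoC (/ 2 + INR K)) by (rewrite RtoC_plus, RtoC_inv by lra; reflexivity).
    apply rGamma_pos_real. generalize (pos_INR K). lra. }
  assert (N2 : rGamma (2 * INR K + 1) <> 0).
  { replace (2 * INR K + 1)%C with (RtoC (2 * INR K + 1)) by (rewrite RtoC_plus, RtoC_mult; reflexivity).
    apply rGamma_pos_real. generalize (pos_INR K). lra. }
  assert (E1 := exp_half_quot l (INR K) N1 N2). fold lam in E1.
  replace (2 * INR K * l)%C with (INR K * (2 * l))%C in E1 by ring. rewrite (Cexp_mult_nat (2 * l)) in E1.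
  assert (E2 := rGamma_ff 0 m). rewrite !Cplus_0_l in E2. fold K in E2. rewrite E2 in E1.
  assert (E3 := rGamma_reflect_shift nu K).
  assert (N3 : rg 0 nu <> 0).
  { apply rg0_neq0. intros k. generalize (INR_S_pos k). lra. }
  assert (N4 : rg 0 (- nu) <> 0).
  { rewrite <- RtoC_opp. apply rg0_neq0. intros k. specialize (Hni (S k)). lra. }
  assert (Nn : RtoC nu <> 0) by (apply RtoC_neq0; lra).
  assert (Nh := rGamma_half_neq0).
  assert (Ns := sgn_neq0 K). assert (Ss := sgn_sq K).
  assert (Np : (rGamma (nu - INR K) * rg K (- nu) <> 0)%C).
  { rewrite E3. exact (Cmult_neq_0 _ _ Ns (Cmult_neq_0 _ _ (Cmult_neq_0 _ _ Nn N3) N4)). }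
  assert (N5 : rGamma (nu - INR K) <> 0) by (intros Q; apply Np; rewrite Q; ring).
  assert (N6 : rg K (- nu) <> 0) by (intros Q; apply Np; rewrite Q; ring).
  assert (E4 : (rg K (- nu) * (- (1)) ^ K = nu * rg 0 nu * rg 0 (- nu) / rGamma (nu - INR K))%C).
  { transitivity ((- (1)) ^ K * (rGamma (nu - INR K) * rg K (- nu)) / rGamma (nu - INR K))%C; [field; auto|].
    rewrite E3. transitivity (((- (1)) ^ K * (- (1)) ^ K) * (nu * rg 0 nu * rg 0 (- nu)) / rGamma (nu - INR K))%C; [field; auto|].
    rewrite Ss. field; auto. }
  replace (1 + nu + INR K)%C with (nu + INR K + 1)%C by ring. fold (rg K nu).
  unfold res_scale.
  assert (NF := INR_fact_C_neq0 m).
  assert (NFK := INR_fact_C_neq0 K).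
  transitivity (nu * rg K nu * / (- (1)) ^ K / (INR K * INR (fact K)) * (nu * rg 0 nu * rg 0 (- nu) / rGamma (nu - INR K)) *
    (Cexp (INR K * lam) / rGamma (/ 2 + INR K)))%C; [field; repeat split; auto|].
  rewrite <- E4, E1. unfold cross_term, fu. fold K.
  replace (nu + - nu + 2 * INR K - 1)%C with (2 * INR K - 1)%C by ring.
  assert (EF : RtoC (INR (fact K)) = (INR K * INR (fact m))%C).
  { unfold K. change (fact (S m)) with (S m * fact m)%nat. rewrite mult_INR, RtoC_mult. reflexivity. }
  rewrite EF. field. repeat split; auto.
Qed.

(** A common form of the residues at nu + k: for k = 0 it becomes the constant term of [cross_fun]
    at sigma = nu, for k > 0 the terms of its series. *)
Lemma residue_shift_first (l : C) (nu : R) (k : nat) : 0 < nu -> (forall j : nat, nu <> INR j) ->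
  (res_scale nu * Res (G_integrand (2 * (l + ln 2)) nu) (nu + INR k) =
   - (nu * / rGamma (/ 2) * Cexp (2 * (nu + INR k) * l) * (rg k nu * rg k nu) *
     (rGamma (2 * nu + INR k + 1) / rGamma (2 * nu + 2 * INR k + 1)) / (INR (fact k) * (nu + INR k))))%C.
Proof.
  intros Hnu Hni. set (lam := (2 * (l + ln 2))%C).
  destruct (G_integrand_residue_shift lam nu k Hni Hnu) as [g [G1 [G2 G3]]].
  rewrite (Res_eq _ g _ G1 G3), G2. clear g G1 G2 G3.
  assert (Pk := pos_INR k).
  set (q := (nu + INR k)%C).
  assert (Eq : q = RtoC (nu + INR k)) by (rewrite RtoC_plus; reflexivity).
  assert (Nq : q <> 0) by (rewrite Eq; apply RtoC_neq0; lra).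
  assert (N1 : rGamma (/ 2 + q) <> 0).
  { replace (/ 2 + q)%C with (RtoC (/ 2 + (nu + INR k))) by (rewrite RtoC_plus, RtoC_inv, Eq by lra; reflexivity).
    apply rGamma_pos_real. lra. }
  assert (N2 : rGamma (2 * q + 1) <> 0).
  { replace (2 * q + 1)%C with (RtoC (2 * (nu + INR k) + 1)) by (rewrite RtoC_plus, RtoC_mult, Eq; reflexivity).
    apply rGamma_pos_real. lra. }
  assert (E1 := exp_half_quot l q N1 N2). fold lam in E1.
  assert (E3 := rGamma_reflect_shift (- nu) k).
  replace (- - nu)%C with (RtoC nu) in E3 by ring.
  replace (- nu - INR k)%C with (- q)%C in E3 by (unfold q; ring).
  assert (N3 : rg 0 nu <> 0).
  { apply rg0_neq0. intros j. generalize (INR_S_pos j). lra. }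
  assert (N4 : rg 0 (- nu) <> 0).
  { rewrite <- RtoC_opp. apply rg0_neq0. intros j. specialize (Hni (S j)). lra. }
  assert (Nn : RtoC nu <> 0) by (apply RtoC_neq0; lra).
  assert (Nn' : (- nu <> 0)%C) by (rewrite <- RtoC_opp; apply RtoC_neq0; lra).
  assert (Nh := rGamma_half_neq0).
  assert (Ns := sgn_neq0 k). assert (Ss := sgn_sq k).
  assert (Np : (rGamma (- q) * rg k nu <> 0)%C).
  { rewrite E3. exact (Cmult_neq_0 _ _ Ns (Cmult_neq_0 _ _ (Cmult_neq_0 _ _ Nn' N4) N3)). }
  assert (N5 : rGamma (- q) <> 0) by (intros Q; apply Np; rewrite Q; ring).
  assert (N6 : rg k nu <> 0) by (intros Q; apply Np; rewrite Q; ring).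
  assert (E4 : (- rg k nu * (- (1)) ^ k = nu * rg 0 nu * rg 0 (- nu) / rGamma (- q))%C).
  { transitivity (- ((- (1)) ^ k * (rGamma (- q) * rg k nu)) / rGamma (- q))%C; [field; auto|].
    rewrite E3. transitivity (((- (1)) ^ k * (- (1)) ^ k) * (nu * rg 0 nu * rg 0 (- nu)) / rGamma (- q))%C; [field; auto|].
    rewrite Ss. field; auto. }
  assert (E5 : (rGamma (1 - q) / rGamma (- q) = - / q)%C).
  { assert (Z := rGamma_rec (- q)). replace (- q + 1)%C with (1 - q)%C in Z by ring.
    assert (Nz : rGamma (1 - q) <> 0) by (intros Q; apply N5; rewrite Z, Q; ring).
    rewrite Z. field. split; auto. }
  unfold res_scale.
  assert (NFK := INR_fact_C_neq0 k).
  transitivity (- (nu * rGamma (1 + nu + q) * (rGamma (1 - q) / rGamma (- q)) * / (- (1)) ^ k / INR (fact k) *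
     (nu * rg 0 nu * rg 0 (- nu) / rGamma (- q)) * (Cexp (q * lam) / rGamma (/ 2 + q))))%C;
    [field; repeat split; auto|].
  rewrite <- E4, E1, E5.
  replace (1 + nu + q)%C with (2 * nu + INR k + 1)%C by (unfold q; ring).
  replace (2 * nu + 2 * INR k + 1)%C with (2 * q + 1)%C by (unfold q; ring).
  replace (rGamma (q + 1)) with (rg k nu) by reflexivity.
  field. repeat split; auto.
Qed.

Lemma residue_shift_0 (l : C) (nu : R) : 0 < nu -> (forall j : nat, nu <> INR j) ->
  (res_scale nu * Res (G_integrand (2 * (l + ln 2)) nu) (nu + INR 0) =
   - (/ rGamma (/ 2) * Cexp ((nu + nu) * l) * (rg 0 nu * rg 0 nu)))%C.
Proof.
  intros Hnu Hni. rewrite residue_shift_first by assumption. change (INR 0) with 0.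
  assert (N2 : rGamma (2 * nu + 0 + 1) <> 0).
  { replace (2 * nu + 0 + 1)%C with (RtoC (2 * nu + 1)) by (rewrite RtoC_plus, RtoC_mult; ring).
    apply rGamma_pos_real. lra. }
  assert (Nn : RtoC nu <> 0) by (apply RtoC_neq0; lra).
  assert (Nh := rGamma_half_neq0).
  replace (2 * nu + 2 * 0 + 1)%C with (2 * nu + 0 + 1)%C by ring.
  replace (2 * (nu + 0) * l)%C with ((nu + nu) * l)%C by ring. simpl (INR (fact 0)).
  replace (nu + 0)%C with (RtoC nu) by ring.
  field. repeat split; auto.
Qed.

Lemma residue_shift_cross_term (l : C) (nu : R) (m : nat) : 0 < nu -> (forall j : nat, nu <> INR j) ->
  (res_scale nu * Res (G_integrand (2 * (l + ln 2)) nu) (nu + INR (S m)) =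
   - (/ rGamma (/ 2) * Cexp ((nu + nu) * l) * (2 * nu) * cross_term (Cexp (2 * l)) m nu nu))%C.
Proof.
  intros Hnu Hni. rewrite residue_shift_first by assumption.
  rewrite (rGamma_ff (2 * nu) m). set (K := S m).
  assert (Pk := pos_INR K).
  assert (N2 : rGamma (2 * nu + 2 * INR K + 1) <> 0).
  { replace (2 * nu + 2 * INR K + 1)%C with (RtoC (2 * nu + 2 * INR K + 1)) by (rewrite !RtoC_plus, !RtoC_mult; ring).
    apply rGamma_pos_real. lra. }
  assert (NK : RtoC (INR K) <> 0) by (apply RtoC_neq0, Rgt_not_eq, INR_S_pos).
  assert (Nq : (nu + INR K <> 0)%C) by (rewrite <- RtoC_plus; apply RtoC_neq0; lra).
  assert (Nh := rGamma_half_neq0).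
  replace (2 * (nu + INR K) * l)%C with ((nu + nu) * l + INR K * (2 * l))%C by ring.
  rewrite Cexp_add, Cexp_mult_nat. unfold cross_term, fu. fold K.
  replace (nu + nu + 2 * INR K - 1)%C with (2 * nu + 2 * INR K - 1)%C by ring.
  assert (NF := INR_fact_C_neq0 m).
  assert (EF : RtoC (INR (fact K)) = (INR K * INR (fact m))%C).
  { unfold K. change (fact (S m)) with (S m * fact m)%nat. rewrite mult_INR, RtoC_mult. reflexivity. }
  rewrite EF. field. repeat split; auto.
Qed.

(** * The residue at the origin *)

Lemma CD_rGamma_lin (c d a : C) : CD (fun s => rGamma (c * s + d)) a (D rGamma (c * a + d) * c).
Proof.
  apply (CD_comp rGamma (fun s => c * s + d)%C); [apply Hol_rGamma; exact I|].
  eapply CD_eq; [apply CD_plus; [apply CD_scal, CD_id|apply CD_const]|ring].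
Qed.

Lemma CD_Cexp_lin (c d a : C) : CD (fun s => Cexp (c * s + d)) a (Cexp (c * a + d) * c).
Proof.
  apply (CD_comp Cexp (fun s => c * s + d)%C); [apply CD_Cexp|].
  eapply CD_eq; [apply CD_plus; [apply CD_scal, CD_id|apply CD_const]|ring].
Qed.

(** The duplication formula differentiated at p = 0. Euler's constant stays hidden in [D rGamma 1]
    and cancels in [origin_residue]. *)
Lemma D_rGamma_half : D rGamma (/ 2) = (rGamma (/ 2) * (D rGamma 1 + 2 * ln 2))%C.
Proof.
  assert (L := CD_mult _ _ _ _ _ (CD_rGamma_lin 1 (/ 2) 0) (CD_rGamma_lin 1 1 0)).
  assert (M := CD_mult _ _ _ _ _ (CD_rGamma_lin 2 1 0) (CD_scal (rGamma (/ 2)) _ _ _ (CD_Cexp_lin (2 * ln 2) 0 0))).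
  cbv beta in L, M.
  assert (X : forall s : C, (rGamma (2 * s + 1) * (rGamma (/ 2) * Cexp (2 * ln 2 * s + 0)) =
     rGamma (1 * s + / 2) * rGamma (1 * s + 1))%C).
  { intros s. replace (1 * s + / 2)%C with (/ 2 + s)%C by ring. replace (1 * s + 1)%C with (s + 1)%C by ring.
    rewrite rGamma_dup_half. replace (2 * s * ln 2)%C with (2 * ln 2 * s + 0)%C by ring. ring. }
  assert (E := CD_unique _ _ _ _ L (CD_ext _ _ _ _ X M)).
  replace (2 * ln 2 * 0 + 0)%C with (RtoC 0) in E by ring. rewrite Cexp_0 in E.
  replace (1 * 0 + 1)%C with (RtoC 1) in E by ring. replace (2 * 0 + 1)%C with (RtoC 1) in E by ring.
  replace (1 * 0 + / 2)%C with (/ 2)%C in E by ring. rewrite rGamma_1 in E.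
  transitivity (D rGamma (/ 2) * 1 * 1 + rGamma (/ 2) * (D rGamma 1 * 1) - rGamma (/ 2) * D rGamma 1)%C; [ring|].
  rewrite E. ring.
Qed.

Lemma D_rGamma_rec (w : C) : D rGamma w = (rg 0 w + w * D (rg 0) w)%C.
Proof.
  apply D_eq. apply (CD_ext (fun s => s * rg 0 s)%C).
  - intros s. unfold rg. rewrite (rGamma_rec s). change (INR 0) with 0. replace (s + 0 + 1)%C with (s + 1)%C by ring. reflexivity.
  - eapply CD_eq; [apply (CD_mult (fun s => s) (rg 0) w 1 (D (rg 0) w)); [apply CD_id|apply Hol_rg; exact I]|cbv beta; ring].
Qed.

(** In the logarithmic derivative of the denominator the contributions of [rGamma (1 - s)] and
    [rGamma (1/2 + s)] combine to 2 ln 2, which cancels the one in the logarithm of z^2. There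
    remain l and the derivative of [rg 0] at nu, as in [cross_opp]. *)
Lemma origin_residue (l : C) (nu : R) : 0 < nu ->
  exists r0 : C, CD (fun s => origin_num (2 * (l + ln 2)) nu s / origin_den nu s)%C 0 r0 /\
    origin_den nu 0 <> 0 /\
    (res_scale nu * r0 = / rGamma (/ 2) * (rg 0 (- nu) * (rg 0 nu * (1 + 2 * nu * l) + 2 * nu * D (rg 0) nu)))%C.
Proof.
  intros Hnu. set (lam := (2 * (l + ln 2))%C).
  assert (Nn : RtoC nu <> 0) by (apply RtoC_neq0; lra).
  assert (Nh := rGamma_half_neq0).
  assert (N3 : rg 0 nu <> 0).
  { apply rg0_neq0. intros k. generalize (INR_S_pos k). lra. }
  assert (Eg : rGamma nu = (nu * rg 0 nu)%C).
  { rewrite rGamma_rec. unfold rg. change (INR 0) with 0. replace (nu + 0 + 1)%C with (nu + 1)%C by ring. reflexivity. }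
  assert (ED : origin_den nu 0 = (nu * rg 0 nu * rGamma (/ 2))%C).
  { unfold origin_den. replace (- (1) * 0 + 1)%C with (RtoC 1) by ring. replace (- (1) * 0 + nu)%C with (RtoC nu) by ring.
    replace (1 * 0 + / 2)%C with (/ 2)%C by ring. rewrite rGamma_1, Eg. ring. }
  assert (ND : origin_den nu 0 <> 0) by (rewrite ED; exact (Cmult_neq_0 _ _ (Cmult_neq_0 _ _ Nn N3) Nh)).
  assert (LN : CD (origin_num lam nu) 0 (lam * rg 0 nu + D (rg 0) nu)).
  { apply (CD_ext (fun s => Cexp (lam * s + 0) * rg 0 (1 * s + nu))%C).
    - intros s. unfold origin_num, rg. change (INR 0) with 0. replace (lam * s + 0)%C with (s * lam)%C by ring.
      replace (1 * s + nu + 0 + 1)%C with (s + (1 + nu))%C by ring. reflexivity.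
    - assert (Q : CD (fun s => rg 0 (1 * s + nu)) 0 (D (rg 0) (1 * 0 + nu) * 1)).
      { apply (CD_comp (rg 0) (fun s => 1 * s + nu)%C); [apply Hol_rg; exact I|].
        eapply CD_eq; [apply CD_plus; [apply CD_scal, CD_id|apply CD_const]|ring]. }
      assert (Z := CD_mult _ _ _ _ _ (CD_Cexp_lin lam 0 0) Q). cbv beta in Z.
      eapply CD_eq; [exact Z|]. replace (lam * 0 + 0)%C with (RtoC 0) by ring. rewrite Cexp_0.
      replace (1 * 0 + nu)%C with (RtoC nu) by ring. ring. }
  assert (LD : CD (origin_den nu) 0 (- D rGamma 1 * (rGamma nu * rGamma (/ 2)) - D rGamma nu * rGamma (/ 2) + rGamma nu * D rGamma (/ 2))).
  { assert (Z := CD_mult _ _ _ _ _ (CD_mult _ _ _ _ _ (CD_rGamma_lin (- (1)) 1 0) (CD_rGamma_lin (- (1)) nu 0)) (CD_rGamma_lin 1 (/ 2) 0)).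
    cbv beta in Z. eapply CD_eq; [exact Z|].
    replace (- (1) * 0 + 1)%C with (RtoC 1) by ring. replace (- (1) * 0 + nu)%C with (RtoC nu) by ring.
    replace (1 * 0 + / 2)%C with (/ 2)%C by ring. rewrite rGamma_1. ring. }
  assert (Z := CD_mult _ _ _ _ _ LN (CD_inv _ _ _ LD ND)). cbv beta in Z.
  eexists. split; [exact Z|]. split; [exact ND|].
  assert (EN : origin_num lam nu 0 = rg 0 nu).
  { unfold origin_num, rg. rewrite Cmult_0_l, Cexp_0. change (INR 0) with 0. replace (0 + (1 + nu))%C with (nu + 0 + 1)%C by ring. ring. }
  rewrite ED, EN, D_rGamma_half, (D_rGamma_rec nu), Eg. unfold res_scale, lam. field. repeat split; auto.
Qed.

(** * Summation of the residues *)

Lemma int_between (m k : nat) (th : R) : 0 < th < 1 -> INR m + th <> INR k.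
Proof.
  intros H E. destruct (Nat.le_gt_cases k m) as [L|L].
  - apply le_INR in L. lra.
  - assert (L' : (S m <= k)%nat) by lia. apply le_INR in L'. rewrite S_INR in L'. lra.
Qed.

Lemma loop_int_residues (lam : C) (nu : R) (r0 SA SB : C) : 0 < nu -> (forall j : nat, nu <> INR j) ->
  CD (fun s => origin_num lam nu s / origin_den nu s)%C 0 r0 -> origin_den nu 0 <> 0 ->
  is_Cseries (fun k => Res (G_integrand lam nu) (INR (S k))) SA ->
  is_Cseries (fun k => Res (G_integrand lam nu) (nu + INR k)) SB ->
  loop_int lam nu = (- (2 * PI * Ci) * (r0 + (SA + SB)))%C.
Proof.
  intros Hnu Hni H0 HD HA HB.
  destruct (nfloor_ex nu ltac:(lra)) as [m [Hm1 Hm2]].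
  assert (Hm1' : INR m < nu) by (specialize (Hni m); lra).
  (* [th] is the fractional part of nu. Abscissae with a fractional part strictly between [th] and 1
     avoid the integers and the translates of nu alike. *)
  set (th := nu - INR m). set (tau := (1 + th) / 2).
  assert (Hth : 0 < th < 1) by (unfold th; lra).
  assert (Htau : th < tau < 1) by (unfold tau; lra).
  assert (PL := Cmod_ge_0 (Cexp lam)).
  destruct (nfloor_ex (nu + 4 * Cmod (Cexp lam) + 1) ltac:(lra)) as [j0 [_ Hj0]].
  set (J := S j0). set (sig := INR m + INR J + tau).
  assert (HJ : nu + 4 * Cmod (Cexp lam) + 1 <= sig).
  { unfold sig, J. rewrite S_INR. generalize (pos_INR m). lra. }
  assert (Ea : forall k, sig + INR k = INR (m + (J + k)) + tau).
  { intros k. unfold sig. rewrite !plus_INR. ring. }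
  assert (Hoff : forall u k, 0 <= u <= 1 -> off nu (vpath (sig + INR k) 1 (-1) u)).
  { intros u k _. apply off_re; unfold vpath, Re; cbn [fst]; rewrite Ea.
    - generalize (pos_INR (m + (J + k))). lra.
    - intros i. apply int_between. lra.
    - intros i E. apply (int_between (m + (J + k)) (m + i) (tau - th)); [lra|]. rewrite (plus_INR m i). unfold th. lra. }
  destruct (loop_int_tail lam nu nu Hnu (Rle_refl nu)) as [B [R0 [_ [_ HT]]]].
  destruct (HT nu (conj (Rle_refl nu) (Rle_refl nu))) as [HL _].
  assert (L1 := Cline_seq _ _ sig HL).
  assert (L2 := vseg_lim lam nu sig 1 (-1) Hnu HJ Hoff).
  assert (L3 := Clim_plus _ _ _ _ L1 L2).
  assert (Horig : locally (RtoC 0) (fun s : C => s <> 0 -> (s * s * G_integrand lam nu s)%C = (origin_num lam nu s / origin_den nu s)%C)).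
  { assert (HDl : locally (RtoC 0) (fun s => origin_den nu s <> 0)).
    { apply near_neq0; [|exact HD]. unfold origin_den.
      apply Hol_mult; [exact copen_all| |apply Hol_rG_lin]. apply Hol_mult; [exact copen_all|apply Hol_rG_lin|apply Hol_rG_lin]. }
    revert HDl. apply filter_imp. intros s Hs Hs0. uncast. unfold origin_den in Hs.
    replace (- (1) * s + 1)%C with (1 - s)%C in Hs by ring. replace (- (1) * s + nu)%C with (nu - s)%C in Hs by ring.
    replace (1 * s + / 2)%C with (/ 2 + s)%C in Hs by ring.
    apply G_integrand_origin; auto; intros E; apply Hs; rewrite E; ring. }
  apply (Clim_unique (fun k => CInt (loop_fun lam nu) (- (sig + INR k)) (sig + INR k) +
     path_int (vpath (sig + INR k) 1 (-1)) (fun _ => (0, -1 - 1)%R) 0 1 (G_integrand lam nu))%C).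
  { replace (loop_int lam nu) with (loop_int lam nu + 0)%C by ring. exact L3. }
  (* To the left of sig + k lie the integers up to m + J + k and the J + k + 1 translates nu, ...,
     nu + J + k. *)
  apply (Clim_ext_loc (fun k => - (2 * PI * Ci) * (r0 +
     (csum (fun k => Res (G_integrand lam nu) (INR (S k))) (m + (J + k)) + csum (fun k => Res (G_integrand lam nu) (nu + INR k)) (S (J + k)))))%C) with (N := 0%nat).
  - intros k _. symmetry.
    assert (Q := loop0_closed lam nu (m + (J + k)) (S (J + k)) (sig + INR k) (INR (S (m + (J + k))))
      (fun s => origin_num lam nu s / origin_den nu s)%C r0 Hnu Hni).
    unfold path_int at 1 in Q. apply Q; clear Q; auto; rewrite ?Ea.
    + lra.
    + rewrite !S_INR, !plus_INR. lra.
    + lra.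
    + rewrite !S_INR, !plus_INR. unfold th in *. lra.
    + rewrite S_INR. lra.
    + unfold J. rewrite !plus_INR, S_INR. generalize (pos_INR m) (pos_INR j0) (pos_INR k). lra.
  - apply Clim_scal, Clim_plus; [apply Clim_const|]. apply Clim_plus.
    + apply (Clim_subseq (csum (fun k => Res (G_integrand lam nu) (INR (S k)))) SA (fun k => m + (J + k))%nat); [intros; lia|exact HA].
    + apply (Clim_subseq (csum (fun k => Res (G_integrand lam nu) (nu + INR k))) SB (fun k => S (J + k))%nat); [intros; lia|exact HB].
Qed.

Lemma cross_sum_converges (t mu sigma : C) : is_Cseries (fun m => cross_term t m mu sigma) (cross_sum t mu sigma).
Proof.
  destruct (cross_term_maj t sigma (Cmod mu) (Cmod_ge_0 _)) as [K [q H]].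
  exact (expmaj_converges _ K q (H mu (Rle_refl _))).
Qed.

(** The residue at 0 and those at the positive integers add up to minus [cross_opp], those at nu + k
    to minus [cross_fun], up to the common factor; the clockwise orientation restores the sign. *)
Lemma loop_int_cross_fun (l : C) (nu : R) : 0 < nu -> (forall j : nat, nu <> INR j) ->
  (res_scale nu * (loop_int (2 * (l + ln 2)) nu / (2 * PI * Ci)) =
   / rGamma (/ 2) * (cross_fun l (Cexp (2 * l)) nu nu + cross_opp l (Cexp (2 * l)) nu))%C.
Proof.
  intros Hnu Hni. set (t := Cexp (2 * l)). set (lam := (2 * (l + ln 2))%C).
  assert (Nw : res_scale nu <> 0).
  { assert (Nn : RtoC nu <> 0) by (apply RtoC_neq0; lra).
    assert (N3 : rg 0 nu <> 0).
    { apply rg0_neq0. intros k. generalize (INR_S_pos k). lra. }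
    assert (N4 : rg 0 (- nu) <> 0).
    { rewrite <- RtoC_opp. apply rg0_neq0. intros k. specialize (Hni (S k)). lra. }
    exact (Cmult_neq_0 _ _ (Cmult_neq_0 _ _ (Cmult_neq_0 _ _ Nn Nn) N3) N4). }
  destruct (origin_residue l nu Hnu) as [r0 [H0 [HD E0]]].
  assert (Div : forall x y, (res_scale nu * x = y)%C -> x = (y / res_scale nu)%C).
  { intros x y <-. field. exact Nw. }
  assert (HA : is_Cseries (fun k => Res (G_integrand lam nu) (INR (S k))) (2 * nu * / rGamma (/ 2) / res_scale nu * cross_sum t nu (- nu))).
  { apply (is_Cseries_ext (fun k => 2 * nu * / rGamma (/ 2) / res_scale nu * cross_term t k nu (- nu))%C).
    - intros k. assert (E := residue_int_cross_term l nu k Hnu Hni). fold lam t in E. rewrite (Div _ _ E). field. auto using rGamma_half_neq0.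
    - apply is_Cseries_scal, cross_sum_converges. }
  assert (HB : is_Cseries (fun k => Res (G_integrand lam nu) (nu + INR k))
     (Res (G_integrand lam nu) (nu + INR 0) + - / rGamma (/ 2) * Cexp ((nu + nu) * l) * (2 * nu) / res_scale nu * cross_sum t nu nu)).
  { apply (is_Cseries_decr (fun k => Res (G_integrand lam nu) (nu + INR k))).
    apply (is_Cseries_ext (fun k => - / rGamma (/ 2) * Cexp ((nu + nu) * l) * (2 * nu) / res_scale nu * cross_term t k nu nu)%C).
    - intros k. assert (E := residue_shift_cross_term l nu k Hnu Hni). fold lam t in E. rewrite (Div _ _ E). field. auto using rGamma_half_neq0.
    - apply is_Cseries_scal, cross_sum_converges. }
  rewrite (loop_int_residues lam nu r0 _ _ Hnu Hni H0 HD HA HB).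
  unfold lam. rewrite (Div _ _ (residue_shift_0 l nu Hnu Hni)), (Div _ _ E0).
  unfold cross_fun, cross_opp. assert (NP := two_PI_Ci_neq0). assert (Nh := rGamma_half_neq0).
  set (P := (2 * PI * Ci)%C) in *. field. repeat split; auto.
Qed.

(* The factors of the integrand that do not depend on the order. *)
Definition loop_weight (lam : C) (t : R) : C :=
  (/ rGamma (- loop0 t) * / rGamma (- loop0 t) * / rGamma (/ 2 + loop0 t) *
   rGamma (1 - loop0 t) * Cexp (loop0 t * lam) * dloop0 t)%C.

(** * Continuity of the loop integral in the order *)

Lemma cont_loop0 (t : R) : continuous loop0 t.
Proof. apply (PD_cont _ _ _ (proj1 c1path_loop0 t)). Qed.

Lemma cont_loop_weight (lam : C) (t : R) : continuous (loop_weight lam) t.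
Proof.
  assert (Cl := cont_loop0 t).
  assert (C0 : forall c : C, continuous (fun _ : R => c) t) by (intros; apply continuous_const).
  destruct (off_nonzero 1 (loop0 t) (off_loop0 1 t Rlt_0_1)) as [N1 [_ N3]].
  unfold loop_weight. repeat cmult.
  - apply cont_inv; [apply cont_rGamma_comp, cont_opp, Cl|exact N1].
  - apply cont_inv; [apply cont_rGamma_comp, cont_opp, Cl|exact N1].
  - apply cont_inv; [apply cont_rGamma_comp, cont_plus; auto|exact N3].
  - apply cont_rGamma_comp, cont_minus; auto.
  - apply cont_Cexp_comp, cont_mult; auto.
  - apply c1path_loop0.
Qed.

Lemma loop_fun_weight (lam : C) (nu t : R) :
  loop_fun lam nu t = (/ rGamma (nu - loop0 t) * rGamma (1 + nu + loop0 t) * loop_weight lam t)%C.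
Proof. unfold loop_fun, G_integrand, loop_weight. ring. Qed.

(** Only two factors of the integrand contain nu, and changing nu translates their arguments, so
    [unif_along] controls both increments uniformly on the bounded part of the loop. *)
Lemma cont_CInt_loop_fun (lam : C) (nu a : R) : 0 < nu -> 0 <= a ->
  continuous (fun mu => CInt (loop_fun lam mu) (- a) a) nu.
Proof.
  intros Hnu Ha. apply cont_C. intros eps He.
  assert (Hab : - a <= a) by lra.
  set (P := fun s => (/ rGamma s)%C). set (U := fun s => rGamma s <> 0).
  set (A1 := fun t => (nu - loop0 t)%C). set (A2 := fun t => (1 + nu + loop0 t)%C).
  assert (HU : copen U).
  { intros s Hs. apply cont_neq0; [apply (Hol_cont Cuniv); [apply Hol_rGamma|exact I]|exact Hs]. }
  assert (C0 : forall (c : C) (t : R), continuous (fun _ : R => c) t) by (intros; apply continuous_const).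
  assert (CA1 : pcont A1 (- a) a) by (intros t _; apply cont_minus; auto using cont_loop0).
  assert (CA2 : pcont A2 (- a) a) by (intros t _; apply cont_plus; auto using cont_loop0).
  assert (HA1 : forall t, U (A1 t)) by (intros t; apply (off_nonzero nu (loop0 t)), off_loop0, Hnu).
  assert (CP : forall s, U s -> continuous P s).
  { intros s Hs. apply cont_inv; [|exact Hs]. apply (Hol_cont Cuniv); [apply Hol_rGamma|exact I]. }
  assert (CG : forall s : C, continuous rGamma s) by (intros s; apply (Hol_cont Cuniv); [apply Hol_rGamma|exact I]).
  destruct (pcont_bounded (fun t => P (A1 t)) (- a) a Hab) as [B1 [HB1 K1]].
  { intros t Ht. apply (continuous_comp A1 P); [apply CA1, Ht|apply CP, HA1]. }
  destruct (pcont_bounded (fun t => rGamma (A2 t)) (- a) a Hab) as [B2 [HB2 K2]].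
  { intros t Ht. apply cont_rGamma_comp, CA2, Ht. }
  destruct (pcont_bounded (loop_weight lam) (- a) a Hab) as [B3 [HB3 K3]].
  { intros t _. apply cont_loop_weight. }
  set (X := (2 * a + 1) * (B3 * (B1 + B2 + 1))).
  assert (HX : 0 < X) by (unfold X; repeat apply Rmult_lt_0_compat; lra).
  (* The bound 1 makes the product of the two increments at most e, so all three error terms are
     linear in e. *)
  set (e := Rmin 1 (eps / (2 * X))).
  assert (Hq : 0 < eps / (2 * X)) by (apply Rdiv_lt_0_compat; lra).
  assert (He0 : 0 < e) by (apply Rmin_pos; lra).
  assert (He1 : e <= 1) by apply Rmin_l.
  assert (HeX : e * X < eps).
  { apply Rle_lt_trans with (eps / (2 * X) * X); [apply Rmult_le_compat_r; [lra|apply Rmin_r]|].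
    replace (eps / (2 * X) * X) with (eps / 2) by (field; lra). lra. }
  destruct (unif_along U P A1 (- a) a HU CP CA1 ltac:(auto) e He0) as [d1 [Hd1 L1]].
  destruct (unif_along Cuniv rGamma A2 (- a) a copen_all ltac:(auto) CA2 ltac:(intros; exact I) e He0) as [d2 [Hd2 L2]].
  assert (Hd : 0 < Rmin (nu / 2) (Rmin d1 d2)) by (repeat apply Rmin_pos; lra).
  exists (mkposreal _ Hd). intros mu Hmu. uncast.
  unfold ball in Hmu; simpl in Hmu; unfold AbsRing_ball, abs, minus, plus, opp in Hmu; simpl in Hmu.
  assert (M1 := Rmin_l (nu / 2) (Rmin d1 d2)). assert (M2 := Rmin_r (nu / 2) (Rmin d1 d2)).
  assert (M3 := Rmin_l d1 d2). assert (M4 := Rmin_r d1 d2).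
  set (h := RtoC (mu - nu)).
  assert (Hh : Cmod h < Rmin d1 d2) by (unfold h; rewrite Cmod_R; unfold Rminus; lra).
  assert (Hmu0 : 0 < mu) by (apply Rabs_lt_between in Hmu; lra).
  rewrite <- CInt_minus by (auto; intros t _; apply cont_loop_fun; assumption).
  apply Rle_lt_trans with ((a - - a) * (e * (B3 * (B1 + B2 + 1)))).
  - apply CInt_norm; [exact Hab|intros t _; apply cont_minus; apply cont_loop_fun; assumption|].
    intros t Ht. rewrite !loop_fun_weight.
    destruct (L1 t h Ht ltac:(lra)) as [_ Q1]. destruct (L2 t h Ht ltac:(lra)) as [_ Q2].
    replace (A1 t + h)%C with (mu - loop0 t)%C in Q1 by (unfold A1, h; rewrite RtoC_minus; ring).
    replace (A2 t + h)%C with (1 + mu + loop0 t)%C in Q2 by (unfold A2, h; rewrite RtoC_minus; ring).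
    specialize (K1 t Ht). specialize (K2 t Ht). specialize (K3 t Ht). cbv beta in K1, K2.
    fold (A1 t) (A2 t). fold (P (A1 t)) (P (mu - loop0 t)%C).
    set (p := P (A1 t)) in *. set (p' := P (mu - loop0 t)%C) in *. set (q := rGamma (A2 t)) in *.
    set (q' := rGamma (1 + mu + loop0 t)) in *. set (w := loop_weight lam t) in *.
    replace (p' * q' * w - p * q * w)%C with (w * ((p' - p) * (q' - q) + (p' - p) * q + p * (q' - q)))%C by ring.
    rewrite Cmod_mult.
    assert (T1 := Cmod_triangle ((p' - p) * (q' - q) + (p' - p) * q) (p * (q' - q))).
    assert (T2 := Cmod_triangle ((p' - p) * (q' - q)) ((p' - p) * q)). rewrite !Cmod_mult in T1, T2.
    assert (Z1 := Cmod_ge_0 (p' - p)). assert (Z2 := Cmod_ge_0 (q' - q)). assert (Z3 := Cmod_ge_0 p). assert (Z4 := Cmod_ge_0 q).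
    assert (Y1 : Cmod (p' - p) * Cmod (q' - q) <= e * 1) by (apply Rmult_le_compat; lra).
    assert (Y2 : Cmod (p' - p) * Cmod q <= e * B2) by (apply Rmult_le_compat; lra).
    assert (Y3 : Cmod p * Cmod (q' - q) <= B1 * e) by (apply Rmult_le_compat; lra).
    replace (e * (B3 * (B1 + B2 + 1))) with (B3 * (e * 1 + e * B2 + B1 * e)) by ring.
    rewrite (Cmod_mult (p' - p) q) in T2.
    apply Rmult_le_compat; try apply Cmod_ge_0; [exact K3|lra].
  - apply Rle_lt_trans with (2 := HeX). replace (a - - a) with (2 * a) by ring.
    replace (2 * a * (e * (B3 * (B1 + B2 + 1)))) with (e * (2 * a * (B3 * (B1 + B2 + 1)))) by ring.
    apply Rmult_le_compat_l; [lra|]. unfold X. apply Rmult_le_compat_r; [|lra].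
    left. apply Rmult_lt_0_compat; lra.
Qed.

(** An argument with three thirds of [eps]: the tails are small uniformly for orders in
    [nu / 2, nu + 1], and the truncated integral is continuous. *)
Lemma cont_loop_int (lam : C) (nu : R) : 0 < nu -> continuous (loop_int lam) nu.
Proof.
  intros Hnu. apply cont_C. intros eps He.
  destruct (loop_int_tail lam (nu / 2) (nu + 1) ltac:(lra) ltac:(lra)) as [B [R0 [HB [HR0 HT]]]].
  set (a := R0 + 4 * (B + 1) / eps).
  assert (Q : 0 < 4 * (B + 1) / eps) by (apply Rdiv_lt_0_compat; lra).
  assert (Ha : R0 <= a) by (unfold a; lra).
  assert (Hs : B * exp (- a) < eps / 3).
  { apply Rle_lt_trans with (B * (eps / (4 * (B + 1)))).
    - apply Rmult_le_compat_l; [exact HB|]. rewrite exp_Ropp.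
      replace (eps / (4 * (B + 1))) with (/ (4 * (B + 1) / eps)) by (field; lra).
      apply Rinv_le_contravar; [exact Q|]. apply Rle_trans with a; [unfold a; lra|].
      generalize (exp_ineq1_le a). lra.
    - replace (B * (eps / (4 * (B + 1)))) with (eps / 4 * (B / (B + 1))) by (field; lra).
      assert (B / (B + 1) <= 1) by (apply Rle_div_l; lra).
      assert (eps / 4 * (B / (B + 1)) <= eps / 4 * 1) by (apply Rmult_le_compat_l; lra). lra. }
  assert (L := proj1 (cont_C _ _) (cont_CInt_loop_fun lam nu a Hnu ltac:(lra)) (eps / 3) ltac:(lra)).
  assert (Hd : 0 < Rmin (nu / 2) 1) by (apply Rmin_pos; lra).
  assert (L2 : locally nu (fun mu : R => Rabs (mu - nu) < Rmin (nu / 2) 1)).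
  { exists (mkposreal _ Hd). intros mu Hmu. exact Hmu. }
  generalize (filter_and _ _ L L2). apply filter_imp. intros mu [H1 H2]. uncast.
  assert (M1 := Rmin_l (nu / 2) 1). assert (M2 := Rmin_r (nu / 2) 1).
  apply Rabs_lt_between in H2.
  destruct (HT mu ltac:(lra)) as [_ T1]. destruct (HT nu ltac:(lra)) as [_ T2].
  specialize (T1 a Ha). specialize (T2 a Ha).
  set (i := CInt (loop_fun lam mu) (- a) a) in *. set (j := CInt (loop_fun lam nu) (- a) a) in *.
  replace (loop_int lam mu - loop_int lam nu)%C with ((loop_int lam mu - i) + (i - j) + - (loop_int lam nu - j))%C by ring.
  assert (Y1 := Cmod_triangle ((loop_int lam mu - i) + (i - j)) (- (loop_int lam nu - j))).
  assert (Y2 := Cmod_triangle (loop_int lam mu - i) (i - j)). rewrite Cmod_opp in Y1. lra.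
Qed.

(** * Principal logarithms in the right half-plane *)

Lemma atan_half (x y r : R) : 0 < x -> 0 <= r -> r * r = x * x + y * y ->
  2 * atan (y / (r + x)) = atan (y / x).
Proof.
  intros Hx Hr E. set (u := y / (r + x)).
  assert (Hy : - r <= y <= r) by (split; nra).
  assert (Hu : -1 < u < 1).
  { unfold u. split; [apply Rlt_div_r|apply Rlt_div_l]; lra. }
  assert (B1 : - (PI / 4) < atan u < PI / 4).
  { rewrite <- atan_1. rewrite <- atan_opp. split; apply atan_increasing; lra. }
  assert (P := PI_RGT_0).
  assert (N1 : 0 < cos (atan u)) by (apply cos_gt_0; lra).
  assert (N2 : 0 < cos (2 * atan u)) by (apply cos_gt_0; lra).
  assert (N3 : 1 - u * u <> 0) by nra.
  assert (T := tan_2a (atan u) ltac:(lra) ltac:(lra)). rewrite !tan_atan in T. specialize (T N3).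
  rewrite <- (atan_tan (2 * atan u)) by lra. rewrite T. f_equal.
  assert (W : u * (r + x) = y) by (unfold u; field; lra).
  assert (K : y * (r + x) = u * (r + x) * (r + x)) by (rewrite W; ring).
  assert (K2 : 2 * x * u * ((r + x) * (r + x)) = y * (1 - u * u) * ((r + x) * (r + x))).
  { transitivity (2 * x * y * (r + x)); [rewrite <- W; ring|].
    transitivity (y * ((r + x) * (r + x) - (u * (r + x)) * (u * (r + x)))); [rewrite W; nra|ring]. }
  assert (K3 : 2 * x * u = y * (1 - u * u)).
  { apply Rmult_eq_reg_r with (2 := Rgt_not_eq _ _ (Rmult_lt_0_compat (r + x) (r + x) ltac:(lra) ltac:(lra))). exact K2. }
  transitivity (2 * x * u / (x * (1 - u * u))); [field; lra|]. rewrite K3. field. lra.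
Qed.

Lemma Cmod_sq (z : C) : Cmod z * Cmod z = Re z * Re z + Im z * Im z.
Proof.
  unfold Cmod. rewrite sqrt_sqrt; [unfold Re, Im; ring|]. unfold Re, Im. nra.
Qed.

Lemma Clog_scale (z : C) (c : R) : 0 < c -> 0 < Re z -> Clog (c * z) = (Clog z + ln c)%C.
Proof.
  intros Hc Hz. unfold Clog, Carg. rewrite Cmod_mult, Cmod_R, (Rabs_pos_eq c) by lra.
  assert (E1 : Re (c * z)%C = c * Re z) by (unfold Re, Cmult, RtoC; simpl; ring).
  assert (E2 : Im (c * z)%C = c * Im z) by (unfold Im, Cmult, RtoC; simpl; ring).
  rewrite E1, E2. assert (Q := Cmod_ge_0 z). assert (Hm := Re_le_Cmod' z).
  assert (Q2 : 0 < c * Re z) by (apply Rmult_lt_0_compat; lra).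
  assert (Q3 : 0 <= c * Cmod z) by (apply Rmult_le_pos; lra).
  destruct (Rlt_dec 0 (c * Cmod z + c * Re z)) as [L|L]; [|lra].
  destruct (Rlt_dec 0 (Cmod z + Re z)) as [L'|L']; [|lra].
  rewrite ln_mult by lra. unfold Cplus, RtoC; simpl. f_equal; [ring|]. rewrite Rplus_0_r.
  do 2 f_equal. field. lra.
Qed.

(** Since |z^2| + Re z^2 = 2 (Re z)^2, the half-angle tangent of z^2 is Im z / Re z, the tangent of
    the argument of z itself. Positivity of the real part keeps the doubled argument within (- PI,
    PI). *)
Lemma Clog_sq (z : C) : 0 < Re z -> Clog (z ^ 2) = (2 * Clog z)%C.
Proof.
  intros Hz. replace (z ^ 2)%C with (z * z)%C by ring.
  assert (Q := Cmod_ge_0 z). assert (Hm := Re_le_Cmod' z). assert (S := Cmod_sq z).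
  unfold Clog, Carg. rewrite Cmod_mult.
  assert (E1 : Re (z * z)%C = Re z * Re z - Im z * Im z) by (unfold Re, Im, Cmult; simpl; ring).
  assert (E2 : Im (z * z)%C = 2 * (Re z * Im z)) by (unfold Re, Im, Cmult; simpl; ring).
  rewrite E1, E2, S.
  replace (Re z * Re z + Im z * Im z + (Re z * Re z - Im z * Im z)) with (2 * (Re z * Re z)) by ring.
  assert (P : 0 < Re z * Re z) by (apply Rmult_lt_0_compat; lra).
  destruct (Rlt_dec 0 (2 * (Re z * Re z))) as [L|L]; [|lra].
  destruct (Rlt_dec 0 (Cmod z + Re z)) as [L'|L']; [|lra].
  rewrite <- S, ln_mult by lra.
  replace (2 * (Re z * Im z) / (2 * (Re z * Re z))) with (Im z / Re z) by (field; lra).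
  rewrite <- (atan_half (Re z) (Im z) (Cmod z)) by lra.
  unfold Cmult, RtoC; simpl. f_equal; ring.
Qed.

Lemma Cexp_Clog (z : C) : 0 < Re z -> Cexp (Clog z) = z.
Proof.
  intros Hz. assert (Hm := Re_le_Cmod' z). assert (S := Cmod_sq z).
  set (x := Re z) in *. set (y := Im z) in *. set (r := Cmod z) in *.
  assert (E : Carg z = atan (y / x)).
  { unfold Carg. fold r x y. destruct (Rlt_dec 0 (r + x)) as [L|L]; [|lra]. apply atan_half; lra. }
  unfold Cexp, Clog. fold r. simpl. rewrite E, exp_ln by lra. rewrite cos_atan, sin_atan.
  assert (R1 : sqrt (1 + (y / x)²) = r / x).
  { apply Rsqr_inj; [apply sqrt_pos|apply Rmult_le_pos; [lra|left; apply Rinv_0_lt_compat, Hz]|].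
    rewrite Rsqr_sqrt by (generalize (Rle_0_sqr (y / x)); lra). unfold Rsqr.
    transitivity ((x * x + y * y) / (x * x)); [field; lra|]. rewrite <- S. field. lra. }
  rewrite R1. rewrite (surjective_pairing z). change (fst z) with x. change (snd z) with y. f_equal; field; lra.
Qed.

Lemma Clog_square_half (z : C) : 0 < Re z -> Clog (z ^ 2) = (2 * (Clog (z / 2) + ln 2))%C.
Proof.
  intros Hz. rewrite Clog_sq by exact Hz.
  assert (Hz2 : 0 < Re (z / 2)%C).
  { replace (z / 2)%C with (/ 2 * z)%C by (field). replace (/ 2)%C with (RtoC (/ 2)) by (rewrite RtoC_inv by lra; reflexivity).
    unfold Re, Cmult, RtoC in *; simpl. lra. }
  rewrite <- (Clog_scale (z / 2) 2) by lra. do 2 f_equal. field.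
Qed.

Lemma Re_half (z : C) : 0 < Re z -> 0 < Re (z / 2)%C.
Proof.
  intros Hz. replace (z / 2)%C with (/ 2 * z)%C by (field). replace (/ 2)%C with (RtoC (/ 2)) by (rewrite RtoC_inv by lra; reflexivity).
  unfold Re, Cmult, RtoC in *; simpl. lra.
Qed.

Lemma Cexp_2_Clog (z : C) : 0 < Re z -> Cexp (2 * Clog z) = (z ^ 2)%C.
Proof.
  intros Hz. replace (2 * Clog z)%C with (Clog z + Clog z)%C by ring. rewrite Cexp_add, Cexp_Clog by exact Hz. ring.
Qed.

(** * Translation of the functions in the theorem *)

Lemma BesselI_bessel (mu : R) (z : C) : BesselI mu z = bessel (Clog (z / 2)) ((z / 2) ^ 2) mu.
Proof.
  unfold BesselI, bessel, bessel_sum, Cpower. f_equal. apply CSeries_ext. intros k. unfold bessel_term, rg.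
  rewrite Cpow_mult_r. reflexivity.
Qed.

Lemma pochhammer_cat (w : C) (n m : nat) : pochhammer w (n + m) = (pochhammer w n * pochhammer (w + INR n) m)%C.
Proof.
  induction m as [|m IH]; [rewrite Nat.add_0_r; simpl; ring|].
  rewrite Nat.add_succ_r. cbn [pochhammer]. rewrite IH, plus_INR, RtoC_plus. ring.
Qed.

(** Duplication gives 4^K (nu)_K (nu + 1/2)_K = (2 nu)_(2 K), which factors as 2 nu, then (2 nu +
    1)_K, which cancels a lower parameter, then the falling factorial of [cross_term]. The term of
    index 0 is the constant term of [cross_fun]. *)
Lemma hypergeometric_cross_fun (nu : R) (z : C) : 0 < nu ->
  (Cpower (z / 2) (2 * nu) / Gamma (nu + 1) ^ 2 *
    hypergeometric [RtoC nu; RtoC (nu + 1 / 2)]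
           [RtoC (nu + 1); RtoC (nu + 1); RtoC (2 * nu + 1)] (z ^ 2) =
   cross_fun (Clog (z / 2)) ((z / 2) ^ 2) nu nu)%C.
Proof.
  intros Hnu. set (l := Clog (z / 2)). set (t := ((z / 2) ^ 2)%C).
  assert (Ng : rg 0 nu <> 0).
  { apply rg0_neq0. intros k. generalize (INR_S_pos k). lra. }
  assert (Poch : forall (x : R) n, 0 < x -> pochhammer x n <> 0).
  { intros x n Hx. destruct (pochhammer_real x n Hx) as [y [Hy ->]]. apply RtoC_neq0. lra. }
  assert (H : hypergeometric [RtoC nu; RtoC (nu + 1 / 2)]
           [RtoC (nu + 1); RtoC (nu + 1); RtoC (2 * nu + 1)] (z ^ 2) =
     (1 + 2 * nu / (rg 0 nu * rg 0 nu) * cross_sum t nu nu)%C).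
  { unfold hypergeometric. apply CSeries_eq.
    set (a := fun k : nat => _).
    replace (RtoC 1) with (a 0%nat) by (unfold a; simpl; field).
    apply is_Cseries_decr.
    apply (is_Cseries_ext (fun m => 2 * nu / (rg 0 nu * rg 0 nu) * cross_term t m nu nu)%C);
      [|apply is_Cseries_scal, cross_sum_converges].
    intros m. unfold a, cross_term, fu. cbn [map Cprod fold_right]. set (K := S m).
    assert (E0 : rg 0 nu = (pochhammer (RtoC (nu + 1)) K * rg K nu)%C).
    { unfold rg. change (INR 0) with 0. rewrite (pochhammer_split _ K), RtoC_plus.
      replace (nu + 0 + 1)%C with (nu + 1)%C by ring. do 2 f_equal. ring. }
    assert (E1 : (4 ^ K * (pochhammer nu K * pochhammer (RtoC (nu + 1 / 2)) K) =
       2 * nu * pochhammer (RtoC (2 * nu + 1)) K * ff (nu + nu + 2 * INR K - 1) m)%C).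
    { replace (RtoC (nu + 1 / 2)) with (nu + / 2)%C by (rewrite RtoC_plus, RtoC_div by lra; field).
      rewrite <- pochhammer_double. replace (2 * K)%nat with (S (K + m)) by (unfold K; lia).
      rewrite pochhammer_S_left, pochhammer_cat.
      replace (RtoC (2 * nu + 1)) with (2 * nu + 1)%C by (rewrite RtoC_plus, RtoC_mult; reflexivity).
      replace (nu + nu + 2 * INR K - 1)%C with (2 * nu + INR K + INR m)%C.
      - rewrite ff_pochhammer. replace (2 * nu + 1 + INR K)%C with (2 * nu + INR K + 1)%C by ring. ring.
      - unfold K. rewrite S_INR, RtoC_plus. ring. }
    assert (Et : (t ^ K * 4 ^ K = (z ^ 2) ^ K)%C).
    { rewrite <- Cpow_mult_l. f_equal. unfold t. field. }
    assert (N4 : (4 ^ K <> 0)%C) by (apply Cpow_nz, RtoC_neq0; lra).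
    assert (NF := INR_fact_C_neq0 m).
    assert (NK : RtoC (INR K) <> 0) by (apply RtoC_neq0, Rgt_not_eq, INR_S_pos).
    assert (EF : RtoC (INR (fact K)) = (INR K * INR (fact m))%C).
    { unfold K. change (fact (S m)) with (S m * fact m)%nat. rewrite mult_INR, RtoC_mult. reflexivity. }
    assert (P1 := Poch (nu + 1) K ltac:(lra)). assert (P2 := Poch (2 * nu + 1) K ltac:(lra)).
    assert (Nr : rg K nu <> 0) by (intros Q; apply Ng; rewrite E0, Q; ring).
    rewrite <- Et, EF, E0.
    transitivity ((2 * nu * pochhammer (RtoC (2 * nu + 1)) K * ff (nu + nu + 2 * INR K - 1) m) * t ^ K /
      (pochhammer (RtoC (nu + 1)) K * pochhammer (RtoC (nu + 1)) K * pochhammer (RtoC (2 * nu + 1)) K * INR K * INR (fact m)))%C;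
      [field; repeat split; auto|].
    rewrite <- E1. field. repeat split; auto. }
  rewrite H. unfold Cpower, Gamma, cross_fun. fold l.
  assert (E : rGamma (nu + 1) = rg 0 nu).
  { unfold rg. change (INR 0) with 0. f_equal. ring. }
  rewrite E. replace (2 * nu * l)%C with ((nu + nu) * l)%C by ring. field. exact Ng.
Qed.

(** * Integral orders and removal of the singularity of K *)

Lemma is_Cseries_skip (n : nat) (a : nat -> C) (L : C) : (forall k, (k < n)%nat -> a k = 0) ->
  is_Cseries (fun j => a (n + j)%nat) L -> is_Cseries a L.
Proof.
  revert a. induction n as [|n IH]; intros a H0 H; [exact H|].
  replace L with (a 0%nat + L)%C by (rewrite H0 by lia; ring).
  apply is_Cseries_decr. apply IH; [|exact H]. intros k Hk. apply H0. lia.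
Qed.

Lemma bessel_sum_converges (t mu : C) : is_Cseries (fun k => bessel_term t k mu) (bessel_sum t mu).
Proof.
  destruct (bessel_term_maj t (Cmod mu) (Cmod_ge_0 _)) as [K [q H]].
  exact (expmaj_converges _ K q (proj1 (H mu (Rle_refl _)))).
Qed.

Lemma rGamma_nat (n : nat) : rGamma (INR n + 1) = (/ INR (fact n))%C.
Proof.
  transitivity (rGamma (INR n + 1) * INR (fact n) / INR (fact n))%C; [field; apply INR_fact_C_neq0|].
  rewrite rGamma_fact. unfold Cdiv. ring.
Qed.

(** The first n terms at order - n vanish because 1/Gamma does at its zeros; shifting the index by n
    turns the rest into t^n times the series at order n, and t^n is absorbed by the exponential
    prefactor. *)
Lemma bessel_opp_nat (l : C) (n : nat) : bessel l (Cexp (2 * l)) (- INR n) = bessel l (Cexp (2 * l)) (INR n).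
Proof.
  set (t := Cexp (2 * l)).
  assert (E : bessel_sum t (- INR n) = (t ^ n * bessel_sum t (INR n))%C).
  { apply CSeries_eq, (is_Cseries_skip n).
    - intros k Hk. unfold bessel_term, rg.
      replace (- INR n + INR k + 1)%C with (- INR (n - k - 1))%C.
      + rewrite rGamma_pole. ring.
      + rewrite !minus_INR by lia. rewrite !RtoC_minus. simpl (INR 1). ring.
    - apply (is_Cseries_ext (fun j => t ^ n * bessel_term t j (INR n))%C); [|apply is_Cseries_scal, bessel_sum_converges].
      intros j. unfold bessel_term, rg. rewrite Cpow_add_r.
      replace (- INR n + INR (n + j) + 1)%C with (INR j + 1)%C by (rewrite plus_INR, RtoC_plus; ring).
      replace (INR n + INR j + 1)%C with (INR (n + j) + 1)%C by (rewrite plus_INR, RtoC_plus; ring).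
      rewrite !rGamma_nat. field. auto using INR_fact_C_neq0. }
  unfold bessel. rewrite E. unfold t. rewrite <- Cexp_mult_nat, Cmult_assoc, <- Cexp_add. do 2 f_equal. ring.
Qed.

Lemma punctured_eq_R (f g : R -> C) (x : R) : continuous f x -> continuous g x ->
  locally x (fun u : R => u <> x -> f u = g u) -> f x = g x.
Proof.
  intros Hf Hg HL. apply NNPP. intros N.
  assert (Hd : continuous (fun s => f s - g s)%C x) by (apply cont_minus; assumption).
  destruct (filter_and _ _ HL (cont_neq0 (fun s => f s - g s)%C x Hd (Cminus_neq0 _ _ N))) as [d K].
  assert (P := cond_pos d).
  destruct (K (x + d / 2)) as [K1 K2].
  - unfold ball; simpl; unfold AbsRing_ball, abs, minus, plus, opp; simpl.
    replace (x + d / 2 + - x) with (d / 2) by ring. rewrite Rabs_pos_eq; lra.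
  - apply K2. rewrite K1; [ring|]. lra.
Qed.

Lemma cont_on_reals (f : C -> C) (x : R) : Hol Cuniv f -> continuous (fun u : R => f (RtoC u)) x.
Proof.
  intros Hf. apply (continuous_comp RtoC f); [apply cont_RtoC, continuous_id|].
  apply (Hol_cont Cuniv); [exact Hf|exact I].
Qed.

(** [Hol_cross_fun] concerns the first variable only. On the diagonal [cross_deriv_same] expresses
    the function through entire functions of the order and their derivatives. *)
Lemma cont_cross_fun_diag (l t : C) (x : R) : continuous (fun mu : R => cross_fun l t mu mu) x.
Proof.
  apply (cont_ext_loc (fun mu : R => - (D (bessel l t) mu * zbessel l t mu - D (zbessel l t) mu * bessel l t mu))%C).
  - apply filter_forall. intros mu. rewrite cross_deriv_same. cring.
  - apply cont_opp, cont_minus; apply cont_mult;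
    apply cont_on_reals; auto using Hol_D, Hol_bessel, Hol_zbessel, copen_all.
Qed.

Lemma sin_PI_reflect (nu : R) : nu <> 0 ->
  (2 * nu * (rg 0 nu * rg 0 (- nu)) = 2 * sin (PI * nu) / PI)%C.
Proof.
  intros H. assert (E := rGamma_reflect nu H).
  replace (1 + nu)%C with (nu + INR 0 + 1)%C in E by (change (INR 0) with 0; ring).
  replace (1 - nu)%C with (- nu + INR 0 + 1)%C in E by (change (INR 0) with 0; ring).
  unfold rg. rewrite E. assert (P := PI_RGT_0).
  rewrite RtoC_div by (apply Rmult_integral_contrapositive_currified; lra). rewrite RtoC_mult.
  field. split; apply RtoC_neq0; lra.
Qed.

Lemma BesselK_formula_nonint (nu : R) (z : C) : 0 < nu -> (forall j : nat, nu <> INR j) ->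
  BesselK_formula nu z =
    ((bessel (Clog (z / 2)) ((z / 2) ^ 2) (- nu) - bessel (Clog (z / 2)) ((z / 2) ^ 2) nu) /
     (2 * nu * (rg 0 nu * rg 0 (- nu))))%C.
Proof.
  intros Hnu Hni. unfold BesselK_formula. rewrite !BesselI_bessel, RtoC_opp.
  assert (N : (rg 0 nu * rg 0 (- nu) <> 0)%C).
  { assert (N3 : rg 0 nu <> 0).
    { apply rg0_neq0. intros k. generalize (INR_S_pos k). lra. }
    assert (N4 : rg 0 (- nu) <> 0).
    { rewrite <- RtoC_opp. apply rg0_neq0. intros k. specialize (Hni (S k)). lra. }
    apply Cmult_neq_0; assumption. }
  assert (E := sin_PI_reflect nu ltac:(lra)).
  assert (Nn : RtoC nu <> 0) by (apply RtoC_neq0; lra).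
  assert (Np : RtoC PI <> 0) by (apply RtoC_neq0, Rgt_not_eq, PI_RGT_0).
  assert (E2 : RtoC (sin (PI * nu)) = (PI * (nu * (rg 0 nu * rg 0 (- nu))))%C).
  { transitivity (PI / 2 * (2 * sin (PI * nu) / PI))%C; [field; exact Np|]. rewrite <- E. field. }
  rewrite E2. field. repeat split; auto; intros Q; apply N; rewrite Q; ring.
Qed.

(** * The derivative with respect to the order *)

(** Replacing [cross_opp] in [DBI_solve] by its value from [loop_int_cross_fun] leaves [cross_fun]
    multiplied by I_nu - I_(-nu); division by the Wronskian makes this - K_nu. *)
Lemma DBI_nonint (nu : R) (z : C) : 0 < nu -> 0 < Re z -> (forall j : nat, nu <> INR j) ->
  D (bessel (Clog (z / 2)) ((z / 2) ^ 2)) nu =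
   (- (nu * BesselI nu z / (2 * sqrt PI)) * (loop_int (Clog (z ^ 2)) nu / (2 * PI * Ci))
    - BesselK_formula nu z * cross_fun (Clog (z / 2)) ((z / 2) ^ 2) nu nu)%C.
Proof.
  intros Hnu Hz Hni. rewrite BesselK_formula_nonint, BesselI_bessel, Clog_square_half by assumption.
  assert (H2 := Re_half z Hz).
  rewrite <- (Cexp_2_Clog (z / 2) H2). set (l := Clog (z / 2)). set (t := Cexp (2 * l)).
  assert (E1 := DBI_solve l t nu). assert (E2 := loop_int_cross_fun l nu Hnu Hni). fold t in E2.
  assert (N3 : rg 0 nu <> 0).
  { apply rg0_neq0. intros k. generalize (INR_S_pos k). lra. }
  assert (N4 : rg 0 (- nu) <> 0).
  { rewrite <- RtoC_opp. apply rg0_neq0. intros k. specialize (Hni (S k)). lra. }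
  assert (Nn : RtoC nu <> 0) by (apply RtoC_neq0; lra).
  assert (Ns : RtoC (sqrt PI) <> 0) by (apply RtoC_neq0, Rgt_not_eq, sqrt_lt_R0, PI_RGT_0).
  set (GL := (loop_int (2 * (l + ln 2)) nu / (2 * PI * Ci))%C) in *.
  rewrite rGamma_half, RtoC_inv in E2 by (apply Rgt_not_eq, sqrt_lt_R0, PI_RGT_0).
  assert (E3 : cross_opp l t nu = (res_scale nu * GL / sqrt PI - cross_fun l t nu nu)%C).
  { rewrite E2. field. exact Ns. }
  rewrite E3 in E1. unfold res_scale in E1.
  transitivity (D (bessel l t) nu * (2 * nu * (rg 0 nu * rg 0 (- nu))) / (2 * nu * (rg 0 nu * rg 0 (- nu))))%C;
    [field; auto|].
  rewrite E1. field. auto.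
Qed.

Lemma frac_part_INR (n : nat) : frac_part (INR n) = 0.
Proof.
  symmetry. apply (Int_part_frac_part_spec (INR n) (Z.of_nat n) 0); [lra|]. rewrite <- INR_IZR_INZ. ring.
Qed.

Lemma frac_part_0_nat (x : R) : 0 < x -> frac_part x = 0 -> exists n, x = INR (S n).
Proof.
  intros Hx H. destruct (fp_nat x H) as [c E]. rewrite E in Hx. apply lt_IZR in Hx.
  exists (Z.to_nat (c - 1)). rewrite E, INR_IZR_INZ. f_equal. lia.
Qed.

Lemma locally_nonint (n : nat) : locally (INR (S n)) (fun u : R => 0 < u /\ (u <> INR (S n) -> forall j : nat, u <> INR j)).
Proof.
  exists (mkposreal (/ 2) ltac:(lra)). intros u Hu. uncast.
  unfold ball in Hu; simpl in Hu; unfold AbsRing_ball, abs, minus, plus, opp in Hu. cbn -[INR] in Hu.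
  apply Rabs_lt_between in Hu. change (match n with O => 1 | S _ => INR n + 1 end) with (INR (S n)) in Hu.
  assert (P := INR_S_pos n). assert (P2 : 1 <= INR (S n)) by (rewrite S_INR; generalize (pos_INR n); lra).
  split; [lra|]. intros N j E.
  destruct (Nat.lt_trichotomy j (S n)) as [L|[->|L]]; [|auto|].
  - assert (L' : (S j <= S n)%nat) by lia. apply le_INR in L'. rewrite (S_INR j) in L'. lra.
  - assert (L' : (S (S n) <= j)%nat) by lia. apply le_INR in L'. rewrite (S_INR (S n)) in L'. lra.
Qed.

Lemma PD_sin_PI (x : R) : PD (fun u => RtoC (sin (PI * u))) x (RtoC (PI * cos (PI * x))).
Proof. apply PD_comps. simpl. split; auto_derive; try exact I; ring. Qed.

Lemma is_lim_punctured (f g : R -> R) (x : R) : continuous g x ->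
  locally x (fun u => u <> x -> f u = g u) -> is_lim f x (g x).
Proof.
  intros Hg HL. apply (filterlim_ext_loc g).
  - revert HL. unfold Rbar_locally'. unfold locally', within. apply filter_imp. intros u Hu Hn. symmetry. apply Hu, Hn.
  - intros P HP. generalize (Hg P HP). unfold filtermap, Rbar_locally', locally', within. apply filter_imp. auto.
Qed.

(* The order [n] is a removable singularity of the quotient defining [BesselK]: both its numerator and [sin] have
   a zero there, and the zero of [sin] is simple. *)
Lemma BesselK_extension (n : nat) (z : C) : 0 < Re z ->
  exists Kt : R -> C, continuous Kt (INR (S n)) /\ Kt (INR (S n)) = BesselK (INR (S n)) z /\
    locally (INR (S n)) (fun mu : R => mu <> INR (S n) -> BesselK_formula mu z = Kt mu).
Proof.
  intros Hz. set (N := INR (S n)). set (l := Clog (z / 2)). set (t := ((z / 2) ^ 2)%C).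
  assert (Et : t = Cexp (2 * l)) by (symmetry; apply Cexp_2_Clog, Re_half, Hz).
  set (Nm := fun s => (bessel l t (- (1) * s + 0) - bessel l t s)%C).
  assert (HN : Hol Cuniv Nm).
  { apply Hol_minus; [exact copen_all| |apply Hol_bessel].
    apply (Hol_comp Cuniv Cuniv (bessel l t) (fun s => - (1) * s + 0)%C); auto using copen_all, Hol_bessel, Hol_linear. }
  assert (N0 : Nm (RtoC N) = 0).
  { unfold Nm. replace (- (1) * N + 0)%C with (- N)%C by ring. unfold N. rewrite Et, bessel_opp_nat. ring. }
  destruct (PD_sin_PI N) as [psi [P1 [P2 P3]]].
  assert (Hs : sin (PI * N) = 0).
  { apply sin_eq_0_1. exists (Z.of_nat (S n)). unfold N. rewrite <- INR_IZR_INZ. ring. }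
  assert (Npsi : psi N <> 0).
  { rewrite P3. apply RtoC_neq0. intros Q. apply Rmult_integral in Q. assert (P := PI_RGT_0). destruct Q as [Q|Q]; [lra|].
    generalize (sin2_cos2 (PI * N)). rewrite Hs, Q. unfold Rsqr. lra. }
  set (Kt := fun mu : R => (PI / 2 * (dquot Nm N (RtoC mu) * / psi mu))%C).
  assert (CK : continuous Kt N).
  { apply cont_mult; [apply continuous_const|]. apply cont_mult.
    - apply cont_on_reals, Hol_dquot; [exact copen_all|exact I|exact HN].
    - apply cont_inv; assumption. }
  assert (LK : locally N (fun mu : R => mu <> N -> BesselK_formula mu z = Kt mu)).
  { generalize (filter_and _ _ P1 (cont_neq0 psi N P2 Npsi)). apply filter_imp.
    intros mu [H1 H2] H3. uncast.
    rewrite Hs in H1. unfold BesselK_formula, Kt. rewrite !BesselI_bessel, RtoC_opp. fold l t.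
    assert (Q := dquot_spec Nm (RtoC N) (RtoC mu)). rewrite N0 in Q.
    assert (Nz : (mu - N <> 0)%C) by (rewrite <- RtoC_minus; apply RtoC_neq0; lra).
    replace (bessel l t (- mu) - bessel l t mu)%C with (Nm (RtoC mu)).
    2:{ unfold Nm. replace (- (1) * mu + 0)%C with (- mu)%C by ring. reflexivity. }
    rewrite H1, Q, RtoC_minus. field. split; auto. }
  exists Kt. split; [exact CK|]. split; [|exact LK].
  (* At an integer [BesselK] is a componentwise limit over punctured neighbourhoods, hence the value
     of the continuous extension. *)
  unfold BesselK. fold N. destruct (Req_EM_T (frac_part N) 0) as [_|F]; [|elim F; apply frac_part_INR].
  apply cont_comps in CK. destruct CK as [CK1 CK2].
  assert (L1 : is_lim (fun mu => Re (BesselK_formula mu z)) N (Re (Kt N))).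
  { apply (is_lim_punctured _ (fun u => Re (Kt u))); [exact CK1|]. revert LK. apply filter_imp. intros u Hu Hn. rewrite (Hu Hn). reflexivity. }
  assert (L2 : is_lim (fun mu => Im (BesselK_formula mu z)) N (Im (Kt N))).
  { apply (is_lim_punctured _ (fun u => Im (Kt u))); [exact CK2|]. revert LK. apply filter_imp. intros u Hu Hn. rewrite (Hu Hn). reflexivity. }
  rewrite (is_lim_unique _ _ _ L1), (is_lim_unique _ _ _ L2). simpl. symmetry. symmetry. apply surjective_pairing.
Qed.

Lemma DBI_formula (nu : R) (z : C) : 0 < nu -> 0 < Re z ->
  D (bessel (Clog (z / 2)) ((z / 2) ^ 2)) nu =
   (- (nu * BesselI nu z / (2 * sqrt PI)) * (loop_int (Clog (z ^ 2)) nu / (2 * PI * Ci))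
    - BesselK nu z * cross_fun (Clog (z / 2)) ((z / 2) ^ 2) nu nu)%C.
Proof.
  intros Hnu Hz. destruct (Req_EM_T (frac_part nu) 0) as [F|F].
  - destruct (frac_part_0_nat nu Hnu F) as [n ->].
    destruct (BesselK_extension n z Hz) as [Kt [C1 [<- L1]]].
    set (l := Clog (z / 2)). set (t := ((z / 2) ^ 2)%C). set (lam := Clog (z ^ 2)).
    apply (punctured_eq_R (fun mu : R => D (bessel l t) mu)
      (fun mu : R => (- (mu * BesselI mu z / (2 * sqrt PI)) * (loop_int lam mu / (2 * PI * Ci)) - Kt mu * cross_fun l t mu mu)%C)).
    + apply cont_on_reals, Hol_D; [exact copen_all|apply Hol_bessel].
    + assert (Hc : forall c : C, continuous (fun _ : R => c) (INR (S n))) by (intros; apply continuous_const).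
      apply cont_minus; [|apply cont_mult; [exact C1|apply cont_cross_fun_diag]].
      apply cont_mult.
      * apply cont_opp, cont_mult; [|apply Hc]. apply cont_mult; [apply cont_RtoC, continuous_id|].
        apply (cont_ext_loc (fun mu : R => bessel l t mu)); [apply filter_forall; intros mu; symmetry; apply BesselI_bessel|].
        apply cont_on_reals, Hol_bessel.
      * apply cont_mult; [apply cont_loop_int, Hnu|apply Hc].
    + generalize (filter_and _ _ L1 (locally_nonint n)). apply filter_imp.
      intros mu [H1 [H2 H3]] H4. uncast. rewrite <- (H1 H4). apply DBI_nonint; auto.
  - unfold BesselK. destruct (Req_EM_T (frac_part nu) 0) as [F'|_]; [contradiction|].
    apply DBI_nonint; auto. intros j ->. apply F, frac_part_INR.
Qed.

Theorem mainTheorem9 (nu : R) (z : C) (hnu : 0 < nu) (hz : 0 < Re z) :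
  @is_derive R_AbsRing C_R_NormedModule (fun mu : R => BesselI mu z) nu
    (- (nu * BesselI nu z / (2 * sqrt PI)) *
         meijerG 3 1 [RtoC (1 / 2); RtoC 1]
           [RtoC 0; RtoC 0; RtoC nu; RtoC (- nu)] (z ^ 2)
     - BesselK nu z * Cpower (z / 2) (2 * nu) / Gamma (nu + 1) ^ 2 *
         hypergeometric [RtoC nu; RtoC (nu + 1 / 2)]
           [RtoC (nu + 1); RtoC (nu + 1); RtoC (2 * nu + 1)] (z ^ 2))%C.
Proof.
  set (l := Clog (z / 2)). set (t := ((z / 2) ^ 2)%C).
  (* The real order enters an entire function through the embedding of the reals, a curve with
     velocity 1. *)
  assert (P : PD (fun mu : R => bessel l t mu) nu (D (bessel l t) nu * 1)).
  { apply (CD_PD_comp (bessel l t) RtoC).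
    - apply (Hol_bessel l t). exact I.
    - apply PD_comps. simpl. split; auto_derive; try exact I; ring. }
  apply PD_is_derive in P.
  replace (D (bessel l t) nu * 1)%C with (D (bessel l t) nu) in P by ring.
  unfold l, t in P. rewrite (DBI_formula nu z hnu hz), <- (hypergeometric_cross_fun nu z hnu), <- (meijerG_loop_int nu (z ^ 2) hnu) in P.
  apply (is_derive_ext (fun mu : R => bessel (Clog (z / 2)) ((z / 2) ^ 2) mu)); [intros mu; symmetry; apply BesselI_bessel|].
  unfold Cdiv in *. rewrite !Cmult_assoc in *. exact P.
Qed.
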